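(* Let $N\ge 3$ and let $\Omega\subset\mathbb{R}^N$ be a bounded domain. Let $\theta>0$ and $\gamma>0$ satisfy $\theta+2\gamma<2$. Let $a:\Omega\times\mathbb{R}\to\mathbb{R}$ be a Carathéodory function such that, for some constants $\alpha,\beta>0$, $$\frac{\alpha}{(1+|s|)^{\theta}}\le a(x,s)\le\beta\quad\text{for a.e. }x\in\Omega\text{ and all }s\in\mathbb{R}.$$ Let $f\in L^m(\Omega)$ with $2\le m<\theta+2$, and let $E\in[L^{2r}(\Omega)]^N$ with $$r\ge\max\left(\frac{m}{2-2\gamma-\theta},\ \frac{m}{6+\theta-2m-2\gamma}\right).$$ Then the Dirichlet problem $$-\operatorname{div}(a(x,u)Du)+u=-\operatorname{div}(u^{\gamma}E(x))+f(x)\ \text{ in }\Omega,\qquad u=0\ \text{ on }\partial\Omega,$$ has a distributional solution $u\in W_0^{1,\frac{2m}{\theta+2}}(\Omega)\cap L^m(\Omega)$.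
   Context: $Du$ denotes the gradient of $u$. A Carathéodory function $a(x,s)$ is measurable in $x$ for every $s$ and continuous in $s$ for a.e. $x$. For real $s$ (possibly negative) the power $s^\gamma$ is understood as the odd power $|s|^{\gamma-1}s$ (with $0^\gamma=0$). A distributional solution of the Dirichlet problem $-\operatorname{div}(a(x,u)Du)+u=-\operatorname{div}(u^{\gamma}E)+f$ in $\Omega$, $u=0$ on $\partial\Omega$ (where $f\in L^1(\Omega)$), is a function $u\in W_0^{1,1}(\Omega)$ such that $u^\gamma E\in[L^1_{loc}(\Omega)]^N$ and $$\int_\Omega a(x,u)Du\cdot D\varphi+\int_\Omega u\varphi=\int_\Omega u^\gamma E\cdot D\varphi+\int_\Omega f\varphi\qquad\forall\varphi\in C_0^\infty(\Omega).$$ *)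

(* Defs.v *)
From HB Require Import structures.
From mathcomp Require Import all_boot all_order all_algebra.
From mathcomp Require Import all_classical all_reals all_analysis.

Set Implicit Arguments.
Unset Strict Implicit.
Unset Printing Implicit Defensive.
Import Order.TTheory GRing.Theory Num.Theory.
Import numFieldNormedType.Exports.
Local Open Scope classical_set_scope.
Local Open Scope ring_scope.

(* Points of R^N are row vectors; the library norm on 'rV[R]_N is the sup norm,
   which has the same open, bounded and compact sets as the Euclidean one. *)

Section lebesgue_measure_rV.
Context (R : realType) (N : nat).

(* None is the empty box; it is needed only to cover set0 when N = 0. *)
Definition box (o : option ('rV[R]_N * 'rV[R]_N)) : set 'rV[R]_N :=
  if o is Some (a, b) then [set x | forall i, a 0 i < x 0 i <= b 0 i]
  else set0.

Definition box_volume (o : option ('rV[R]_N * 'rV[R]_N)) : \bar R :=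
  if o is Some (a, b) then (\prod_i Num.max 0 (b 0 i - a 0 i))%:E else 0%E.

Definition box_cover (A : set 'rV[R]_N) :
    set (nat -> option ('rV[R]_N * 'rV[R]_N)) :=
  [set F | A `<=` \bigcup_k box (F k)].

Definition lebesgue_outer (A : set 'rV[R]_N) : \bar R :=
  ereal_inf [set (\sum_(k <oo) box_volume (F k))%E | F in box_cover A].

Local Open Scope ereal_scope.

Let box_volume_ge0 o : 0 <= box_volume o.
Proof.
case: o => [[a b]|//]; rewrite /box_volume lee_fin.
by apply: prodr_ge0 => i _; rewrite le_max lexx.
Qed.

Let lebesgue_outer_ge0 A : 0 <= lebesgue_outer A.
Proof.
apply: le_ereal_inf_tmp => _ [F _ <-].
exact: nneseries_ge0.
Qed.

Let lebesgue_outer0 : lebesgue_outer set0 = 0.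
Proof.
apply/eqP; rewrite eq_le; apply/andP; split; last exact: lebesgue_outer_ge0.
apply: ereal_inf_lbound; exists (fun=> None); first by [].
by rewrite eseries0.
Qed.

Let le_lebesgue_outer :
  {homo lebesgue_outer : A B / A `<=` B >-> A <= B}.
Proof.
move=> A B AB; apply/ereal_inf_le_tmp => x [F BF <-].
by exists F => //; exact: subset_trans AB BF.
Qed.

Let lebesgue_outer_sigma_subadditive : sigma_subadditive lebesgue_outer.
Proof.
move=> A; have [[i ioo]|] := pselect (exists i, lebesgue_outer (A i) = +oo).
  by rewrite (eseries_pinfty _ _ ioo) ?leey// => n _; rewrite -ltNye
    (lt_le_trans _ (lebesgue_outer_ge0 _)).
rewrite -forallNE => Aoo.
suff add2e (e : {posnum R}) : lebesgue_outer (\bigcup_n A n) <=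
    \sum_(i <oo) lebesgue_outer (A i) + e%:num%:E.
  by apply/lee_addgt0Pr => _/posnumP[].
rewrite (le_trans _ (epsilon_trick _ _ _))//.
pose P n (F : nat -> option ('rV[R]_N * 'rV[R]_N)) := box_cover (A n) F /\
  \sum_(k <oo) box_volume (F k) <=
    lebesgue_outer (A n) + (e%:num / (2 ^ n.+1)%:R)%:E.
have [G PG] : {G : nat -> nat -> _ & forall n, P n (G n)}.
  apply: (@choice _ _ P) => n; rewrite /P.
  have fn : lebesgue_outer (A n) \is a fin_num.
    by rewrite ge0_fin_numE// ltey; apply/eqP/Aoo.
  have en1 : (0 < e%:num / (2 ^ n.+1)%:R)%R by [].
  have [x [F AF <-] xS] := lb_ereal_inf_adherent en1 fn.
  by exists F; split => //; exact/ltW.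
pose v := box_volume \o uncurry G.
have v_ge0 x : 0 <= v x by exact: box_volume_ge0.
apply: (@le_trans _ _ (\esum_(i in setT) v i)).
  apply: ereal_inf_lbound => /=.
  have /card_esym/ppcard_eqP[f] := card_nat2.
  exists (uncurry G \o f).
    move=> t [i _ /(PG i).1 [j _ Gij]].
    by exists (f^-1%FUN (i, j)) => //=; rewrite invK ?inE.
  by rewrite -(esum_pred_image v _ xpredT) ?[fun=> _]set_true// image_eq.
rewrite (_ : esum _ _ = \sum_(i <oo) \sum_(j <oo) v (i, j)); last first.
  pose J : nat -> set (nat * nat) := fun i => [set (i, j) | j in setT].
  rewrite (_ : setT = \bigcup_k J k); last first.
    by rewrite predeqE => -[a b]; split => // _; exists a => //; exists b.
  rewrite esum_bigcupT //=; last first.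
    apply/trivIsetP => i j _ _ ij.
    rewrite predeqE => -[n m] /=; split => //= -[] [_] _ [<-{n} _].
    by move=> [m' _] [] /esym/eqP; rewrite (negbTE ij).
  rewrite -(image_id [set: nat]) -fun_true esum_pred_image//; last first.
    by move=> n _; exact: esum_ge0.
  apply: eq_eseriesr => /= j _.
  rewrite -(esum_pred_image v (pair j) predT)//=; last first.
    by move=> ? ? _ _; exact: (@can_inj _ _ _ snd).
  by congr esum; rewrite predeqE => -[a b]; split; move=> [i _ <-]; exists i.
apply: lee_nneseries => [n _ _|n _]; first exact: nneseries_ge0.
exact: (PG n).2.
Qed.

HB.instance Definition _ := isOuterMeasure.Build R _ lebesgue_outer
  lebesgue_outer0 lebesgue_outer_ge0 le_lebesgue_outer
  lebesgue_outer_sigma_subadditive.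

End lebesgue_measure_rV.

Definition lebesgue_outer_measure (R : realType) (N : nat) :
  {outer_measure set 'rV[R]_N -> \bar R} := @lebesgue_outer R N.

(* R^N with the sigma-algebra of Lebesgue measurable sets; the carrier is
   convertible to 'rV[R]_N. *)
Notation Rn R N := (caratheodory_type (lebesgue_outer_measure R N)).

Definition leb (R : realType) (N : nat) : {measure set (Rn R N) -> \bar R} :=
  (lebesgue_outer_measure R N : set (Rn R N) -> \bar R).

Section sobolev.
Context (R : realType) (N : nat).
Implicit Types (Om : set 'rV[R]_N) (u f phi : 'rV[R]_N -> R).
Implicit Types (G : 'rV[R]_N -> 'rV[R]_N).

Definition bounded_domain Om :=
  [/\ open Om, connected Om, Om !=set0 & bounded_set Om].

Definition dotv (v w : 'rV[R]_N) : R := \sum_i v 0 i * w 0 i.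

Definition partial_deriv (i : 'I_N) phi : 'rV[R]_N -> R :=
  fun x => 'D_(delta_mx 0 i) phi x.

Definition grad phi : 'rV[R]_N -> 'rV[R]_N :=
  fun x => \row_i partial_deriv i phi x.

Definition smooth phi := forall s : seq 'I_N,
  let psi := foldr partial_deriv phi s in
  continuous psi /\ forall i x, derivable psi x (delta_mx 0 i).

(* C_0^oo(Om), each function being extended by 0 outside Om *)
Definition test_function Om phi :=
  let supp := closure [set x | phi x != 0] in
  [/\ smooth phi, compact supp & supp `<=` Om].

(* f in L^p(Om), expressed on the extension of f by 0 outside Om *)
Definition inLp Om (p : R) f := f \_ Om \in Lfun (leb R N) p%:E.

Definition normLp Om (p : R) f : \bar R :=
  ('N[leb R N]_(p%:E) [EFin \o (f \_ Om)])%E.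

Definition inL1loc Om f :=
  measurable_fun (Om : set (Rn R N)) f /\
  forall K, compact K -> K `<=` Om ->
    (leb R N).-integrable (K : set (Rn R N)) (EFin \o f).

Definition weak_gradient Om u G :=
  [/\ inL1loc Om u, forall i, inL1loc Om (fun x => G x 0 i) &
  forall phi, test_function Om phi -> forall i,
    \int[leb R N]_(x in Om) (u x * partial_deriv i phi x) =
    - \int[leb R N]_(x in Om) (G x 0 i * phi x)].

Definition inW1p Om (p : R) u G :=
  [/\ weak_gradient Om u G, inLp Om p u & forall i, inLp Om p (fun x => G x 0 i)].

Definition normW1p Om (p : R) u G : \bar R :=
  (normLp Om p u + \sum_i normLp Om p (fun x => G x 0%R i))%E.

(* u lies in W_0^{1,p}(Om), the closure of C_0^oo(Om) in W^{1,p}(Om), and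
   G is its weak gradient *)
Definition inW01p_grad Om (p : R) u G :=
  inW1p Om p u G /\
  forall e : R, 0 < e -> exists2 phi, test_function Om phi &
    (normW1p Om p (fun x => u x - phi x)%R (fun x => G x - grad phi x)%R
      < e%:E)%E.

Definition inW01p Om (p : R) u := exists G, inW01p_grad Om p u G.

Definition caratheodory_function Om (a : 'rV[R]_N -> R -> R) :=
  (forall s, measurable_fun (Om : set (Rn R N)) (a ^~ s)) /\
  {ae leb R N, forall x, Om x -> continuous (a x)}.

Definition odd_power (gamma s : R) : R := `|s| `^ (gamma - 1) * s.

Definition distributional_solution Om (a : 'rV[R]_N -> R -> R) (gamma : R)
    (E : 'rV[R]_N -> 'rV[R]_N) f u :=
  exists Du, [/\ inW01p_grad Om 1 u Du,
    forall i, inL1loc Om (fun x => odd_power gamma (u x) * E x 0 i) &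
    forall phi, test_function Om phi ->
      \int[leb R N]_(x in Om) (a x (u x) * dotv (Du x) (grad phi x))
      + \int[leb R N]_(x in Om) (u x * phi x)
      = \int[leb R N]_(x in Om)
          (odd_power gamma (u x) * dotv (E x) (grad phi x))
      + \int[leb R N]_(x in Om) (f x * phi x)].

End sobolev.

(* Main.v *)
Require Import Defs.
From HB Require Import structures.
From mathcomp Require Import all_boot all_order all_algebra.
From mathcomp Require Import all_classical all_reals all_analysis.
From mathcomp Require Import measurable_realfun ring lra zify.

(** The problem is discretized by finite volumes on the cells of [2^-n Z^N] that
    lie well inside [Om].  The principal flux through a face is a difference of the
    primitive [A(x, s)] of [a(x, .)], and the drift is upwinded with a monotone
    regularization of the odd power, so that every flux is monotone in each of the
    two adjacent values; the scheme is then solved by an [l^1] contraction argument.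

    Testing the scheme with [u (1 + |u|)^(m-2)] and absorbing the drift by Young's
    inequality (this is where [r >= m / (2 - 2 gamma - theta)] enters) bounds [u] in
    [L^m] and [(1 + |u|)^((m-2-theta)/2) Du] in [L^2], hence by Hoelder the difference
    quotients in [L^q], [q = 2m / (theta + 2)], which lies strictly between 1 and 2.

    The [L^1] control of translations gives a subsequence converging almost
    everywhere.  Weak compactness in [L^q] is replaced by convex combinations of the
    tails of the sequence of difference quotients, which converge strongly because
    of the uniform convexity of [int phi(.)], [phi y = (1 + y^2)^(q/2) - 1], on bounded
    subsets of [L^q].  Interpolating these combinations by smooth splines supported
    in [Om] produces the approximating test functions for [W_0^(1,q)].  In the limit of the equation,
    the quotients [(A(x, t) - A(x, s)) / (t - s)] tend to [a(x, u)] almost everywhere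
    and stay bounded, whereas the drift converges by Vitali's theorem. *)

Set Implicit Arguments.
Unset Strict Implicit.
Unset Printing Implicit Defensive.
Import Order.TTheory GRing.Theory Num.Theory.
Import numFieldNormedType.Exports.
Local Open Scope classical_set_scope.
Local Open Scope ring_scope.

(** * Lebesgue measure and lattices *)

Section box_geometry.
Context (R : realType) (N : nat).
Notation mu := (lebesgue_outer_measure R N).
Implicit Types (a b x z : 'rV[R]_N) (o : option ('rV[R]_N * 'rV[R]_N)).

(** The coercivity degenerates like [(1 + |u|)^(-theta)], so the energy controls [Du] only with a
    weight. This weight has to survive on the lattice, where the chain rule fails; it is evaluated
    at [Mx s t], built on the larger of two adjacent values, for which the increments of [psi] and
    of [A] still satisfy weighted lower bounds. Working on a lattice makes the problem finite, and
    monotone fluxes make it solvable by contraction. Since the boundary of [Om] is arbitrary, the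
    unknowns sit on cells away from it: extension by zero and smooth interpolation then stay inside
    [Om]. Two discrete gradients occur: the difference quotients appear in the equation, the
    gradients of the splines give the approximation by test functions. The same convex weights serve
    both, and the two limits coincide because each is the weak gradient of [u]. The inequality
    [q > 1], on which the arguments in [L^q] rest, comes from [2 <= m] and [theta < 2]; a moment
    [p > 1] for the drift exists because [r > 1] and [m > 2 gamma]. *)

Definition setc a (i : 'I_N) (c : R) : 'rV[R]_N :=
  \row_j (if j == i then c else a 0 j).

Definition cut_le i c o :=
  if o is Some (a, b) then Some (a, setc b i (Num.min (b 0 i) c)) else None.

Definition cut_gt i c o :=
  if o is Some (a, b) then Some (setc a i (Num.max (a 0 i) c), b) else None.

Lemma box_cut_le i c o : box o `&` [set x | x 0 i <= c] `<=` box (cut_le i c o).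
Proof.
case: o => [[a b] x [abx xc] j|x []//]; have /andP[-> xb] := abx j.
rewrite mxE /=; case: eqP => [->|//]; rewrite le_min xc andbT.
by have /andP[] := abx i.
Qed.

Lemma box_cut_gt i c o :
  box o `&` ~` [set x | x 0 i <= c] `<=` box (cut_gt i c o).
Proof.
case: o => [[a b] x [abx /negP]|x []//]; rewrite -ltNge => xc j.
have /andP[xa ->] := abx j; rewrite mxE andbT /=.
case: eqP => [->|//]; rewrite gt_max xc andbT.
by have /andP[] := abx i.
Qed.

Lemma box_volume_ge0 o : (0 <= box_volume o)%E.
Proof.
case: o => [[a b]|//]; rewrite /box_volume lee_fin.
by apply: prodr_ge0 => i _; rewrite le_max lexx.
Qed.

(** The truncation [Num.max 0] makes the splitting exact also when the hyperplane misses the box: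
    one of the two pieces then has a nonpositive side and volume 0. *)
Lemma box_volume_cut i c o :
  box_volume o = (box_volume (cut_le i c o) + box_volume (cut_gt i c o))%E.
Proof.
case: o => [[a b]|]; last by rewrite /= adde0.
rewrite /= -EFinD; congr EFin; rewrite (bigD1 i)//= [X in _ = X + _](bigD1 i)//= [X in _ = _ + X](bigD1 i)//=.
rewrite !mxE eqxx.
under [X in _ * X + _]eq_bigr => j ji do rewrite mxE (negbTE ji).
under [X in _ + _ * X]eq_bigr => j ji do rewrite mxE (negbTE ji).
rewrite -mulrDl; congr (_ * _); case: (leP (b 0 i) c) => bc; case: (leP (a 0 i) c) => ac;
  do ![case: leP => ?]; lra.
Qed.

(** Caratheodory's criterion is checked on covers: cutting every box of a cover of [X] by the
    hyperplane covers both parts of [X], and the volumes add up exactly. *)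
Lemma measurable_halfspace i c :
  measurable ([set x | x 0 i <= c] : set (Rn R N)).
Proof.
apply: le_caratheodory_measurable => X; apply: le_ereal_inf_tmp => _ [F XF <-].
under eq_eseriesr do rewrite (box_volume_cut i c).
rewrite nneseriesD; [|by move=> *; exact: box_volume_ge0..].
apply: leeD; apply: ereal_inf_lbound.
  exists (cut_le i c \o F) => // x [/XF[k _ Fk] xc].
  by exists k => //; apply: box_cut_le.
exists (cut_gt i c \o F) => // x [/XF[k _ Fk] xc].
by exists k => //; apply: box_cut_gt.
Qed.

Lemma measurable_box o : measurable (box o : set (Rn R N)).
Proof.
case: o => [[a b]|]; last exact: measurable0.
rewrite [X in measurable X](_ : _ = \bigcap_(i in [set: 'I_N])
    ([set x : 'rV[R]_N | x 0 i <= b 0 i] `\` [set x | x 0 i <= a 0 i])).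
  apply: fin_bigcap_measurable => [|i _]; first exact: finite_finset.
  by apply: measurableD; exact: measurable_halfspace.
apply/seteqP; split=> x /= H i.
  by move=> _; have /andP[ax xb] := H i; split=> //=; apply/negP; rewrite -ltNge.
by have [/= -> /negP] := H i I; rewrite -ltNge => ->.
Qed.

Lemma leb_box_le o : (leb R N (box o) <= box_volume o)%E.
Proof.
rewrite (_ : box_volume o =
    \sum_(k <oo) box_volume (if k == 0%N then o else None))%E.
  apply: ereal_inf_lbound; exists (fun k => if k == 0%N then o else None) => //.
  by move=> x ox; exists 0%N.
rewrite (@nneseriesD1 _ _ 0%N)//=; last by move=> k _; exact: box_volume_ge0.
by rewrite eseries0 ?adde0// => k _ /= /negbTE ->.
Qed.

(* Integrating the covering inequality one coordinate at a time. *)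
Lemma cover_volume n : forall (a b : nat -> R) (A B : nat -> nat -> R)
    (c : nat -> R) (v : R), (forall k, 0 <= c k) -> 0 <= v ->
  (forall x : nat -> R, (forall i, (i < n)%N -> a i < x i <= b i) ->
    (v%:E <= \sum_(k <oo)
      (c k * \prod_(i < n) \1_(`]A k i, B k i]%classic : set R) (x i))%:E)%E) ->
  ((v * \prod_(i < n) Num.max 0 (b i - a i))%:E <=
   \sum_(k <oo) (c k * \prod_(i < n) Num.max 0 (B k i - A k i))%:E)%E.
Proof.
have prod_ge0 (A B : nat -> R) k : 0 <= \prod_(i < k) Num.max 0 (B i - A i).
  by apply: prodr_ge0 => i _; rewrite le_max lexx.
elim: n => [a b A B c v c0 v0 H|n IH a b A B c v c0 v0 H].
  rewrite big_ord0 mulr1; apply: le_trans (H (fun=> 0) _) _ => //.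
  by apply: lee_nneseries => k *; rewrite !big_ord0 ?mulr1 lee_fin.
have [ab|ab] := leP (b n) (a n).
  rewrite big_ord_recr /= (_ : Num.max 0 (b n - a n) = 0) ?mulr0 ?mulr0.
    by apply: nneseries_ge0 => k *; rewrite lee_fin mulr_ge0// prod_ge0.
  by apply/max_idPl; rewrite subr_le0.
pose P := \prod_(i < n) Num.max 0 (b i - a i).
pose Q k := \prod_(i < n) Num.max 0 (B k i - A k i).
pose I k : set R := `]A k n, B k n]%classic.
(* With the last coordinate frozen at [t], the factor [\1_(I k) t] joins the weight [c k]; this is
   why the statement carries weights. *)
have sliced t : `]a n, b n]%classic t ->
    ((v * P)%:E <= \sum_(k <oo) (c k * Q k * \1_(I k) t)%:E)%E.
  rewrite /= in_itv /= => abt.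
  under eq_eseriesr do rewrite mulrAC.
  apply: IH => // [k|x Hx]; first by rewrite mulr_ge0.
  apply: le_trans (H (fun i => if i == n then t else x i) _) _ => [i|].
    rewrite ltnS leq_eqVlt; case: eqP => [-> //|_] /= ; exact: Hx.
  apply: lee_nneseries => [k *|k _]; rewrite lee_fin.
    by rewrite mulr_ge0// prodr_ge0.
  rewrite big_ord_recr /= eqxx [X in _ <= X]mulrAC mulrA ler_wpM2r//.
  rewrite ler_wpM2l// le_eqVlt; apply/orP; left; apply/eqP/eq_bigr => i _.
  by rewrite ltn_eqF.
have mI k : measurable (I k) by exact: measurable_itv.
have mQI k (D : set R) : measurable_fun D (fun t => (c k * Q k * \1_(I k) t)%:E).
  by apply/measurable_EFinP/measurable_funM => //; exact: measurable_indic.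
have: (\int[lebesgue_measure]_(t in `]a n, b n]) (v * P)%:E <=
  \int[lebesgue_measure]_(t in `]a n, b n])
      \sum_(k <oo) (c k * Q k * \1_(I k) t)%:E)%E.
  apply: ge0_le_integral => //.
  - by move=> t _; rewrite lee_fin mulr_ge0// prod_ge0.
  - apply: ge0_emeasurable_sum => [k t *|k _].
      by rewrite lee_fin !mulr_ge0// prod_ge0.
    exact: mQI.
rewrite integral_cst//= lebesgue_measure_itv /= lte_fin ab.
rewrite integral_nneseries//; last 2 first.
- by move=> k; exact: mQI.
- by move=> k t _; rewrite lee_fin !mulr_ge0// prod_ge0.
rewrite big_ord_recr /= -/P mulrA -[X in (X%:E * _)%E]/(v * P) => H1.
rewrite (_ : Num.max 0 (b n - a n) = b n - a n); last first.
  by apply/max_idPr; rewrite subr_ge0 ltW.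
apply: le_trans H1 _.
apply: lee_nneseries => [k *|k _].
  by apply: integral_ge0 => t _; rewrite lee_fin !mulr_ge0// prod_ge0.
rewrite big_ord_recr /= -/(Q k) mulrA.
under eq_integral do rewrite EFinM.
rewrite ge0_integralZl_EFin//; last 2 first.
- by apply/measurable_EFinP; apply: measurable_indic; exact: mI.
- by rewrite mulr_ge0// prod_ge0.
rewrite integral_indic//; last exact: mI.
apply: (@le_trans _ _ ((c k * Q k)%:E * (Num.max 0 (B k n - A k n))%:E)%E) => //.
rewrite lee_wpmul2l ?lee_fin ?mulr_ge0 ?prod_ge0//.
apply: (le_trans (le_measure lebesgue_measure _ _ (@subIsetl _ _ _))).
- by rewrite inE; apply: measurableI; [exact: mI|exact: measurable_itv].
- by rewrite inE; exact: mI.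
rewrite /= lebesgue_measure_itv /= lte_fin; case: ifPn => AB.
  by rewrite -EFinD lee_fin le_max lexx orbT.
by rewrite lee_fin le_max lexx.
Qed.

Lemma leb_box_ge a b : (0 < N)%N -> ((\prod_i Num.max 0 (b 0 i - a 0 i))%:E <= leb R N (box (Some (a, b))))%E.
Proof.
case: N a b => // n a b _; apply: le_ereal_inf_tmp => _ [F abF <-].
pose nz (v : 'rV[R]_n.+1) (i : nat) : R := v 0 (inord i).
(* An empty box [None] is read as a product of intervals []0, 0]]; as the dimension is positive, it
   contributes volume 0. *)
pose lo k := if F k is Some (p, _) then nz p else fun=> 0.
pose hi k := if F k is Some (_, p) then nz p else fun=> 0.
have nzE v (i : 'I_n.+1) : nz v i = v 0 i by rewrite /nz inord_val.
have -> : \prod_i Num.max 0 (b 0 i - a 0 i) =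
    1 * \prod_(i < n.+1) Num.max 0 (nz b i - nz a i).
  by rewrite mul1r; apply: eq_bigr => i _; rewrite !nzE.
apply: le_trans (@cover_volume n.+1 _ _ lo hi (fun=> 1) 1 _ _ _) _ => // [x Hx|].
  have [|k _] := abF (\row_i x i).
    by move=> i; rewrite mxE; have := Hx i (ltn_ord i); rewrite !nzE.
  move=> Fk; rewrite (@nneseriesD1 _ _ k)//; last first.
    by move=> j _; rewrite lee_fin mul1r; apply: prodr_ge0.
  rewrite -[X in (X <= _)%E]adde0 leeD//; last first.
    by apply: nneseries_ge0 => j *; rewrite lee_fin mul1r; apply: prodr_ge0.
  rewrite lee_fin mul1r big1// => i _; rewrite indicE mem_set//= in_itv /=.
  move: Fk; rewrite /lo /hi; case: (F k) => [[p q]|//] /= /(_ i).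
  by rewrite mxE !nzE.
apply: lee_nneseries => [k *|k _].
  by rewrite lee_fin mul1r; apply: prodr_ge0 => i *; rewrite le_max lexx.
rewrite mul1r /lo /hi; case: (F k) => [[p q]|] /=.
  by rewrite lee_fin le_eqVlt; apply/orP; left; apply/eqP/eq_bigr => i _; rewrite !nzE.
by rewrite big_ord_recl /= subrr maxxx mul0r.
Qed.

(** Shifting a cover preserves its volumes, which gives one inequality for every shift; the reverse
    one is the same inequality for the opposite shift. *)
Lemma lebesgue_outer_translate z (A : set 'rV[R]_N) :
  mu [set x | A (x + z)] = mu A.
Proof.
suff H y (B : set 'rV[R]_N) : (mu [set x | B (x + y)%R] <= mu B)%E.
  apply/eqP; rewrite eq_le H/=; have := H (- z) [set x | A (x + z)].
  by under eq_set => x do rewrite /= subrK.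
apply: le_ereal_inf_tmp => _ [F BF <-].
pose sh o := if o is Some (a, b) then Some (a - y, b - y) else None.
apply: ereal_inf_lbound; exists (sh \o F).
  move=> x /= /BF[k _ Fk]; exists k => //=.
  case: (F k) Fk => [[a b]|//] /= ab i; have := ab i.
  by rewrite !mxE ltrBlDr lerBrDr.
apply: eq_eseriesr => k _ /=; case: (F k) => [[a b]|//] /=.
by congr EFin; apply: eq_bigr => i _; rewrite !mxE opprB addrA subrK.
Qed.

(** The sigma-algebra consists of all Lebesgue measurable sets, so continuity would not suffice; the
    Caratheodory condition is transported through the invariance of the outer measure instead. *)
Lemma measurable_translate z :
  measurable_fun setT (fun x : Rn R N => x + z : Rn R N).
Proof.
move=> _ A mA; rewrite setTI.
have {}mA : caratheodory_measurable mu A by exact: mA.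
suff : caratheodory_measurable mu [set x | A (x + z)] by exact.
move=> X; have := mA [set x | X (x - z)].
rewrite -(lebesgue_outer_translate z) => /=.
under eq_set => x do rewrite /= addrK.
rewrite (_ : [set x | X x] = X)// => ->; congr (_ + _)%E.
  rewrite -(lebesgue_outer_translate z); congr (mu _).
  by apply/seteqP; split => x /=; rewrite addrK.
rewrite -(lebesgue_outer_translate z); congr (mu _).
by apply/seteqP; split => x /=; rewrite addrK.
Qed.

End box_geometry.

Section lattice.
Context (R : realType) (N : nat).
Implicit Types (h : R) (x : 'rV[R]_N) (k : 'rV[int]_N).

(** With [ceil - 1] instead of [floor], the cell of index [k] is the product of the intervals []h
    k_i, h (k_i + 1)]], a left-open box as in the definition of the measure. *)
Definition idx h x : 'rV[int]_N := \row_i (Num.ceil (x 0 i / h) - 1).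

Definition pt h k : 'rV[R]_N := \row_i (h * (k 0 i)%:~R).

Definition dir (e : 'I_N) : 'rV[int]_N := delta_mx 0 e.

Lemma idxP h x k : 0 < h ->
  idx h x = k <-> forall i, h * (k 0 i)%:~R < x 0 i <= h * (k 0 i + 1)%:~R.
Proof.
move=> h0; split=> [<- i|H].
  rewrite mxE subrK ![h * _]mulrC -ltr_pdivlMr// -ler_pdivrMr//.
  exact: ceil_itv.
apply/rowP => i; rewrite mxE; apply/eqP; rewrite subr_eq; apply/eqP.
by apply: ceil_def; rewrite addrK ltr_pdivlMr// ler_pdivrMr// ![_ * h]mulrC.
Qed.

Lemma idx_translate h x k : 0 < h -> idx h (x + pt h k) = idx h x + k.
Proof.
move=> h0; apply/(idxP _ _ h0) => i; rewrite !mxE.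
have /(idxP _ _ h0)/(_ i) : idx h x = idx h x by [].
rewrite !mxE !rmorphD /= !mulrDr => /andP[H1 H2].
by apply/andP; split; lra.
Qed.

Lemma cell_box h k : 0 < h ->
  [set x | idx h x = k] = box (Some (pt h k, pt h (k + const_mx 1))).
Proof.
move=> h0; apply/seteqP; split => x /=.
  by move=> /(idxP _ _ h0) H i; have := H i; rewrite !mxE.
by move=> H; apply/(idxP _ _ h0) => i; have := H i; rewrite !mxE.
Qed.

Lemma measurable_cell h k : 0 < h ->
  measurable ([set x | idx h x = k] : set (Rn R N)).
Proof. by move=> h0; rewrite cell_box//; exact: measurable_box. Qed.

Lemma leb_cell h k : (0 < N)%N -> 0 < h ->
  leb R N [set x | idx h x = k] = (h ^+ N)%:E.
Proof.
move=> N0 h0; rewrite cell_box//.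
have E : \prod_i Num.max 0 (pt h (k + const_mx 1) 0 i - pt h k 0 i) = h ^+ N.
  under eq_bigr => i _.
    rewrite !mxE rmorphD /= mulrDr mulr1 addrAC subrr add0r.
    rewrite (max_idPr _)//; first over; exact: ltW.
  by rewrite prodr_const card_ord.
apply/eqP; rewrite eq_le (le_trans (leb_box_le _)) /=; last by rewrite E.
by rewrite -E leb_box_ge.
Qed.

Lemma idx_dist h x i : 0 < h ->
  pt h (idx h x) 0 i < x 0 i <= pt h (idx h x) 0 i + h.
Proof.
move=> h0; have /(idxP _ _ h0)/(_ i) : idx h x = idx h x by [].
by rewrite !mxE !rmorphD /= !mulrDr mulr1.
Qed.

Lemma rV_norm_le (v : 'rV[R]_N) c : 0 <= c ->
  (forall i, `|v 0 i| <= c) -> `|v| <= c.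
Proof.
move=> c0 H; rewrite /Num.norm/= mx_normrE; apply/bigmax_leP; split=> //.
by case=> i j _ /=; rewrite ord1.
Qed.

Lemma rV_normP (v : 'rV[R]_N) i : `|v 0 i| <= `|v|.
Proof.
by rewrite [leRHS]/Num.norm/= mx_normrE; apply: (le_bigmax _ _ (0, i)).
Qed.

(** An open set is the countable union of the lattice cells of mesh [1 / (n + 1)], over all [n],
    that it contains. *)
Lemma open_measurable_Rn (U : set 'rV[R]_N) : open U ->
  measurable (U : set (Rn R N)).
Proof.
move=> oU; pose h n : R := n.+1%:R^-1.
have h0 n : 0 < h n by rewrite invr_gt0.
rewrite [X in measurable X](_ : _ = \bigcup_(p : nat * 'rV[int]_N)
   (if `[< [set x | idx (h p.1) x = p.2] `<=` U >]
    then [set x | idx (h p.1) x = p.2] else set0)).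
  apply: countable_bigcupT_measurable => [|p]; first exact: countableP.
  by case: ifP => _; [exact: measurable_cell|exact: measurable0].
apply/seteqP; split => x; last first.
  by move=> [p _]; case: ifPn => // /asboolP; apply.
move=> Ux; have := open_nbhs_nbhs (conj oU Ux).
rewrite -nbhs_ballE => -[e /= e0 eU].
have [n ne] : exists n, h n < e.
  exists (Num.truncn e^-1); rewrite /h invf_plt ?posrE//.
  by rewrite truncnS_gt.
exists (n, idx (h n) x) => //=; case: ifPn => // /asboolP[] y yx; apply: eU.
rewrite mx_norm_ball /ball_ /=; apply: le_lt_trans ne.
apply: rV_norm_le => [|i]; first exact: ltW.
rewrite !mxE ler_norml; have := idx_dist x i (h0 n).
by have := idx_dist y i (h0 n); rewrite yx => /andP[? ?] /andP[? ?]; lra.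
Qed.

End lattice.

(** * Real-valued integrals *)

Section real_integral.
Context d (T : measurableType d) (R : realType).
Variable mu : {measure set T -> \bar R}.
Implicit Types (f g : T -> R) (p : R).
Notation mf f := (measurable_fun [set: T] f).
Notation intg f := (mu.-integrable [set: T] (EFin \o f)).
Notation Int f := (\int[mu]_x f x).

Lemma intg_mf f : intg f -> mf f.
Proof. by move=> /(measurable_int mu)/measurable_EFinP. Qed.

Lemma intg_dom f g : mf f -> (forall x, `|f x| <= g x) -> intg g -> intg f.
Proof.
move=> mf_ fg gi; apply: le_integrable gi => //; first exact/measurable_EFinP.
by move=> x _ /=; rewrite lee_fin (le_trans (fg x))// ler_norm.
Qed.

Lemma intgD f g : intg f -> intg g -> intg (fun x => f x + g x).
Proof.
by move=> fi gi; apply: eq_integrable (integrableD measurableT fi gi).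
Qed.

Lemma intgZ c f : intg f -> intg (fun x => c * f x).
Proof.
by move=> fi; apply: eq_integrable (integrableZl measurableT c fi).
Qed.

Lemma intgN f : intg f -> intg (fun x => - f x).
Proof.
by move=> fi; apply: eq_integrable (integrableN fi).
Qed.

Lemma intgB f g : intg f -> intg g -> intg (fun x => f x - g x).
Proof. by move=> fi gi; apply: intgD => //; exact: intgN. Qed.

Lemma intg_norm f : intg f -> intg (fun x => `|f x|).
Proof. exact: integrable_norm. Qed.

Lemma intg0 : intg (fun=> 0).
Proof. exact: integrable0. Qed.

Lemma intg_sum I (s : seq I) (F : I -> T -> R) :
  (forall i, intg (F i)) -> intg (fun x => \sum_(i <- s) F i x).
Proof.
move=> Fi; elim: s => [|i s IH].
  by under eq_fun do rewrite big_nil; exact: intg0.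
by under eq_fun do rewrite big_cons; exact: intgD.
Qed.

Lemma IntD f g : intg f -> intg g -> Int (fun x => f x + g x) = Int f + Int g.
Proof. exact: RintegralD. Qed.

Lemma IntB f g : intg f -> intg g -> Int (fun x => f x - g x) = Int f - Int g.
Proof. exact: RintegralB. Qed.

Lemma IntZ c f : intg f -> Int (fun x => c * f x) = c * Int f.
Proof. exact: RintegralZl. Qed.

Lemma Int0 : Int (fun=> 0) = 0.
Proof. by rewrite /Rintegral integral0. Qed.

Lemma Int_sum I (s : seq I) (F : I -> T -> R) : (forall i, intg (F i)) ->
  Int (fun x => \sum_(i <- s) F i x) = \sum_(i <- s) Int (F i).
Proof.
move=> Fi; elim: s => [|i s IH].
  by under [in LHS]eq_fun do rewrite big_nil; rewrite big_nil Int0.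
under [in LHS]eq_fun do rewrite big_cons.
by rewrite IntD ?IH ?big_cons//; exact: intg_sum.
Qed.

Lemma le_Int f g : intg f -> intg g -> (forall x, f x <= g x) ->
  Int f <= Int g.
Proof. by move=> fi gi fg; apply: le_Rintegral. Qed.

Lemma Int_ge0 f : (forall x, 0 <= f x) -> 0 <= Int f.
Proof. by move=> f0; apply: Rintegral_ge0. Qed.

Lemma norm_Int f : intg f -> `|Int f| <= Int (fun x => `|f x|).
Proof. by move=> fi; apply: le_normr_Rintegral. Qed.

Lemma Int_dom f g : mf f -> (forall x, `|f x| <= g x) -> intg g ->
  Int (fun x => `|f x|) <= Int g.
Proof.
by move=> fm fg gi; apply: le_Int => //; apply: intg_norm; apply: intg_dom gi.
Qed.

Lemma intg_EFin f : intg f -> (Int f)%:E = (\int[mu]_x (f x)%:E)%E.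
Proof. by move=> fi; rewrite /Rintegral fineK//; exact: integrable_fin_num. Qed.

Lemma intg_ge0 f C : mf f -> (forall x, 0 <= f x) ->
  (\int[mu]_x (f x)%:E <= C%:E)%E -> intg f /\ Int f <= C.
Proof.
move=> fm f0 fC; have fi : intg f.
  apply/integrableP; split; first exact/measurable_EFinP.
  rewrite (le_lt_trans _ (ltry C))//; apply: le_trans fC.
  by apply: ge0_le_integral => //=; [exact/measurableT_comp/measurableT_comp|
    exact/measurable_EFinP|by move=> x _; rewrite ger0_norm].
by split => //; rewrite -lee_fin intg_EFin.
Qed.

Lemma intg_indic (B : set T) : measurable B -> (mu B < +oo)%E ->
  intg (\1_B : T -> R).
Proof.
move=> mB Bfin; apply/integrableP; split.
  by apply/measurable_EFinP; exact: measurable_indic.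
under eq_integral do rewrite /= ger0_norm//.
by rewrite integral_indic// setIT.
Qed.

Lemma Int_indic (B : set T) : measurable B -> Int (\1_B : T -> R) = fine (mu B).
Proof. by move=> mB; rewrite /Rintegral integral_indic// setIT. Qed.

Lemma Int_dct (F : nat -> T -> R) f g :
  (forall n, mf (F n)) -> mf f ->
  {ae mu, forall x, F n x @[n --> \oo] --> f x} ->
  intg g -> (forall n x, `|F n x| <= g x) ->
  [/\ intg f, Int (fun x => `|F n x - f x|) @[n --> \oo] --> 0 &
      Int (F n) @[n --> \oo] --> Int f].
Proof.
move=> mF fm Ff gi Fg.
have Fi n : intg (F n) by apply: intg_dom gi.
have [] := @dominated_convergence _ _ _ mu _ measurableT
  (fun n => EFin \o F n) (EFin \o f) (EFin \o g) _ _ _ gi _.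
- by move=> n; exact/measurable_EFinP.
- exact/measurable_EFinP.
- by apply: filterS Ff => x Ffx _; apply: cvg_EFin => //; exact: nearW.
- by apply: nearW => x n _ /=; rewrite lee_fin.
move=> fi H1 H2; split=> //; first exact: (fine_cvg H1).
by apply: fine_cvg; rewrite intg_EFin.
Qed.

Lemma Int_fatou (F : nat -> T -> R) f C :
  (forall n, intg (F n)) -> mf f -> (forall n x, 0 <= F n x) ->
  (forall x, 0 <= f x) -> {ae mu, forall x, F n x @[n --> \oo] --> f x} ->
  (forall n, Int (F n) <= C) -> intg f /\ Int f <= C.
Proof.
move=> Fi fm F0 f0 Ff FC; apply: intg_ge0 => //.
have mF n : measurable_fun setT (EFin \o F n).
  by apply/measurable_EFinP; exact: intg_mf.
have mL : measurable_fun setT (fun x => limn_einf (fun n => (F n x)%:E)).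
  apply: (emeasurable_fun_cvg (fun n x => einfs (fun k => (F k x)%:E) n)).
    by move=> n; exact: (measurable_fun_einfs (f := fun n => EFin \o F n)).
  by move=> x _; rewrite limn_einf_lim; exact: is_cvg_einfs.
rewrite (@ae_eq_integral _ _ _ mu setT
  (fun x => limn_einf (fun n => (F n x)%:E)) (EFin \o f))//; last 2 first.
- exact/measurable_EFinP.
- apply: filterS Ff => x Ffx _ /=; apply/esym.
  have : (F n x)%:E @[n --> \oo] --> (f x)%:E.
    by apply: cvg_EFin => //; exact: nearW.
  by move=> /cvg_limn_einf_sup[].
apply: le_trans (fatou mu measurableT mF _) _ => [n x _|]; first by rewrite lee_fin.
rewrite limn_einf_lim; apply: lime_le; first exact: is_cvg_einfs.
apply: nearW => n; apply: (@le_trans _ _ (\int[mu]_x (F n x)%:E)%E).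
  by apply: ereal_inf_lbound => /=; exists n => /=.
by rewrite -intg_EFin// lee_fin.
Qed.

(** Monotone convergence makes the sum of the series integrable, hence finite almost everywhere. *)
Lemma ae_bounded_series (F : nat -> T -> R) C :
  (forall n, intg (F n)) -> (forall n x, 0 <= F n x) ->
  (forall n, \sum_(0 <= k < n) Int (F k) <= C) ->
  {ae mu, forall x, exists K, forall n, \sum_(0 <= k < n) F k x <= K}.
Proof.
move=> Fi F0 FC.
have mF n : measurable_fun setT (EFin \o F n).
  by apply/measurable_EFinP; exact: intg_mf.
pose S x := (\sum_(n <oo) (F n x)%:E)%E.
have S0 x : (0 <= S x)%E by apply: nneseries_ge0 => *; rewrite lee_fin.
have Si : mu.-integrable setT S.
  apply/integrableP; split.
    by apply: ge0_emeasurable_sum => [n x *|n _]; [rewrite lee_fin|exact: mF].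
  under eq_integral do rewrite gee0_abs//.
  rewrite integral_nneseries//; last by move=> n x _; rewrite lee_fin.
  apply: le_lt_trans (ltry C); apply: lime_le.
    by apply: is_cvg_nneseries => n *; apply: integral_ge0 => x _; rewrite lee_fin.
  apply: nearW => n; under eq_bigr do rewrite -intg_EFin//.
  by rewrite sumEFin lee_fin.
apply: filterS (integrable_ae measurableT Si) => x /(_ Logic.I) Sx.
exists (fine (S x)) => n; rewrite -lee_fin fineK// -sumEFin.
by apply: nneseries_lim_ge => *; rewrite lee_fin.
Qed.

Lemma ae_null (P : T -> Prop) : {ae mu, forall x, P x} ->
  exists Z, [/\ measurable Z, mu Z = 0 & forall x, ~ Z x -> P x].
Proof.
move=> [Z [mZ Z0 PZ]]; exists Z; split=> // x Zx; apply: contrapT => Px.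
exact/Zx/PZ.
Qed.

Lemma continuous_norm_powR p : 0 < p -> continuous (fun y : R => `|y| `^ p).
Proof.
move=> p0 y; have [->|y0] := eqVneq y 0.
  apply/cvgrPdist_le => e e0 /=; rewrite normr0 powR0 ?gt_eqF//.
  have d0 : 0 < e `^ p^-1 by rewrite powR_gt0.
  near=> t; have te : `|t| < e `^ p^-1 by near: t; move: (e `^ p^-1) d0 => r r0; exact: (@nbhs0_lt _ R).
  rewrite sub0r normrN ger0_norm ?powR_ge0//.
  apply: (@le_trans _ _ ((e `^ p^-1) `^ p)); last first.
    by rewrite -powRrM mulVf ?lt0r_neq0// powRr1// ltW.
  by apply: ge0_ler_powR; rewrite ?nnegrE ?powR_ge0// ltW.
have y1 : 0 < `|y| by rewrite normr_gt0.
apply: (@continuous_comp _ _ _ (fun y : R => `|y|) (fun y => y `^ p)).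
  exact: norm_continuous.
apply: differentiable_continuous; apply/derivable1_diffP.
by apply: derivable_powR; rewrite in_itv/= y1.
Unshelve. all: by end_near. Qed.

Lemma measurable_norm_powR f p : mf f -> mf (fun x => `|f x| `^ p).
Proof.
by move=> fm; apply: (measurableT_comp (measurable_powR p)); exact: measurableT_comp.
Qed.

(** The factor [2 ^+ k] still leaves the convergent series of [2^k 4^-k], so almost everywhere
    [|g k.+1 - g k|^p <= K 2^-k]; after a root of order [p] the increments are dominated by a
    geometric series. This also covers [p < 1]. *)
Lemma ae_cvg_of_fast p (g : nat -> T -> R) : 0 < p ->
  (forall k, mf (g k)) ->
  (forall k, intg (fun x => `|g k.+1 x - g k x| `^ p) /\
    Int (fun x => `|g k.+1 x - g k x| `^ p) <= 4 ^- k) ->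
  exists h : T -> R, mf h /\ {ae mu, forall x, g n x @[n --> \oo] --> h x}.
Proof.
move=> p0 gm gp.
have [|k||Z [mZ Z0 PZ]] := @ae_null _ (@ae_bounded_series
  (fun k x => 2 ^+ k * `|g k.+1 x - g k x| `^ p) 2 _ _ _).
- by move=> k; apply: intgZ; case: (gp k).
- by move=> x; rewrite mulr_ge0// ?powR_ge0// exprn_ge0.
- move=> n; apply: (@le_trans _ _ (\sum_(0 <= k < n) 2^-1 ^+ k)).
    apply: ler_sum => k _; rewrite IntZ; last by case: (gp k).
    have [_ /(ler_wpM2l (exprn_ge0 k (ler0n R 2)))] := gp k.
    move=> /le_trans; apply; rewrite -exprVn -exprMn.
    by rewrite (_ : 2 * 4^-1 = 2^-1)//; field.
  have := @geometric_seriesE R 1 2^-1; rewrite /series/=.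
  rewrite (_ : (fun _ => _) = fun n => \sum_(0 <= k < n) 2^-1 ^+ k :> R); last first.
    by apply/funext => m; apply: eq_bigr => k _; rewrite /geometric/= mul1r.
  move=> /(_ _)/funeqP ->; last by apply/eqP; lra.
  have h0 : (0 : R) <= 2^-1 ^+ n by rewrite exprn_ge0.
  by rewrite /= ler_pdivrMr ?mul1r; lra.
have cvgZ x : ~ Z x -> cvgn (fun n => g n x).
  move=> /PZ[K HK].
  have K0 : 0 <= K by have := HK 0%N; rewrite big_geq.
  have -> : (fun n => g n x) =
      (fun n => g 0%N x + series (fun k => g k.+1 x - g k x) n).
    by apply/funext => n; rewrite /series/= telescope_sumr// addrC subrK.
  apply: is_cvgD; first exact: is_cvg_cst.
  apply: normed_cvg.
  pose r : R := 2^-1 `^ p^-1.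
  apply: (@series_le_cvg _ _ (geometric (K `^ p^-1) r)) => [k|k|k|] /=.
  - exact: normr_ge0.
  - by rewrite /geometric /= mulr_ge0 ?powR_ge0// exprn_ge0// powR_ge0.
  - rewrite /geometric /= /r -powR_mulrn ?powR_ge0// powRAC -powRM ?powR_ge0//.
    apply: (@le_trans _ _ ((`|g k.+1 x - g k x| `^ p) `^ p^-1)).
      by rewrite -powRrM mulfV ?lt0r_neq0// powRr1.
    apply: ge0_ler_powR; rewrite ?nnegrE ?powR_ge0 ?invr_ge0 ?(ltW p0)// ?mulr_ge0 ?powR_ge0//.
    rewrite powR_mulrn// exprVn ler_pdivlMr ?exprn_gt0// mulrC.
    apply: le_trans (HK k.+1); rewrite big_nat_recr//= lerDr.
    by apply: sumr_ge0 => j _; rewrite mulr_ge0 ?powR_ge0// exprn_ge0.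
  - apply: is_cvg_geometric_series; rewrite /r ger0_norm ?powR_ge0//.
    apply: (@lt_le_trans _ _ (1 `^ p^-1)); last by rewrite powR1.
    by apply: gt0_ltr_powR; rewrite ?invr_gt0 ?nnegrE//; lra.
(* Setting the functions to 0 on the null set [Z] makes them converge everywhere, so that the limit
   is measurable. *)
pose G n x := g n x * \1_(~` Z) x.
pose h x := limn (fun n => G n x).
have Gh x : G n x @[n --> \oo] --> h x.
  rewrite /h /G; case: (pselect (Z x)) => Zx.
    rewrite indicE memNset; last by move=> /(_ Zx).
    by under eq_fun do rewrite mulr0; apply: is_cvg_cst.
  rewrite indicE mem_set//; under eq_fun do rewrite mulr1; exact: cvgZ.
exists h; split.
  apply: (@measurable_fun_cvg _ _ _ _ G) => //.
  move=> n; apply: measurable_funM => //; apply: measurable_indic.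
  exact: measurableC.
exists Z; split=> // x /= nx; apply: contrapT => Zx; apply: nx.
have := Gh x; rewrite /G indicE mem_set//.
by under eq_fun do rewrite mulr1.
Qed.

Lemma Lp_complete p (g : nat -> T -> R) : 0 < p ->
  (forall k, mf (g k)) ->
  (forall k l, intg (fun x => `|g k x - g l x| `^ p)) ->
  (forall e, 0 < e -> exists n0, forall k l, (n0 <= k)%N -> (n0 <= l)%N ->
    Int (fun x => `|g k x - g l x| `^ p) <= e) ->
  exists (s : nat -> nat) (h : T -> R), [/\ mf h, forall n, (n <= s n)%N,
    {ae mu, forall x, g (s n) x @[n --> \oo] --> h x} &
    forall e, 0 < e -> exists n0, forall k, (n0 <= k)%N ->
      intg (fun x => `|g k x - h x| `^ p) /\
      Int (fun x => `|g k x - h x| `^ p) <= e].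
Proof.
move=> p0 gm gi gC.
have e0 n : (0 : R) < 4 ^- n by rewrite invr_gt0 exprn_gt0.
have [N HN] := choice (fun n => gC _ (e0 n)).
(* The cumulative sums make [s] nondecreasing, so that [s n] and [s n.+1] both lie beyond the
   threshold [N n]; the summand [n] gives [n <= s n]. *)
pose s n := (\sum_(j < n.+1) N j + n)%N.
have sN n : (N n <= s n)%N.
  by rewrite /s big_ord_recr /= -addnA addnCA leq_addr.
have sS n : (s n <= s n.+1)%N.
  by rewrite /s [X in (_ <= X + _)%N]big_ord_recr /= leq_add// leq_addr.
have [|k|h [hm gh]] := @ae_cvg_of_fast p (fun n => g (s n)) p0.
- by move=> k; exact: gm.
- by split=> //; apply: HN => //; apply: leq_trans (sN _) (sS _).
exists s, h; split=> // [n|e e_gt0]; first by rewrite /s leq_addl.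
have [n0 Hn0] := gC _ e_gt0; exists n0 => k k0.
(* Fatou's lemma along the subsequence turns the Cauchy estimate of the whole sequence into an
   estimate against the limit. *)
apply: (@Int_fatou (fun n x => `|g k x - g (s (n0 + n)%N) x| `^ p)) => //.
- by apply: measurable_norm_powR; apply: measurable_funB.
- apply: filterS gh => x ghx.
  apply: (@continuous_cvg _ _ _ _ _ (fun n => g k x - g (s (n0 + n)%N) x)
    (fun y => `|y| `^ p) (g k x - h x)); first exact: continuous_norm_powR.
  apply: cvgB; first exact: cvg_cst.
  under eq_fun do rewrite addnC.
  by move: ghx; rewrite -(cvg_shiftn n0).
- move=> n; apply: Hn0 => //; apply: leq_trans (leq_addl _ _).
  by rewrite leq_addr.
Qed.

End real_integral.

(** * Convex combinations converging in L^q *)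

Section power_inequalities.
Context (R : realType).
Implicit Types (x y a b p q e : R).

(** If [y <= e X^k] the first term dominates, otherwise [X < (y / e)^(1/k)] and the second one does.
    The parameter [k] is the gap between the two powers of [X]; for the drift it is chosen so that
    [p + k = m]. *)
Lemma young_powR p k e y X : 0 <= p -> 0 < k -> 0 < e -> 0 <= y -> 0 <= X ->
  y * X `^ p <= e * X `^ (p + k) + e `^ (- (p / k)) * y `^ ((p + k) / k).
Proof.
move=> p0 k0 e0 y0 X0; have pk : p + k != 0 by rewrite gt_eqF// ltr_wpDl.
have [yX|Xy] := leP y (e * X `^ k).
  rewrite -[leLHS]addr0 lerD ?mulr_ge0 ?powR_ge0// (addrC p) powRD; last first.
    by rewrite addrC (negbTE pk).
  by rewrite mulrA ler_wpM2r ?powR_ge0.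
have yp : 0 < y by apply: le_lt_trans Xy; rewrite mulr_ge0 ?powR_ge0// ltW.
rewrite -[leLHS]add0r lerD ?mulr_ge0 ?powR_ge0 ?(ltW e0)//.
have XE : X = (X `^ k) `^ k^-1.
  by rewrite -powRrM mulfV ?lt0r_neq0// powRr1.
have Xle : X `^ p <= (y / e) `^ (p / k).
  rewrite (mulrC p) powRrM; apply: ge0_ler_powR; rewrite ?nnegrE ?powR_ge0//.
  rewrite {1}XE; apply: ge0_ler_powR; rewrite ?nnegrE ?powR_ge0 ?invr_ge0 ?(ltW k0)//.
    by rewrite divr_ge0// ltW.
  by rewrite ler_pdivlMr// mulrC ltW.
apply: le_trans (ler_wpM2l y0 Xle) _.
rewrite powRM ?invr_ge0 ?(ltW e0)// -(powR_inv1 (ltW e0)) -powRrM mulN1r.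
rewrite (mulrDl p) mulfV ?lt0r_neq0// powRD; last first.
  by rewrite gt_eqF// ltr_wpDl// divr_ge0// ltW.
by rewrite powRr1// le_eqVlt; apply/orP; left; apply/eqP; ring.
Qed.

(** For [z] equal to [x] or [y] the ratio [z / (x + y)] lies in [[0, 1]], hence is at most its own
    power of exponent [s]; the two cases are added. *)
Lemma powR_subadd s x y : 0 < s <= 1 -> 0 <= x -> 0 <= y ->
  (x + y) `^ s <= x `^ s + y `^ s.
Proof.
move=> /andP[s0 s1] x0 y0; have [xy|] := ltP 0 (x + y); last first.
  move=> xy; have /eqP : x + y = 0 by apply: le_anti; rewrite xy addr_ge0.
  by rewrite paddr_eq0// => /andP[/eqP -> /eqP ->]; rewrite addr0 powR0 ?addr0// lt0r_neq0.
have H z : 0 <= z -> z <= x + y -> z * (x + y) `^ s <= (x + y) * z `^ s.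
  rewrite le_eqVlt => /predU1P[<-|z0] zxy.
    by rewrite mul0r mulr_ge0 ?powR_ge0// ltW.
  have G : z / (x + y) <= (z / (x + y)) `^ s.
    by apply: ger1_powR => //; rewrite divr_gt0//= ler_pdivrMr// mul1r.
  rewrite -[z in leRHS](@divfK _ (x + y)) ?lt0r_neq0// powRM ?divr_ge0 ?(ltW z0) ?(ltW xy)//.
  rewrite mulrA ler_wpM2r ?powR_ge0//.
  by apply: le_trans (ler_wpM2l (ltW xy) G); rewrite mulrC divfK ?lt0r_neq0.
rewrite -(ler_pM2l xy) mulrDr [leLHS]mulrDl lerD//; apply: H => //.
  by rewrite lerDl.
by rewrite lerDr.
Qed.

(** After subtraction of the parabola [k y^2 / 2] the derivative is nondecreasing on the segment, so
    the mean slope over the right half is at least the one over the left half. *)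
Lemma midpoint_gap (f f' : R -> R) k a b :
  (forall y, is_derive y 1 f (f' y)) -> a <= b ->
  (forall x y, a <= x -> x <= y -> y <= b -> k * (y - x) <= f' y - f' x) ->
  k * (b - a) ^+ 2 / 4 <= f a + f b - 2 * f ((a + b) / 2).
Proof.
move=> df; rewrite le_eqVlt => /predU1P[<-|ab] H.
  have -> : (a + a) / 2 = a by field.
  by rewrite subrr expr0n /= mulr0 mul0r; lra.
pose c := (a + b) / 2.
have ac : a < c by rewrite /c; lra.
have cb : c < b by rewrite /c; lra.
pose g y := f y - k / 2 * y ^+ 2.
have dg y : is_derive y 1 g (f' y - k * y).
  by apply: is_derive_eq; rewrite /GRing.scale/=; field.
have cg A : {within A, continuous g}.
  apply: continuous_subspaceT => y; apply: differentiable_continuous.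
  by apply/derivable1_diffP; have [] := dg y.
have [x /[!in_itv]/= /andP[ax xc] Hx] := MVT ac (fun y _ => dg y) (cg _).
have [y /[!in_itv]/= /andP[cy yb] Hy] := MVT cb (fun y _ => dg y) (cg _).
have xy : x <= y by exact: ltW (lt_trans xc cy).
have := H x y (ltW ax) xy (ltW yb); move: Hx Hy.
have -> : c - a = (b - a) / 2 by rewrite /c; field.
have -> : b - c = (b - a) / 2 by rewrite /c; field.
rewrite /g -/c => Hx Hy Hxy.
have : 0 <= (f' y - k * y - (f' x - k * x)) * ((b - a) / 2).
  by apply: mulr_ge0; lra.
rewrite mulrBl -Hx -Hy => G.
have -> : k * (b - a) ^+ 2 / 4 = k / 2 * (a ^+ 2 + b ^+ 2 - 2 * c ^+ 2).
  by rewrite /c; field.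
by lra.
Qed.

(** A substitute for [|y|^q], equal to it up to an error of at most 1 when [0 < q <= 2]. It is twice
    differentiable at 0 also for [q < 2], with an explicit lower bound for the second derivative. *)
Definition phi q y : R := (1 + y ^+ 2) `^ (q / 2) - 1.

Let s1 y : 0 < 1 + y ^+ 2.
Proof. by rewrite ltr_pwDl// sqr_ge0. Qed.

Lemma is_derive_phi q y :
  is_derive y 1 (phi q) (q * y * (1 + y ^+ 2) `^ (q / 2 - 1)).
Proof.
have H := is_derive1_powR (q / 2) (s1 y).
have H2 : is_derive y 1 (fun y : R => 1 + y ^+ 2) (2 * y).
  by apply: is_derive_eq; rewrite /GRing.scale/=; ring.
have := @is_derive1_comp R (fun z => z `^ (q / 2)) (fun y => 1 + y ^+ 2) y _ _ H H2.
by move=> H3; apply: is_derive_eq; rewrite subr0; move: (_ `^ (_ - 1)) => P; field.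
Qed.

Lemma is_derive_phi' q y : is_derive y 1
    (fun y => q * y * (1 + y ^+ 2) `^ (q / 2 - 1))
    (q * (1 + y ^+ 2) `^ (q / 2 - 2) * (1 + (q - 1) * y ^+ 2)).
Proof.
have H := is_derive1_powR (q / 2 - 1) (s1 y).
have H2 : is_derive y 1 (fun y : R => 1 + y ^+ 2) (2 * y).
  by apply: is_derive_eq; rewrite /GRing.scale/=; ring.
have H3 := @is_derive1_comp R (fun z => z `^ (q / 2 - 1)) (fun y => 1 + y ^+ 2) y _ _ H H2.
have H4 : is_derive y 1 (fun y : R => q * y) q.
  by apply: is_derive_eq; rewrite /GRing.scale/=; ring.
have E : (1 + y ^+ 2) `^ (q / 2 - 1) = (1 + y ^+ 2) * (1 + y ^+ 2) `^ (q / 2 - 2).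
  rewrite -{2}[1 + _ ^+ 2]powRr1 ?ltW// -powRD; last by apply/implyP => _; exact: lt0r_neq0.
  by congr powR; ring.
apply: is_derive_eq; rewrite /GRing.scale/= E.
rewrite (_ : q / 2 - 1 - 1 = q / 2 - 2); last by ring.
by field.
Qed.

Lemma phi_ge0 q y : 0 <= q -> 0 <= phi q y.
Proof.
move=> q0; rewrite subr_ge0 -[leLHS](powRr0 (1 + y ^+ 2)) ler_powR//.
  by rewrite lerDl sqr_ge0.
by rewrite divr_ge0.
Qed.

Lemma phi_le q y : 0 < q <= 2 -> phi q y <= `|y| `^ q.
Proof.
move=> /andP[q0 q2]; rewrite lerBlDl.
apply: le_trans (powR_subadd _ _ _) _ => //; first by apply/andP; split; lra.
  by rewrite sqr_ge0.
rewrite powR1 lerD2l -real_normK ?num_real// -powR_mulrn// -powRrM.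
by rewrite (_ : 2%:R * (q / 2) = q)//; field.
Qed.

Lemma le_phi q y : 0 < q -> `|y| `^ q <= phi q y + 1.
Proof.
move=> q0; rewrite subrK (_ : `|y| `^ q = (y ^+ 2) `^ (q / 2)).
  apply: ge0_ler_powR; rewrite ?nnegrE ?sqr_ge0 ?divr_ge0 ?(ltW (s1 _))// ?(ltW q0)//.
  by rewrite lerDr.
rewrite -real_normK ?num_real// -powR_mulrn// -powRrM.
by rewrite (_ : 2%:R * (q / 2) = q)//; field.
Qed.

(** The second derivative at [z] is at least [q (q - 1) (1 + z^2)^(q/2 - 1)]. The exponent is
    nonpositive and [z^2 <= a^2 + b^2] between [a] and [b], so [1 + z^2] may be replaced by
    [1 + a^2 + b^2] on the whole segment. *)
Lemma phi_gap q a b : 1 < q <= 2 ->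
  q * (q - 1) / 4 * (1 + a ^+ 2 + b ^+ 2) `^ (q / 2 - 1) * (a - b) ^+ 2 <=
  phi q a + phi q b - 2 * phi q ((a + b) / 2).
Proof.
move=> /andP[q1 q2]; wlog ab : a b / a <= b => [H|].
  have [/H//|/ltW/H] := leP a b.
  rewrite (_ : (b - a) ^+ 2 = (a - b) ^+ 2); last by ring.
  by rewrite addrAC (addrC b) (addrC (phi q b)).
pose k := q * (q - 1) * (1 + a ^+ 2 + b ^+ 2) `^ (q / 2 - 1).
apply: le_trans (@midpoint_gap _ _ k _ _ (is_derive_phi q) ab _).
  by rewrite le_eqVlt; apply/orP; left; apply/eqP; rewrite /k; field.
move=> x y ax; rewrite le_eqVlt => /predU1P[<- _|xy yb].
  by rewrite !subrr mulr0.
have [z /[!in_itv]/= /andP[xz zy] ->] := MVT xy (fun y _ => is_derive_phi' q y)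
  (continuous_subspaceT (fun y => differentiable_continuous
    (let: DeriveDef h _ := is_derive_phi' q y in (derivable1_diffP _ _).1 h))).
rewrite ler_wpM2r ?subr_ge0 ?(ltW xy)// /k.
have zab : z ^+ 2 <= a ^+ 2 + b ^+ 2.
  by have [z0|z0] := leP 0 z; nra.
have z2 := sqr_ge0 z.
apply: (@le_trans _ _ (q * (q - 1) * (1 + z ^+ 2) `^ (q / 2 - 1))).
  apply: ler_wpM2l; first by apply: mulr_ge0; lra.
  rewrite -[q / 2 - 1]opprB !powRN lef_pV2 ?posrE ?powR_gt0//; last first.
    by rewrite -addrA ltr_pwDl// addr_ge0 ?sqr_ge0.
  apply: ge0_ler_powR; rewrite ?nnegrE; first lra.
  - by rewrite ltW.
  - by rewrite !addr_ge0// sqr_ge0.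
  - by rewrite -addrA lerD2l.
have -> : (1 + z ^+ 2) `^ (q / 2 - 1) = (1 + z ^+ 2) * (1 + z ^+ 2) `^ (q / 2 - 2).
  rewrite -{2}[1 + _ ^+ 2]powRr1 ?ltW// -powRD; last by apply/implyP => _; exact: lt0r_neq0.
  by congr powR; ring.
have P0 := powR_ge0 (1 + z ^+ 2) (q / 2 - 2).
rewrite -!mulrA; apply: ler_wpM2l; first lra.
rewrite mulrA [leRHS]mulrC; apply: ler_wpM2r => //; nra.
Qed.

(** Let [Z = (1 + a^2 + b^2)^(1/2)]. If [|a - b| <= e Z] the first term suffices; otherwise
    [|a - b|^(q-2) <= (e Z)^(q-2)] and the quadratic gap of [phi] takes over. Once integrated, a
    small convexity gap yields a small distance in [L^q] on bounded sets. *)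
Lemma norm_powR_gap q e a b : 1 < q <= 2 -> 0 < e ->
  `|a - b| `^ q <= e `^ q * (1 + a ^+ 2 + b ^+ 2) `^ (q / 2) +
   e `^ (q - 2) * (4 / (q * (q - 1))) *
     (phi q a + phi q b - 2 * phi q ((a + b) / 2)).
Proof.
move=> /andP[q1 q2] e0.
set Z2 := 1 + a ^+ 2 + b ^+ 2.
have Z0 : 0 < Z2 by rewrite /Z2 -addrA ltr_pwDl// addr_ge0 ?sqr_ge0.
have c0 : 0 < q * (q - 1) by rewrite mulr_gt0//; lra.
have := @phi_gap q a b; rewrite q1 q2 => /(_ isT) G.
set gap := phi q a + _ - _ in G *.
have gapZ : Z2 `^ (q / 2 - 1) * (a - b) ^+ 2 <= 4 / (q * (q - 1)) * gap.
  by rewrite mulrAC ler_pdivlMr//; move: G; rewrite -/Z2; lra.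
have ZE : Z2 `^ (q / 2) = (Z2 `^ 2^-1) `^ q by rewrite -powRrM mulrC.
have [tZ|Zt] := leP `|a - b| (e * Z2 `^ 2^-1).
  rewrite -[leLHS]addr0 lerD//.
    rewrite ZE -powRM ?powR_ge0 ?(ltW e0)//.
    by apply: ge0_ler_powR; rewrite ?nnegrE ?mulr_ge0 ?powR_ge0 ?(ltW e0)//; lra.
  rewrite -mulrA mulr_ge0 ?powR_ge0//; apply: le_trans gapZ.
  by rewrite mulr_ge0 ?powR_ge0 ?sqr_ge0.
rewrite -[leLHS]add0r lerD ?mulr_ge0 ?powR_ge0//.
rewrite -mulrA; apply: le_trans (ler_wpM2l (powR_ge0 _ _) gapZ).
have t0 : 0 < `|a - b| by apply: le_lt_trans Zt; rewrite mulr_ge0 ?powR_ge0// ltW.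
rewrite -[(a - b) ^+ 2]real_normK ?num_real// -powR_mulrn//.
have -> : Z2 `^ (q / 2 - 1) = (Z2 `^ 2^-1) `^ (q - 2).
  by rewrite -powRrM; congr powR; field.
rewrite mulrA -powRM ?powR_ge0 ?(ltW e0)//.
have -> : `|a - b| `^ q = `|a - b| `^ (q - 2) * `|a - b| `^ 2%:R.
  by rewrite -powRD ?subrK//; apply/implyP => _; exact: lt0r_neq0.
apply: ler_wpM2r; first exact: powR_ge0.
rewrite -[q - 2]opprB !powRN lef_pV2 ?posrE ?powR_gt0//; last first.
  by rewrite mulr_gt0// powR_gt0.
by apply: ge0_ler_powR; rewrite ?nnegrE ?mulr_ge0 ?powR_ge0 ?(ltW e0) ?(ltW Zt)//; lra.
Qed.

End power_inequalities.

Section convergence_lemmas.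
Context d (T : measurableType d) (R : realType).
Variable mu : {measure set T -> \bar R}.
Implicit Types (f g : T -> R) (p : R).
Notation mf f := (measurable_fun [set: T] f).
Notation intg f := (mu.-integrable [set: T] (EFin \o f)).
Notation Int f := (\int[mu]_x f x).

Lemma ler_powRD p (x y : R) : 0 <= p ->
  `|x + y| `^ p <= 2 `^ p * (`|x| `^ p + `|y| `^ p).
Proof.
move=> p0; wlog xy : x y / `|x| <= `|y| => [H|].
  have [/H//|/ltW/H] := leP `|x| `|y|.
  by rewrite addrC [X in _ * X]addrC.
apply: (@le_trans _ _ ((2 * `|y|) `^ p)).
  apply: ge0_ler_powR; rewrite ?nnegrE ?mulr_ge0//.
  by rewrite mulr2n mulrDl mul1r (le_trans (ler_normD _ _))// lerD2r.
by rewrite powRM// ler_wpM2l ?powR_ge0// lerDr powR_ge0.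
Qed.

Lemma intg_powRD p f g : 0 <= p -> mf f -> mf g ->
  intg (fun x => `|f x| `^ p) -> intg (fun x => `|g x| `^ p) ->
  intg (fun x => `|f x + g x| `^ p).
Proof.
move=> p0 fm gm fi gi.
apply: (@intg_dom _ _ _ _ _ (fun x => 2 `^ p * (`|f x| `^ p + `|g x| `^ p))).
- by apply: measurable_norm_powR; exact: measurable_funD.
- by move=> x; rewrite ger0_norm ?powR_ge0// ler_powRD.
- by apply: intgZ; exact: intgD.
Qed.

Lemma intg_powRZ p c f : intg (fun x => `|f x| `^ p) ->
  intg (fun x => `|c * f x| `^ p).
Proof.
move=> fi; under eq_fun do rewrite normrM powRM//.
exact: intgZ.
Qed.

Lemma intg_powR_sum p (N : nat) (F : nat -> T -> R) : 0 < p ->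
  (forall n, mf (F n)) -> (forall n, intg (fun x => `|F n x| `^ p)) ->
  intg (fun x => `|\sum_(n < N) F n x| `^ p).
Proof.
move=> p0 Fm Fi; elim: N => [|N IH].
  under eq_fun do rewrite big_ord0 normr0 powR0 ?lt0r_neq0//.
  exact: intg0.
under eq_fun do rewrite big_ord_recr/=.
apply: intg_powRD => //; first exact: ltW.
by apply: measurable_sum.
Qed.

Lemma Int_bounded_cvg0 (B : set T) (F : nat -> T -> R) p M : 0 < p ->
  measurable B -> (mu B < +oo)%E -> (forall n, mf (F n)) ->
  (forall n x, `|F n x| <= M * \1_B x) ->
  {ae mu, forall x, F n x @[n --> \oo] --> 0} ->
  Int (fun x => `|F n x| `^ p) @[n --> \oo] --> 0.
Proof.
move=> p0 mB Bfin Fm FM F0.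
have [] := @Int_dct _ _ _ mu (fun n x => `|F n x| `^ p) (fun=> 0)
  (fun x => M `^ p * \1_B x).
- by move=> n; exact: measurable_norm_powR.
- by [].
- apply: filterS F0 => x F0x.
  rewrite [X in _ --> X](_ : 0 = `|0 : R| `^ p); last first.
    by rewrite normr0 powR0// lt0r_neq0.
  by apply: (@continuous_cvg _ _ _ _ _ (F ^~ x) (fun y => `|y| `^ p));
    [exact: continuous_norm_powR|].
- by apply: intgZ; exact: intg_indic.
- move=> n x; rewrite ger0_norm ?powR_ge0//; have := FM n x.
  rewrite indicE; case: (x \in B); rewrite ?mulr1 ?mulr0 => H.
    apply: ge0_ler_powR; rewrite ?nnegrE ?(ltW p0)//.
    exact: le_trans H.
  have /eqP -> : `|F n x| == 0 by rewrite eq_le H normr_ge0.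
  by rewrite powR0// lt0r_neq0.
by move=> _ _; rewrite Int0.
Qed.

(** One factor vanishes strongly in the dual exponent, the other is only bounded. Young's inequality
    with a parameter plays the part of Hoelder's: the parameter first makes the bounded term small,
    then [n] is taken large. *)
Lemma Int_product_cvg0 q C (b g : nat -> T -> R) : 1 < q ->
  (forall n, mf (b n)) -> (forall n, mf (g n)) ->
  (forall n, intg (fun x => `|g n x| `^ q) /\ Int (fun x => `|g n x| `^ q) <= C) ->
  (forall n, intg (fun x => `|b n x| `^ (q / (q - 1)))) ->
  Int (fun x => `|b n x| `^ (q / (q - 1))) @[n --> \oo] --> 0 ->
  (forall n, intg (fun x => b n x * g n x)) /\
  Int (fun x => b n x * g n x) @[n --> \oo] --> 0.
Proof.
move=> q1 bm gm gC bi b0.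
have q10 : 0 < q - 1 by rewrite subr_gt0.
have dom e n x : 0 < e -> `|b n x * g n x| <=
    e * `|g n x| `^ q + e `^ (- (1 / (q - 1))) * `|b n x| `^ (q / (q - 1)).
  move=> e0; rewrite normrM -[X in _ * X <= _]powRr1//.
  have := @young_powR R 1 (q - 1) e `|b n x| `|g n x|.
  by rewrite (addrC 1) subrK; apply.
have di e n : intg (fun x => e * `|g n x| `^ q +
    e `^ (- (1 / (q - 1))) * `|b n x| `^ (q / (q - 1))).
  by apply: intgD; apply: intgZ => //; case: (gC n).
have pm n : mf (fun x => b n x * g n x) by apply: measurable_funM.
have pi n : intg (fun x => b n x * g n x).
  by apply: intg_dom (di 1 n) => // x; exact: dom.
split=> //; have C0 : 0 <= C.
  by apply: le_trans (gC 0%N).2; apply: Int_ge0 => x; exact: powR_ge0.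
apply/cvgrPdist_le => e e0.
(* Chosen so that [dl * C <= e / 2]; the added 1 avoids a division by 0 when [C = 0]. *)
pose dl := e / (2 * (C + 1)).
have dl0 : 0 < dl by rewrite divr_gt0// mulr_gt0// ltr_wpDl.
pose K := dl `^ (- (1 / (q - 1))).
have K0 : 0 < K by rewrite powR_gt0.
have eK : 0 < e / 2 / K by rewrite !divr_gt0.
near=> n; rewrite sub0r normrN; apply: le_trans (norm_Int (pi n)) _.
apply: le_trans (Int_dom (pm n) (fun x => dom dl n x dl0) (di dl n)) _.
have [gi gle] := gC n.
rewrite IntD; [|by apply: intgZ..].
rewrite !IntZ// [leRHS](splitr e) lerD//.
  apply: (@le_trans _ _ (dl * (C + 1))).
    by rewrite ler_wpM2l ?(ltW dl0)// (le_trans gle)// lerDl.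
  by rewrite /dl le_eqVlt; apply/orP; left; apply/eqP; field; rewrite gt_eqF// ltr_wpDl.
rewrite -/K mulrC -ler_pdivlMr//.
apply: le_trans (ler_norm _) _.
near: n; exact: (cvgr0_norm_le _ b0 _ eK).
Unshelve. all: by end_near. Qed.

(** A moment [p > 1] gives equi-integrability: [|F n|] exceeds its truncation at height [K] by at
    most [K^(1-p) |F n|^p], uniformly small for large [K], while the truncations converge by
    domination. *)
Lemma Int_vitali (B : set T) (F : nat -> T -> R) p C : 1 < p ->
  measurable B -> (mu B < +oo)%E -> (forall n, mf (F n)) ->
  (forall n x, ~ B x -> F n x = 0) ->
  (forall n, intg (fun x => `|F n x| `^ p) /\ Int (fun x => `|F n x| `^ p) <= C) ->
  {ae mu, forall x, F n x @[n --> \oo] --> 0} ->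
  (forall n, intg (F n)) /\ Int (fun x => `|F n x|) @[n --> \oo] --> 0.
Proof.
move=> p1 mB Bfin Fm FB FC F0.
have C0 : 0 <= C.
  by apply: le_trans (FC 0%N).2; apply: Int_ge0 => x; exact: powR_ge0.
pose m K n x := Num.min `|F n x| K.
have mm K n : mf (m K n).
  by apply: measurable_minr => //; exact: measurableT_comp.
have mB0 K n x : 0 < K -> `|m K n x| <= K * \1_B x.
  move=> K0; rewrite ger0_norm ?le_min ?normr_ge0 ?(ltW K0)// indicE.
  have [xB|/negP xB] := boolP (x \in B); first by rewrite mulr1 ge_min lexx orbT.
  by rewrite mulr0 /m FB ?normr0 ?ge_min ?lexx// => Bx; apply: xB; rewrite inE.
have mi K n : 0 < K -> intg (m K n).
  move=> K0; apply: intg_dom (mm K n) (fun x => mB0 K n x K0) _.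
  by apply: intgZ; exact: intg_indic.
have dom K n x : 0 < K -> `|F n x| <= m K n x + K `^ (1 - p) * `|F n x| `^ p.
  move=> K0; rewrite /m; case: (leP `|F n x| K) => FK.
    by rewrite lerDl mulr_ge0 ?powR_ge0.
  rewrite -[leLHS]add0r lerD ?(ltW K0)//.
  have F1 : 0 < `|F n x| by exact: lt_trans FK.
  apply: (@le_trans _ _ (`|F n x| `^ (1 - p) * `|F n x| `^ p)).
    rewrite -powRD ?subrK ?powRr1//.
    by apply/implyP => _; exact: lt0r_neq0.
  apply: ler_wpM2r; first exact: powR_ge0.
  rewrite -[1 - p]opprB !powRN lef_pV2 ?posrE ?powR_gt0//.
  by apply: ge0_ler_powR; rewrite ?nnegrE ?(ltW K0) ?(ltW FK)//; lra.
have di K n : 0 < K -> intg (fun x => m K n x + K `^ (1 - p) * `|F n x| `^ p).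
  by move=> K0; apply: intgD; [exact: mi|apply: intgZ; case: (FC n)].
have Fi n : intg (F n).
  by apply: intg_dom (di 1 n ltr01) => // x; exact: dom.
split=> //; apply/cvgrPdist_le => e e0.
(* The solution of [K^(1-p) (C + 1) = e / 2]. *)
pose K := (2 * (C + 1) / e) `^ (p - 1)^-1.
have C1 : 0 < C + 1 by rewrite ltr_wpDl.
have K0 : 0 < K by rewrite powR_gt0// divr_gt0// mulr_gt0.
have KE : K `^ (1 - p) * (C + 1) = e / 2.
  rewrite -[1 - p]opprB powRN /K -powRrM mulVf ?powRr1 ?gt_eqF ?subr_gt0//.
    by field; rewrite !gt_eqF.
  by rewrite divr_ge0 ?mulr_ge0 ?(ltW e0) ?(ltW C1).
near=> n; rewrite sub0r normrN ger0_norm; last by apply: Int_ge0 => x.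
apply: le_trans (Int_dom (Fm n) (fun x => dom K n x K0) (di K n K0)) _.
have [gi gle] := FC n.
rewrite IntD; [|exact: mi|exact: intgZ].
rewrite IntZ// [leRHS](splitr e) lerD//; last first.
  by rewrite -KE ler_wpM2l ?powR_ge0// (le_trans gle)// lerDl.
apply: le_trans (ler_norm _) _; near: n.
have e2 : 0 < e / 2 by rewrite divr_gt0.
apply: (cvgr0_norm_le _ _ _ e2).
have -> : (fun n => Int (m K n)) = (fun n => Int (fun x => `|m K n x| `^ 1)).
  apply/funext => n; congr Rintegral; apply/funext => x; rewrite powRr1// ger0_norm//.
  by rewrite le_min normr_ge0 (ltW K0).
apply: (Int_bounded_cvg0 ltr01 mB Bfin (mm K) (fun n x => mB0 K n x K0)).
apply: filterS F0 => x F0x; apply/cvgrPdist_le => a a0; near=> k.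
rewrite sub0r normrN ger0_norm ?le_min ?normr_ge0 ?(ltW K0)// ge_min.
apply/orP; left; near: k; exact: (cvgr0_norm_le _ F0x _ a0).
Unshelve. all: by end_near. Qed.

(** With [t] the weighted mean of the [|y n|], Young's inequality for [|y n| t^(q-1)] is averaged
    with the weights; the resulting term [t^q / q'] is absorbed on the left. *)
Lemma jensen_powR q (N : nat) (c y : nat -> R) : 1 < q ->
  (forall n, 0 <= c n) -> \sum_(n < N) c n = 1 ->
  `|\sum_(n < N) c n * y n| `^ q <= \sum_(n < N) c n * `|y n| `^ q.
Proof.
move=> q1 c0 c1; pose t := \sum_(n < N) c n * `|y n|.
have q0 : 0 < q by lra.
have t0 : 0 <= t by apply: sumr_ge0 => n _; rewrite mulr_ge0.
apply: (@le_trans _ _ (t `^ q)).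
  apply: ge0_ler_powR; rewrite ?nnegrE ?(ltW q0)//.
  apply: le_trans (ler_norm_sum _ _ _) _.
  by apply: ler_sum => n _; rewrite normrM ger0_norm.
have [->|tn0] := eqVneq t 0.
  by rewrite powR0 ?lt0r_neq0//; apply: sumr_ge0 => n _; rewrite mulr_ge0 ?powR_ge0.
pose q' := q / (q - 1).
have q'0 : 0 < q' by rewrite divr_gt0// subr_gt0.
have E1 : t * t `^ (q - 1) = t `^ q by rewrite mulr_powRB1.
have E2 : (t `^ (q - 1)) `^ q' = t `^ q.
  by rewrite -powRrM /q' mulrC divfK// gt_eqF// subr_gt0.
have E3 : q^-1 + q'^-1 = 1.
  by rewrite /q'; field; rewrite !gt_eqF ?subr_gt0.
have Y n : `|y n| * t `^ (q - 1) <= `|y n| `^ q / q + t `^ q / q'.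
  by rewrite -E2; apply: conjugate_powR; rewrite ?powR_ge0.
have [w E1'] : exists w, w = t `^ q by exists (t `^ q).
have : t `^ q <= (\sum_(n < N) c n * `|y n| `^ q) / q + w / q'.
  have {}Y n : `|y n| * t `^ (q - 1) <= `|y n| `^ q / q + w / q' by rewrite E1'.
  have -> : t `^ q = \sum_(n < N) c n * (`|y n| * t `^ (q - 1)).
    by rewrite -E1 {1}/t mulr_suml; apply: eq_bigr => n _; rewrite mulrA.
  have -> : w / q' = \sum_(n < N) c n * (w / q') by rewrite -mulr_suml c1 mul1r.
  rewrite mulr_suml -big_split /=.
  by apply: ler_sum => n _; rewrite -[X in _ <= X + _]mulrA -mulrDr ler_wpM2l.
rewrite E1'; have -> : q'^-1 = 1 - q^-1 by rewrite -E3; ring.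
rewrite mulrBr mulr1 addrCA lerDl subr_ge0.
by rewrite ler_pM2r// invr_gt0.
Qed.

End convergence_lemmas.

Section convex_combinations.
Context (R : realType).

(** The weights are functions on all of [nat] and [N] only bounds their support, so that
    combinations of different lengths can be averaged without reindexing. *)
Definition tail_weights (k N : nat) (c : nat -> R) :=
  [/\ forall n, 0 <= c n, forall n, (n < k)%N -> c n = 0,
      forall n, (N <= n)%N -> c n = 0 & \sum_(n < N) c n = 1].

Lemma sum_widen (N M : nat) (c : nat -> R) : (N <= M)%N ->
  (forall n, (N <= n)%N -> c n = 0) -> \sum_(n < M) c n = \sum_(n < N) c n.
Proof.
move=> NM c0; rewrite (big_ord_widen _ c NM) [RHS]big_mkcond /=.
by apply: eq_bigr => i _; case: ltnP => // /c0.
Qed.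

Lemma tail_weights_mid k l N M c e : (k <= l)%N -> tail_weights k N c ->
  tail_weights l M e ->
  tail_weights k (maxn N M) (fun n => (c n + e n) / 2).
Proof.
move=> kl [c0 ck cN c1] [e0 el eM e1]; split.
- by move=> n; rewrite divr_ge0// addr_ge0.
- by move=> n nk; rewrite ck// el ?addr0 ?mul0r// (leq_trans nk).
- by move=> n; rewrite geq_max => /andP[nN nM]; rewrite cN// eM// addr0 mul0r.
rewrite -mulr_suml big_split/= (sum_widen (leq_maxl N M))//.
by rewrite (sum_widen (leq_maxr N M))// c1 e1; field.
Qed.

Lemma tail_weights_unit k : tail_weights k k.+1 (fun n => (n == k)%:R).
Proof.
split=> [//|n nk|n kn|]; first by rewrite ltn_eqF.
  by rewrite gtn_eqF.
rewrite big_ord_recr /= eqxx big1 ?add0r// => i _.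
by rewrite ltn_eqF.
Qed.

(** The weights of index [k] charge only indices from [k] on, so an estimate that holds eventually
    for [a] passes to its averages. *)
Lemma tail_weights_cvg (a : nat -> R) (l : R) (N : nat -> nat)
    (c : nat -> nat -> R) :
  (forall k, tail_weights k (N k) (c k)) -> a n @[n --> \oo] --> l ->
  \sum_(n < N k) c k n * a n @[k --> \oo] --> l.
Proof.
move=> cw /cvgrPdist_le al; apply/cvgrPdist_le => e e0.
have [m _ Hm] := al e e0.
exists m => // k /= mk; have [c0 ck cN c1] := cw k.
rewrite -[l]mul1r -c1 mulr_suml -sumrB.
apply: le_trans (ler_norm_sum _ _ _) _.
rewrite -[leRHS]mul1r -c1 mulr_suml; apply: ler_sum => n _.
rewrite -mulrBr normrM ger0_norm//; have [nk|kn] := ltnP n k.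
  by rewrite ck// !mul0r.
by rewrite ler_wpM2l//; apply: Hm; exact: leq_trans kn.
Qed.

Context d (T : measurableType d).
Variable mu : {measure set T -> \bar R}.
Notation mf f := (measurable_fun [set: T] f).
Notation intg f := (mu.-integrable [set: T] (EFin \o f)).
Notation Int f := (\int[mu]_x f x).

Lemma intg_phi (q : R) (f : T -> R) : 0 < q <= 2 -> mf f -> intg (fun x => `|f x| `^ q) ->
  intg (fun x => phi q (f x)).
Proof.
move=> /andP[q0 q2] fm; apply: intg_dom => [|x].
  apply: measurable_funB => //.
  apply: (measurableT_comp (measurable_powR _)).
  by apply: measurable_funD => //; exact: measurable_funX.
by rewrite ger0_norm ?phi_ge0 ?(ltW q0)// phi_le// q0.
Qed.

(* The functional [sum_j int phi(W_j)] is uniformly convex on bounded sets, so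
   almost minimizers over the convex hulls of the tails are Cauchy. *)
Lemma convex_combination_Lq (J : finType) (q C : R) (B : set T)
    (F : nat -> J -> T -> R) : 1 < q <= 2 -> measurable B -> (mu B < +oo)%E ->
  (forall n j, mf (F n j)) -> (forall n j x, ~ B x -> F n j x = 0) ->
  (forall n j, intg (fun x => `|F n j x| `^ q) /\
     Int (fun x => `|F n j x| `^ q) <= C) ->
  exists (N : nat -> nat) (c : nat -> nat -> R) (H : J -> T -> R),
    let W k j x := \sum_(n < N k) c k n * F n j x in
  [/\ forall k, tail_weights k (N k) (c k), forall j, mf (H j),
      forall j x, ~ B x -> H j x = 0,
      forall j, intg (fun x => `|H j x| `^ q) &
      forall j e, 0 < e -> exists n0, forall k, (n0 <= k)%N ->
        intg (fun x => `|W k j x - H j x| `^ q) /\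
        Int (fun x => `|W k j x - H j x| `^ q) <= e].
Proof.
have arith (P1 P2 M d1 d2 i1 i2 s e : R) : s - e / 4 <= M -> P1 < d1 + i1 ->
    P2 < d2 + i2 -> i1 <= e / 4 -> i2 <= e / 4 -> d1 <= s -> d2 <= s ->
    P1 + P2 - 2 * M <= e by move=> *; lra.
have arith2 (x y M c : R) : x <= c -> y <= c -> 3 * M + (x + y) <= 3 * M + 2 * c + 1.
  by move=> *; lra.
move=> q12 mB Bfin Fm FB FC; have /andP[q1 q2] := q12.
have q0 : 0 < q by lra.
have q02 : 0 < q <= 2 by rewrite q0.
pose comb N (c : nat -> R) j x := \sum_(n < N) c n * F n j x.
have mcomb N c j : mf (comb N c j).
  by apply: measurable_sum => n; apply: measurable_funM.
have icomb N c j : intg (fun x => `|comb N c j x| `^ q).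
  apply: (@intg_powR_sum _ _ _ mu q N (fun n x => c n * F n j x)) => // n.
    by apply: measurable_funM.
  by apply: intg_powRZ; case: (FC n j).
have combB N c j x : ~ B x -> comb N c j x = 0.
  by move=> Bx; rewrite /comb big1// => n _; rewrite FB// mulr0.
have [Phi PhiE] : exists Phi : nat -> (nat -> R) -> R, forall N c,
    Phi N c = \sum_(j : J) Int (fun x => phi q (comb N c j x)).
  by exists (fun N c => \sum_(j : J) Int (fun x => phi q (comb N c j x))).
have iphi N c j : intg (fun x => phi q (comb N c j x)) by exact: intg_phi.
have phi0 y : 0 <= phi q y by apply: phi_ge0; exact: ltW.
have Phi0 N c : 0 <= Phi N c.
  by rewrite PhiE; apply: sumr_ge0 => j _; apply: Int_ge0 => x.
pose S k := [set t | exists N c, tail_weights k N c /\ t = Phi N c].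
have S_has k : has_inf (S k).
  split; first by exists (Phi k.+1 (fun n => (n == k)%:R)), k.+1, (fun n => (n == k)%:R);
    split=> //; exact: tail_weights_unit.
  by exists 0 => _ [N [c [_ ->]]].
pose dd k := inf (S k).
pose C' := \sum_(j : J) C.
have dd_le k : dd k <= C'.
  apply: (@le_trans _ _ (Phi k.+1 (fun n => (n == k)%:R))).
    apply: ge_inf; first by case: (S_has k).
    by exists k.+1, (fun n => (n == k)%:R); split=> //; exact: tail_weights_unit.
  rewrite PhiE; apply: ler_sum => j _; have [Fi Fle] := FC k j; apply: le_trans Fle.
  apply: le_Int => // x; rewrite /comb big_ord_recr /= eqxx mul1r big1 ?add0r.
    exact: phi_le.
  by move=> i _; rewrite ltn_eqF// mul0r.
have /choice[Nc HNc] : forall k, exists p : nat * (nat -> R),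
    tail_weights k p.1 p.2 /\ Phi p.1 p.2 < dd k + k.+1%:R^-1.
  move=> k; have k0 : (0 : R) < k.+1%:R^-1 by rewrite invr_gt0.
  have [_ [N [c [cw ->]]] lt] := inf_adherent k0 (S_has k).
  by exists (N, c).
pose N k := (Nc k).1; pose c k := (Nc k).2.
pose W k := comb (N k) (c k).
pose s := sup (range dd).
have dd_sup : has_sup (range dd).
  by split; [exists (dd 0%N), 0%N|exists C' => _ [k _ <-]].
pose gap k l j x := phi q (W k j x) + phi q (W l j x) -
  2 * phi q ((W k j x + W l j x) / 2).
have midE k l j x : (W k j x + W l j x) / 2 =
    comb (maxn (N k) (N l)) (fun n => (c k n + c l n) / 2) j x.
  have [_ _ ck _] := (HNc k).1; have [_ _ cl _] := (HNc l).1.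
  rewrite /W /comb.
  rewrite -(@sum_widen _ _ (fun n => c k n * F n j x) (leq_maxl (N k) (N l))); last first.
    by move=> n /ck; rewrite -/(c k) => ->; rewrite mul0r.
  rewrite -(@sum_widen _ _ (fun n => c l n * F n j x) (leq_maxr (N k) (N l))); last first.
    by move=> n /cl; rewrite -/(c l) => ->; rewrite mul0r.
  by rewrite -big_split mulr_suml; apply: eq_bigr => n _ /=; field.
have gap0 k l j x : 0 <= gap k l j x.
  apply: le_trans (phi_gap _ _ q12); rewrite mulr_ge0 ?sqr_ge0//.
  rewrite mulr_ge0 ?powR_ge0// divr_ge0// mulr_ge0//; lra.
have igap k l j : intg (gap k l j).
  rewrite /gap; under eq_fun do rewrite midE.
  by apply: intgB; [apply: intgD|apply: intgZ]; exact: iphi.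
(* The midpoint of [W k] and [W l] is a combination of the tail from [n1], so its energy is at least
   [s - e / 4], whereas those of [W k] and [W l] are at most [s + e / 4]; the total gap is at most
   [e]. *)
have gap_small e : 0 < e -> exists n0, forall k l, (n0 <= k)%N -> (n0 <= l)%N ->
    forall j, Int (gap k l j) <= e.
  move=> e0; have e4 : 0 < e / 4 by rewrite divr_gt0.
  have [_ [n1 _ <-] Hn1] := sup_adherent e4 dd_sup.
  have ddS k l : (k <= l)%N -> dd k <= dd l.
    move=> kl; apply: lb_le_inf; first by case: (S_has l).
    move=> _ [M [b [bw ->]]]; apply: ge_inf; first by case: (S_has k).
    exists M, b; split=> //; case: bw => b0 bl bM b1; split=> // n nk.
    by apply: bl; exact: leq_trans nk kl.
  pose n2 := Num.truncn (e / 4)^-1.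
  exists (maxn n1 n2) => k l; rewrite !geq_max => /andP[k1 k2] /andP[l1 l2] j.
  have small m : (n2 <= m)%N -> m.+1%:R^-1 <= e / 4.
    move=> nm; rewrite invf_ple ?posrE//; apply: (@le_trans _ _ n2.+1%:R).
      by rewrite ltW// truncnS_gt.
    by rewrite ler_nat.
  have le_s m : dd m <= s by apply: sup_ubound; [case: dd_sup|exists m].
  apply: (@le_trans _ _ (\sum_j Int (gap k l j))).
    rewrite (bigD1 j)//= lerDl; apply: sumr_ge0 => i _.
    by apply: Int_ge0 => x.
  have -> : \sum_j Int (gap k l j) = Phi (N k) (c k) + Phi (N l) (c l) -
      2 * Phi (maxn (N k) (N l)) (fun n => (c k n + c l n) / 2).
    rewrite !PhiE mulr_sumr -sumrN -!big_split /=; apply: eq_bigr => i _.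
    transitivity (Int (fun x => (phi q (W k i x) + phi q (W l i x)) -
        2 * phi q (comb (maxn (N k) (N l)) (fun n => (c k n + c l n) / 2) i x))).
      by congr Rintegral; apply/funext => x; rewrite /gap midE.
    rewrite (IntB (intgD (iphi _ _ _) (iphi _ _ _)) (intgZ 2 (iphi _ _ _))).
    by rewrite (IntD (iphi _ _ _) (iphi _ _ _)) (IntZ 2 (iphi _ _ _)).
  have mid_ge : s - e / 4 <= Phi (maxn (N k) (N l)) (fun n => (c k n + c l n) / 2).
    apply: ltW; apply: (lt_le_trans Hn1); apply: ge_inf; first by case: (S_has n1).
    exists (maxn (N k) (N l)), (fun n => (c k n + c l n) / 2); split=> //.
    have W1 m : (n1 <= m)%N -> tail_weights n1 (N m) (c m).
      move=> nm; have [b0 bl bM b1] := (HNc m).1; split=> // n nk.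
      by apply: bl; exact: leq_trans nk nm.
    exact: tail_weights_mid (leqnn _) (W1 _ k1) (W1 _ l1).
  exact: (arith _ _ _ _ _ _ _ _ _ mid_ge (HNc k).2 (HNc l).2 (small _ k2) (small _ l2) (le_s k) (le_s l)).
have Phi_le k : Phi (N k) (c k) <= C' + 1.
  apply: ltW; apply: lt_le_trans (HNc k).2 _; apply: lerD => //.
  by rewrite invf_le1// ler1n.
(* A bound for the integral of the factor of [e ^ q] in [dist] below: three times the measure of [B]
   and the energy bound [C' + 1] twice, the last 1 making it positive. *)
pose K := 3 * fine (mu B) + 2 * (C' + 1) + 1.
have K0 : 0 < K.
  rewrite /K ltr_wpDl//; apply: addr_ge0; apply: mulr_ge0 => //.
  by apply: le_trans (Phi0 _ _) (Phi_le 0%N).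
have IW k j : Int (fun x => phi q (W k j x)) <= C' + 1.
  apply: le_trans (Phi_le k); rewrite PhiE (bigD1 j)//= lerDl.
  by apply: sumr_ge0 => i _; apply: Int_ge0 => x.
pose cq := 4 / (q * (q - 1)).
have cq0 : 0 <= cq by rewrite divr_ge0// mulr_ge0//; lra.
have dist e k l j x : 0 < e -> `|W k j x - W l j x| `^ q <=
    e `^ q * (3 * \1_B x + (phi q (W k j x) + phi q (W l j x))) +
    e `^ (q - 2) * cq * gap k l j x.
  move=> e0; have [xB|/negP xB] := boolP (x \in B); last first.
    have Bx : ~ B x by move=> Bx; apply: xB; rewrite inE.
    have Wk : W k j x = 0 by exact: combB.
    have Wl : W l j x = 0 by exact: combB.
    rewrite [in leLHS]Wk [in leLHS]Wl subrr normr0 powR0 ?lt0r_neq0//.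
    apply: addr_ge0; apply: mulr_ge0; rewrite ?powR_ge0//.
      by apply: addr_ge0; [exact: mulr_ge0|exact: addr_ge0].
    by rewrite mulr_ge0 ?powR_ge0.
  rewrite indicE xB mulr1; apply: le_trans (norm_powR_gap _ _ q12 e0) _.
  rewrite lerD2r ler_wpM2l ?powR_ge0//.
  set a := W k j x; set b := W l j x.
  have s01 : 0 < q / 2 <= 1 by apply/andP; split; lra.
  apply: (@le_trans _ _ (1 + (a ^+ 2) `^ (q / 2) + (b ^+ 2) `^ (q / 2))).
    apply: le_trans (powR_subadd s01 _ _) _; rewrite ?addr_ge0 ?sqr_ge0//.
    rewrite lerD2r; apply: le_trans (powR_subadd s01 _ _) _; rewrite ?sqr_ge0//.
    by rewrite powR1.
  have E y : (y ^+ 2) `^ (q / 2) = `|y| `^ q :> R.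
    rewrite -real_normK ?num_real// -powR_mulrn// -powRrM.
    by rewrite (_ : 2%:R * (q / 2) = q)//; field.
  by rewrite !E; have := le_phi a q0; have := le_phi b q0; lra.
have iB : intg (\1_B : T -> R) by exact: intg_indic.
have idist k l j : intg (fun x => `|W k j x - W l j x| `^ q).
  under eq_fun do rewrite -mulN1r; apply: intg_powRD; first exact: ltW.
  - exact: mcomb.
  - by apply: measurable_funM => //; exact: mcomb.
  - exact: icomb.
  - by apply: intg_powRZ; exact: icomb.
have cauchy j e : 0 < e -> exists n0, forall k l, (n0 <= k)%N -> (n0 <= l)%N ->
    Int (fun x => `|W k j x - W l j x| `^ q) <= e.
  move=> e0; pose eta := (e / (2 * K)) `^ q^-1.
  have eta0 : 0 < eta by rewrite powR_gt0// divr_gt0// mulr_gt0.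
  have etaE : eta `^ q = e / (2 * K).
    rewrite /eta -powRrM mulVf ?lt0r_neq0// powRr1//.
    by rewrite divr_ge0 ?mulr_ge0 ?(ltW e0) ?(ltW K0).
  pose D := eta `^ (q - 2) * cq + 1.
  have D0 : 0 < D by rewrite ltr_wpDl// mulr_ge0 ?powR_ge0.
  have eD : 0 < e / (2 * D) by rewrite divr_gt0// mulr_gt0.
  have [n0 Hn0] := gap_small _ eD.
  exists n0 => k l k0 l0; have gj := Hn0 k l k0 l0 j.
  have ib : intg (fun x => 3 * \1_B x + (phi q (W k j x) + phi q (W l j x))).
    by apply: intgD; [exact: intgZ|apply: intgD; exact: iphi].
  apply: le_trans (le_Int (idist k l j) _ (fun x => dist eta k l j x eta0)) _.
    by apply: intgD; apply: intgZ.
  rewrite IntD; [|exact: intgZ|exact: intgZ].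
  rewrite !IntZ// [leRHS](splitr e) lerD//.
    rewrite etaE.
    have IK : Int (fun x => 3 * \1_B x + (phi q (W k j x) + phi q (W l j x))) <= K.
      rewrite IntD; [|exact: intgZ|by apply: intgD; exact: iphi].
      rewrite IntZ// Int_indic// IntD; [|exact: iphi|exact: iphi].
      exact: (arith2 _ _ _ _ (IW k j) (IW l j)).
    apply: le_trans (ler_wpM2l _ IK) _.
      by rewrite divr_ge0 ?mulr_ge0 ?(ltW e0) ?(ltW K0).
    by rewrite le_eqVlt; apply/orP; left; apply/eqP; field; rewrite gt_eqF.
  apply: (@le_trans _ _ (D * (e / (2 * D)))).
    apply: ler_pM => //; first by rewrite mulr_ge0 ?powR_ge0.
      by apply: Int_ge0 => x.
    by rewrite /D lerDl.
  by rewrite le_eqVlt; apply/orP; left; apply/eqP; field; rewrite gt_eqF.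
have /choice[H0 HH] : forall j, exists h : T -> R, mf h /\
    forall e, 0 < e -> exists n0, forall k, (n0 <= k)%N ->
      intg (fun x => `|W k j x - h x| `^ q) /\
      Int (fun x => `|W k j x - h x| `^ q) <= e.
  move=> j; have [_ [h [hm _ _ hc]]] := Lp_complete q0 (fun k => mcomb (N k) (c k) j)
    (fun k l => idist k l j) (cauchy j).
  by exists h.
(* The cut-off makes the limit vanish outside [B] at every point and not only almost everywhere. *)
pose H j x := H0 j x * \1_B x.
have Hm j : mf (H j).
  by apply: measurable_funM; [case: (HH j)|exact: measurable_indic].
have HW j e : 0 < e -> exists n0, forall k, (n0 <= k)%N ->
    intg (fun x => `|W k j x - H j x| `^ q) /\
    Int (fun x => `|W k j x - H j x| `^ q) <= e.
  move=> e0; have [_ /(_ e e0)[n0 Hn0]] := HH j; exists n0 => k /Hn0[hi hle].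
  have le x : `|W k j x - H j x| `^ q <= `|W k j x - H0 j x| `^ q.
    rewrite /H indicE; have [xB|/negP xB] := boolP (x \in B).
      by rewrite mulr1.
    have Wk : W k j x = 0 by apply: combB => Bx; apply: xB; rewrite inE.
    by rewrite mulr0 subr0 Wk normr0 powR0 ?powR_ge0// lt0r_neq0.
  have hi' : intg (fun x => `|W k j x - H j x| `^ q).
    apply: intg_dom hi => [|x]; last by rewrite ger0_norm ?powR_ge0.
    by apply: measurable_norm_powR; apply: measurable_funB => //; exact: mcomb.
  by split=> //; exact: le_trans (le_Int hi' hi le) hle.
exists N, c, H; split=> //.
- by move=> k; case: (HNc k).
- by move=> j x Bx; rewrite /H indicE memNset// mulr0.
- move=> j; have [n0 /(_ n0 (leqnn _))[hi _]] := HW j 1 ltr01.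
  have -> : (fun x => `|H j x| `^ q) =
      (fun x => `|W n0 j x + -1 * (W n0 j x - H j x)| `^ q).
    by apply/funext => x; congr (`|_| `^ _); ring.
  apply: intg_powRD.
  - exact: ltW.
  - exact: mcomb.
  - by apply: measurable_funM => //; apply: measurable_funB => //; exact: mcomb.
  - exact: icomb.
  - exact: intg_powRZ.
Qed.

End convex_combinations.

Section countable_cases.
Context d (T : measurableType d) d' (U : measurableType d').

Lemma measurable_countable_cases (K : countType) (i : T -> K) (F : K -> T -> U) :
  (forall k, measurable [set x | i x = k]) ->
  (forall k, measurable_fun setT (F k)) ->
  measurable_fun setT (fun x => F (i x) x).
Proof.
move=> mi mF _ B mB; rewrite setTI.
rewrite [X in measurable X](_ : _ = \bigcup_(k : K)
  ([set x | i x = k] `&` (F k @^-1` B))).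
  apply: countable_bigcupT_measurable => [|k]; first exact: countableP.
  by apply: measurableI => //; rewrite -[X in measurable X]setTI; exact: mF.
by apply/seteqP; split=> [x Bx|x [k _ /= [<-]]] //; exists (i x).
Qed.

End countable_cases.

(** * Translations and lattice functions *)

Section lebesgue_Rn.
Context (R : realType) (N : nat).
Notation mu := (leb R N).
Notation mf f := (measurable_fun [set: Rn R N] (f : Rn R N -> R)).
Notation intg f := (mu.-integrable [set: Rn R N] (EFin \o (f : Rn R N -> R))).
Notation Int f := (\int[mu]_x (f : Rn R N -> R) x).
Implicit Types (f g : 'rV[R]_N -> R) (z x : 'rV[R]_N).

Lemma continuous_measurable_Rn f : continuous f -> mf f.
Proof.
move=> /continuousP fc.
apply: (@measurability _ _ (Rn R N) R setT f _ (RGenOpens.measurableE R)).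
move=> _ [_ [c [e ->] <-]]; rewrite setTI; apply: open_measurable_Rn.
exact/fc/interval_open.
Qed.

Lemma measurable_comp_translate f z : mf f -> mf (fun x => f (x + z)).
Proof. by move=> fm; exact: (measurableT_comp fm (measurable_translate z)). Qed.

Lemma ge0_integral_translate (f : Rn R N -> \bar R) z :
  measurable_fun setT f -> (forall x, (0 <= f x)%E) ->
  (\int[mu]_x f (x + z)%R = \int[mu]_x f x)%E.
Proof.
move=> fm f0.
have mT := measurable_translate z.
transitivity (\int[pushforward mu (fun x : Rn R N => x + z : Rn R N)%R]_x f x)%E.
  by rewrite (ge0_integral_pushforward mT).
apply: eq_measure_integral => A mA _.
exact: (lebesgue_outer_translate z A).
Qed.

Lemma intg_translate f z : intg f -> intg (fun x => f (x + z)).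
Proof.
move=> fi; have fm := intg_mf fi; have /integrableP[_ fle] := fi.
apply/integrableP; split.
  by apply/measurable_EFinP; exact: measurable_comp_translate.
apply: le_lt_trans fle; rewrite le_eqVlt; apply/orP; left; apply/eqP.
have fmn : mf (fun x => `|f x|) by exact: measurableT_comp.
have fme : measurable_fun [set: Rn R N] (EFin \o ((fun x => `|f x|) : Rn R N -> R)).
  exact/measurable_EFinP.
exact: (ge0_integral_translate z fme (fun x => normr_ge0 (f x))).
Qed.

Lemma Int_translate f z : intg f -> Int (fun x => f (x + z)) = Int f.
Proof.
move=> fi; have fm := intg_mf fi; congr fine.
have mT := measurable_translate z.
transitivity (\int[pushforward mu (fun x : Rn R N => (x + z)%R : Rn R N)]_x (f x)%:E)%E.
  have fem : measurable_fun [set: Rn R N] (EFin \o (f : Rn R N -> R)).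
    exact/measurable_EFinP.
  have fiz : mu.-integrable ((fun x : Rn R N => x + z : Rn R N) @^-1` setT)
      ((EFin \o (f : Rn R N -> R)) \o (fun x : Rn R N => x + z : Rn R N)).
    exact: intg_translate.
  exact/esym/(integral_pushforward mT fem fiz measurableT).
apply: eq_measure_integral => A mA _.
exact: (lebesgue_outer_translate z A).
Qed.

Lemma leb_bounded (B : set 'rV[R]_N) : bounded_set B -> (mu B < +oo)%E.
Proof.
move=> [M [Mr HM]].
have BM x : B x -> `|x| <= M + 1 by apply: HM; rewrite ltrDl.
pose K : 'rV[R]_N := const_mx (M + 1).
(* The lower corner is moved by 1 because boxes are open on the left. *)
apply: (@le_lt_trans _ _ (box_volume (Some (- K - const_mx 1, K)))); last exact: ltry.
apply: le_trans (leb_box_le _); apply: (le_outer_measure (lebesgue_outer_measure R N)).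
move=> x /BM xM i; have := le_trans (rV_normP x i) xM.
by rewrite !mxE ler_norml => /andP[? ?]; apply/andP; split; lra.
Qed.

End lebesgue_Rn.

Section lattice_functions.
Context (R : realType) (N : nat) (h : R).
Hypothesis h0 : 0 < h.
Notation mu := (leb R N).
Notation mf f := (measurable_fun [set: Rn R N] (f : Rn R N -> R)).
Notation intg f := (mu.-integrable [set: Rn R N] (EFin \o (f : Rn R N -> R))).
Notation Int f := (\int[mu]_x (f : Rn R N -> R) x).
Implicit Types (U V : 'rV[int]_N -> R) (I : seq 'rV[int]_N).

Lemma measurable_lat_cases (F : 'rV[int]_N -> 'rV[R]_N -> R) :
  (forall k, mf (F k)) -> mf (fun x => F (idx h x) x).
Proof.
move=> mF; apply: (@measurable_countable_cases _ (Rn R N) _ R _ (idx h) F) => // k.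
exact: measurable_cell.
Qed.

Lemma measurable_lat U : mf (fun x => U (idx h x)).
Proof. exact: (@measurable_lat_cases (fun k _ => U k)). Qed.

Lemma lat_cases_sum I (F : 'rV[int]_N -> 'rV[R]_N -> R) x : uniq I ->
  (forall k, k \notin I -> F k x = 0) ->
  F (idx h x) x = \sum_(k <- I) \1_[set x | idx h x = k] x * F k x.
Proof.
move=> uI FI; have [kI|kI] := boolP (idx h x \in I); last first.
  rewrite FI// big_seq big1// => k kI'; rewrite indicE memNset ?mul0r//= => E.
  by move: kI; rewrite E kI'.
rewrite (bigD1_seq _ kI uI)/= indicE mem_set// mul1r big1 ?addr0// => k kx.
by rewrite indicE memNset ?mul0r//= => E; move: kx; rewrite E eqxx.
Qed.

Lemma intg_lat_cases I (F : 'rV[int]_N -> 'rV[R]_N -> R) : uniq I ->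
  (forall k x, k \notin I -> F k x = 0) ->
  (forall k, intg (fun x => \1_[set x | idx h x = k] x * F k x)) ->
  intg (fun x => F (idx h x) x) /\ Int (fun x => F (idx h x) x) =
    \sum_(k <- I) Int (fun x => \1_[set x | idx h x = k] x * F k x).
Proof.
move=> uI FI Fi; have E : (fun x => F (idx h x) x) =
    (fun x => \sum_(k <- I) \1_[set x | idx h x = k] x * F k x).
  by apply/funext => x; apply: lat_cases_sum => // k; exact: FI.
by rewrite E; split; [exact: intg_sum|rewrite Int_sum].
Qed.

Lemma intg_cell k : (0 < N)%N ->
  intg (\1_[set x | idx h x = k] : 'rV[R]_N -> R).
Proof.
by move=> N0; apply: intg_indic; [exact: measurable_cell|rewrite leb_cell ?ltry].
Qed.

Lemma intg_lat I U : (0 < N)%N -> uniq I -> (forall k, k \notin I -> U k = 0) ->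
  intg (fun x => U (idx h x)) /\
  Int (fun x => U (idx h x)) = h ^+ N * \sum_(k <- I) U k.
Proof.
move=> N0 uI UI; have Ui k : intg (fun x => \1_[set x | idx h x = k] x * U k).
  by under eq_fun do rewrite mulrC; apply: intgZ; exact: intg_cell.
have [ui ->] := @intg_lat_cases I (fun k _ => U k) uI (fun k _ => UI k) Ui.
split=> //; rewrite mulr_sumr; apply: eq_bigr => k _.
under eq_Rintegral do rewrite mulrC.
rewrite IntZ; last exact: intg_cell.
rewrite Int_indic; last exact: measurable_cell.
by rewrite leb_cell//= mulrC.
Qed.

Definition l1int (z : 'rV[int]_N) := (\sum_(e < N) `|z 0%R e|%N)%N.

(* With [kappa = 1] ([p = 1]) the bound is linear in the length of the shift,
   which is what compactness needs. *)
Lemma shift_bound p kappa b I U : (0 < N)%N -> uniq I -> 0 < p -> 1 <= kappa ->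
  (forall x y : R, `|x + y| `^ p <= kappa * (`|x| `^ p + `|y| `^ p)) ->
  (forall k, k \notin I -> U k = 0) ->
  (forall e, Int (fun x => `|U (idx h x + dir e) - U (idx h x)| `^ p) <= b) ->
  forall L z, (l1int z <= L)%N ->
  intg (fun x => `|U (idx h x + z) - U (idx h x)| `^ p) /\
  Int (fun x => `|U (idx h x + z) - U (idx h x)| `^ p) <= L%:R * kappa ^+ L * b.
Proof.
move=> N0 uI p0 k1 kap UI Ub.
have k0 : 0 <= kappa by exact: le_trans k1.
have b0 : 0 <= b.
  by apply: le_trans (Ub (Ordinal N0)); apply: Int_ge0 => x; exact: powR_ge0.
have zi z w : intg (fun x => `|U (idx h x + z) - U (idx h x + w)| `^ p).
  pose J := undup ([seq k - z | k <- I] ++ [seq k - w | k <- I]).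
  have JP k : k \notin J -> U (k + z) = 0 /\ U (k + w) = 0.
    rewrite mem_undup mem_cat negb_or => /andP[kz kw]; split; apply: UI.
      by apply: contra kz => kI; apply/mapP; exists (k + z); rewrite ?addrK.
    by apply: contra kw => kI; apply/mapP; exists (k + w); rewrite ?addrK.
  apply: (@intg_lat J (fun k => `|U (k + z) - U (k + w)| `^ p) N0 _ _).1.
    exact: undup_uniq.
  by move=> k /JP[-> ->]; rewrite subrr normr0 powR0// lt0r_neq0.
have zi0 z : intg (fun x => `|U (idx h x + z) - U (idx h x)| `^ p).
  by have := zi z 0; under eq_fun do rewrite addr0.
(* One lattice step from [z] costs [b], whatever [z] and the sign of the step: translating the
   variable by a lattice vector reduces it to the hypothesis. *)
have step z e (b1 : bool) :
    Int (fun x => `|U (idx h x + (z + (-1) ^+ b1 *: dir e)) - U (idx h x + z)| `^ p) <= b.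
  pose w := if b1 then z - dir e else z.
  apply: le_trans (Ub e); rewrite le_eqVlt; apply/orP; left; apply/eqP.
  have -> : (fun x => `|U (idx h x + dir e) - U (idx h x)| `^ p) =
      (fun x => `|U (idx h x + dir e) - U (idx h x + 0)| `^ p).
    by apply/funext => x; rewrite addr0.
  rewrite -(Int_translate (pt h w) (zi (dir e) 0)).
  congr Rintegral; apply/funext => x; rewrite !idx_translate// addr0 /w.
  case: b1 {w}; last by rewrite expr0 scale1r !addrA.
  by rewrite expr1 scaleN1r -distrC !addrA subrK.
elim=> [|L IH] z; rewrite ?ltnS.
  rewrite leqn0 sum_nat_eq0 => /forallP z0.
  have -> : z = 0.
    by apply/rowP => e; rewrite mxE; have := z0 e; rewrite absz_eq0 => /eqP.
  split=> //; rewrite !mul0r.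
  under eq_Rintegral do rewrite addr0 subrr normr0 powR0 ?lt0r_neq0//.
  by rewrite Int0.
move=> zL; split=> //; have [zL'|Lz] := leqP (l1int z) L.
  have [_ /le_trans] := IH z zL'; apply.
  rewrite ler_wpM2r// ler_pM ?exprn_ge0 ?ler_nat//.
  by rewrite exprS ler_peMl// exprn_ge0.
have [e ze] : exists e, z 0 e != 0.
  apply: contrapT => /forallNP z0; move: Lz; rewrite /l1int big1// => e _.
  by apply/eqP; rewrite absz_eq0; apply: contrapT => /negP; apply: z0.
pose b1 := z 0 e < 0.
pose z' := z - (-1) ^+ b1 *: dir e.
have z'L : (l1int z' <= L)%N.
  rewrite -ltnS; apply: leq_trans zL; rewrite /l1int (bigD1 e)//= [X in (_ < X)%N](bigD1 e)//=.
  rewrite (eq_bigr (fun i => `|z 0%R i|%N)); last first.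
    by move=> i ie; rewrite /z' !mxE /= ?eqxx (negbTE ie) ?andbF mulr0 subr0.
  rewrite ltn_add2r /z' !mxE /= ?eqxx mulr1 /b1.
  by case: ltrP ze; rewrite ?expr1 ?expr0; lia.
have [_ IHz] := IH z' z'L.
have E x : U (idx h x + z) - U (idx h x) =
    (U (idx h x + (z' + (-1) ^+ b1 *: dir e)) - U (idx h x + z')) +
    (U (idx h x + z') - U (idx h x)) by rewrite /z' addrNK addrA subrK.
under eq_Rintegral do rewrite E.
apply: le_trans (le_Int _ _ (fun x => kap _ _)) _.
- by under eq_fun do rewrite -E.
- by apply: intgZ; apply: intgD.
rewrite IntZ; last exact: intgD.
rewrite IntD//.
apply: (@le_trans _ _ (kappa * (b + L%:R * kappa ^+ L * b))).
  by rewrite ler_wpM2l// lerD.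
rewrite -[X in X + _]mul1r -mulrDl mulrA ler_wpM2r// exprS.
rewrite mulrCA ler_wpM2l// -[in leRHS]natr1 mulrDl mul1r addrC lerD2l.
by rewrite exprn_ege1.
Qed.

End lattice_functions.

Lemma cvg_sum_fin (R : realType) (I : Type) (s : seq I) (f : nat -> I -> R) (l : I -> R) :
  (forall i, f n i @[n --> \oo] --> l i) ->
  \sum_(i <- s) f n i @[n --> \oo] --> \sum_(i <- s) l i.
Proof.
move=> fl; elim: s => [|i s IH].
  by rewrite big_nil; under eq_fun do rewrite big_nil; exact: cvg_cst.
by rewrite big_cons; under eq_fun do rewrite big_cons; exact: cvgD.
Qed.

(** * Monotone networks *)

Section monotone_network.
Context (R : realType) (K : zmodType) (D : finType) (d : D -> K).

(** The left side is a sum over a translate of [I]. Its terms outside [I] vanish, and the part of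
    [I] that the translate misses has nonnegative terms. *)
Lemma sum_shift_le (I : seq K) (X : K -> R) z : uniq I ->
  (forall k, 0 <= X k) -> (forall k, k \notin I -> X k = 0) ->
  \sum_(k <- I) X (k + z) <= \sum_(k <- I) X k.
Proof.
move=> uI X0 XI; rewrite -(big_map (fun k => k + z) xpredT X).
set J := map _ I; have uJ : uniq J by rewrite map_inj_uniq//; exact: addIr.
rewrite (bigID (mem I))/= [X in _ + X]big1 ?addr0; last by move=> k /XI.
rewrite [leRHS](bigID (mem J))/= -big_filter -[X in _ <= X + _]big_filter.
rewrite (perm_big [seq k <- I | k \in J])/=; last first.
  apply: uniq_perm; rewrite ?filter_uniq// => k.
  by rewrite !mem_filter andbC.
by rewrite lerDl sumr_ge0.
Qed.

Variables (I : seq K) (v L : R) (phi : D -> K -> R -> R -> R) (F : K -> R).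
Hypotheses (uI : uniq I) (v0 : 0 < v) (L0 : 0 <= L).
Hypothesis phi1 : forall e k s s' t, s <= s' ->
  0 <= phi e k s' t - phi e k s t <= L * (s' - s).
Hypothesis phi2 : forall e k s t t', t <= t' ->
  0 <= phi e k s t - phi e k s t' <= L * (t' - t).

(** The residual at site [k]: absorption, plus the flux leaving along each [d e], minus the flux
    arriving from [k - d e], minus the source. *)
Let T (U : K -> R) k := v * U k +
  \sum_e (phi e k (U k) (U (k + d e)) - phi e (k - d e) (U (k - d e)) (U k)) - F k.

Lemma divided_difference (g : R -> R) a b : (forall s s', s <= s' ->
  0 <= g s' - g s <= L * (s' - s)) ->
  exists2 p, 0 <= p <= L & g a - g b = p * (a - b).
Proof.
move=> Hg; have [<-|ab] := eqVneq a b.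
  by exists 0; rewrite ?lexx// !subrr mulr0.
exists ((g a - g b) / (a - b)); last by rewrite divfK// subr_eq0.
wlog lt_ab : a b ab / b < a => [H|].
  have [|/H H1|] := ltgtP b a; [exact: H| |by move=> E; rewrite E eqxx in ab].
  by rewrite -[g a - g b]opprB -[a - b]opprB invrN mulrNN H1// eq_sym.
have ab0 : 0 < a - b by rewrite subr_gt0.
have /andP[g0 gL] := Hg _ _ (ltW lt_ab).
by rewrite divr_ge0 ?(ltW ab0)//= ler_pdivrMr.
Qed.

(** A relaxation step so small that the diagonal coefficient [1 - lam * (v + S k)] below stays
    nonnegative, each of the [2 #|D|] slopes in [S k] being at most [L]; it is the analogue of a CFL
    condition. *)
Let lam := (v + (#|D|%:R * 2) * L)^-1.

Let lam0 : 0 < lam.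
Proof. by rewrite invr_gt0 ltr_pwDl// !mulr_ge0. Qed.

Let G (U : K -> R) k := if k \in I then U k - lam * T U k else 0.

(* [G] is a nonexpansive redistribution of the l1 mass minus the absorption [lam * v]. *)
Let G_contraction (U V : K -> R) : (forall k, k \notin I -> U k = 0) ->
  (forall k, k \notin I -> V k = 0) ->
  \sum_(k <- I) `|G U k - G V k| <= (1 - lam * v) * \sum_(k <- I) `|U k - V k|.
Proof.
move=> UI VI; pose X k := U k - V k.
(* The fluxes of [U] and [V] differ by secant slopes [p] and [q] in [[0, L]] times values of
   [X = U - V]. Their nonnegativity is what keeps all coefficients of the update nonnegative. *)
have /choice[p Hp] : forall ek : D * K, exists p,
    0 <= p <= L /\ phi ek.1 ek.2 (U ek.2) (U (ek.2 + d ek.1)) -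
      phi ek.1 ek.2 (V ek.2) (U (ek.2 + d ek.1)) = p * X ek.2.
  move=> [e k] /=; have [p ? ?] := divided_difference (U k) (V k)
    (fun s s' => @phi1 e k s s' (U (k + d e))); by exists p.
have /choice[q Hq] : forall ek : D * K, exists q,
    0 <= q <= L /\ phi ek.1 ek.2 (V ek.2) (U (ek.2 + d ek.1)) -
      phi ek.1 ek.2 (V ek.2) (V (ek.2 + d ek.1)) = - (q * X (ek.2 + d ek.1)).
  move=> [e k] /=; have [|q ? E] := @divided_difference (fun t => - phi e k (V k) t)
    (U (k + d e)) (V (k + d e)).
    by move=> s s' /(@phi2 e k (V k)); rewrite opprK addrC.
  by exists q; split=> //; rewrite -E; ring.
have p0 e k : 0 <= p (e, k) by have [/andP[]] := Hp (e, k).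
have q0 e k : 0 <= q (e, k) by have [/andP[]] := Hq (e, k).
have pL e k : p (e, k) <= L by have [/andP[]] := Hp (e, k).
have qL e k : q (e, k) <= L by have [/andP[]] := Hq (e, k).
have dphi e k : phi e k (U k) (U (k + d e)) - phi e k (V k) (V (k + d e)) =
    p (e, k) * X k - q (e, k) * X (k + d e).
  have [_ /= <-] := Hp (e, k); rewrite -[X in _ - X](opprK).
  by have [_ /= <-] := Hq (e, k); ring.
pose S k := \sum_e (p (e, k) + q (e, k - d e)).
pose c k := 1 - lam * (v + S k).
have c0 k : 0 <= c k.
  rewrite subr_ge0 /lam mulrC ler_pdivrMr ?mul1r; last first.
    by rewrite ltr_pwDl// !mulr_ge0.
  rewrite lerD2l (_ : #|D|%:R * 2 * L = \sum_(e : D) (L + L)).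
    by apply: ler_sum => e _; exact: lerD.
  by rewrite sumr_const -mulr_natl; ring.
have GE k : k \in I -> G U k - G V k = c k * X k + lam *
    \sum_e (q (e, k) * X (k + d e) + p (e, k - d e) * X (k - d e)).
  move=> kI; rewrite /G kI.
  have -> : U k - lam * T U k - (V k - lam * T V k) = X k - lam * (T U k - T V k).
    by rewrite /X; ring.
  have -> : T U k - T V k = v * X k + \sum_e ((p (e, k) * X k - q (e, k) * X (k + d e)) -
      (p (e, k - d e) * X (k - d e) - q (e, k - d e) * X k)).
    rewrite /T; set A := \sum_e _; set B := \sum_e _.
    have -> : v * U k + A - F k - (v * V k + B - F k) = v * X k + (A - B).
      by rewrite /X; ring.
    congr (_ + _); rewrite /A /B -sumrB; apply: eq_bigr => e _.
    rewrite -dphi; have := dphi e (k - d e); rewrite subrK => <-; ring.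
  rewrite /c /S.
  have -> : \sum_e ((p (e, k) * X k - q (e, k) * X (k + d e)) -
      (p (e, k - d e) * X (k - d e) - q (e, k - d e) * X k)) =
      (\sum_e (p (e, k) + q (e, k - d e))) * X k -
      \sum_e (q (e, k) * X (k + d e) + p (e, k - d e) * X (k - d e)).
    by rewrite mulr_suml -sumrB; apply: eq_bigr => e _; ring.
  by ring.
have X0 k : k \notin I -> X k = 0.
  by move=> kI; rewrite /X UI// VI// subrr.
apply: (@le_trans _ _ (\sum_(k <- I) (c k * `|X k| + lam *
   \sum_e (q (e, k) * `|X (k + d e)| + p (e, k - d e) * `|X (k - d e)|)))).
  rewrite big_seq [leRHS]big_seq; apply: ler_sum => k kI; rewrite GE//.
  apply: le_trans (ler_normD _ _) _; apply: lerD.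
    by rewrite normrM (ger0_norm (c0 k)).
  rewrite normrM (ger0_norm (ltW lam0)) ler_wpM2l ?(ltW lam0)//.
  apply: le_trans (ler_norm_sum _ _ _) _; apply: ler_sum => e _.
  by apply: le_trans (ler_normD _ _) _; rewrite !normrM (ger0_norm (p0 _ _)) (ger0_norm (q0 _ _)).
rewrite big_split /= -mulr_sumr exchange_big /=.
have sh : \sum_e \sum_(k <- I) (q (e, k) * `|X (k + d e)| + p (e, k - d e) * `|X (k - d e)|) <=
    \sum_(k <- I) S k * `|X k|.
  rewrite [leRHS](eq_bigr (fun k => \sum_e (p (e, k) + q (e, k - d e)) * `|X k|)); last first.
    by move=> k _; rewrite mulr_suml.
  rewrite [leRHS]exchange_big /=; apply: ler_sum => e _.
  rewrite [leRHS](eq_bigr (fun k => q (e, k - d e) * `|X k| + p (e, k) * `|X k|)); last first.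
    by move=> k _; rewrite mulrDl addrC.
  rewrite !big_split /=; apply: lerD.
    rewrite (eq_bigr (fun k => (fun j => q (e, j - d e) * `|X j|) (k + d e))); last first.
      by move=> k _ /=; rewrite addrK.
    apply: sum_shift_le => // k; first by rewrite mulr_ge0.
    by move=> /X0 ->; rewrite normr0 mulr0.
  apply: (@sum_shift_le I (fun k => p (e, k) * `|X k|) (- d e) uI) => k.
    by rewrite mulr_ge0.
  by move=> /X0 ->; rewrite normr0 mulr0.
apply: le_trans (lerD (lexx _) (ler_wpM2l (ltW lam0) sh)) _.
rewrite mulr_sumr -big_split mulr_sumr /= le_eqVlt; apply/orP; left; apply/eqP.
by apply: eq_bigr => k _; rewrite /c /X; ring.
Qed.

(** The iterates of [G] from 0 have geometrically small increments in [l^1], hence converge at every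
    site; on [I] the residual of an iterate is [lam^-1] times an increment and therefore vanishes in
    the limit. *)
Lemma monotone_network_solution : exists U : K -> R,
  (forall k, k \notin I -> U k = 0) /\
  forall k, k \in I -> v * U k +
    \sum_e (phi e k (U k) (U (k + d e)) - phi e (k - d e) (U (k - d e)) (U k)) = F k.
Proof.
pose x n := iter n G (fun=> 0).
have xI n k : k \notin I -> x n k = 0.
  by case: n => [//|n] kI; rewrite /x /= /G (negbTE kI).
pose r := 1 - lam * v.
have r0 : 0 <= r.
  rewrite subr_ge0 /lam mulrC ler_pdivrMr ?mul1r ?lerDl ?mulr_ge0//.
  by rewrite ltr_pwDl// !mulr_ge0.
have r1 : `|r| < 1 by rewrite ger0_norm// ltrBlDr ltrDl mulr_gt0.
pose C := \sum_(k <- I) `|x 1%N k - x 0%N k|.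
have step n : \sum_(k <- I) `|x n.+1 k - x n k| <= r ^+ n * C.
  elim: n => [|n IH]; first by rewrite expr0 mul1r.
  apply: le_trans (G_contraction (xI n.+1) (xI n)) _.
  by rewrite exprS -mulrA ler_wpM2l.
have xstep n k : `|x n.+1 k - x n k| <= r ^+ n * C.
  have [kI|kI] := boolP (k \in I); last first.
    rewrite (xI n.+1 _ kI) (xI n _ kI) subrr normr0 mulr_ge0 ?exprn_ge0 ?sumr_ge0//.
  apply: le_trans (step n); rewrite (bigD1_seq _ kI uI)/= lerDl.
  exact: sumr_ge0.
have geoE n : geometric C r n = r ^+ n * C by rewrite /geometric /= mulrC.
have xcvg k : cvgn (fun n => x n k).
  have -> : (fun n => x n k) = (fun n => x 0%N k + series (fun j => x j.+1 k - x j k) n).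
    by apply/funext => n; rewrite /series/= telescope_sumr// addrC subrK.
  apply: is_cvgD; first exact: is_cvg_cst.
  apply: normed_cvg; apply: (@series_le_cvg _ _ (geometric C r)) => [j|j|j|].
  - exact: normr_ge0.
  - by rewrite geoE; exact: le_trans (normr_ge0 _) (xstep j k).
  - by rewrite geoE; exact: xstep.
  - exact: is_cvg_geometric_series.
pose U k := limn (fun n => x n k); exists U; split.
  move=> k kI; rewrite /U; apply: cvg_lim => //.
  by under eq_fun do rewrite xI//; exact: cvg_cst.
have phic e k j l : phi e k (x n j) (x n l) @[n --> \oo] --> phi e k (U j) (U l).
  apply/cvgrPdist_le => eps eps0.
  have L1 : 0 < 2 * (L + 1) by rewrite mulr_gt0// ltr_wpDl.
  have dl0 : 0 < eps / (2 * (L + 1)) by rewrite divr_gt0.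
  have /cvgrPdist_le/(_ _ dl0) cj := xcvg j; have /cvgrPdist_le/(_ _ dl0) cl := xcvg l.
  have lip (g : R -> R) a b : (forall s s', s <= s' -> 0 <= g s' - g s <= L * (s' - s)) ->
      `|g a - g b| <= L * `|a - b|.
    move=> /(divided_difference a b)[p /andP[p0 pL] ->].
    by rewrite normrM (ger0_norm p0) ler_wpM2r.
  near=> n.
  have -> : phi e k (U j) (U l) - phi e k (x n j) (x n l) =
     (phi e k (U j) (U l) - phi e k (x n j) (U l)) +
     (phi e k (x n j) (U l) - phi e k (x n j) (x n l)) by ring.
  apply: le_trans (ler_normD _ _) _.
  have A1 := lip (fun s => phi e k s (U l)) (U j) (x n j) (fun s s' => @phi1 e k s s' (U l)).
  have A2 : `|phi e k (x n j) (U l) - phi e k (x n j) (x n l)| <= L * `|U l - x n l|.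
    rewrite -normrN opprB -[phi e k (x n j) (x n l)]opprK addrC.
    apply: (lip (fun t => - phi e k (x n j) t)) => s s' /(@phi2 e k (x n j)).
    by rewrite opprK addrC.
  apply: le_trans (lerD A1 A2) _; rewrite -mulrDr.
  apply: (@le_trans _ _ ((L + 1) * (eps / (2 * (L + 1)) + eps / (2 * (L + 1))))).
    apply: ler_pM; rewrite ?addr_ge0 ?lerDl//.
    by apply: lerD; near: n.
  by rewrite le_eqVlt; apply/orP; left; apply/eqP; field; rewrite gt_eqF// ltr_wpDl.
move=> k kI; have Tc : T (x n) k @[n --> \oo] --> T U k.
  rewrite /T; apply: cvgB; last exact: cvg_cst.
  apply: cvgD; first by apply: cvgMl_tmp; exact: xcvg.
  by apply: cvg_sum_fin => e; apply: cvgB; exact: phic.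
have T0 : T (x n) k @[n --> \oo] --> 0.
  have -> : (fun n => T (x n) k) = (fun n => lam^-1 * (x n k - x n.+1 k)).
    apply/funext => n; rewrite [x n.+1]/= {3}/x /= -/(x n) /G kI opprB addrC subrK mulrA.
    by rewrite mulVf ?mul1r// lt0r_neq0.
  have H : x n k - x n.+1 k @[n --> \oo] --> U k - U k.
    apply: cvgB; first exact: xcvg.
    by have := xcvg k; rewrite -(cvg_shiftS (fun n => x n k)).
  by rewrite -(mulr0 lam^-1) -(subrr (U k)); exact: cvgMl_tmp.
have : T U k = 0 by rewrite -(cvg_lim _ Tc)// (cvg_lim _ T0).
by move=> /eqP; rewrite subr_eq0 => /eqP.
Unshelve. all: by end_near. Qed.

End monotone_network.

(** * Caratheodory functions *)

Section caratheodory_functions.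
Context d (T : measurableType d) (R : realType).
Notation mf f := (measurable_fun [set: T] f).
Implicit Types (b : T -> R -> R).

(** The second variable is rounded down to the grid of step [1 / (n + 1)]. Each approximation is a
    countable patchwork of functions measurable in the first variable, and continuity gives the
    limit. *)
Lemma measurable_caratheodory b : (forall s, mf (b ^~ s)) ->
  (forall x, continuous (b x)) ->
  measurable_fun setT (fun p : T * R => b p.1 p.2).
Proof.
move=> bm bc.
pose r n (t : R) := (Num.floor (n.+1%:R * t))%:~R / n.+1%:R : R.
apply: (@measurable_fun_cvg _ _ _ setT (fun n (p : T * R) => b p.1 (r n p.2))).
  move=> n; pose i (p : T * R) := Num.floor (n.+1%:R * p.2).
  apply: (@measurable_countable_cases _ (T * R)%type _ R _ i
    (fun k p => b p.1 (k%:~R / n.+1%:R))) => k; last first.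
    exact: (measurableT_comp (bm _) measurable_fst).
  rewrite (_ : [set x | i x = k] = snd @^-1`
      `[k%:~R / n.+1%:R, (k + 1)%:~R / n.+1%:R[%classic).
    by rewrite -[X in measurable X]setTI; apply: measurable_snd => //;
      exact: measurable_itv.
  apply/seteqP; split => -[x t] /=; rewrite /i /= in_itv /=.
    move=> <-; rewrite ler_pdivrMr// ltr_pdivlMr// [t * _]mulrC.
    exact: floor_itv.
  rewrite ler_pdivrMr// ltr_pdivlMr// [t * _]mulrC.
  exact: floor_def.
move=> [x t] _ /=; have := bc x t; apply: cvg_comp.
apply/cvgrPdist_le => e e0; near=> n.
have n0 : (0 : R) < n.+1%:R by [].
rewrite /r -(@ler_pM2l _ n.+1%:R)// -{1}(ger0_norm (ltW n0)) -normrM mulrBr.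
rewrite [_ * (_ / _)]mulrC divfK ?gt_eqF// ger0_norm ?subr_ge0 ?floor_le//.
apply: (@le_trans _ _ 1).
  by rewrite lerBlDr ltW// addrC -(intrD1) floorD1_gt.
rewrite -ler_pdivrMr// mul1r.
have : e^-1 <= n%:R by near: n; exact: nbhs_infty_ger.
by move=> /le_trans; apply; rewrite ler_nat.
Unshelve. all: by end_near. Qed.

Lemma measurable_superposition b (u : T -> R) : (forall s, mf (b ^~ s)) ->
  (forall x, continuous (b x)) -> mf u -> mf (fun x => b x (u x)).
Proof.
move=> bm bc um.
apply: (measurableT_comp (measurable_caratheodory bm bc)
  (g := fun x => (x, u x))).
by apply: measurable_fun_pair.
Qed.

Notation lambda := (@lebesgue_measure R).

Let P b x s : R := \int[lambda]_(t in `[0, s]) b x t.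

(** Tonelli's theorem for the product with Lebesgue measure on the line gives measurability of the
    parameter integral. *)
Let Pm b s M : (forall s, mf (b ^~ s)) -> (forall x, continuous (b x)) ->
  (forall x t, 0 <= b x t <= M) -> mf (P b ^~ s).
Proof.
move=> bm bc bM.
pose f (p : T * R) := (b p.1 p.2 * \1_(`[0, s]%classic : set R) p.2)%:E.
have fm : measurable_fun setT f.
  apply/measurable_EFinP; apply: measurable_funM.
    exact: measurable_caratheodory.
  apply: (measurableT_comp _ measurable_snd).
  by apply: measurable_indic; exact: measurable_itv.
have f0 p : (0 <= f p)%E.
  by rewrite lee_fin mulr_ge0//; have /andP[] := bM p.1 p.2.
have Fm : measurable_fun setT (fubini_F lambda f).
  exact: measurable_fun_fubini_tonelli_F.
have := measurableT_comp (fine_measurable measurableT) Fm.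
apply: eq_measurable_fun => x _ /=; rewrite /P /Rintegral /fubini_F; congr fine.
rewrite [RHS]integral_mkcond; apply: eq_integral => t _ /=.
by rewrite /f /= patchE indicE; case: ifP => _; rewrite ?mulr1 ?mulr0.
Qed.

Let Pbound (g : R -> R) s t lo hi : continuous g -> 0 <= s -> s <= t ->
  (forall y, s <= y <= t -> lo <= g y <= hi) ->
  lo * (t - s) <= \int[lambda]_(y in `[0, t]) g y - \int[lambda]_(y in `[0, s]) g y
    <= hi * (t - s).
Proof.
move=> gc s0 st glh.
have gi0 (k : R -> R) u v : continuous k -> lambda.-integrable `[u, v] (EFin \o k).
  move=> kc;  apply: continuous_compact_integrable; first exact: segment_compact.
  exact: continuous_subspaceT.
have gi u v := gi0 g u v gc.
rewrite (@Rintegral_itvB _ g (BLeft 0) (BRight t) s)//=.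
have gi' : lambda.-integrable `]s, t] (EFin \o g).
  apply: integrableS (gi s t); [exact: measurable_itv..|].
  by apply: subset_itv_oc_cc.
have mst : measurable (`]s, t]%classic : set R) by exact: measurable_itv.
have ci c : lambda.-integrable `]s, t] (EFin \o cst c).
  apply: integrableS (gi0 (cst c) s t _); [exact: measurable_itv..| |].
    exact: subset_itv_oc_cc.
  by move=> y; exact: cvg_cst.
have E c : \int[lambda]_(y in `]s, t]) (cst c y) = c * (t - s).
  rewrite Rintegral_cst//= lebesgue_measure_itv /= lte_fin; congr (_ * _).
  by case: ltrP => //= ts; rewrite (@le_anti _ _ s t) ?st ?ts// subrr.
rewrite -!E; apply/andP; split; apply: le_Rintegral => // y; rewrite /= in_itv /= => /andP[sy yt].
  by have /andP[] : lo <= g y <= hi by apply: glh; rewrite (ltW sy).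
by have /andP[] : lo <= g y <= hi by apply: glh; rewrite (ltW sy).
Qed.

(** The relation [A' = b] is recorded by bounding increments of [A] with any bounds of [b] on the
    segment. Ellipticity, the Lipschitz bound and the limit of divided differences all follow from
    this form. *)
Lemma caratheodory_primitive b M : (forall s, mf (b ^~ s)) ->
  (forall x, continuous (b x)) -> (forall x t, 0 <= b x t <= M) ->
  exists A : T -> R -> R, (forall s, mf (A ^~ s)) /\
    forall x s t lo hi, s <= t -> (forall y, s <= y <= t -> lo <= b x y <= hi) ->
      lo * (t - s) <= A x t - A x s <= hi * (t - s).
Proof.
move=> bm bc bM; pose b' x t := b x (- t).
have bc' x : continuous (b' x).
  move=> t; apply: (@continuous_comp _ _ _ -%R (b x)); first exact: opp_continuous.
  exact: bc.
(* Integrals start at 0; for negative [s] they are taken over [[0, -s]] after reflecting [b]. *)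
pose A x s := if 0 <= s then P b x s else - P b' x (- s).
have P0 c x : P c x 0 = 0 by rewrite /P set_itv1 Rintegral_set1.
exists A; split.
  move=> s; rewrite /A; case: (0 <= s); first exact: Pm bm bc bM.
  apply: measurable_funN; apply: Pm bc' _ => [t|x t]; first exact: bm.
  exact: bM.
move=> x s t lo hi st blh; rewrite /A.
have [s0|s0] := leP 0 s.
  by rewrite (le_trans s0 st); apply: Pbound.
have neg u : s <= u -> u <= 0 -> u <= t ->
    lo * (u - s) <= - P b' x (- u) - - P b' x (- s) <= hi * (u - s).
  move=> su u0 ut; rewrite opprK [- P _ _ _ + _]addrC.
  have := @Pbound (b' x) (- u) (- s) lo hi (bc' x).
  rewrite oppr_ge0 lerN2 opprK [- s + u]addrC; apply => // y /andP[uy ys].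
  by apply: blh; rewrite lerNr ys /= (le_trans _ ut)// lerNl.
have [t0|t0] := leP 0 t; last exact: neg (ltW t0) (lexx _).
have := neg 0 (ltW s0) (lexx _) t0; rewrite oppr0 P0 oppr0.
have := @Pbound (b x) 0 t lo hi (bc x) (lexx _) t0.
rewrite -/(P b x t) -/(P b x 0) P0 !subr0 => /(_ _)/andP[|A1 A2].
  by move=> y /andP[y0 yt]; apply: blh; rewrite yt (le_trans (ltW s0)).
move=> /andP[A3 A4]; apply/andP; split; lra.
Qed.

End caratheodory_functions.

(** * The finite volume scheme and its a priori bounds *)

Section test_nonlinearity.
Context (R : realType).
Implicit Types (s t h x E : R).

Definition psi (m s : R) := s * (1 + `|s|) `^ (m - 2).

(** Two neighbouring values share one weight. The larger modulus is taken so that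
    [al * Mx s t ^ (- th)] bounds the coefficient from below on the whole segment between them. *)
Definition Mx s t : R := 1 + Num.max `|s| `|t|.

Lemma Mx_ge1 s t : 1 <= Mx s t.
Proof. by rewrite /Mx lerDl le_max normr_ge0. Qed.

Lemma Mx_gt0 s t : 0 < Mx s t.
Proof. exact: lt_le_trans (Mx_ge1 s t). Qed.

Lemma MxC s t : Mx s t = Mx t s.
Proof. by rewrite /Mx maxC. Qed.

Lemma Mx_l s t : 1 + `|s| <= Mx s t.
Proof. by rewrite lerD2l le_max lexx. Qed.

Lemma psi_energy m s : 2 <= m -> `|s| `^ m <= s * psi m s.
Proof.
move=> m2; rewrite /psi mulrA -expr2 -real_normK ?num_real//.
have -> : `|s| `^ m = `|s| ^+ 2 * `|s| `^ (m - 2).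
  rewrite -powR_mulrn// -powRD ?subrKC//; apply/implyP.
  by move=> /eqP m0; exfalso; move: m2; rewrite m0; lra.
rewrite ler_wpM2l ?exprn_ge0//; apply: ge0_ler_powR; rewrite ?nnegrE.
- by rewrite subr_ge0.
- by [].
- by rewrite addr_ge0.
- by rewrite lerDr.
Qed.

Lemma psi_bound m s : 2 <= m -> `|psi m s| <= (1 + `|s|) `^ (m - 1).
Proof.
move=> m2; rewrite /psi normrM (ger0_norm (powR_ge0 _ _)).
have s1 : 0 < 1 + `|s| by rewrite ltr_pwDl.
have -> : (1 + `|s|) `^ (m - 1) = (1 + `|s|) * (1 + `|s|) `^ (m - 2).
  rewrite -{2}[1 + `|s|]powRr1 ?ltW// -powRD.
    by congr powR; ring.
  by apply/implyP => _; exact: lt0r_neq0.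
by rewrite ler_wpM2r ?powR_ge0// lerDr.
Qed.

Let psiN m s : psi m (- s) = - psi m s.
Proof. by rewrite /psi normrN mulNr. Qed.

(** With [rho = (1 + s) / (1 + t)] the upper bound reduces to [rho (1 - rho^(m-2)) <= 2 (1 - rho)].
    Since [m <= 4], [rho^(m-2) >= rho^2], and the rest is [(1 - rho)^2 (2 + rho) >= 0]. The constant
    3 is [m - 1] at [m = 4]. *)
Let psi_diff_pos m s t : 2 <= m <= 4 -> 0 <= s -> s <= t ->
  (1 + t) `^ (m - 2) * (t - s) <= psi m t - psi m s <=
    3 * (1 + t) `^ (m - 2) * (t - s).
Proof.
move=> /andP[m2 m4] s0 st; have t0 := le_trans s0 st.
have s1 : 0 < 1 + s by lra.
have t1 : 0 < 1 + t by lra.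
rewrite /psi !ger0_norm//.
set P := (1 + t) `^ (m - 2); set Q := (1 + s) `^ (m - 2).
have P0 : 0 <= P by exact: powR_ge0.
have Q0 : 0 <= Q by exact: powR_ge0.
have QP : Q <= P.
  by apply: ge0_ler_powR; rewrite ?nnegrE ?(ltW s1) ?(ltW t1)//; lra.
apply/andP; split; first nra.
suff : (1 + s) * (P - Q) <= 2 * (t - s) * P by nra.
pose rho := (1 + s) / (1 + t).
have rho0 : 0 < rho by rewrite divr_gt0.
have rho1 : rho <= 1 by rewrite ler_pdivrMr// mul1r lerD2l.
have QE : Q = rho `^ (m - 2) * P.
  by rewrite /Q /P -powRM ?(ltW rho0) ?(ltW t1)// /rho divfK ?lt0r_neq0.
have r2 : rho ^+ 2 <= rho `^ (m - 2).
  rewrite -powR_mulrn ?(ltW rho0)//.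
  by apply: ger_powR; [rewrite rho0 rho1|lra].
have sE : 1 + s = rho * (1 + t) by rewrite /rho divfK ?lt0r_neq0.
have tE : t - s = (1 - rho) * (1 + t).
  by rewrite mulrBl -sE mul1r; ring.
rewrite tE [in leLHS]sE QE.
have -> : rho * (1 + t) * (P - rho `^ (m - 2) * P) =
  (1 + t) * P * (rho * (1 - rho `^ (m - 2))) by ring.
have -> : 2 * ((1 - rho) * (1 + t)) * P = (1 + t) * P * (2 * (1 - rho)) by ring.
apply: ler_wpM2l; first by rewrite mulr_ge0// ltW.
move: (rho `^ (m - 2)) r2 => y r2.
have H1 : rho * (1 - y) <= rho * (1 - rho ^+ 2) by rewrite ler_wpM2l ?(ltW rho0)// lerD2l lerN2.
have H2 : 0 <= (1 - rho) ^+ 2 * (2 + rho) by rewrite mulr_ge0 ?sqr_ge0 ?addr_ge0 ?(ltW rho0).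
by lra.
Qed.

(** Oddness reduces equal signs to the nonnegative case. For opposite signs the larger of [|s|] and
    [|t|] is at least half of [t - s], whence the factor [1 / 2]. *)
Lemma psi_diff m s t : 2 <= m <= 4 -> s <= t ->
  Mx s t `^ (m - 2) / 2 * (t - s) <= psi m t - psi m s <=
    3 * Mx s t `^ (m - 2) * (t - s).
Proof.
move=> m24; have /andP[m2 m4] := m24.
have mono x y : 0 <= x -> x <= y -> (1 + x) `^ (m - 2) <= (1 + y) `^ (m - 2).
  move=> x0 xy; apply: ge0_ler_powR; rewrite ?nnegrE; lra.
have [s0|s0] := leP 0 s.
  move=> st; have t0 := le_trans s0 st.
  have -> : Mx s t = 1 + t.
    by rewrite /Mx !ger0_norm//; congr (_ + _); apply/max_idPr.
  have /andP[H1 H2] := psi_diff_pos m24 s0 st; rewrite H2 andbT.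
  have P0 := powR_ge0 (1 + t) (m - 2); apply: le_trans H1.
  by move: (_ `^ _) P0 => P P0; nra.
have [t0 st|t0 st] := leP t 0.
  have t0' : 0 <= - t by lra.
  have -> : Mx s t = 1 + - s.
    by rewrite /Mx (ltr0_norm s0) (ler0_norm t0); congr (_ + _); apply/max_idPl; lra.
  have st' : - t <= - s by rewrite lerN2.
  have /andP[] := psi_diff_pos m24 t0' st'.
  rewrite !psiN opprK; have P0 := powR_ge0 (1 - s) (m - 2).
  move: (_ `^ _) P0 => P P0; move: (psi m s) (psi m t) => a b H1 H2.
  by apply/andP; split; nra.
rewrite /psi (ltr0_norm s0) (gtr0_norm t0) /Mx (ltr0_norm s0) (gtr0_norm t0).
have Ps0 := powR_ge0 (1 - s) (m - 2); have Pt0 := powR_ge0 (1 + t) (m - 2).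
case: (leP (- s) t) => H.
  have PP : (1 + - s) `^ (m - 2) <= (1 + t) `^ (m - 2) by apply: mono => //; lra.
  move: ((1 + - s) `^ _) ((1 + t) `^ _) PP Ps0 Pt0 => P Q PP P0 Q0.
  by apply/andP; split; nra.
have PP : (1 + t) `^ (m - 2) <= (1 + - s) `^ (m - 2) by apply: mono => //; lra.
move: ((1 + - s) `^ _) ((1 + t) `^ _) PP Ps0 Pt0 => P Q PP P0 Q0.
by apply/andP; split; nra.
Qed.

Let G (g h u : R) := (u + h) `^ g - h `^ g.

(* A monotone Lipschitz regularization of the odd power. *)
Definition greg g h s := if 0 <= s then G g h s else - G g h (- s).

(** Concavity in elementary form: the ratio [(v + h) / (u + h) >= 1] bounds its own power of
    exponent [g < 1]. The shift by [h] caps the slope at [h^(g-1)], whereas the slope of the odd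
    power is infinite at 0. *)
Let G_lip g h u v : 0 < g < 1 -> 0 < h -> 0 <= u -> u <= v ->
  0 <= G g h v - G g h u <= h `^ (g - 1) * (v - u).
Proof.
move=> /andP[g0 g1] h0 u0 uv; rewrite /G opprB addrA subrK.
have uh : 0 < u + h by lra.
have vh : 0 < v + h by lra.
rewrite subr_ge0; apply/andP; split.
  by apply: ge0_ler_powR; rewrite ?nnegrE ?(ltW uh) ?(ltW vh) ?(ltW g0)// lerD2r.
have H : (v + h) `^ g <= (u + h) `^ g * ((v + h) / (u + h)).
  rewrite -{1}[v + h](@divfK _ (u + h)) ?lt0r_neq0// mulrC.
  rewrite powRM ?divr_ge0 ?(ltW uh) ?(ltW vh)// ler_wpM2l ?powR_ge0//.
  by apply: ler1_powR (ltW g1); rewrite ler_pdivlMr// mul1r lerD2r.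
have H2 : (u + h) `^ (g - 1) <= h `^ (g - 1).
  rewrite -[g - 1]opprB !powRN lef_pV2 ?posrE ?powR_gt0//.
  by apply: ge0_ler_powR; rewrite ?nnegrE ?(ltW uh) ?(ltW h0)//; lra.
have E : (u + h) `^ g = (u + h) * (u + h) `^ (g - 1).
  by rewrite mulr_powRB1// ltW.
apply: (@le_trans _ _ ((u + h) `^ (g - 1) * (v - u))).
  rewrite lerBlDr; apply: le_trans H _; rewrite E.
  rewrite le_eqVlt; apply/orP; left; apply/eqP; field; exact: lt0r_neq0.
by rewrite ler_wpM2r// subr_ge0.
Qed.

Let G0 g h : G g h 0 = 0.
Proof. by rewrite /G add0r subrr. Qed.

Lemma greg_lip g h s t : 0 < g < 1 -> 0 < h -> s <= t ->
  0 <= greg g h t - greg g h s <= h `^ (g - 1) * (t - s).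
Proof.
move=> g01 h0 st; rewrite /greg.
have [s0|s0] := leP 0 s.
  by rewrite (le_trans s0 st); exact: G_lip.
have [t0|t0] := leP 0 t; last first.
  rewrite opprK addrC; have := @G_lip g h (- t) (- s) g01 h0.
  by rewrite opprK [- s + t]addrC oppr_ge0 lerN2; apply=> //; exact: ltW.
have := @G_lip g h 0 t g01 h0 (lexx _) t0.
have := @G_lip g h 0 (- s) g01 h0 (lexx _); rewrite oppr_ge0 => /(_ (ltW s0)).
rewrite !G0 !subr0 opprK; have := powR_ge0 h (g - 1).
by move: (h `^ _) (G _ _ _) (G _ _ _) => H a b H0 /andP[? ?] /andP[? ?]; apply/andP; split; lra.
Qed.

Let G_bounds g h u : 0 < g < 1 -> 0 < h -> 0 <= u ->
  0 <= G g h u <= u `^ g /\ u `^ g <= G g h u + h `^ g.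
Proof.
move=> g01 h0 u0; have /andP[g0 g1] := g01.
have := @G_lip g h 0 u g01 h0 (lexx _) u0; rewrite G0 subr0 => /andP[-> _].
rewrite /G subrK lerBlDr powR_subadd ?g0 ?(ltW g1) ?(ltW h0)//.
by split=> //; apply: ge0_ler_powR; rewrite ?nnegrE ?addr_ge0 ?(ltW g0) ?(ltW h0)// lerDl ltW.
Qed.

Lemma norm_greg g h s : 0 < g < 1 -> 0 < h -> `|greg g h s| <= `|s| `^ g.
Proof.
move=> g01 h0; rewrite /greg; have [s0|s0] := leP 0 s.
  have [/andP[H1 H2] _] := G_bounds g01 h0 s0.
  by rewrite (ger0_norm H1) (ger0_norm s0).
have s0' : 0 <= - s by rewrite oppr_ge0 ltW.
have [/andP[H1 H2] _] := G_bounds g01 h0 s0'.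
by rewrite normrN (ger0_norm H1) (ltr0_norm s0).
Qed.

Lemma odd_powerE g s : 0 < g -> odd_power g s =
  if 0 <= s then s `^ g else - (- s) `^ g.
Proof.
move=> g0; rewrite /odd_power mulrC; have [s0|s0] := leP 0 s.
  by rewrite ger0_norm// mulr_powRB1.
rewrite ltr0_norm// -[s in s * _]opprK mulNr mulr_powRB1//.
by rewrite oppr_ge0 ltW.
Qed.

Lemma norm_odd_power g s : 0 < g -> `|odd_power g s| = `|s| `^ g.
Proof.
move=> g0; rewrite odd_powerE//; have [s0|s0] := leP 0 s.
  by rewrite (ger0_norm s0) ger0_norm ?powR_ge0.
by rewrite (ltr0_norm s0) normrN ger0_norm ?powR_ge0.
Qed.

Lemma greg_odd_power g h s : 0 < g < 1 -> 0 < h ->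
  `|greg g h s - odd_power g s| <= h `^ g.
Proof.
move=> g01 h0; have /andP[g0 _] := g01; rewrite odd_powerE// /greg.
have [s0|s0] := leP 0 s.
  have [/andP[H1 H2] H3] := G_bounds g01 h0 s0.
  by rewrite distrC ger0_norm ?subr_ge0// lerBlDl.
have s0' : 0 <= - s by rewrite oppr_ge0 ltW.
have [/andP[H1 H2] H3] := G_bounds g01 h0 s0'.
by rewrite opprK addrC ger0_norm ?subr_ge0// lerBlDl.
Qed.

(** Approximates a component of [- a(x, u) Du + u^gamma E]. The positive part of [E] carries the
    value behind and the negative part the value ahead, so that the flux increases in [s] and
    decreases in [t]. *)
Definition flux (A : R -> R) (g h E s t : R) :=
  (A s - A t) / h + Num.max 0 E * greg g h s - Num.max 0 (- E) * greg g h t.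

Lemma upwind_le g h E s t : 0 < g < 1 -> 0 < h ->
  `|Num.max 0 E * greg g h s - Num.max 0 (- E) * greg g h t| <=
  `|E| * Mx s t `^ g.
Proof.
move=> g01 h0; have /andP[g0 _] := g01.
have le x : `|x| <= Mx s t -> `|greg g h x| <= Mx s t `^ g.
  move=> xM; apply: le_trans (norm_greg _ g01 h0) _.
  by apply: ge0_ler_powR; rewrite ?nnegrE ?(ltW g0) ?(ltW (Mx_gt0 _ _)).
have sM : `|s| <= Mx s t by apply: le_trans (Mx_l s t); rewrite lerDr.
have tM : `|t| <= Mx s t by rewrite MxC; apply: le_trans (Mx_l t s); rewrite lerDr.
have [E0|E0] := leP 0 E.
  rewrite (max_idPl (_ : - E <= 0)) ?oppr_le0// mul0r subr0.
  by rewrite normrM ler_wpM2l// le.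
by rewrite mul0r sub0r normrN normrM (max_idPr _) ?oppr_ge0 ?(ltW E0)// normrN ler_wpM2l// le.
Qed.

(** With [X = Mx s t] and [D = |t - s| / h], the principal part is at least [(al / 2) a^2] and the
    drift at most [3 a c] in modulus, where [a = X^((m-2-th)/2) D] and [c = |E| X^((m-2+th+2g)/2)].
    Completing the square, [3 a c <= (al / 4) a^2 + (9 / al) c^2], which explains both constants. *)
Lemma energy_flux (A : R -> R) th g al m h E s t :
  2 <= m <= 4 -> 0 < al -> 0 < h -> 0 < g < 1 ->
  (forall s t, s <= t -> al * Mx s t `^ (- th) * (t - s) <= A t - A s) ->
  al / 4 * Mx s t `^ (m - 2 - th) * ((t - s) / h) ^+ 2 -
    9 / al * (E ^+ 2 * Mx s t `^ (m - 2 + th + 2 * g)) <=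
  flux A g h E s t * ((psi m s - psi m t) / h).
Proof.
move=> m24 al0 h0 g01 HA.
have AL u v : al / 2 * Mx u v `^ (m - 2 - th) * (v - u) ^+ 2 <=
    (A u - A v) * (psi m u - psi m v).
  wlog uv : u v / u <= v => [H|].
    have [/H//|/ltW/H] := leP u v.
    by rewrite MxC -sqrrN opprB -[(A v - _) * _]mulrNN !opprB.
  have := HA u v uv; have /andP[+ _] := psi_diff m24 uv.
  have X0 := Mx_gt0 u v.
  have -> : Mx u v `^ (m - 2 - th) = Mx u v `^ (- th) * Mx u v `^ (m - 2).
    rewrite -powRD; first by congr powR; ring.
    by apply/implyP => _; exact: lt0r_neq0.
  have Pt := powR_ge0 (Mx u v) (- th); have Pm := powR_ge0 (Mx u v) (m - 2).
  move: (_ `^ (- th)) (_ `^ (m - 2)) Pt Pm => a b a0 b0 H1 H2.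
  have vu : 0 <= v - u by rewrite subr_ge0.
  have := ler_pM _ _ H2 H1; rewrite !mulr_ge0 ?divr_ge0 ?(ltW al0)// => /(_ isT isT).
  by move=> H; rewrite -[leRHS]mulrNN !opprB; apply: le_trans H; lra.
have psiL : `|psi m s - psi m t| <= 3 * Mx s t `^ (m - 2) * `|t - s|.
  have [st|/ltW ts] := leP s t.
    have /andP[H1 H2] := psi_diff m24 st.
    rewrite distrC (ger0_norm (_ : 0 <= t - s)) ?subr_ge0// ger0_norm//.
    by apply: le_trans H1; rewrite mulr_ge0 ?divr_ge0 ?powR_ge0 ?subr_ge0.
  have /andP[H1 H2] := psi_diff m24 ts.
  rewrite MxC distrC [`|t - s|]distrC (ger0_norm (_ : 0 <= s - t)) ?subr_ge0//.
  rewrite distrC ger0_norm//.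
  by apply: le_trans H1; rewrite mulr_ge0 ?divr_ge0 ?powR_ge0 ?subr_ge0.
have UL := @upwind_le g h E s t g01 h0.
set X := Mx s t in UL psiL *; have X0 : 0 < X := Mx_gt0 s t.
set up := _ * greg g h s - _ in UL.
have -> : flux A g h E s t = (A s - A t) / h + up by rewrite /flux /up addrA.
pose D := `|t - s| / h.
have D0 : 0 <= D by rewrite divr_ge0// ltW.
have DE : ((t - s) / h) ^+ 2 = D ^+ 2.
  by rewrite /D -real_normK ?num_real// normrM normfV (gtr0_norm h0).
have a1 : al / 2 * X `^ (m - 2 - th) * D ^+ 2 <=
    (A s - A t) / h * ((psi m s - psi m t) / h).
  have -> : (A s - A t) / h * ((psi m s - psi m t) / h) =
      ((A s - A t) * (psi m s - psi m t)) / h ^+ 2 by field; exact: lt0r_neq0.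
  rewrite -DE expr_div_n mulrA.
  by rewrite ler_wpM2r ?invr_ge0 ?exprn_ge0 ?(ltW h0)//; exact: AL.
have a2 : `|up * ((psi m s - psi m t) / h)| <= `|E| * X `^ g * (3 * X `^ (m - 2) * D).
  rewrite normrM ler_pM// normrM normfV (gtr0_norm h0) /D mulrA.
  by rewrite ler_wpM2r// invr_ge0 ltW.
pose a := X `^ ((m - 2 - th) / 2) * D.
pose c := `|E| * X `^ ((m - 2 + th + 2 * g) / 2).
have pw p q : X `^ p * X `^ q = X `^ (p + q).
  by rewrite -powRD//; apply/implyP => _; exact: lt0r_neq0.
have sq p : (X `^ (p / 2)) ^+ 2 = X `^ p by rewrite expr2 pw -splitr.
have a3 : `|E| * X `^ g * (3 * X `^ (m - 2) * D) = 3 * (a * c).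
  transitivity (3 * (`|E| * D * (X `^ g * X `^ (m - 2)))); first by ring.
  rewrite pw (_ : g + (m - 2) = (m - 2 - th) / 2 + (m - 2 + th + 2 * g) / 2).
    by rewrite -pw /a /c; ring.
  by field.
have aE : X `^ (m - 2 - th) * D ^+ 2 = a ^+ 2.
  by rewrite -sq -exprMn.
have cE : E ^+ 2 * X `^ (m - 2 + th + 2 * g) = c ^+ 2.
  by rewrite -sq -[E ^+ 2]real_normK ?num_real// -exprMn.
rewrite DE.
have -> : al / 4 * X `^ (m - 2 - th) * D ^+ 2 = al / 4 * a ^+ 2.
  by rewrite -aE; ring.
have -> : 9 / al * (E ^+ 2 * X `^ (m - 2 + th + 2 * g)) = 9 / al * c ^+ 2 by rewrite -cE.
have {}a1 : al / 2 * a ^+ 2 <= (A s - A t) / h * ((psi m s - psi m t) / h).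
  by apply: le_trans a1; rewrite -aE le_eqVlt; apply/orP; left; apply/eqP; ring.
rewrite [leRHS]mulrDl.
move: a2; rewrite a3 => /ler_normlP[a2 _].
have young : 3 * (a * c) <= al / 4 * a ^+ 2 + 9 / al * c ^+ 2.
  have sq0 : 0 <= (al * a / 2 - 3 * c) ^+ 2 by exact: sqr_ge0.
  rewrite -(ler_pM2l al0) (_ : al * (al / 4 * a ^+ 2 + 9 / al * c ^+ 2) =
    al ^+ 2 * a ^+ 2 / 4 + 9 * c ^+ 2); last by field; exact: lt0r_neq0.
  by nra.
move: a1 a2 young.
move: ((A s - A t) / h * _) (up * _) (a * c) (9 / al * _) (a ^+ 2) => z1 z2 z3 z4 z5.
by lra.
Qed.

(** A pointwise Hoelder inequality: [D] is compared with [X^(m/q)], [X = Mx s t]. Below it,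
    [D^q <= X^m]; above it, [D^(q-2) <= X^(m(q-2)/q)], and [q = 2m/(th+2)] is the exponent for which
    this last power is [X^(m-2-th)]. *)
Lemma gradient_powR th m q D s t : 0 <= D -> m < th + 2 -> 0 < m -> 0 < q < 2 ->
  (th + 2) * q = 2 * m ->
  D `^ q <= Mx s t `^ (m - 2 - th) * D ^+ 2 + Mx s t `^ m.
Proof.
move=> D0 mth m0 /andP[q0 q2] qE; set X := Mx s t.
have X0 : 0 < X := Mx_gt0 s t.
have [DX|XD] := leP D (X `^ (m / q)).
  apply: (@le_trans _ _ (X `^ m)); last first.
    by rewrite lerDr mulr_ge0 ?powR_ge0 ?exprn_ge0.
  rewrite -(divfK (lt0r_neq0 q0) m) powRrM.
  by apply: ge0_ler_powR; rewrite ?nnegrE ?powR_ge0 ?(ltW q0).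
apply: (@le_trans _ _ (X `^ (m - 2 - th) * D ^+ 2)); last by rewrite lerDl powR_ge0.
have Dp : 0 < D by apply: lt_trans XD; rewrite powR_gt0.
have -> : D ^+ 2 = D `^ q * D `^ (2 - q).
  rewrite -powRD ?subrKC ?powR_mulrn//.
  by apply/implyP => _; exact: lt0r_neq0.
rewrite mulrCA -[leLHS]mulr1 ler_wpM2l ?powR_ge0//.
apply: (@le_trans _ _ (X `^ (m - 2 - th) * (X `^ (m / q)) `^ (2 - q))).
  rewrite -powRrM -powRD; last by apply/implyP => _; exact: lt0r_neq0.
  rewrite (_ : m - 2 - th + m / q * (2 - q) = 0) ?powRr0//.
  have -> : m / q * (2 - q) = 2 * m / q - m by field; exact: lt0r_neq0.
  by rewrite -qE mulfK ?lt0r_neq0//; ring.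
rewrite ler_wpM2l ?powR_ge0//; apply: ge0_ler_powR; rewrite ?nnegrE ?powR_ge0 ?(ltW XD) ?D0//.
by rewrite subr_ge0 ltW.
Qed.

Lemma Mx_powR m s t : 0 <= m ->
  Mx s t `^ m <= 2 `^ m * (1 + `|s| `^ m + `|t| `^ m).
Proof.
move=> m0; have le x : (1 + `|x|) `^ m <= 2 `^ m * (1 + `|x| `^ m).
  have [x1|x1] := leP `|x| 1.
    apply: (@le_trans _ _ (2 `^ m)).
      by apply: ge0_ler_powR; rewrite ?nnegrE ?addr_ge0//; lra.
    by rewrite ler_peMr ?powR_ge0// lerDl powR_ge0.
  apply: (@le_trans _ _ ((2 * `|x|) `^ m)).
    by apply: ge0_ler_powR; rewrite ?nnegrE ?addr_ge0 ?mulr_ge0//; lra.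
  by rewrite powRM// ler_wpM2l ?powR_ge0// lerDr.
rewrite /Mx; case: (leP `|s| `|t|) => _; apply: le_trans (le _) _;
  rewrite ler_wpM2l ?powR_ge0//.
  by rewrite -addrA [X in _ <= _ + X]addrC addrA lerDl powR_ge0.
by rewrite lerDl powR_ge0.
Qed.

End test_nonlinearity.

(** * Solvability of the scheme at a fixed mesh *)

Section scheme.
Context (R : realType) (N : nat).
Notation mu := (leb R N).
Notation mf f := (measurable_fun [set: Rn R N] (f : Rn R N -> R)).
Notation intg f := (mu.-integrable [set: Rn R N] (EFin \o (f : Rn R N -> R))).
Notation Int f := (\int[mu]_x (f : Rn R N -> R) x).
Variables (Om : set 'rV[R]_N) (A : 'rV[R]_N -> R -> R) (f : 'rV[R]_N -> R)
  (E : 'I_N -> 'rV[R]_N -> R) (th g m r al be : R).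
Hypotheses (N0 : (0 < N)%N) (mOm : measurable (Om : set (Rn R N)))
  (Om_fin : (mu Om < +oo)%E).
Hypotheses (m24 : 2 <= m <= 4) (g01 : 0 < g < 1) (al0 : 0 < al) (be0 : 0 < be).
Hypothesis Am : forall s, mf (A ^~ s).
Hypothesis Ale : forall x s t, s <= t ->
  al * Mx s t `^ (- th) * (t - s) <= A x t - A x s <= be * (t - s).
Hypotheses (fm : mf f) (f_off : forall x, ~ Om x -> f x = 0)
  (fi : intg (fun x => `|f x| `^ m)).
Hypotheses (Em : forall e, mf (E e)) (E_off : forall e x, ~ Om x -> E e x = 0)
  (r1 : 1 <= r) (Ei : forall e, intg (fun x => `|E e x| `^ (2 * r))).

Let m0 : 0 < m. Proof. by move: m24; lra. Qed.

Lemma intg_of_powR p (u : 'rV[R]_N -> R) : 1 <= p -> mf u ->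
  (forall x, ~ Om x -> u x = 0) -> intg (fun x => `|u x| `^ p) -> intg u.
Proof.
move=> p1 um uO ui; apply: (@intg_dom _ (Rn R N) R mu _ (fun x : Rn R N => \1_Om x + `|u x| `^ p)) => //.
  move=> x; rewrite indicE; have [xO|/negP xO] := boolP (x \in Om); last first.
    by rewrite uO ?normr0 ?addr_ge0 ?powR_ge0// => xO'; apply: xO; rewrite inE.
  have [u1|u1] := leP `|u x| 1; first by rewrite (le_trans u1)// lerDl powR_ge0.
  rewrite -[leLHS]add0r lerD//; apply: le1r_powR => //; exact: ltW.
by apply: intgD => //; exact: intg_indic.
Qed.

Let f1 : intg f.
Proof. by apply: (intg_of_powR _ fm f_off fi); move: m24; lra. Qed.

Let E1 e : intg (E e).
Proof. by apply: (intg_of_powR _ (Em e) _ (Ei e)); [move: r1; lra|exact: E_off]. Qed.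

Lemma intg_lat2 h (I : seq 'rV[int]_N) U z (Psi : R -> R -> R) : 0 < h ->
  uniq I -> (forall k, k \notin I -> U k = 0) -> Psi 0 0 = 0 ->
  intg (fun x => Psi (U (idx h x)) (U (idx h x + z))).
Proof.
move=> h0 uI UI P0; pose J := undup (I ++ [seq k - z | k <- I]).
apply: (@intg_lat _ _ _ h0 J (fun k => Psi (U k) (U (k + z))) N0 _ _).1.
  exact: undup_uniq.
move=> k; rewrite mem_undup mem_cat negb_or => /andP[kI kz].
rewrite !UI// -?P0//; apply: contra kz => kI'.
by apply/mapP; exists (k + z); rewrite ?addrK.
Qed.

Section existence.
Variables (h : R) (I : seq 'rV[int]_N).
Hypotheses (h0 : 0 < h) (uI : uniq I).

Let Fl e x s t := flux (A x) g h (E e x) s t.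

Let Flm e s t : mf (fun x => Fl e x s t).
Proof.
rewrite /Fl /flux; move: (greg g h s) (greg g h t) => gs gt.
have maxm (F : Rn R N -> R) : mf F -> mf (fun x => Num.max 0 (F x)).
  by move=> Fm; under eq_fun do rewrite maxC; exact: measurable_funrpos.
have mulm (F : Rn R N -> R) c : mf F -> mf (fun x => F x * c).
  by move=> Fm; apply: measurable_funM => //; exact: measurable_cst.
have m1 : mf (fun x => (A x s - A x t) / h) by apply: mulm; exact: measurable_funB.
have m2 : mf (fun x => Num.max 0 (E e x) * gs) by apply: mulm; exact: maxm.
have m3 : mf (fun x => Num.max 0 (- E e x) * gt).
  by apply: mulm; apply: maxm; exact: measurableT_comp.
exact: measurable_funB (measurable_funD m1 m2) m3.
Qed.

Let Acont x s t : `|A x s - A x t| <= be * `|t - s|.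
Proof.
have aux u v : u <= v -> `|A x u - A x v| <= be * `|v - u|.
  move=> uv; have /andP[H1 H2] := Ale x uv.
  rewrite distrC (ger0_norm (_ : 0 <= v - u)) ?subr_ge0// ger0_norm//.
  by apply: le_trans H1; rewrite !mulr_ge0 ?(ltW al0) ?powR_ge0// subr_ge0.
have [/aux//|/ltW/aux] := leP s t.
by rewrite distrC [`|s - t|]distrC.
Qed.

Let Fl_le e x s t : `|Fl e x s t| <= be * `|t - s| / h + Mx s t `^ g * `|E e x|.
Proof.
rewrite /Fl /flux -addrA; apply: le_trans (ler_normD _ _) _; apply: lerD.
  by rewrite normrM normfV (gtr0_norm h0) ler_wpM2r// invr_ge0 ltW.
by rewrite [leRHS]mulrC; exact: upwind_le.
Qed.

Let cell k : set (Rn R N) := [set x | idx h x = k].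

Let mcell k : measurable (cell k).
Proof. exact: measurable_cell. Qed.

Let intg_cell_mul k (u : 'rV[R]_N -> R) : intg u -> intg (fun x => \1_(cell k) x * u x).
Proof.
move=> ui; apply: (@intg_dom _ (Rn R N) R mu _ (fun x : Rn R N => `|u x|)).
- by apply: measurable_funM; [exact: measurable_indic|exact: intg_mf ui].
- move=> x; rewrite normrM ler_piMl// indicE.
  by case: (x \in _); rewrite ?normr1 ?normr0.
- exact: intg_norm.
Qed.

Let intg_cell_Fl e k s t : intg (fun x => \1_(cell k) x * Fl e x s t).
Proof.
apply: (@intg_dom _ (Rn R N) R mu _ (fun x : Rn R N => \1_(cell k) x * (be * `|t - s| / h) +
  Mx s t `^ g * (\1_(cell k) x * `|E e x|))).
- by apply: measurable_funM; [exact: measurable_indic|exact: Flm].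
- move=> x; rewrite normrM ger0_norm// [_ * (\1__ _ * _)]mulrCA -mulrDr ler_wpM2l//.
- apply: intgD.
    under eq_fun do rewrite mulrC; apply: intgZ; exact: intg_cell.
  by apply: intgZ; apply: intg_cell_mul; exact: intg_norm.
Qed.

(** The flux through the face between [k] and [k + dir e] is averaged over the cell [k], since [A]
    and [E] are only measurable in [x] and have no traces on faces; [h^-1] converts the volume of
    the cell into the area of the face. *)
Let phi e k s t := h^-1 * Int (fun x => \1_(cell k) x * Fl e x s t).

(** This Lipschitz constant may blow up as [h] tends to 0; it serves only the solvability at a fixed
    mesh. *)
Let L := h^-1 * (be / h * h ^+ N + h `^ (g - 1) * \sum_e Int (fun x => `|E e x|)).

Let L0 : 0 <= L.
Proof.
rewrite mulr_ge0 ?invr_ge0 ?(ltW h0)// addr_ge0//.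
  by rewrite mulr_ge0 ?exprn_ge0 ?divr_ge0 ?(ltW h0) ?(ltW be0).
by rewrite mulr_ge0 ?powR_ge0// sumr_ge0// => e _; apply: Int_ge0 => x.
Qed.

(** Serves both arguments of the flux: a pointwise bound of the increment is integrated over one
    cell, where the part with [|E e|] is majorized by the full integral, summed over the
    directions. *)
Let phi_lip e k s t s' t' c : 0 <= c ->
  (forall x, 0 <= Fl e x s t - Fl e x s' t' <= (be / h + h `^ (g - 1) * `|E e x|) * c) ->
  0 <= phi e k s t - phi e k s' t' <= L * c.
Proof.
move=> c0 H; rewrite -mulrBr -IntB; [|exact: intg_cell_Fl..].
have D0 x : 0 <= \1_(cell k) x * Fl e x s t - \1_(cell k) x * Fl e x s' t'.
  by rewrite -mulrBr mulr_ge0//; have /andP[] := H x.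
rewrite mulr_ge0 ?invr_ge0 ?(ltW h0)//=; last by apply: Int_ge0.
rewrite /L -mulrA ler_wpM2l ?invr_ge0 ?(ltW h0)//.
apply: (@le_trans _ _ (Int (fun x => be / h * c * \1_(cell k) x +
    h `^ (g - 1) * c * `|E e x|))).
  apply: le_Int.
  - by apply: intgB; exact: intg_cell_Fl.
  - apply: intgD; apply: intgZ; [exact: intg_cell|exact: intg_norm].
  - move=> x; rewrite -mulrBr; have /andP[H1 H2] := H x.
    rewrite indicE; case: (x \in _); rewrite ?mul1r ?mul0r ?mulr1 ?mulr0.
      by apply: le_trans H2 _; rewrite mulrDl lerD2l mulrAC.
    by rewrite add0r !mulr_ge0 ?powR_ge0.
rewrite IntD; [|by apply: intgZ; exact: intg_cell|by apply: intgZ; exact: intg_norm].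
rewrite !IntZ; [|exact: intg_norm|exact: intg_cell].
rewrite Int_indic// leb_cell// /= mulrDl; apply: lerD.
  by rewrite mulrAC.
rewrite [leRHS]mulrAC ler_wpM2l//; first by rewrite mulr_ge0 ?powR_ge0.
rewrite (bigD1 e)//= lerDl sumr_ge0// => i _.
by apply: Int_ge0 => x.
Qed.

Let maxE (x : R) : 0 <= Num.max 0 x <= `|x|.
Proof. by rewrite le_max lexx ge_max normr_ge0 ler_norm. Qed.

(** The cell equations are multiplied by [ps k] and summed; reindexing the incoming fluxes is the
    discrete integration by parts. Written with integrals over the whole space, the scheme becomes a
    weak formulation with piecewise constant test functions. *)
Lemma scheme_solution : exists U : 'rV[int]_N -> R,
  (forall k, k \notin I -> U k = 0) /\
  forall ps : 'rV[int]_N -> R, (forall k, k \notin I -> ps k = 0) ->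
  [/\ intg (fun x => f x * ps (idx h x)),
      forall e, intg (fun x => flux (A x) g h (E e x) (U (idx h x)) (U (idx h x + dir e)) *
        ((ps (idx h x) - ps (idx h x + dir e)) / h)) &
      Int (fun x => U (idx h x) * ps (idx h x)) +
      \sum_e Int (fun x => flux (A x) g h (E e x) (U (idx h x)) (U (idx h x + dir e)) *
        ((ps (idx h x) - ps (idx h x + dir e)) / h)) =
      Int (fun x => f x * ps (idx h x))].
Proof.
have hN : 0 < h ^+ N by rewrite exprn_gt0.
have [||U [UI HU]] := @monotone_network_solution R _ _ (@dir N) I (h ^+ N) L phi
    (fun k => Int (fun x => \1_(cell k) x * f x)) uI hN L0.
- move=> e k s s' t ss'; apply: phi_lip; first by rewrite subr_ge0.
  move=> x; rewrite /Fl /flux.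
  have -> : (A x s' - A x t) / h + Num.max 0 (E e x) * greg g h s' -
      Num.max 0 (- E e x) * greg g h t - ((A x s - A x t) / h +
      Num.max 0 (E e x) * greg g h s - Num.max 0 (- E e x) * greg g h t) =
      (A x s' - A x s) / h + Num.max 0 (E e x) * (greg g h s' - greg g h s) by ring.
  have /andP[g1 g2] := greg_lip g01 h0 ss'.
  have /andP[a1 a2] := Ale x ss'; have /andP[e1 e2] := maxE (E e x).
  have a3 : 0 <= A x s' - A x s.
    by apply: le_trans a1; rewrite !mulr_ge0 ?(ltW al0) ?powR_ge0// subr_ge0.
  apply/andP; split.
    by apply: addr_ge0; [exact: divr_ge0 (ltW h0)|exact: mulr_ge0].
  rewrite [leRHS]mulrDl; apply: lerD.
    by rewrite mulrAC ler_wpM2r ?invr_ge0 ?(ltW h0).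
  by rewrite [h `^ _ * _]mulrC -mulrA ler_pM.
- move=> e k s t t' tt'; apply: phi_lip; first by rewrite subr_ge0.
  move=> x; rewrite /Fl /flux.
  have -> : (A x s - A x t) / h + Num.max 0 (E e x) * greg g h s -
      Num.max 0 (- E e x) * greg g h t - ((A x s - A x t') / h +
      Num.max 0 (E e x) * greg g h s - Num.max 0 (- E e x) * greg g h t') =
      (A x t' - A x t) / h + Num.max 0 (- E e x) * (greg g h t' - greg g h t) by ring.
  have /andP[g1 g2] := greg_lip g01 h0 tt'.
  have /andP[a1 a2] := Ale x tt'; have := maxE (- E e x); rewrite normrN => /andP[e1 e2].
  have a3 : 0 <= A x t' - A x t.
    by apply: le_trans a1; rewrite !mulr_ge0 ?(ltW al0) ?powR_ge0// subr_ge0.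
  apply/andP; split.
    by apply: addr_ge0; [exact: divr_ge0 (ltW h0)|exact: mulr_ge0].
  rewrite [leRHS]mulrDl; apply: lerD.
    by rewrite mulrAC ler_wpM2r ?invr_ge0 ?(ltW h0).
  by rewrite [h `^ _ * _]mulrC -mulrA ler_pM.
exists U; split=> // ps psI.
have fcell k : intg (fun x => \1_(cell k) x * (ps k * f x)).
  by have := intgZ (ps k) (intg_cell_mul k f1); under eq_fun do rewrite mulrCA.
have [|fi1 fE] := @intg_lat_cases R N h I (fun k x => ps k * f x) uI _ fcell.
  by move=> k x /psI ->; rewrite mul0r.
pose G e k x := Fl e x (U k) (U (k + dir e)).
have Gi e (c : 'rV[int]_N -> R) k : intg (fun x => \1_(cell k) x * (c k * G e k x)).
  have := intgZ (c k) (intg_cell_Fl e k (U k) (U (k + dir e))).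
  by under eq_fun do rewrite mulrCA.
(* The sites at which [ps (k + dir e)] may be nonzero. *)
pose J e := [seq k - dir e | k <- I].
have uJ e : uniq (J e) by rewrite map_inj_uniq//; exact: addIr.
have lat1 e : intg (fun x => ps (idx h x) * G e (idx h x) x) /\
    Int (fun x => ps (idx h x) * G e (idx h x) x) =
    h * \sum_(k <- I) ps k * phi e k (U k) (U (k + dir e)).
  have [|H1 H2] := @intg_lat_cases R N h I (fun k x => ps k * G e k x) uI _ (Gi e ps).
    by move=> k x /psI ->; rewrite mul0r.
  split=> //; rewrite H2 mulr_sumr; apply: eq_bigr => k _.
  rewrite /phi mulrCA mulVKf ?lt0r_neq0//.
  by rewrite -IntZ; [congr Rintegral; apply/funext => x; rewrite mulrCA|exact: intg_cell_Fl].
have lat2 e : intg (fun x => ps (idx h x + dir e) * G e (idx h x) x) /\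
    Int (fun x => ps (idx h x + dir e) * G e (idx h x) x) =
    h * \sum_(k <- I) ps k * phi e (k - dir e) (U (k - dir e)) (U k).
  have [|H1 H2] := @intg_lat_cases R N h (J e) (fun k x => ps (k + dir e) * G e k x)
    (uJ e) _ (Gi e (fun k => ps (k + dir e))).
    move=> k x kJ; rewrite psI ?mul0r//; apply: contra kJ => kI.
    by apply/mapP; exists (k + dir e); rewrite ?addrK.
  split=> //; rewrite H2 big_map mulr_sumr; apply: eq_bigr => k _.
  rewrite subrK /phi mulrCA mulVKf ?lt0r_neq0//.
  rewrite -IntZ; last exact: intg_cell_Fl.
  by congr Rintegral; apply/funext => x; rewrite mulrCA /G subrK.
have flE e : (fun x => flux (A x) g h (E e x) (U (idx h x)) (U (idx h x + dir e)) *
    ((ps (idx h x) - ps (idx h x + dir e)) / h)) =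
    (fun x => h^-1 * (ps (idx h x) * G e (idx h x) x - ps (idx h x + dir e) * G e (idx h x) x)).
  by apply/funext => x; rewrite /G /Fl; ring.
have [|ui uE] := @intg_lat R N h h0 I (fun k => U k * ps k) N0 uI.
  by move=> k /psI ->; rewrite mulr0.
split.
- by under eq_fun do rewrite mulrC.
- by move=> e; rewrite flE; apply: intgZ; apply: intgB; [case: (lat1 e)|case: (lat2 e)].
have -> : Int (fun x => f x * ps (idx h x)) = Int (fun x => ps (idx h x) * f x).
  by congr Rintegral; apply/funext => x; rewrite mulrC.
rewrite fE uE (eq_bigr (fun e => \sum_(k <- I) ps k * (phi e k (U k) (U (k + dir e)) -
    phi e (k - dir e) (U (k - dir e)) (U k)))); last first.
  move=> e _; rewrite flE IntZ; last first.
    by apply: intgB; [case: (lat1 e)|case: (lat2 e)].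
  rewrite IntB; [|by case: (lat1 e)|by case: (lat2 e)].
  rewrite (lat1 e).2 (lat2 e).2 -mulrBr mulKf ?lt0r_neq0// -sumrB.
  by apply: eq_bigr => k _; rewrite mulrBr.
rewrite exchange_big mulr_sumr -big_split /= big_seq [RHS]big_seq.
apply: eq_bigr => k kI.
have -> : Int (fun x => \1_(cell k) x * (ps k * f x)) =
    ps k * Int (fun x => \1_(cell k) x * f x).
  rewrite -IntZ; last exact: intg_cell_mul.
  by congr Rintegral; apply/funext => x; rewrite mulrCA.
by rewrite -(HU k kI) mulrDr mulr_sumr; congr (_ + _); ring.
Qed.

End existence.

End scheme.

(** * Estimates uniform in the mesh *)

Section a_priori_bounds.
Context (R : realType).
Implicit Types (s t : R).

(** Young's inequality with [p = m - 2 + th + 2 g] and [k = 2 - th - 2 g], so that [p + k = m],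
    splits the drift term of [energy_flux] into a small multiple of [Mx s t ^ m] and a multiple of
    [|E|^(2m/k) <= 1 + |E|^(2r)]. The flag [o] stands for membership in [Om] and keeps the constants
    integrable. *)
Lemma energy_pointwise (A : R -> R) th g al h m r E s t e (o : bool) :
  2 <= m <= 4 -> 0 < al -> 0 < h -> 0 < g < 1 -> 0 < th -> 0 < 2 - th - 2 * g ->
  m / (2 - th - 2 * g) <= r -> 0 < e ->
  (forall s t, s <= t -> al * Mx s t `^ (- th) * (t - s) <= A t - A s) ->
  (~~ o -> E = 0) ->
  al / 4 * (Mx s t `^ (m - 2 - th) * ((t - s) / h) ^+ 2) <=
  flux A g h E s t * ((psi m s - psi m t) / h) +
  9 / al * (e * 2 `^ m * (o%:R + `|s| `^ m + `|t| `^ m) +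
    e `^ (- ((m - 2 + th + 2 * g) / (2 - th - 2 * g))) * (o%:R + `|E| `^ (2 * r))).
Proof.
move=> m24 al0 h0 g01 th0 k0 mr e0 HA oE.
have arith : [/\ 0 <= m - 2 + th + 2 * g, 0 < m, 0 <= m &
    m - 2 + th + 2 * g + (2 - th - 2 * g) = m] by split; move: m24 g01 th0; lra.
have [p0 m0 m0' pk] := arith.
rewrite -lerBlDr [_ * (Mx _ _ `^ _ * _)]mulrA.
apply: le_trans _ (energy_flux E s t m24 al0 h0 g01 HA).
rewrite lerB// ler_pM2l ?divr_gt0//.
have [b1|b0] := boolP o; last first.
  rewrite (oE b0) expr0n mul0r; apply: addr_ge0; rewrite ?mulr_ge0 ?addr_ge0 ?powR_ge0 ?(ltW e0)//.
apply: le_trans (young_powR p0 k0 e0 (sqr_ge0 E) (ltW (Mx_gt0 s t))) _.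
rewrite pk; apply: lerD; first by rewrite -mulrA ler_wpM2l ?(ltW e0) ?Mx_powR.
rewrite ler_wpM2l ?powR_ge0// -[E ^+ 2]real_normK ?num_real// -powR_mulrn// -powRrM.
have [E1|E1] := leP `|E| 1.
  apply: (@le_trans _ _ (1 `^ (2 * (m / (2 - th - 2 * g))))); last first.
    by rewrite powR1 lerDl powR_ge0.
  by apply: ge0_ler_powR; rewrite ?nnegrE// mulr_ge0 ?divr_ge0 ?(ltW k0).
rewrite -[leLHS]add0r lerD// ler_powR ?(ltW E1)// ler_wpM2l//.
Qed.

(** The same splitting for the source: [|psi m s|] is at most [(1 + |s|)^(m-1)], and Young's
    inequality is used with the powers [m - 1] and 1. *)
Lemma source_pointwise m e s y (o : bool) : 2 <= m -> 0 < e -> (~~ o -> y = 0) ->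
  `|y * psi m s| <= e * 2 `^ m * (o%:R + `|s| `^ m) + e `^ (- (m - 1)) * `|y| `^ m.
Proof.
move=> m2 e0 oy; have arith : [/\ 0 <= m - 1, 0 <= m & m - 1 + 1 = m] by split; move: m2; lra.
have [m10 m0 mE] := arith; have [b1|b0] := boolP o; last first.
  by rewrite (oy b0) mul0r normr0 addr_ge0// mulr_ge0 ?addr_ge0 ?mulr_ge0 ?powR_ge0 ?(ltW e0).
rewrite normrM; apply: (@le_trans _ _ (`|y| * (1 + `|s|) `^ (m - 1))).
  by rewrite ler_wpM2l// psi_bound.
apply: le_trans (young_powR m10 ltr01 e0 (normr_ge0 y) (addr_ge0 ler01 (normr_ge0 s))) _.
rewrite mE !divr1 lerD2r -mulrA ler_wpM2l ?(ltW e0)//.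
have := ler_powRD 1 `|s| m0.
by rewrite normr1 powR1 normr_id ger0_norm// addr_ge0.
Qed.

Context d (T : measurableType d) (mu : {measure set T -> \bar R}).
Notation mf f := (measurable_fun [set: T] f).
Notation intg f := (mu.-integrable [set: T] (EFin \o f)).
Notation Int f := (\int[mu]_x f x).

(** [u] stands for the lattice function and [w e] for its shift in direction [e]; translation
    invariance enters as the equality of their integrals of order [m]. The constant is fixed before
    [h], [A] and [u], hence is uniform in the mesh. *)
Lemma a_priori_bounds N (Om : set T) (f : T -> R) (E : 'I_N -> T -> R) (th g m r al q : R) :
  measurable Om -> (mu Om < +oo)%E ->
  2 <= m <= 4 -> 0 < al -> 0 < g < 1 -> 0 < th -> 0 < 2 - th - 2 * g ->
  m / (2 - th - 2 * g) <= r -> m < th + 2 -> 0 < q < 2 -> (th + 2) * q = 2 * m ->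
  (0 < N)%N ->
  (forall x, ~ Om x -> f x = 0) -> intg (fun x => `|f x| `^ m) ->
  (forall e x, ~ Om x -> E e x = 0) -> (forall e, intg (fun x => `|E e x| `^ (2 * r))) ->
  exists C, forall h (A : T -> R -> R) (u : T -> R) (w : 'I_N -> T -> R), 0 < h ->
  (forall x s t, s <= t -> al * Mx s t `^ (- th) * (t - s) <= A x t - A x s) ->
  mf u -> (forall e, mf (w e)) ->
  (forall e x, ~ Om x -> w e x = u x) ->
  intg (fun x => `|u x| `^ m) -> intg (fun x => u x * psi m (u x)) ->
  (forall e, intg (fun x => `|w e x| `^ m)) ->
  (forall e, Int (fun x => `|w e x| `^ m) = Int (fun x => `|u x| `^ m)) ->
  (forall e, intg (fun x => Mx (u x) (w e x) `^ (m - 2 - th) * ((w e x - u x) / h) ^+ 2)) ->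
  intg (fun x => f x * psi m (u x)) ->
  (forall e, intg (fun x => flux (A x) g h (E e x) (u x) (w e x) *
     ((psi m (u x) - psi m (w e x)) / h))) ->
  Int (fun x => u x * psi m (u x)) +
  \sum_e Int (fun x => flux (A x) g h (E e x) (u x) (w e x) *
     ((psi m (u x) - psi m (w e x)) / h)) = Int (fun x => f x * psi m (u x)) ->
  Int (fun x => `|u x| `^ m) <= C /\
  forall e, intg (fun x => `|(w e x - u x) / h| `^ q) /\
    Int (fun x => `|(w e x - u x) / h| `^ q) <= C.
Proof.
move=> mOm Omfin m24 al0 g01 th0 kap0 mr mth q02 qE N0 f_off fi E_off Ei.
have arith2 (a b c dd s w o k1 ff : R) : s <= a -> w <= b + (4^-1 * s + k1) -> a + b = c ->
    c <= 4^-1 * (o + s) + ff -> 0 <= w -> 0 <= s ->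
    s <= 2 * (4^-1 * o + ff + k1) /\ w <= 2 * (4^-1 * o + ff + k1) by move=> *; lra.
have [m2 m0] : 2 <= m /\ 0 < m by move: m24; lra.
have [q0 q2] : 0 < q /\ q < 2 by move: q02 => /andP[].
have p2 : 0 < 2 `^ m :> R by rewrite powR_gt0.
have NR : 0 < N%:R :> R by rewrite ltr0n.
(* [e1] makes the coefficient [9 / al * e1 * 2^m] equal to [1 / (8 N)]: over [N] directions with two
   values each, this costs a quarter of the integral of [|u|^m]. [e2] makes the source cost another
   quarter, so half of that integral survives on the left. *)
pose e1 := al / (72 * N%:R) / 2 `^ m; pose e2 := (2 `^ m)^-1 / 4.
have e10 : 0 < e1 by rewrite /e1 !divr_gt0 ?mulr_gt0.
have e20 : 0 < e2 by rewrite /e2 divr_gt0 ?invr_gt0.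
pose c1 := e1 `^ (- ((m - 2 + th + 2 * g) / (2 - th - 2 * g))).
pose c2 := e2 `^ (- (m - 1)); pose O := Int (\1_Om : T -> R).
have c10 : 0 <= c1 by exact: powR_ge0.
have c20 : 0 <= c2 by exact: powR_ge0.
have O0 : 0 <= O by apply: Int_ge0 => x; rewrite indicE.
have iO : intg (\1_Om : T -> R) by exact: intg_indic.
pose F := Int (fun x => `|f x| `^ m).
have F0 : 0 <= F by apply: Int_ge0 => x; exact: powR_ge0.
pose G e := Int (fun x => `|E e x| `^ (2 * r)).
have G0 e : 0 <= G e by apply: Int_ge0 => x; exact: powR_ge0.
have Ke1 : 9 / al * (e1 * 2 `^ m) = (8 * N%:R)^-1.
  by rewrite /e1; field; rewrite !lt0r_neq0.
have Ke2 : e2 * 2 `^ m = 4^-1 by rewrite /e2; field; rewrite lt0r_neq0.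
pose K1 := \sum_e ((8 * N%:R)^-1 * O + 9 / al * (c1 * (O + G e))).
pose K := 4^-1 * O + c2 * F + K1.
have K10 : 0 <= K1.
  apply: sumr_ge0 => e _; apply: addr_ge0; first by rewrite mulr_ge0// invr_ge0 mulr_ge0.
  apply: mulr_ge0; first by rewrite divr_ge0// ltW.
  exact: mulr_ge0 c10 (addr_ge0 O0 (G0 e)).
have K0 : 0 <= K by rewrite !addr_ge0 ?mulr_ge0.
pose C := 2 * K + 8 * K / al + 2 `^ m * (O + 4 * K).
have C2 : 8 * K / al + 2 `^ m * (O + 4 * K) <= C.
  by rewrite /C -addrA lerDr mulr_ge0.
have C1 : 2 * K <= C.
  rewrite /C -addrA lerDl addr_ge0//.
    by rewrite divr_ge0 ?(ltW al0)// mulr_ge0.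
  by rewrite mulr_ge0 ?(ltW p2)// addr_ge0// mulr_ge0.
exists C => h A u w h0 HA um wm w_off ui upi wi wE Wi fpi Fi eqn.
have oM x : (x \in Om)%:R = \1_Om x :> R by rewrite indicE.
have offE e x : ~~ (x \in Om) -> E e x = 0 by move/negP; rewrite inE; exact: E_off.
have offf x : ~~ (x \in Om) -> f x = 0 by move/negP; rewrite inE; exact: f_off.
set S := Int (fun x => `|u x| `^ m).
have S0 : 0 <= S by apply: Int_ge0 => x; exact: powR_ge0.
pose W e := Int (fun x => Mx (u x) (w e x) `^ (m - 2 - th) * ((w e x - u x) / h) ^+ 2).
have W0 e : 0 <= W e by apply: Int_ge0 => x; rewrite mulr_ge0 ?powR_ge0 ?sqr_ge0.
pose Q e := Int (fun x => flux (A x) g h (E e x) (u x) (w e x) *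
     ((psi m (u x) - psi m (w e x)) / h)).
have HS : S <= Int (fun x => u x * psi m (u x)).
  by apply: le_Int => // x; exact: psi_energy.
have iOm e : intg (fun x => \1_Om x + `|u x| `^ m + `|w e x| `^ m).
  by apply: intgD => //; apply: intgD.
have HO e : Int (fun x => \1_Om x + `|u x| `^ m + `|w e x| `^ m) = O + S + S.
  by rewrite IntD ?IntD ?wE//; apply: intgD.
have iOE e : intg (fun x => \1_Om x + `|E e x| `^ (2 * r)) by exact: intgD.
have arith0 (a b c k : R) : a * b * c + a * k = a * (b * c + k) by ring.
have HW e : al / 4 * W e <= Q e + ((8 * N%:R)^-1 * (O + S + S) + 9 / al * (c1 * (O + G e))).
  have -> : Q e + ((8 * N%:R)^-1 * (O + S + S) + 9 / al * (c1 * (O + G e))) =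
      Int (fun x => flux (A x) g h (E e x) (u x) (w e x) *
        ((psi m (u x) - psi m (w e x)) / h) +
        9 / al * (e1 * 2 `^ m * (\1_Om x + `|u x| `^ m + `|w e x| `^ m) +
          c1 * (\1_Om x + `|E e x| `^ (2 * r)))).
    rewrite IntD//; last by apply: intgZ; apply: intgD; exact: intgZ.
    rewrite IntZ; last by apply: intgD; exact: intgZ.
    rewrite IntD; [|exact: intgZ..].
    rewrite [in RHS]IntZ// [in RHS]IntZ// HO (IntD iO (Ei e)) -Ke1; congr (_ + _).
    exact: arith0.
  have -> : al / 4 * W e = Int (fun x => al / 4 *
      (Mx (u x) (w e x) `^ (m - 2 - th) * ((w e x - u x) / h) ^+ 2)) by rewrite IntZ.
  apply: le_Int; first exact: intgZ.
    by apply: intgD => //; apply: intgZ; apply: intgD; exact: intgZ.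
  by move=> x; rewrite -oM; apply: energy_pointwise => //; [exact: HA|exact: offE].
have HF : Int (fun x => f x * psi m (u x)) <= 4^-1 * (O + S) + c2 * F.
  have -> : 4^-1 * (O + S) + c2 * F = Int (fun x =>
      e2 * 2 `^ m * (\1_Om x + `|u x| `^ m) + c2 * `|f x| `^ m).
    rewrite IntD; [|by apply: intgZ; exact: intgD|exact: intgZ].
    by rewrite !IntZ//; [rewrite (IntD iO ui) Ke2|exact: intgD].
  apply: le_Int => //.
    by apply: intgD; [apply: intgZ; exact: intgD|exact: intgZ].
  move=> x; rewrite -oM; apply: le_trans (ler_norm _) _.
  by apply: source_pointwise => //; exact: offf.
have sumW : al / 4 * \sum_e W e <= \sum_e Q e + (4^-1 * S + K1).
  apply: (@le_trans _ _ (\sum_e (Q e + ((8 * N%:R)^-1 * (2 * S) +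
      ((8 * N%:R)^-1 * O + 9 / al * (c1 * (O + G e))))))).
    rewrite mulr_sumr; apply: ler_sum => e _; apply: le_trans (HW e) _.
    by rewrite lerD2l addrA lerD2r -mulrDr le_eqVlt; apply/orP; left; apply/eqP; congr (_ * _); ring.
  rewrite big_split lerD2l /= big_split lerD2r /= sumr_const card_ord -mulr_natl.
  by rewrite le_eqVlt; apply/orP; left; apply/eqP; field; rewrite lt0r_neq0.
have [HS2 HW2] := arith2 _ _ _ 0 S _ O K1 (c2 * F) HS sumW eqn HF
  (mulr_ge0 (divr_ge0 (ltW al0) (ler0n _ 4)) (sumr_ge0 _ (fun e _ => W0 e))) S0.
split; first exact: le_trans HS2 C1.
move=> e; have WK : W e <= 8 * K / al.
  have : al / 4 * W e <= 2 * K.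
    apply: le_trans HW2; rewrite ler_wpM2l ?divr_ge0 ?(ltW al0)//.
    by rewrite (bigD1 e)//= lerDl sumr_ge0.
  move=> H; rewrite ler_pdivlMr//.
  have -> : W e * al = 4 * (al / 4 * W e) by field.
  have -> : 8 * K = 4 * (2 * K) by ring.
  by rewrite ler_wpM2l.
have Dm : mf (fun x => `|(w e x - u x) / h| `^ q).
  apply: measurable_norm_powR; apply: (measurable_funM (g := fun=> h^-1)).
    exact: measurable_funB.
  exact: measurable_cst.
have iB : intg (fun x => Mx (u x) (w e x) `^ (m - 2 - th) * ((w e x - u x) / h) ^+ 2 +
    2 `^ m * (\1_Om x + `|u x| `^ m + `|w e x| `^ m)).
  by apply: intgD => //; exact: intgZ.
have le1 x : `|(w e x - u x) / h| `^ q <=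
    Mx (u x) (w e x) `^ (m - 2 - th) * ((w e x - u x) / h) ^+ 2 +
    2 `^ m * (\1_Om x + `|u x| `^ m + `|w e x| `^ m).
  have [xO|/negP xO] := boolP (x \in Om); last first.
    rewrite w_off; last by move=> xO'; apply: xO; rewrite inE.
    by rewrite subrr mul0r normr0 powR0 ?gt_eqF// expr0n mulr0 add0r mulr_ge0 ?addr_ge0 ?powR_ge0 ?(ltW p2)// indicE.
  rewrite -[_ ^+ 2]real_normK ?num_real//.
  apply: le_trans (gradient_powR (u x) (w e x) (normr_ge0 _) mth m0 q02 qE) _.
  by rewrite lerD2l indicE xO Mx_powR// ltW.
split.
  by apply: intg_dom iB => // x; rewrite (ger0_norm (powR_ge0 _ _)).
apply: le_trans C2.
have -> : Int (fun x => `|(w e x - u x) / h| `^ q) =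
    Int (fun x => `| `|(w e x - u x) / h| `^ q|).
  by congr Rintegral; apply/funext => x; rewrite (ger0_norm (powR_ge0 _ _)).
apply: (le_trans (Int_dom Dm _ iB)).
  by move=> x; rewrite (ger0_norm (powR_ge0 _ _)).
rewrite IntD//; last exact: intgZ.
rewrite IntZ// HO; apply: lerD => //.
by rewrite ler_wpM2l ?(ltW p2)// -addrA lerD2l; move: HS2; rewrite -/K; lra.
Qed.

End a_priori_bounds.

(** * Compactness of lattice functions *)

Section monochromatic_subsequence.
Implicit Types A : set nat.

Let unbounded A := forall n, exists2 m, (n <= m)%N & A m.

Lemma unbounded_color A (T : finType) (c : nat -> T) : unbounded A ->
  exists t, unbounded [set n | A n /\ c n = t].
Proof.
move=> uA; apply: contrapT => H.
have {}H t : exists n, forall m, (n <= m)%N -> A m -> c m <> t.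
  apply: contrapT => Ht; apply: H; exists t => n; apply: contrapT => Hn.
  by apply: Ht; exists n => m nm Am cm; apply: Hn; exists m.
have [b Hb] := choice H.
have [m bm Am] := uA (\max_t b t)%N.
by apply: (Hb (c m) m _ Am); rewrite ?(leq_trans _ bm)// leq_bigmax.
Qed.

(** Total boundedness in terms of finite colorings: nested unbounded sets, monochromatic at the
    scales [1 / (j + 1)], are chosen by the pigeonhole principle, and a diagonal sequence is
    extracted. *)
Lemma coloring_cauchy (R : realType) (d : nat -> nat -> R) :
  (forall e, 0 < e -> exists (T : finType) (c : nat -> T) n0, forall n n',
    (n0 <= n)%N -> (n0 <= n')%N -> c n = c n' -> d n n' <= e) ->
  exists s : nat -> nat, (forall n, (n <= s n)%N) /\
  forall e, 0 < e -> exists n0, forall k l, (n0 <= k)%N -> (n0 <= l)%N ->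
    d (s k) (s l) <= e.
Proof.
move=> H; have step (j : nat) (A : {A | unbounded A}) : exists B : {B | unbounded B},
    sval B `<=` sval A /\ forall n n', sval B n -> sval B n' -> d n n' <= j.+1%:R^-1.
  case: A => A uA /=; have j0 : 0 < j.+1%:R^-1 :> R by rewrite invr_gt0.
  have [T [c [n0 Hc]]] := H _ j0.
  have [t ut] := unbounded_color c uA.
  have uB : unbounded [set n | (n0 <= n)%N /\ (A n /\ c n = t)].
    move=> n; have [m nm [Am cm]] := ut (maxn n n0).
    by move: nm; rewrite geq_max => /andP[nm n0m]; exists m.
  exists (exist _ _ uB); split=> [n [_ []]//|n n' [n1 [_ cn]] [n2 [_ cn']]].
  by apply: Hc => //; rewrite cn cn'.
have /choice[F HF] j : exists F : {A | unbounded A} -> {A | unbounded A}, forall B,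
    sval (F B) `<=` sval B /\
    forall n n', sval (F B) n -> sval (F B) n' -> d n n' <= j.+1%:R^-1.
  by have [F HF] := choice (step j); exists F.
have uT : unbounded setT by move=> n; exists n.
pose fix A j := if j is i.+1 then F i (A i) else exist _ _ uT.
have Asub i j : (i <= j)%N -> sval (A j) `<=` sval (A i).
  elim: j => [|j IH]; first by rewrite leqn0 => /eqP ->.
  rewrite leq_eqVlt => /predU1P[->//|/IH ij].
  by apply: subset_trans ij; have [] := HF j (A j).
have /choice[s Hs] n : exists m, (n <= m)%N /\ sval (A n) m.
  by have [m nm Am] := svalP (A n) n; exists m.
exists s; split=> [n|e e0]; first by case: (Hs n).
have [j _ je] := near_infty_natSinv_lt (PosNum e0).
exists j.+1 => k l jk jl; apply: le_trans (ltW (je j (leqnn j))).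
by have [_] := HF j (A j); apply; [apply: (Asub _ _ jk)|apply: (Asub _ _ jl)]; apply: (Hs _).2.
Qed.

End monochromatic_subsequence.

Section compactness.
Context (R : realType) (N : nat).
Notation mu := (leb R N).
Notation mf f := (measurable_fun [set: Rn R N] (f : Rn R N -> R)).
Notation intg f := (mu.-integrable [set: Rn R N] (EFin \o (f : Rn R N -> R))).
Notation Int f := (\int[mu]_x (f : Rn R N -> R) x).
Implicit Types (h C : R) (U : 'rV[int]_N -> R) (k z : 'rV[int]_N).

Definition blk (K : nat) k : 'rV[int]_N := \row_i (k 0%R i %/ K%:Z)%Z.

(** Floor division is compatible with left-open cells because the bounds of a coarse cell are points
    of the fine lattice. *)
Lemma idx_blk h K x : 0 < h -> (0 < K)%N -> idx (h * K%:R) x = blk K (idx h x).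
Proof.
move=> h0 K0; have KR : 0 < K%:R :> R by rewrite ltr0n.
apply/(idxP _ _ (mulr_gt0 h0 KR)) => i; rewrite mxE.
have /(_ i)/andP[H1 H2] := (idxP x (idx h x) h0).1 erefl.
set k := idx h x 0 i in H1 H2 *.
have d1 := divz_eq k K%:Z; have d2 : (0 <= k %% K%:Z < K%:Z)%Z.
  by rewrite modz_ge0 ?ltz_pmod// gt_eqF// ltz_nat.
have e1 : (k %/ K%:Z)%Z * K%:Z <= k by rewrite {2}d1; lia.
have e2 : k + 1 <= ((k %/ K%:Z)%Z + 1) * K%:Z by rewrite {1}d1; lia.
have -> : h * K%:R * (k %/ K%:Z)%Z%:~R = h * ((k %/ K%:Z)%Z * K%:Z)%:~R :> R.
  by rewrite intrM /=; ring.
have -> : h * K%:R * ((k %/ K%:Z)%Z + 1)%:~R = h * (((k %/ K%:Z)%Z + 1) * K%:Z)%:~R :> R.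
  by rewrite intrM /=; ring.
apply/andP; split.
  by apply: le_lt_trans H1; rewrite ler_pM2l// ler_int.
by apply: le_trans H2 _; rewrite ler_pM2l// ler_int.
Qed.

(** [P] averages [U] over blocks of [K^N] cells. Two sites of a block differ by a shift with entries
    in [[-K, K)], so the error is at most [K^-N] times the sum of [(2K)^N] translation differences,
    each at most [N K h C] in [L^1]; this gives the constant [2^N N]. *)
Lemma block_average h (K : nat) C (I : seq 'rV[int]_N) U :
  (0 < N)%N -> 0 < h -> (0 < K)%N -> 0 <= C -> uniq I ->
  (forall k, k \notin I -> U k = 0) ->
  (forall e, Int (fun x => `|U (idx h x + dir e) - U (idx h x)|) <= h * C) ->
  exists P : 'rV[int]_N -> R,
  [/\ forall m, P m != 0 -> exists2 k, U k != 0 & blk K k = m,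
    intg (fun x => `|U (idx h x) - P (idx (h * K%:R) x)|) &
    Int (fun x => `|U (idx h x) - P (idx (h * K%:R) x)|) <=
      2 ^+ N * N%:R * (h * K%:R) * C].
Proof.
move=> N0 h0 K0 C0 uI UI hU; have KR : 0 < K%:R :> R by rewrite ltr0n.
have KZ : (K%:Z != 0)%Z by rewrite eqz_nat -lt0n.
pose r (m : 'rV[int]_N) (c : {ffun 'I_N -> 'I_K}) : 'rV[int]_N :=
  \row_i (m 0 i * K%:Z + (c i)%:Z).
pose s (c : {ffun 'I_N -> 'I_(K + K)}) : 'rV[int]_N := \row_i ((c i)%:Z - K%:Z).
pose V := (K%:R ^+ N)^-1 : R.
have V0 : 0 <= V by rewrite invr_ge0 exprn_ge0.
pose P m := V * \sum_c U (r m c).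
have cardK (k : nat) : #|{ffun 'I_N -> 'I_k}| = (k ^ N)%N.
  by rewrite card_ffun !card_ord.
have sum1 (u : R) : u = V * \sum_(c : {ffun 'I_N -> 'I_K}) u.
  rewrite sumr_const [#|_|]cardK -mulr_natl natrX mulrA mulVf ?mul1r//.
  by rewrite expf_neq0 ?lt0r_neq0.
have modK (k : int) : (0 <= k %% K%:Z < K%:Z)%Z.
  by rewrite modz_ge0 ?ltz_pmod// ltz_nat.
have blkE k c i : r (blk K k) c 0 i = k 0 i - (k 0%R i %% K%:Z)%Z + (c i)%:Z.
  rewrite !mxE.
  by rewrite {2}(divz_eq (k 0 i) K%:Z); lia.
have pw k : `|U k - P (blk K k)| <= V * \sum_c `|U (k + s c) - U k|.
  rewrite {1}(sum1 (U k)) /P -mulrBr -sumrB normrM (ger0_norm V0) ler_wpM2l//.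
  apply: le_trans (ler_norm_sum _ _ _) _.
  have pf (c : {ffun 'I_N -> 'I_K}) i :
      (`|((c i)%:Z + K%:Z - (k 0%R i %% K%:Z)%Z)%R|%N < K + K)%N.
    by have := modK (k 0 i); have := ltn_ord (c i); lia.
  (* For a given site the offsets within its block inject into one set of [(2K)^N] shifts that does
     not depend on the site. *)
  pose ph c : {ffun 'I_N -> 'I_(K + K)} := [ffun i => Ordinal (pf c i)].
  have phE c : r (blk K k) c = k + s (ph c).
    apply/rowP => i; rewrite blkE !mxE ffunE /=.
    by have := modK (k 0 i); have := ltn_ord (c i); lia.
  have ph_inj : injective ph.
    move=> c c' /ffunP cc; apply/ffunP => i; apply/val_inj.
    have := congr1 val (cc i); rewrite !ffunE /=.
    by have := modK (k 0 i); have := ltn_ord (c i); have := ltn_ord (c' i); lia.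
  rewrite (eq_bigr (fun c => `|U (k + s (ph c)) - U k|)); last first.
    by move=> c _; rewrite phE distrC.
  rewrite -(@big_imset _ _ _ _ _ ph predT (fun c => `|U (k + s c) - U k|)); last first.
    by move=> x y _ _; exact: ph_inj.
  rewrite [leRHS](bigID (mem [set ph x | x in predT]%SET))/= lerDl.
  exact: sumr_ge0.
have fE z : (fun x : 'rV[R]_N => `|U (idx h x + z) - U (idx h x)| `^ 1) =
    (fun x => `|U (idx h x + z) - U (idx h x)|).
  by apply/funext => x; rewrite powRr1.
have sh c : intg (fun x => `|U (idx h x + s c) - U (idx h x)|) /\
    Int (fun x => `|U (idx h x + s c) - U (idx h x)|) <= (N * K)%:R * (h * C).
  have [|||] := @shift_bound R N h h0 1 1 (h * C) I U N0 uI ltr01 (lexx 1) _ UI _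
    (N * K)%N (s c).
  - by move=> x y; rewrite !powRr1// mul1r ler_normD.
  - by move=> e; rewrite fE; exact: hU.
  - rewrite /l1int; apply: leq_trans (_ : \sum_(e < N) K <= _)%N.
      by apply: leq_sum => e _; rewrite mxE; have := ltn_ord (c e); lia.
    by rewrite sum_nat_const card_ord.
  by rewrite fE expr1n mulr1.
have iS : intg (fun x => V * \sum_c `|U (idx h x + s c) - U (idx h x)|).
  by apply: intgZ; apply: intg_sum => c; case: (sh c).
have mP : mf (fun x => `|U (idx h x) - P (idx (h * K%:R) x)|).
  have m1 : mf (fun x => U (idx h x)) by exact: measurable_lat.
  have m2 : mf (fun x => P (idx (h * K%:R) x)) by apply: measurable_lat; exact: mulr_gt0.
  exact: (measurableT_comp (@normr_measurable R setT) (measurable_funB m1 m2)).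
have le x : `| `|U (idx h x) - P (idx (h * K%:R) x)| | <=
    V * \sum_c `|U (idx h x + s c) - U (idx h x)|.
  by rewrite normr_id idx_blk//; exact: pw.
exists P; split.
- move=> m Pm; have [c Uc] : exists c, U (r m c) != 0.
    apply: contrapT => H; move/negP: Pm; apply; rewrite /P big1 ?mulr0// => c _.
    by apply/eqP; apply: contrapT => Uc; apply: H; exists c; apply/negP.
  exists (r m c) => //; apply/rowP => i; rewrite !mxE divzMDl// divz_small ?addr0//.
  by move: (ltn_ord (c i)); clear; lia.
- exact: intg_dom iS.
have := Int_dom mP le iS.
have -> : Int (fun x => `| `|U (idx h x) - P (idx (h * K%:R) x)| |) =
    Int (fun x => `|U (idx h x) - P (idx (h * K%:R) x)|).
  by congr Rintegral; apply/funext => x; rewrite normr_id.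
move=> H; apply: le_trans H _.
rewrite IntZ; last by apply: intg_sum => c; case: (sh c).
rewrite Int_sum; last by move=> c; case: (sh c).
apply: (@le_trans _ _ (V * \sum_(c : {ffun 'I_N -> 'I_(K + K)}) (N * K)%:R * (h * C))).
  by rewrite ler_wpM2l//; apply: ler_sum => c _; case: (sh c).
rewrite sumr_const [#|_|]cardK -[_ *+ ((K + K) ^ N)]mulr_natl addnn -mul2n natrX !natrM exprMn.
rewrite le_eqVlt; apply/orP; left; apply/eqP; rewrite /V; field.
by rewrite expf_neq0 ?lt0r_neq0.
Qed.

(** Averaged onto one coarse dyadic lattice, the fine functions become, up to [e / 4], functions on
    finitely many cells with values in a fixed interval. Rounding these values gives a finite
    coloring for which equal colors mean distance at most [e]. *)
Lemma lattice_compactness (B C : R) (I : nat -> seq 'rV[int]_N) (U : nat -> 'rV[int]_N -> R) :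
  (0 < N)%N -> 0 <= B -> 0 <= C -> (forall n, uniq (I n)) ->
  (forall n k, k \notin I n -> U n k = 0) ->
  (forall n k i, U n k != 0 -> `|(k 0 i)%:~R| <= B * 2 ^+ n) ->
  (forall n, Int (fun x => `|U n (idx (2 ^- n) x)|) <= C) ->
  (forall n e, Int (fun x => `|U n (idx (2 ^- n) x + dir e) - U n (idx (2 ^- n) x)|) <=
    2 ^- n * C) ->
  exists (s : nat -> nat) (u : 'rV[R]_N -> R), [/\ mf u, forall n, (n <= s n)%N &
    {ae mu, forall x, U (s n) (idx (2 ^- s n) x) @[n --> \oo] --> u x}].
Proof.
move=> N0 B0 C0 uI UI UB UC UD.
have hn n : 0 < 2 ^- n :> R by rewrite invr_gt0 exprn_gt0.
pose u n (x : 'rV[R]_N) := U n (idx (2 ^- n) x).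
have ui n : intg (u n) by case: (@intg_lat R N _ (hn n) (I n) (U n) N0 (uI n) (UI n)).
pose C1 := 2 ^+ N * N%:R * C.
have C10 : 0 <= C1 by rewrite !mulr_ge0 ?exprn_ge0.
suff [s [sn Hs]] : exists s : nat -> nat, (forall n, (n <= s n)%N) /\
    forall e, 0 < e -> exists n0, forall k l : nat, (n0 <= k)%N -> (n0 <= l)%N ->
    Int (fun x => `|u (s k) x - u (s l) x|) <= e.
  have pE (k l : nat) : (fun x => `|u (s k) x - u (s l) x| `^ 1) =
      (fun x => `|u (s k) x - u (s l) x|) by apply/funext => x; rewrite powRr1.
  have [|||s' [v [vm s'n sv _]]] := @Lp_complete _ (Rn R N) R mu 1 (fun k : nat => u (s k)) ltr01.
  - by move=> k; exact: intg_mf (ui _).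
  - by move=> k l; rewrite pE; apply: intg_norm; exact: intgB.
  - by move=> e /Hs[n0 Hn]; exists n0 => k l *; rewrite pE; exact: Hn.
  by exists (s \o s'), v; split=> // n; exact: leq_trans (s'n n) (sn _).
apply: (@coloring_cauchy R (fun a b => Int (fun x => `|u a x - u b x|))) => e e0.
have arith (a b c : R) : a <= e / 4 -> b <= e / 4 -> c <= e / 2 -> a + b + c <= e.
  by move=> *; lra.
(* The coarse mesh [2^-k] for which averaging costs at most [e / 4]. *)
have [k Hk] : exists k : nat, 2 ^- k * C1 <= e / 4.
  have d0 : 0 < e / 4 / (C1 + 1) by rewrite !divr_gt0// ltr_wpDl.
  have [k _ /(_ k (leqnn k))] := near_infty_natSinv_expn_lt (PosNum d0).
  rewrite /= ltr_pdivlMr ?ltr_wpDl// => Hk; exists k.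
  apply: le_trans (ltW Hk); apply: ler_pM => //; [by rewrite div1r|by rewrite lerDl].
pose hk : R := 2 ^- k.
have HP n : exists P : 'rV[int]_N -> R, (k <= n)%N ->
    [/\ forall m i, P m != 0 -> `|(m 0 i)%:~R| <= B * 2 ^+ k + 1,
     intg (fun x => `|u n x - P (idx hk x)|) &
     Int (fun x => `|u n x - P (idx hk x)|) <= e / 4].
  have [kn|] := leqP k n; last by exists (fun=> 0).
  have K0 : (0 < 2 ^ (n - k))%N by rewrite expn_gt0.
  have KR : 0 < (2 ^ (n - k))%:R :> R by rewrite ltr0n.
  have hE : 2 ^- n * (2 ^ (n - k))%:R = hk :> R.
    have p0 j : 2 ^+ j != 0 :> R by rewrite expf_neq0.
    by rewrite natrX /hk -{1}(subnK kn) exprD; field; rewrite !p0.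
  have [P [H1 H2 H3]] := block_average N0 (hn n) K0 C0 (uI n) (UI n) (UD n).
  exists P => _; rewrite -hE; split=> //; last first.
    by apply: le_trans H3 _; rewrite hE mulrAC mulrC.
  move=> m i /H1[l /UB Ul <-]; rewrite mxE.
  have := Ul i; rewrite -{1}(subnK kn) exprD -natrX => {}Ul.
  have d1 := divz_eq (l 0 i) (2 ^ (n - k))%:Z.
  have d2 : (0 <= l 0%R i %% (2 ^ (n - k))%:Z < (2 ^ (n - k))%:Z)%Z.
    by rewrite modz_ge0 ?ltz_pmod// gt_eqF// ltz_nat.
  set K := (2 ^ (n - k))%N in K0 KR d1 d2 Ul *.
  have d3 : `|(l 0%R i %/ K%:Z)%Z| * K%:Z <= `|l 0 i| + K%:Z.
    rewrite -{2}(ger0_norm (_ : 0 <= K%:Z))// -normrM.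
    have -> : (l 0%R i %/ K%:Z)%Z * K%:Z = l 0 i - (l 0%R i %% K%:Z)%Z by rewrite {2}d1 addrK.
    by have /andP[d20 d21] := d2; apply: le_trans (ler_normB _ _) _; rewrite lerD2l ger0_norm// ltW.
  have {}d3 : `|(l 0%R i %/ K%:Z)%Z%:~R| * K%:R <= `|(l 0 i)%:~R| + K%:R :> R.
    by rewrite -!intr_norm -[K%:R]/(K%:Z%:~R) -intrM -intrD ler_int.
  rewrite -(ler_pM2r KR) mulrDl mul1r; apply: le_trans d3 _; rewrite lerD2r.
  by apply: le_trans Ul _; rewrite mulrA mulrAC.
have [P {}HP] := choice HP.
pose M := (Num.truncn (B * 2 ^+ k + 1)).+1.
have MB : B * 2 ^+ k + 1 <= M%:R.
  by rewrite ltW// /M; have /andP[] := truncn_itv (addr_ge0 (mulr_ge0 B0 (exprn_ge0 k (ler0n R 2))) ler01).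
pose z (c : {ffun 'I_N -> 'I_(M + M).+1}) : 'rV[int]_N := \row_i ((c i)%:Z - M%:Z).
pose J := undup [seq z c | c <- enum {ffun 'I_N -> 'I_(M + M).+1}].
have uJ : uniq J by exact: undup_uniq.
have PJ n : (k <= n)%N -> forall m, m \notin J -> P n m = 0.
  move=> /HP[H1 _ _] m mJ; apply/eqP; apply: contraNT mJ => /H1 {}H1.
  rewrite mem_undup; apply/mapP.
  have mM i : `|m 0 i| <= M%:Z.
    by rewrite -(ler_int R) intr_norm; apply: le_trans (H1 i) MB.
  exists [ffun i => inord `|(m 0 i + M%:Z)%R|%N]; first by rewrite mem_enum.
  apply/rowP => i; rewrite mxE ffunE inordK; move: (mM i); clear; lia.
have hkN : 0 < hk ^+ N by rewrite exprn_gt0// /hk.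
(* A value on one coarse cell is at most the [L^1] norm of the averaged function divided by the
   volume of the cell. *)
pose V := (C + e / 4) / hk ^+ N.
have PV n m : (k <= n)%N -> `|P n m| <= V.
  move=> kn; have [mJ|mJ] := boolP (m \in J); last first.
    by rewrite (PJ n kn)// normr0 divr_ge0 ?(ltW hkN)// addr_ge0// ltW// divr_gt0.
  have [_ H2 H3] := HP n kn.
  have [a1 a2] := @intg_lat R N hk (hn k) J (fun m => `|P n m|) N0 uJ
    (fun m mJ => eq_trans (congr1 Num.norm (PJ n kn m mJ)) (normr0 _)).
  rewrite /V ler_pdivlMr// mulrC; apply: (@le_trans _ _ (Int (fun x => `|P n (idx hk x)|))).
    rewrite a2 ler_pM2l// (bigD1_seq m)//= lerDl sumr_ge0//.
  apply: (@le_trans _ _ (Int (fun x => `|u n x| + `|u n x - P n (idx hk x)|))).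
    apply: le_Int => //; first by apply: intgD => //; exact: intg_norm.
    move=> x; rewrite distrC -[X in `|X| <= _](subrK (u n x)) addrC.
    exact: ler_normD.
  by rewrite IntD//; [exact: lerD (UC n) H3|exact: intg_norm].
have V0 : 0 < V by rewrite divr_gt0// ltr_wpDl// divr_gt0.
(* The rounding step for which all coarse cells together contribute at most [e / 2]. *)
pose dl := e / 2 / (hk ^+ N * (size J).+1%:R).
have dl0 : 0 < dl by rewrite !divr_gt0// mulr_gt0.
pose q n m := Num.truncn ((P n m + V) / dl).
pose Q := Num.truncn ((V + V) / dl).
exists {ffun {ffun 'I_N -> 'I_(M + M).+1} -> 'I_Q.+1},
  (fun n => [ffun c => inord (q n (z c))]), k => n n' kn kn' /ffunP cc.
have qP l m : (k <= l)%N -> [/\ (q l m <= Q)%N, (q l m)%:R * dl <= P l m + V &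
    P l m + V < (q l m).+1%:R * dl].
  move=> kl; have /ler_normlP[p1 p2] := PV l m kl.
  have pos : 0 <= (P l m + V) / dl by rewrite divr_ge0 ?(ltW dl0)// -lerBlDr sub0r lerNl.
  have /andP[t1 t2] := truncn_itv pos.
  split; [|by rewrite -ler_pdivlMr|by rewrite -ltr_pdivrMr].
  by apply: le_truncn; rewrite ler_pM2r ?invr_gt0// lerD2r.
have same m : m \in J -> `|P n m - P n' m| <= dl.
  rewrite mem_undup => /mapP[c _ ->]; have [n1 n2 n3] := qP n (z c) kn.
  have [n1' n2' n3'] := qP n' (z c) kn'.
  have := congr1 val (cc c); rewrite !ffunE /= !inordK ?ltnS// => qq.
  move: n2' n3' n2 n3; rewrite qq; move: (q n' _) => j; rewrite -natr1 mulrDl mul1r.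
  move: (P n _) (P n' _) (j%:R * dl) => a b y H1 H2 H3 H4.
  by rewrite ler_distl; apply/andP; split; lra.
have [_ i1 I1] := HP n kn; have [_ i2 I2] := HP n' kn'.
have [i3 I3] := @intg_lat R N hk (hn k) J (fun m => `|P n m - P n' m|) N0 uJ
  (fun m mJ => eq_trans (congr1 Num.norm (congr2 (fun a b => a - b) (PJ n kn m mJ) (PJ n' kn' m mJ)))
   (eq_trans (congr1 Num.norm (subrr 0)) (normr0 _))).
apply: (@le_trans _ _ (Int (fun x => `|u n x - P n (idx hk x)| +
    `|u n' x - P n' (idx hk x)| + `|P n (idx hk x) - P n' (idx hk x)|))).
  apply: le_Int; first by apply: intg_norm; exact: intgB.
    by apply: intgD => //; exact: intgD.
  move=> x; rewrite [`|u n' x - _|]distrC.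
  have -> : u n x - u n' x = (u n x - P n (idx hk x)) + (P n' (idx hk x) - u n' x) +
    (P n (idx hk x) - P n' (idx hk x)) by ring.
  apply: le_trans (ler_normD _ _) _; rewrite lerD2r; exact: ler_normD.
rewrite IntD//; last exact: intgD.
rewrite IntD// I3.
apply: (arith _ _ _ I1 I2).
apply: (@le_trans _ _ (hk ^+ N * ((size J).+1%:R * dl))); last first.
  by rewrite /dl le_eqVlt; apply/orP; left; apply/eqP; field; rewrite !lt0r_neq0.
  rewrite ler_pM2l//; apply: (@le_trans _ _ (\sum_(m <- J) dl)).
    by rewrite big_seq [leRHS]big_seq; apply: ler_sum => m /same.
  by rewrite big_const_seq count_predT iter_addr_0 -[dl *+ _]mulr_natl ler_pM2r// ler_nat.
Qed.

End compactness.

(** * Smooth functions *)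

Section one_dimensional_smooth_functions.
Context (R : realType).
Implicit Types (f g : R -> R) (t a b : R).

Fixpoint dn n f : Prop := if n is n'.+1 then
  exists2 f', (forall t, is_derive t 1 f (f' t)) & dn n' f' else True.

Lemma dnW n f : dn n.+1 f -> dn n f.
Proof.
elim: n f => [//|n IH] f [f' Hf' /IH f'n].
by exists f'.
Qed.

Lemma dn_cst n c : dn n (fun=> c).
Proof.
elim: n c => [//|n IH] c; exists (fun=> 0); last exact: IH.
by move=> t; exact: is_derive_cst.
Qed.

Lemma dnD n f g : dn n f -> dn n g -> dn n (fun t => f t + g t).
Proof.
elim: n f g => [//|n IH] f g [f' Hf f'n] [g' Hg g'n].
exists (fun t => f' t + g' t); last exact: IH.
by move=> t; apply: is_deriveD.
Qed.

Lemma dnM n f g : dn n f -> dn n g -> dn n (fun t => f t * g t).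
Proof.
elim: n f g => [//|n IH] f g fn gn; have fn' := dnW fn; have gn' := dnW gn.
case: fn gn => [f' Hf f'n] [g' Hg g'n].
exists (fun t => f t * g' t + g t * f' t); last by apply: dnD; exact: IH.
by move=> t; apply: is_deriveM.
Qed.

Lemma dnZ n c f : dn n f -> dn n (fun t => c * f t).
Proof. by apply: dnM; exact: dn_cst. Qed.

Lemma dnV n f : (forall t, f t != 0) -> dn n f -> dn n (fun t => (f t)^-1).
Proof.
move=> f0; elim: n f f0 => [//|n IH] f f0 fn; have fn' := dnW fn.
case: fn => [f' Hf f'n]; have Vn := IH f f0 fn'.
exists (fun t => -1 * ((f t)^-1 * (f t)^-1) * f' t).
  move=> t; apply: is_derive_eq (is_deriveV (f0 t) (Hf t)) _.
  by rewrite /GRing.scale /= expr2 mulN1r invfM.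
by apply: dnM => //; apply: dnZ; exact: dnM.
Qed.

Lemma is_derive_affine f a b t df : is_derive (a * t + b) 1 f df ->
  is_derive t 1 (fun t => f (a * t + b)) (df * a).
Proof.
move=> Hf; apply: (@is_derive1_comp _ f (fun t => a * t + b)) => //.
have := @is_deriveD _ _ _ (fun t => a * t) (fun=> b) t 1 (a * 1 + t * 0) 0
  (is_deriveM (is_derive_cst a t 1) (is_derive_id t 1)) (is_derive_cst b t 1).
by rewrite mulr1 mulr0 !addr0.
Qed.

Lemma dn_affine n f a b : dn n f -> dn n (fun t => f (a * t + b)).
Proof.
elim: n f => [//|n IH] f [f' Hf f'n]; exists (fun t => a * f' (a * t + b)).
  by move=> t; rewrite mulrC; apply: is_derive_affine.
by apply: dnZ; exact: IH.
Qed.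

Lemma dn_continuous f : dn 1 f -> continuous f.
Proof.
move=> [f' Hf _] t; apply: differentiable_continuous.
by apply/derivable1_diffP; case: (Hf t).
Qed.

(* [t^(-k) exp(-1/t)] for [t > 0]; the derivative is [flat k.+2 - k flat k.+1]. *)
Definition flat (k : nat) t := if 0 < t then t^-1 ^+ k * expR (- t^-1) else 0.

(** With [y = 1 / t], the bound [exp y >= y^(k+2) / (k+2)!] beats the factor [y^k] and leaves
    [y^-2]. The quadratic decay makes the derivative at 0 vanish. *)
Lemma flat_le k t : `|flat k t| <= (k.+2)`!%:R * t ^+ 2.
Proof.
rewrite /flat; case: ltP => t0; last by rewrite normr0 mulr_ge0 ?sqr_ge0.
have y0 : 0 < t^-1 by rewrite invr_gt0.
rewrite ger0_norm ?mulr_ge0 ?exprn_ge0 ?expR_ge0 ?(ltW y0)//.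
rewrite expRN -[t in leRHS]invrK; move: (t^-1) y0 => y y0.
rewrite ler_pdivrMr ?expR_gt0// exprVn -mulrA [y ^- 2 * _]mulrC mulrA ler_pdivlMr ?exprn_gt0//.
rewrite -exprD addn2 mulrC -ler_pdivrMr ?ltr0n ?fact_gt0//.
by apply: le_trans (expR_ge1Dxn k.+1 (ltW y0)); rewrite lerDr.
Qed.

Lemma is_derive_quadratic f C : f 0 = 0 -> (forall t, `|f t| <= C * t ^+ 2) ->
  is_derive (0 : R) (1 : R) f 0.
Proof.
move=> f0 fC; have H : (fun h : R => h^-1 *: ((f \o shift 0) (h *: 1) - f 0)) @ 0^' --> 0.
  apply/cvgr0Pnorm_le => e e0.
  have d0 : 0 < e / (`|C| + 1) by rewrite divr_gt0// ltr_wpDl.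
  near=> h; have h0 : h != 0 by near: h; exact: nbhs_dnbhs_neq.
  rewrite /= f0 subr0 addr0 /GRing.scale /= mulr1 normrM normfV.
  rewrite ler_pdivrMl ?normr_gt0//; apply: le_trans (fC h) _.
  have hd : `|h| <= e / (`|C| + 1).
    by near: h; exact: dnbhs0_le.
  rewrite -real_normK ?num_real// expr2 mulrCA ler_wpM2l//.
  apply: (@le_trans _ _ ((`|C| + 1) * `|h|)).
    by rewrite ler_wpM2r// (le_trans (ler_norm C))// lerDl.
  by rewrite mulrC -ler_pdivlMr// ltr_wpDl.
by apply: DeriveDef; [apply/cvg_ex; exists 0|exact: cvg_lim H].
Unshelve. all: by end_near. Qed.

Lemma is_derive_flat k t : is_derive t 1 (flat k) (flat k.+2 t - k%:R * flat k.+1 t).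
Proof.
have [t0|t0|t0] := ltgtP t 0.
- rewrite /flat ltNge (ltW t0)/= mulr0 subr0.
  apply: near_eq_is_derive (is_derive_cst 0 t 1).
  near=> s; rewrite /flat ltNge ifF//; apply/negbTE; rewrite negbK ltW//.
  by near: s; exact: lt_nbhsl.
- pose F s : R := s^-1 ^+ k * expR (- s^-1).
  apply: (@near_eq_is_derive _ _ _ F).
    near=> s; rewrite /flat ifT//.
    by near: s; exact: lt_nbhsr.
  have tn0 : t != 0 by rewrite gt_eqF.
  have H1 := is_deriveV tn0 (is_derive_id t 1).
  have H2 : is_derive t 1 (fun s : R => s^-1 ^+ k) ((k%:R * t^-1 ^+ k.-1) *: (- t ^- 2 *: 1)).
    have -> : (fun s : R => s^-1 ^+ k) = (fun s : R => s^-1) ^+ k.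
      by apply/funext => s; rewrite exprfctE.
    exact: is_deriveX.
  have H3 : is_derive t 1 (fun s : R => expR (- s^-1)) (expR (- t^-1) * (- (- t ^- 2 *: 1))).
    exact: (@is_derive1_comp R expR (fun s => - s^-1) t _ _ (is_derive_expR _) (is_deriveN H1)).
  apply: is_derive_eq (is_deriveM H2 H3) _.
  rewrite /flat t0 /GRing.scale /=; case: k {F H2} => [|k] /=.
    by rewrite !mul0r !mulr0 addr0 subr0 !expr0 mul1r mulr1 opprK exprVn mulrC.
  by rewrite !exprS; field.
- rewrite t0 /flat ltxx mulr0 subr0; apply: is_derive_quadratic (flat_le k).
  by rewrite /flat ltxx.
Unshelve. all: by end_near. Qed.

Lemma dn_flat n k : dn n (flat k).
Proof.
elim: n k => [//|n IH] k; exists (fun t => flat k.+2 t + - k%:R * flat k.+1 t).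
  by move=> t; rewrite mulNr; exact: is_derive_flat.
by apply: dnD => //; exact: dnZ.
Qed.

(** The classical transition function from 0 to 1; the denominator is positive because [t] and
    [1 - t] are never both nonpositive. *)
Definition smooth_step t := flat 0 t / (flat 0 t + flat 0 (1 - t)).

Let flat_ge0 t : 0 <= flat 0 t.
Proof. by rewrite /flat; case: ltP => // _; rewrite mulr_ge0 ?expR_ge0. Qed.

Let flat_gt0 t : 0 < t -> 0 < flat 0 t.
Proof. by move=> t0; rewrite /flat t0 mulr_gt0 ?expR_gt0. Qed.

Let den_gt0 t : 0 < flat 0 t + flat 0 (1 - t).
Proof.
have [t0|t0] := leP t 0; first by rewrite ltr_wpDl// flat_gt0//; lra.
by rewrite ltr_pwDl// flat_gt0.
Qed.

Lemma dn_smooth_step n : dn n smooth_step.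
Proof.
apply: dnM; first exact: dn_flat.
apply: dnV; first by move=> t; exact: lt0r_neq0.
apply: dnD; first exact: dn_flat.
have := dn_affine (-1) 1 (dn_flat n 0).
by under eq_fun do rewrite mulN1r addrC.
Qed.

Lemma smooth_step0 t : t <= 0 -> smooth_step t = 0.
Proof. by move=> t0; rewrite /smooth_step {1}/flat ltNge t0 mul0r. Qed.

Lemma smooth_step1 t : 1 <= t -> smooth_step t = 1.
Proof.
move=> t1; rewrite /smooth_step [flat 0 (1 - t)]/flat ifF; last first.
  by apply/negbTE; rewrite -leNgt; move: t1; lra.
by rewrite addr0 divff// lt0r_neq0// flat_gt0//; move: t1; lra.
Qed.

Lemma smooth_step01 t : 0 <= smooth_step t <= 1.
Proof.
by rewrite divr_ge0 ?(ltW (den_gt0 t))//= ler_pdivrMr// mul1r lerDl.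
Qed.

End one_dimensional_smooth_functions.

Section smooth_functions.
Context (R : realType) (N : nat).
Implicit Types (f g : 'rV[R]_N -> R) (i : 'I_N) (x : 'rV[R]_N).
Notation bas i := (delta_mx 0 i : 'rV[R]_N).

(* The partial derivatives are quantified existentially so that closure under
   sums and products is a direct induction. *)
Fixpoint Dn n f : Prop := if n is n'.+1 then
  continuous f /\ forall i, exists2 f', (forall x, is_derive x (bas i) f (f' x)) & Dn n' f'
  else True.

Lemma DnW n f : Dn n.+1 f -> Dn n f.
Proof.
elim: n f => [//|n IH] f [fc Hf]; split=> // i.
by have [f' H1 H2] := Hf i; exists f' => //; exact: IH.
Qed.

Lemma Dn_cst n c : Dn n (fun=> c).
Proof.
elim: n c => [//|n IH] c; split=> [|i]; first exact: cst_continuous.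
by exists (fun=> 0); [move=> x; exact: is_derive_cst|exact: IH].
Qed.

Lemma DnD n f g : Dn n f -> Dn n g -> Dn n (fun x => f x + g x).
Proof.
elim: n f g => [//|n IH] f g [fc Hf] [gc Hg]; split=> [x|i].
  exact: (cvgD (fc x) (gc x)).
have [f' f1 f2] := Hf i; have [g' g1 g2] := Hg i.
exists (fun x => f' x + g' x); last exact: IH.
by move=> x; apply: is_deriveD.
Qed.

Lemma DnM n f g : Dn n f -> Dn n g -> Dn n (fun x => f x * g x).
Proof.
elim: n f g => [//|n IH] f g fn gn; have fn' := DnW fn; have gn' := DnW gn.
case: fn gn => [fc Hf] [gc Hg]; split=> [x|i].
  exact: (cvgM (fc x) (gc x)).
have [f' f1 f2] := Hf i; have [g' g1 g2] := Hg i.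
exists (fun x => f x * g' x + g x * f' x); last by apply: DnD; exact: IH.
by move=> x; apply: is_deriveM.
Qed.

Lemma is_derive_coord (g : R -> R) j i x dg : is_derive (x 0 j) 1 g dg ->
  is_derive x (bas i) (fun x => g (x 0 j)) (if i == j then dg else 0).
Proof.
case: eqP => [->|/eqP ij] Hg.
  have E : (fun h : R => h^-1 *: (((fun x => g (x 0 j)) \o shift x) (h *: bas j) - g (x 0 j))) =
      (fun h : R => h^-1 *: ((g \o shift (x 0 j)) (h *: 1) - g (x 0 j))).
    by apply/funext => h; rewrite /= !mxE !eqxx.
  by case: Hg => [g1 g2]; apply: DeriveDef; rewrite ?/derivable ?/derive E.
have E : (fun h : R => h^-1 *: (((fun x => g (x 0 j)) \o shift x) (h *: bas i) - g (x 0 j))) =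
      (fun=> 0).
  apply/funext => h; rewrite /= !mxE [j == i]eq_sym (negbTE ij) mulr0 add0r.
  by rewrite subrr scaler0.
apply: DeriveDef; rewrite ?/derivable ?/derive E; first exact: is_cvg_cst.
exact: lim_cst.
Qed.

Lemma Dn_coord (g : R -> R) n j : (forall k, dn k g) -> Dn n (fun x => g (x 0 j)).
Proof.
elim: n g => [//|n IH] g Hg; split=> [x|i].
  apply: (@continuous_comp _ _ _ (fun x => x 0 j) g); first exact: coord_continuous.
  by apply: dn_continuous; exact: Hg.
have [g' g1 _] := Hg 1%N.
have Hg' k : dn k g'.
  have [g'' g1' g2'] := Hg k.+1; rewrite (_ : g' = g'')//; apply/funext => t.
  by have [_ <-] := g1 t; have [_ <-] := g1' t.
exists (fun x => (if i == j then 1 else 0) * g' (x 0 j)); last first.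
  by apply: DnM; [exact: Dn_cst|exact: IH].
move=> x; apply: is_derive_eq (is_derive_coord i (g1 _)) _.
by case: ifP; rewrite ?mul1r ?mul0r.
Qed.

Lemma Dn_sum n (J : Type) (s : seq J) (F : J -> 'rV[R]_N -> R) :
  (forall j, Dn n (F j)) -> Dn n (fun x => \sum_(j <- s) F j x).
Proof.
move=> FD; elim: s => [|j s IH].
  by under eq_fun do rewrite big_nil; exact: Dn_cst.
by under eq_fun do rewrite big_cons; exact: DnD.
Qed.

Lemma Dn_prod n (J : Type) (s : seq J) (F : J -> 'rV[R]_N -> R) :
  (forall j, Dn n (F j)) -> Dn n (fun x => \prod_(j <- s) F j x).
Proof.
move=> FD; elim: s => [|j s IH].
  by under eq_fun do rewrite big_nil; exact: Dn_cst.
by under eq_fun do rewrite big_cons; exact: DnM.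
Qed.

Lemma smooth_Dn f : (forall n, Dn n f) -> smooth f.
Proof.
move=> fD s; have sD n : Dn n (foldr (@partial_deriv R N) f s).
  elim: s n => [//|i s IH] n; have [_ /(_ i)[f' H1 H2]] := IH n.+1.
  rewrite (_ : foldr _ _ _ = f')//; apply/funext => x.
  by rewrite /= /partial_deriv; have [_ ->] := H1 x.
split; first by have [] := sD 1%N.
by move=> i x; have [_ /(_ i)[f' H1 _]] := sD 1%N; case: (H1 x).
Qed.

End smooth_functions.

(** * Integration by parts and difference quotients *)

Section compactly_supported.
Context (R : realType) (N : nat).
Notation mu := (leb R N).
Notation mf f := (measurable_fun [set: Rn R N] (f : Rn R N -> R)).
Notation intg f := (mu.-integrable [set: Rn R N] (EFin \o (f : Rn R N -> R))).
Notation Int f := (\int[mu]_x (f : Rn R N -> R) x).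
Implicit Types (f g : 'rV[R]_N -> R) (i : 'I_N) (x : 'rV[R]_N).
Notation bas i := (delta_mx 0 i : 'rV[R]_N).

(** The regularity that integration by parts uses, with the support in a ball of radius [M] instead
    of in [Om], so that tests on [Om] and on the whole space are treated alike. *)
Definition C1c M f := [/\ continuous f, forall i x, derivable f x (bas i),
  forall i, continuous (partial_deriv i f) & forall x, M < `|x| -> f x = 0].

Lemma test_C1c Om f : test_function Om f -> exists M, C1c M f.
Proof.
move=> [fs /compact_bounded[M [_ MB]] _]; exists (M + 1); split.
- by have [] := fs [::].
- by move=> i x; have [_] := fs [::].
- by move=> i; have [] := fs [:: i].
- move=> x Mx; apply/eqP; apply: contrapT => /negP fx.
  have M1 : M < M + 1 by rewrite ltrDl.
  have H := MB _ M1 x.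
  suff : `|x| <= M + 1 by rewrite leNgt Mx.
  exact/H/subset_closure.
Qed.

Lemma C1cM M f g : C1c M f -> C1c M g -> C1c M (fun x => f x * g x).
Proof.
move=> [f1 f2 f3 f4] [g1 g2 g3 g4]; split.
- by move=> x; exact: (cvgM (f1 x) (g1 x)).
- by move=> i x; apply: (@derivableM _ _ f g).
- move=> i; have -> : partial_deriv i (fun x => f x * g x) =
      (fun x => f x * partial_deriv i g x + g x * partial_deriv i f x).
    by apply/funext => x; rewrite /partial_deriv (@deriveM _ _ f g).
  by move=> x; exact: (cvgD (cvgM (f1 x) (g3 i x)) (cvgM (g1 x) (f3 i x))).
- by move=> x /f4 ->; rewrite mul0r.
Qed.

Lemma C1cW M M' f : M <= M' -> C1c M f -> C1c M' f.
Proof. by move=> MM [? ? ? H]; split=> // x /(le_lt_trans MM)/H. Qed.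

Lemma C1c_partial0 M f i x : C1c M f -> M < `|x| -> partial_deriv i f x = 0.
Proof.
move=> [_ _ _ f0] Mx; rewrite /partial_deriv (@near_eq_derive _ _ _ _ (fun=> 0)) ?derive_cst//.
near=> y; apply: f0; near: y.
by apply: (@cvgr_gt _ _ _ _ (fun y : 'rV[R]_N => `|y|) `|x|) => //; exact: norm_continuous.
Unshelve. all: by end_near. Qed.

Lemma bounded_continuous_ball M f : continuous f -> (forall x, M < `|x| -> f x = 0) ->
  exists2 C, 0 <= C & forall x, `|f x| <= C.
Proof.
move=> fc f0; pose B := [set x : 'rV[R]_N | `|x| <= M].
have cB : compact B.
  apply: bounded_closed_compact.
    by exists M; split=> [|y My x /= xM]; rewrite ?num_real// (le_trans xM)// ltW.
  rewrite (_ : B = (fun x : 'rV[R]_N => `|x|) @^-1` [set t | t <= M])//.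
  by apply: closed_comp; [move=> x _; exact: norm_continuous|exact: closed_le].
have /compact_bounded[C [_ CB]] : compact (f @` B).
  by apply: continuous_compact => //; exact: continuous_subspaceT.
exists (`|C| + 1) => [|x]; first by rewrite addr_ge0.
have [xM|xM] := leP `|x| M; last by rewrite f0// normr0 addr_ge0.
apply: (CB (`|C| + 1)); last by exists x.
by rewrite ltr_pwDr// ler_norm.
Qed.

Lemma is_derive_line f i x t : derivable f (x + t *: bas i) (bas i) ->
  is_derive t 1 (fun t => f (x + t *: bas i)) (partial_deriv i f (x + t *: bas i)).
Proof.
move=> fd; have E : (fun h : R => h^-1 *: (((fun t => f (x + t *: bas i)) \o shift t) (h *: 1)
    - f (x + t *: bas i))) =
    (fun h => h^-1 *: ((f \o shift (x + t *: bas i)) (h *: bas i) - f (x + t *: bas i))).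
  apply/funext => h /=; congr (_ *: (f _ - _)).
  by rewrite (_ : h *: 1 = h) ?scalerDl 1?addrCA//; exact: mulr1.
by apply: DeriveDef; rewrite ?/derivable ?/derive E.
Qed.

Lemma C1c_lipschitz M f : C1c M f -> exists2 C, 0 <= C & forall x i t,
  [/\ `|f x| <= C, `|partial_deriv i f x| <= C & `|f (x + t *: bas i) - f x| <= C * `|t|].
Proof.
move=> fM; have [fc fd fp f0] := fM.
have [C0 C00 HC0] := bounded_continuous_ball fc f0.
have /choice[C HC] i : exists C, 0 <= C /\ forall x, `|partial_deriv i f x| <= C.
  have [C ? ?] := bounded_continuous_ball (fp i) (fun x => C1c_partial0 i fM).
  by exists C.
pose K := C0 + \sum_i C i.
have CK i : C i <= K.
  by rewrite /K (bigD1 i)//= addrCA lerDl addr_ge0// sumr_ge0// => j _; case: (HC j).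
have K0 : C0 <= K by rewrite lerDl sumr_ge0// => j _; case: (HC j).
exists K => [|x i t]; first exact: le_trans K0.
split; [exact: le_trans (HC0 x) K0|by apply: le_trans (CK i); case: (HC i)|].
have lip a b : a <= b -> `|f (x + b *: bas i) - f (x + a *: bas i)| <= K * (b - a).
  move=> ab; have [||c _ ->] := @MVT_segment R (fun t => f (x + t *: bas i))
    (fun t => partial_deriv i f (x + t *: bas i)) a b ab.
  - by move=> s _; exact: is_derive_line.
  - apply: continuous_subspaceT => s; apply: differentiable_continuous.
    by apply/derivable1_diffP; case: (@is_derive_line f i x s (fd i _)).
  rewrite normrM (ger0_norm (_ : 0 <= b - a)) ?subr_ge0//.
  by rewrite ler_wpM2r ?subr_ge0//; apply: le_trans (CK i); case: (HC i).
have [t0|t0] := leP 0 t.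
  by have := lip 0 t t0; rewrite scale0r addr0 subr0 (ger0_norm t0).
by have := lip t 0 (ltW t0); rewrite scale0r addr0 sub0r distrC (ltr0_norm t0).
Qed.

Lemma cvg_difference_quotient f i x (t : nat -> R) : derivable f x (bas i) ->
  (forall n, t n != 0) -> t n @[n --> \oo] --> 0 ->
  (f (x + t n *: bas i) - f x) / t n @[n --> \oo] --> partial_deriv i f x.
Proof.
move=> fd t0 tc; have td : t n @[n --> \oo] --> 0^'.
  move=> A HA; have H : \forall n \near \oo, t n != 0 -> A (t n) := tc _ HA.
  suff : \forall n \near \oo, A (t n) by [].
  by near=> n; move: (t0 n); near: n; exact: H.
have -> : (fun n => (f (x + t n *: bas i) - f x) / t n) =
    (fun h : R => h^-1 *: ((f \o shift x) (h *: bas i) - f x)) \o t.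
  by apply/funext => n; rewrite /= [t n *: _ + x]addrC mulrC.
exact: cvg_comp td fd.
Unshelve. all: by end_near. Qed.

Definition cball M : set (Rn R N) := [set x | `|x : 'rV[R]_N| <= M].

Lemma intg_cball M : intg (\1_(cball M) : Rn R N -> R).
Proof.
apply: intg_indic.
  have nm : mf (fun x => `|x|) by apply: continuous_measurable_Rn; exact: norm_continuous.
  have := nm measurableT _ (measurable_itv `]-oo, M]); rewrite setTI.
  by congr measurable; apply/seteqP; split=> x /=; rewrite in_itv.
apply: leb_bounded; exists M; split=> [|y My x /= xM]; first exact: num_real.
by rewrite (le_trans xM)// ltW.
Qed.

Lemma le_cball M C (a : R) x : `|a| <= C -> (M < `|x| -> a = 0) -> `|a| <= C * \1_(cball M) x.
Proof.
move=> aC a0; rewrite indicE; have [xB|/negP xB] := boolP (x \in _); first by rewrite mulr1.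
rewrite a0 ?normr0 ?mulr0// ltNge; apply/negP => xM.
by apply: xB; rewrite inE.
Qed.

Lemma intg_bounded_ball M f C : mf f -> (forall x, `|f x| <= C) ->
  (forall x, M < `|x| -> f x = 0) -> intg f.
Proof.
move=> fm fC f0.
apply: (@intg_dom _ (Rn R N) R mu _ (fun x : Rn R N => C * \1_(cball M) x)) => //.
  by move=> x; apply: le_cball => //; exact: f0.
by apply: intgZ; exact: intg_cball.
Qed.

Lemma C1c_measurable M f : C1c M f -> mf f /\ forall i, mf (partial_deriv i f).
Proof.
by move=> [fc _ fp _]; split=> [|i]; apply: continuous_measurable_Rn => //; exact: fp.
Qed.

Lemma measurable_difference_quotient f i t : mf f ->
  mf (fun x => (f (x + t *: bas i) - f x) / t).
Proof.
move=> fm; have m1 : mf (fun x => f (x + t *: bas i)) by exact: measurable_comp_translate.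
exact: (measurable_funM (measurable_funB m1 fm) (measurable_cst t^-1)).
Qed.

Lemma C1c_quotient M f i : C1c M f -> exists2 C, 0 <= C & forall t x, t != 0 ->
  `|t| <= 1 -> `|(f (x + t *: bas i) - f x) / t| <= C /\
  (M + 1 < `|x| -> (f (x + t *: bas i) - f x) / t = 0).
Proof.
move=> fM; have [C C0 HC] := C1c_lipschitz fM; have [_ _ _ f0] := fM.
exists C => // t x t0 t1; split.
  by rewrite normrM normfV ler_pdivrMr ?normr_gt0//; case: (HC x i t).
move=> Mx; rewrite f0; last first.
  have b1 : `|t *: bas i| <= 1.
    apply: le_trans t1; rewrite normrZ ler_piMr// rV_norm_le// => j.
    by rewrite mxE; case: (_ && _); rewrite ?normr1 ?normr0.
  have := ler_normB (x + t *: bas i) (t *: bas i); rewrite addrK => H.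
  by move: Mx H b1; move: `|x| `|_ + _| `|_ *: _| => a b c; lra.
by rewrite f0 ?subr0 ?mul0r// (lt_trans _ Mx)// ltrDl.
Qed.

(** Difference quotients have integral 0 by translation invariance, and they converge to the partial
    derivative while staying bounded and supported in a fixed ball. *)
Lemma Int_partial0 M f i : C1c M f -> Int (partial_deriv i f) = 0.
Proof.
move=> fM; have [C C0 HC] := C1c_quotient i fM; have [fm pm] := C1c_measurable fM.
have [_ fd _ f0] := fM; pose t n : R := n.+1%:R^-1.
have t0 n : t n != 0 by rewrite invr_eq0.
have t1 n : `|t n| <= 1 by rewrite ger0_norm ?invr_ge0// invf_le1// ler1n.
have [C' _ HC'] := C1c_lipschitz fM.
have fi : intg f by apply: (@intg_bounded_ball M f C' fm _ f0) => x; case: (HC' x i 0).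
pose F n x := (f (x + t n *: bas i) - f x) / t n.
have Fm n : mf (F n) by exact: measurable_difference_quotient.
have F0 n : Int (F n) = 0.
  have -> : F n = (fun x => (t n)^-1 * (f (x + t n *: bas i) - f x)).
    by apply/funext => x; rewrite mulrC.
  have si := intg_translate (t n *: bas i) fi.
  rewrite (@IntZ _ (Rn R N) R mu (t n)^-1 (fun x => f (x + t n *: bas i) - f x)); last exact: intgB.
  by rewrite IntB// (Int_translate (t n *: bas i) fi) subrr mulr0.
have tc : t n @[n --> \oo] --> 0 by exact: cvg_harmonic.
have [|||_ _] := @Int_dct _ (Rn R N) R mu F (partial_deriv i f)
    (fun x => C * \1_(cball (M + 1)) x) Fm (pm i).
- by apply: aeW => x; exact: cvg_difference_quotient.
- by apply: intgZ; exact: intg_cball.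
- by move=> n x; have [H1 H2] := HC (t n) x (t0 n) (t1 n); exact: le_cball.
move=> H; rewrite -(cvg_lim _ H)//; apply: cvg_lim => //.
by under eq_fun do rewrite F0; exact: cvg_cst.
Qed.

Lemma C1c_mul_intg M f g : continuous f -> C1c M g -> intg (fun x => f x * g x).
Proof.
move=> fc gM; have [gc _ _ g0] := gM.
have c : continuous (fun x => f x * g x) by move=> x; exact: (cvgM (fc x) (gc x)).
have z x : M < `|x| -> f x * g x = 0 by move=> /g0 ->; rewrite mulr0.
have [C _ HC] := bounded_continuous_ball c z.
exact: intg_bounded_ball (continuous_measurable_Rn c) HC z.
Qed.

Lemma C1c_by_parts M f g i : C1c M f -> C1c M g ->
  Int (fun x => partial_deriv i f x * g x) = - Int (fun x => f x * partial_deriv i g x).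
Proof.
move=> fM gM; have := Int_partial0 i (C1cM fM gM).
have [f1 f2 f3 f4] := fM; have [g1 g2 g3 g4] := gM.
have -> : partial_deriv i (fun x => f x * g x) =
    (fun x => partial_deriv i f x * g x + f x * partial_deriv i g x).
  apply/funext => x; rewrite /partial_deriv (@deriveM _ _ f g)//.
  by rewrite addrC [_ *: 'D_(bas i) f x]mulrC.
have i1 : intg (fun x => partial_deriv i f x * g x) by exact: C1c_mul_intg gM.
have i2 : intg (fun x => f x * partial_deriv i g x).
  by have := C1c_mul_intg (g3 i) fM; under eq_fun do rewrite mulrC.
by rewrite (IntD i1 i2) => /eqP; rewrite addr_eq0 => /eqP.
Qed.

End compactly_supported.

Section products.
Context d (T : measurableType d) (R : realType) (mu : {measure set T -> \bar R}).
Notation mf f := (measurable_fun [set: T] f).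
Notation intg f := (mu.-integrable [set: T] (EFin \o f)).
Notation Int f := (\int[mu]_x f x).

Lemma intg_mul_bounded (u q : T -> R) C : intg u -> mf q -> (forall x, `|q x| <= C) ->
  intg (fun x => u x * q x).
Proof.
move=> ui qm qC; apply: (@intg_dom _ T R mu _ (fun x => C * `|u x|)).
- exact: (measurable_funM (intg_mf ui) qm).
- by move=> x; rewrite normrM mulrC ler_wpM2r.
- by apply: intgZ; exact: intg_norm.
Qed.

Lemma cvg_Int_mul (un : nat -> T -> R) (u : T -> R) (qn : nat -> T -> R) (q : T -> R) C :
  (forall n, intg (un n)) -> intg u ->
  Int (fun x => `|un n x - u x|) @[n --> \oo] --> 0 ->
  (forall n, mf (qn n)) -> mf q -> (forall n x, `|qn n x| <= C) ->
  {ae mu, forall x, qn n x @[n --> \oo] --> q x} -> intg (fun x => u x * q x) ->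
  Int (fun x => un n x * qn n x) @[n --> \oo] --> Int (fun x => u x * q x).
Proof.
move=> uni ui uc qnm qm qC qc uqi.
have i1 n : intg (fun x => (un n x - u x) * qn n x).
  by apply: intg_mul_bounded (qnm n) (qC n); exact: intgB.
have i2 n : intg (fun x => u x * qn n x) by exact: intg_mul_bounded ui (qnm n) (qC n).
have -> : (fun n => Int (fun x => un n x * qn n x)) =
    (fun n => Int (fun x => (un n x - u x) * qn n x) + Int (fun x => u x * qn n x)).
  apply/funext => n; rewrite -(IntD (i1 n) (i2 n)).
  by congr Rintegral; apply/funext => x; rewrite -mulrDl subrK.
rewrite -[X in _ --> X]add0r; apply: cvgD.
  apply/norm_cvg0P; apply: (@squeeze_cvgr _ _ _ _ (fun=> 0)
      (fun n => C * Int (fun x => `|un n x - u x|))); [|exact: cvg_cst|].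
    apply: nearW => n; rewrite normr_ge0/= -IntZ; last by apply: intg_norm; exact: intgB.
    apply: le_trans (norm_Int (i1 n)) _; apply: le_Int.
    - exact: intg_norm.
    - by apply: intgZ; apply: intg_norm; exact: intgB.
    - by move=> x; rewrite normrM mulrC ler_wpM2r.
  by rewrite -[X in _ --> X](mulr0 C); apply: cvgM uc; exact: cvg_cst.
have [|||||_ _] := @Int_dct _ T R mu (fun n x => u x * qn n x) (fun x => u x * q x)
  (fun x => C * `|u x|).
- by move=> n; exact: intg_mf (i2 n).
- exact: intg_mf uqi.
- by apply: filterS qc => x qx; apply: cvgM => //; exact: cvg_cst.
- by apply: intgZ; exact: intg_norm.
- by move=> n x; rewrite normrM mulrC ler_wpM2r.
by [].
Qed.

End products.

Section difference_quotients.
Context (R : realType) (N : nat).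
Notation mu := (leb R N).
Notation mf f := (measurable_fun [set: Rn R N] (f : Rn R N -> R)).
Notation intg f := (mu.-integrable [set: Rn R N] (EFin \o (f : Rn R N -> R))).
Notation Int f := (\int[mu]_x (f : Rn R N -> R) x).
Notation bas i := (delta_mx 0 i : 'rV[R]_N).

(** Translating the variable moves the difference onto [f], where it becomes a quotient with step
    [- t n] that converges boundedly. *)
Lemma cvg_Int_difference M (f : 'rV[R]_N -> R) i (t : nat -> R)
    (un : nat -> 'rV[R]_N -> R) (u : 'rV[R]_N -> R) :
  C1c M f -> (forall n, 0 < t n <= 1) -> t n @[n --> \oo] --> 0 ->
  (forall n, intg (un n)) -> intg u ->
  Int (fun x => `|un n x - u x|) @[n --> \oo] --> 0 ->
  Int (fun x => (un n (x + t n *: bas i) - un n x) / t n * f x) @[n --> \oo] -->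
    - Int (fun x => u x * partial_deriv i f x).
Proof.
move=> fM t01 tc uni ui uc.
have [C C0 HC] := C1c_quotient i fM; have [fm pm] := C1c_measurable fM.
have [C' _ HC'] := C1c_lipschitz fM; have [_ fd _ f0] := fM.
have t0 n : - t n != 0 by rewrite oppr_eq0; have /andP[/lt0r_neq0] := t01 n.
have t1 n : `|- t n| <= 1.
  by rewrite normrN ger0_norm; have /andP[? ?] := t01 n => //; exact: ltW.
have fb x : `|f x| <= C' by case: (HC' x i 0).
have pb x : `|partial_deriv i f x| <= C' by case: (HC' x i 0).
have E n : Int (fun x => (un n (x + t n *: bas i) - un n x) / t n * f x) =
    - Int (fun x => un n x * ((f (x + - t n *: bas i) - f x) / - t n)).
  have k1 : intg (fun x => un n x * f x) by exact: intg_mul_bounded (uni n) fm fb.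
  have k2 : intg (fun x => un n x * f (x + - t n *: bas i)).
    apply: (@intg_mul_bounded _ (Rn R N) R mu (un n) (fun x => f (x + - t n *: bas i)) C' (uni n)).
      exact: measurable_comp_translate.
    by move=> x; exact: fb.
  have k3 := intg_translate (t n *: bas i) k2.
  have -> : Int (fun x => (un n (x + t n *: bas i) - un n x) / t n * f x) =
      Int (fun x => (t n)^-1 * (un n (x + t n *: bas i) * f (x + t n *: bas i + - t n *: bas i)
        - un n x * f x)).
    by congr Rintegral; apply/funext => x; rewrite scaleNr addrK; ring.
  rewrite IntZ; last exact: intgB.
  rewrite (IntB k3 k1) (Int_translate (t n *: bas i) k2) -(IntB k2 k1).
  have -> : Int (fun x => un n x * ((f (x + - t n *: bas i) - f x) / - t n)) =
      Int (fun x => - (t n)^-1 * (un n x * f (x + - t n *: bas i) - un n x * f x)).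
    by congr Rintegral; apply/funext => x; rewrite invrN; ring.
  by rewrite [X in _ = - X]IntZ ?mulNr ?opprK//; exact: intgB.
under eq_fun do rewrite E.
pose qn n x := (f (x + - t n *: bas i) - f x) / - t n.
have qm n : mf (qn n) by exact: measurable_difference_quotient.
have qC n x : `|qn n x| <= C by case: (HC (- t n) x (t0 n) (t1 n)).
have qc : {ae mu, forall x, qn n x @[n --> \oo] --> partial_deriv i f x}.
  apply: aeW => x; apply: cvg_difference_quotient => //.
  by rewrite -oppr0; exact: cvgN.
have uq : intg (fun x => u x * partial_deriv i f x) by exact: intg_mul_bounded ui (pm i) pb.
apply: cvgN.
exact: (@cvg_Int_mul _ (Rn R N) R mu un u qn (partial_deriv i f) C uni ui uc qm (pm i) qC qc uq).
Qed.

End difference_quotients.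

Lemma powR_sum_le (R : realType) (J : Type) (s : seq J) (a : J -> R) (q : R) : 0 < q ->
  `|\sum_(j <- s) a j| `^ q <= (2 `^ q) ^+ size s * \sum_(j <- s) `|a j| `^ q.
Proof.
move=> q0; have k1 : 1 <= 2 `^ q :> R by rewrite -[leLHS](powRr0 (2 : R)) ler_powR ?ler1n ?ltW.
have k0 : 0 <= 2 `^ q :> R by exact: powR_ge0.
elim: s => [|j s IH].
  by rewrite !big_nil mulr0 normr0 powR0// gt_eqF.
rewrite !big_cons /= exprS -mulrA; apply: le_trans (ler_powRD _ _ (ltW q0)) _.
rewrite ler_wpM2l// mulrDr lerD// ler_peMl ?powR_ge0//.
exact: exprn_ege1.
Qed.

(** * Spline interpolation *)

Section spline.
Context (R : realType).
Implicit Types t : R.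

(** The endpoints matter: the identities for [spl] are used on [0 < t <= 1], and at [t = 1] they
    involve the derivative of the step at 0. *)
Lemma continuous_itv_zero (f : R -> R) a b : continuous f -> a < b ->
  (forall t, t < a \/ b < t -> f t = 0) -> forall t, t <= a \/ b <= t -> f t = 0.
Proof.
move=> fc ab f0 t H; apply/eqP; apply: contrapT => /negP ft.
have : \forall s \near t, f s != 0.
  exact: (cvgr_neq0 (f t) (fc t) ft).
move=> /nbhs_ballP[e /= e0 He].
have [ta|bt] : t <= a \/ b <= t := H.
  have /He /eqP : ball t e (t - e / 2).
    by rewrite /ball /= opprB addrCA subrr addr0 ger0_norm; lra.
  by apply; apply: f0; left; lra.
have /He /eqP : ball t e (t + e / 2).
  by rewrite /ball /= opprD addrA subrr add0r normrN ger0_norm; lra.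
by apply; apply: f0; right; lra.
Qed.

Lemma derive_smooth_step : exists (S' : R -> R) M,
  [/\ forall t, is_derive t 1 (@smooth_step R) (S' t),
      forall t, t <= 0 \/ 1 <= t -> S' t = 0 & forall t, `|S' t| <= M].
Proof.
have [S' SE S'1] := @dn_smooth_step R 2; have S'c := dn_continuous S'1.
have S'0 : forall t, t <= 0 \/ 1 <= t -> S' t = 0.
  apply: continuous_itv_zero => // t H.
  have [_ <-] := SE t; case: H => Ht.
    rewrite (@near_eq_derive _ _ _ _ (fun=> (0 : R))) ?derive_cst//.
    near=> s; apply: smooth_step0; apply: ltW; near: s; exact: lt_nbhsl.
  rewrite (@near_eq_derive _ _ _ _ (fun=> (1 : R))) ?derive_cst//.
  near=> s; apply: smooth_step1; apply: ltW; near: s; exact: lt_nbhsr.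
have /compact_bounded[M [_ MB]] : compact (S' @` `[0, 1]).
  by apply: continuous_compact; [exact: continuous_subspaceT|exact: segment_compact].
exists S', (`|M| + 1); split=> // t.
have [t0|t0] := leP t 0; first by rewrite S'0 ?normr0 ?addr_ge0//; left.
have [t1|t1] := leP 1 t; first by rewrite S'0 ?normr0 ?addr_ge0//; right.
apply: (MB (`|M| + 1)); last by exists t; rewrite //= in_itv/= !ltW.
by rewrite ltr_pwDr// ler_norm.
Unshelve. all: by end_near. Qed.

(** A bump on [[0, 2]] whose integer translates sum to 1 by telescoping; at each point at most two
    of them are nonzero. *)
Definition spl t := smooth_step t - smooth_step (t - 1).

Lemma dn_spl n : dn n spl.
Proof.
apply: dnD; first exact: dn_smooth_step.
have := dnZ (-1) (dn_affine 1 (-1) (@dn_smooth_step R n)).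
by under eq_fun do rewrite mulN1r mul1r.
Qed.

Lemma spl0 t : t <= 0 \/ 2 <= t -> spl t = 0.
Proof.
rewrite /spl => -[t0|t2]; first by rewrite !smooth_step0 ?subrr//; lra.
by rewrite !smooth_step1 ?subrr//; lra.
Qed.

Lemma spl_partition t : 0 < t <= 1 -> spl t + spl (t + 1) = 1.
Proof.
move=> t01; rewrite /spl addrK [smooth_step (t - 1)]smooth_step0; last by lra.
by rewrite [smooth_step (t + 1)]smooth_step1; [ring|lra].
Qed.

Lemma norm_spl t : `|spl t| <= 1.
Proof.
have := @smooth_step01 R t; have := @smooth_step01 R (t - 1); rewrite /spl.
move: (smooth_step _) (smooth_step _) => a b H1 H2.
by rewrite ler_norml; apply/andP; split; lra.
Qed.

Lemma derive_spl : exists (b' : R -> R) M, [/\ forall t, is_derive t 1 spl (b' t),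
  forall t, t <= 0 \/ 2 <= t -> b' t = 0,
  forall t, 0 < t <= 1 -> b' t + b' (t + 1) = 0 & forall t, `|b' t| <= M].
Proof.
have [S' [M [S1 S2 S3]]] := derive_smooth_step.
exists (fun t => S' t - S' (t - 1)), (M + M); split=> t.
- apply: is_deriveB.
  have := @is_derive_affine _ (@smooth_step R) 1 (-1) t (S' (t - 1)).
  rewrite mul1r mulr1 => /(_ (S1 _)).
  by under eq_fun do rewrite mul1r.
- by case=> Ht; rewrite !S2 ?subrr//; [left|left|right|right]; lra.
- move=> t01; rewrite addrK [S' (t - 1)]S2; last by left; lra.
  by rewrite [S' (t + 1)]S2; [ring|right; lra].
- by apply: le_trans (ler_normB _ _) _; exact: lerD.
Qed.

End spline.

Lemma sum_supp_eq (R : realType) (K : eqType) (s1 s2 : seq K) (F : K -> R) :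
  uniq s1 -> uniq s2 -> (forall k, F k != 0 -> (k \in s1) && (k \in s2)) ->
  \sum_(k <- s1) F k = \sum_(k <- s2) F k.
Proof.
move=> u1 u2 F12.
have red (s s' : seq K) : uniq s -> (forall k, F k != 0 -> k \in s') ->
    \sum_(k <- s) F k = \sum_(k <- [seq k <- s | k \in s']) F k.
  move=> us Fs; rewrite big_filter [LHS](bigID (mem s'))/= addrC big1 ?add0r// => k ks.
  by apply/eqP; apply: contraNT ks => /Fs.
rewrite (red s1 s2) ?(red s2 s1)//; [|by move=> k /F12/andP[]..].
apply: perm_big; apply: uniq_perm; rewrite ?filter_uniq// => k.
by rewrite !mem_filter andbC.
Qed.

Section interpolation.
Context (R : realType) (N : nat).
Notation mu := (leb R N).
Notation mf f := (measurable_fun [set: Rn R N] (f : Rn R N -> R)).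
Notation intg f := (mu.-integrable [set: Rn R N] (EFin \o (f : Rn R N -> R))).
Notation Int f := (\int[mu]_x (f : Rn R N -> R) x).
Variables (h : R) (I : seq 'rV[int]_N) (U : 'rV[int]_N -> R).
Hypotheses (N0 : (0 < N)%N) (h0 : 0 < h) (uI : uniq I)
  (UI : forall k, k \notin I -> U k = 0).
Implicit Types (x : 'rV[R]_N) (k : 'rV[int]_N) (i j : 'I_N).

Definition shv (ep : {ffun 'I_N -> bool}) : 'rV[int]_N := \row_j (ep j : nat)%:Z.

Definition weight (b : 'I_N -> R -> R) k x := \prod_j b j (h^-1 * x 0 j + - (k 0 j)%:~R).

(** At [x] only the [2^N] nodes [idx h x - shv ep] contribute, and their weights sum to the product
    of the [c j] by expanding a product of binomials. All [c j = 1] gives the distance to the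
    lattice function; [c i = 0], with the derivative of the spline in coordinate [i], gives the
    gradient. *)
Lemma interp_bound (b : 'I_N -> R -> R) (c : 'I_N -> R) M x :
  (forall j t, t <= 0 \/ 2 <= t -> b j t = 0) ->
  (forall j t, 0 < t <= 1 -> b j t + b j (t + 1) = c j) ->
  (forall j t, `|b j t| <= M) ->
  `|\sum_(k <- I) U k * weight b k x - (\prod_j c j) * U (idx h x)| <=
  M ^+ N * \sum_ep `|U (idx h x + - shv ep) - U (idx h x)|.
Proof.
move=> b0 bc bM; have [k0 k0E] : exists k0, idx h x = k0 by exists (idx h x).
rewrite k0E.
pose tau j := h^-1 * x 0 j - (k0 0 j)%:~R.
have tau01 j : 0 < tau j <= 1.
  have /(_ j)/andP[H1 H2] := (idxP x k0 h0).1 k0E.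
  rewrite /tau subr_gt0 lerBlDr mulrC ltr_pdivlMr// ler_pdivrMr// mulrC H1/= mulrC.
  by move: H2; rewrite intrD addrC.
pose J := [seq k0 + - shv ep | ep <- index_enum {ffun 'I_N -> bool}].
have shv_inj : injective (fun ep => k0 + - shv ep).
  move=> ep ep' /addrI/oppr_inj/rowP E; apply/ffunP => j; have := E j; rewrite !mxE.
  by case: (ep j); case: (ep' j).
have uJ : uniq J by rewrite map_inj_uniq ?index_enum_uniq.
have wE ep : weight b (k0 + - shv ep) x = \prod_j b j (tau j + (ep j : nat)%:R).
  by apply: eq_bigr => j _; congr b; rewrite /tau !mxE intrD opprD addrA mulrNz opprK.
have wJ k : weight b k x != 0 -> k \in J.
  move=> wk; have bk j : b j (h^-1 * x 0 j + - (k 0 j)%:~R) != 0.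
    by apply: contraNneq wk => bj; rewrite /weight (bigD1 j)//= bj mul0r.
  (* A nonzero factor forces [0 < tau j + (k0 0 j - k 0 j) < 2], and [tau j] lies in []0, 1]]. *)
  have dk j : k0 0 j - k 0 j = 0 \/ k0 0 j - k 0 j = 1.
    have e1 : h^-1 * x 0 j + - (k 0 j)%:~R = tau j + (k0 0 j - k 0 j)%:~R.
      by rewrite /tau intrB; ring.
    have := bk j; rewrite e1 => bj; have /andP[t0 t1] := tau01 j.
    have d0 : -1 < (k0 0 j - k 0 j)%:~R :> R.
      rewrite ltNge; apply/negP => d1; case/eqP: bj; apply: b0; left; lra.
    have d2 : (k0 0 j - k 0 j)%:~R < 2 :> R.
      rewrite ltNge; apply/negP => d1; case/eqP: bj; apply: b0; right; lra.
    move: d0 d2; rewrite -[-1](intrN R 1) -[2]/(2%:~R) !ltr_int.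
    move: (k0 0 j - k 0 j) => d; lia.
  apply/mapP; exists [ffun j => k0 0 j != k 0 j]; first by rewrite mem_index_enum.
  apply/rowP => j; rewrite !mxE ffunE.
  by have [d|d] := dk j; case: eqP => /= e; lia.
rewrite (@sum_supp_eq _ _ I J (fun k => U k * weight b k x) uI uJ); last first.
  move=> k; rewrite mulf_eq0 negb_or => /andP[Uk /wJ ->]; rewrite andbT.
  by apply: contraNT Uk => /UI ->.
have -> : \prod_j c j = \sum_ep weight b (k0 + - shv ep) x.
  under [RHS]eq_bigr do rewrite wE.
  rewrite -(bigA_distr_bigA (fun j (e : bool) => b j (tau j + (e : nat)%:R))).
  apply: eq_bigr => j _; rewrite big_bool /= addr0 addrC.
  by rewrite bc.
rewrite big_map mulr_suml -sumrB mulr_sumr.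
apply: le_trans (ler_norm_sum _ _ _) _; apply: ler_sum => ep _.
rewrite [weight _ _ _ * _]mulrC -mulrBl normrM mulrC ler_wpM2r//.
rewrite wE normr_prod; apply: (@le_trans _ _ (\prod_(j < N) M)).
  by apply: ler_prod => j _; rewrite normr_ge0 bM.
by rewrite prodr_const card_ord.
Qed.

Definition interp x := \sum_(k <- I) U k * weight (fun=> @spl R) k x.

Lemma Dn_interp n : Dn n interp.
Proof.
apply: Dn_sum => k; apply: DnM; first exact: Dn_cst.
apply: Dn_prod => j.
have H l : dn l (fun t => @spl R (h^-1 * t + - (k 0 j)%:~R)) by apply: dn_affine; exact: dn_spl.
exact: (Dn_coord n j H).
Qed.

Lemma is_derive_interp (b' : R -> R) x i : (forall t : R, is_derive t (1 : R) (@spl R) (b' t)) ->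
  is_derive x (delta_mx 0 i : 'rV[R]_N) interp
    (h^-1 * \sum_(k <- I) U k * weight (fun j => if j == i then b' else @spl R) k x).
Proof.
move=> Hb; pose g k j t := @spl R (h^-1 * t + - (k 0 j)%:~R).
have gd k j (t : R) : is_derive t (1 : R) (g k j) (b' (h^-1 * t + - (k 0 j)%:~R) * h^-1).
  exact: is_derive_affine.
have dsum (s : seq 'rV[int]_N) (F : 'rV[int]_N -> 'rV[R]_N -> R) dF :
    (forall k, is_derive x (delta_mx 0 i : 'rV[R]_N) (F k) (dF k)) ->
    is_derive x (delta_mx 0 i : 'rV[R]_N) (fun x => \sum_(k <- s) F k x) (\sum_(k <- s) dF k).
  move=> HF; elim: s => [|k s IH].
    by rewrite big_nil; under eq_fun do rewrite big_nil; exact: is_derive_cst.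
  by rewrite big_cons; under eq_fun do rewrite big_cons; exact: is_deriveD.
have dprod k (s : seq 'I_N) : i \notin s ->
    is_derive x (delta_mx 0 i : 'rV[R]_N) (fun x => \prod_(j <- s) g k j (x 0 j)) 0.
  elim: s => [_|j s IH].
    by under eq_fun do rewrite big_nil; exact: is_derive_cst.
  rewrite inE negb_or => /andP[ij /IH H]; under eq_fun do rewrite big_cons.
  have H' := is_derive_coord i (gd k j (x 0 j)); rewrite (negbTE ij) in H'.
  by apply: is_derive_eq (is_deriveM H' H) _; rewrite !scaler0 addr0.
rewrite mulr_sumr; apply: dsum => k.
have wE (b : 'I_N -> R -> R) y : weight b k y = b i (h^-1 * y 0 i + - (k 0 i)%:~R) *
    \prod_(j <- [seq j <- index_enum 'I_N | j != i]) b j (h^-1 * y 0 j + - (k 0 j)%:~R).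
  by rewrite big_filter /weight (bigD1 i).
have H1 : is_derive x (delta_mx 0 i : 'rV[R]_N) (fun y => g k i (y 0 i))
    (b' (h^-1 * x 0 i + - (k 0 i)%:~R) * h^-1).
  by have := is_derive_coord i (gd k i (x 0 i)); rewrite eqxx.
have H2 := dprod k [seq j <- index_enum 'I_N | j != i] _.
have {}H2 := H2 ltac:(by rewrite mem_filter eqxx).
have -> : (fun x => U k * weight (fun=> @spl R) k x) = (fun x => U k * (g k i (x 0 i) *
    \prod_(j <- [seq j <- index_enum 'I_N | j != i]) g k j (x 0 j))).
  by apply/funext => y; rewrite wE.
apply: is_derive_eq (is_deriveM (is_derive_cst (U k) x _) (is_deriveM H1 H2)) _.
rewrite wE eqxx /GRing.scale /= !mulr0 !add0r addr0.
rewrite (_ : \prod_(j <- _) (if j == i then b' else @spl R) _ =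
  \prod_(j <- [seq j <- index_enum 'I_N | j != i]) g k j (x 0 j)); first by ring.
by rewrite !big_filter; apply: eq_bigr => j /negbTE ->.
Qed.

Lemma interp_support x : interp x != 0 -> exists2 k, k \in I & `|x - pt h k| <= 2 * h.
Proof.
move=> ix; have [k kI wk] : exists2 k, k \in I & weight (fun=> @spl R) k x != 0.
  apply: contrapT => H; case/eqP: ix; rewrite /interp big_seq big1// => k kI.
  by apply/eqP; rewrite mulf_eq0; apply/orP; right; apply: contrapT => /negP wk; apply: H; exists k.
exists k => //; apply: rV_norm_le => [|j]; first by rewrite mulr_ge0// ltW.
have bj : @spl R (h^-1 * x 0 j + - (k 0 j)%:~R) != 0.
  by apply: contraNneq wk => bj; rewrite /weight (bigD1 j)//= bj mul0r.
have t0 : 0 < h^-1 * x 0 j + - (k 0 j)%:~R.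
  by rewrite ltNge; apply: contra bj => t0; rewrite spl0//; left.
have t2 : h^-1 * x 0 j + - (k 0 j)%:~R < 2.
  by rewrite ltNge; apply: contra bj => t2; rewrite spl0//; right.
rewrite !mxE -(ler_pM2l (_ : 0 < h^-1)) ?invr_gt0//.
rewrite -{1}[h^-1]ger0_norm ?invr_ge0 ?(ltW h0)// -normrM mulrBr mulKf ?lt0r_neq0//.
by rewrite mulrCA mulVf ?lt0r_neq0// mulr1 ger0_norm ltW.
Qed.

Definition ncube : R := #|{ffun 'I_N -> bool}|%:R.

(* The crude constant comes from iterating [(a + b)^q <= 2^q (a^q + b^q)]. *)
Definition cube_const (q : R) : R :=
  (2 `^ q) ^+ #|{ffun 'I_N -> bool}| * (ncube * (N%:R * (2 `^ q) ^+ N)).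

Lemma cube_bound q b (F : 'rV[R]_N -> R) M : 0 < q -> 0 <= M -> mf F ->
  (forall e, Int (fun x => `|U (idx h x + dir e) - U (idx h x)| `^ q) <= b) ->
  (forall x, `|F x| <= M * \sum_ep `|U (idx h x + - shv ep) - U (idx h x)|) ->
  intg (fun x => `|F x| `^ q) /\ Int (fun x => `|F x| `^ q) <= M `^ q * cube_const q * b.
Proof.
move=> q0 M0 Fm Ub FU.
have k1 : 1 <= 2 `^ q :> R by rewrite -[leLHS](powRr0 (2 : R)) ler_powR ?ler1n ?ltW.
have sh ep : intg (fun x => `|U (idx h x + - shv ep) - U (idx h x)| `^ q) /\
    Int (fun x => `|U (idx h x + - shv ep) - U (idx h x)| `^ q) <= N%:R * (2 `^ q) ^+ N * b.
  apply: (@shift_bound R N h h0 q (2 `^ q) b I U N0 uI q0 k1 _ UI Ub).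
    by move=> y z; exact: ler_powRD (ltW q0).
  rewrite /l1int; apply: leq_trans (_ : \sum_(e < N) 1 <= _)%N.
    by apply: leq_sum => e _; rewrite !mxE abszN absz_nat; case: (ep e).
  by rewrite sum_nat_const card_ord muln1.
pose S x := \sum_ep `|U (idx h x + - shv ep) - U (idx h x)| `^ q.
have iS : intg S by apply: intg_sum => ep; case: (sh ep).
pose K := M `^ q * (2 `^ q) ^+ #|{ffun 'I_N -> bool}|.
have le x : `| `|F x| `^ q | <= K * S x.
  rewrite (ger0_norm (powR_ge0 _ _)).
  apply: le_trans (ge0_ler_powR (ltW q0) _ _ (FU x)) _.
  - by rewrite nnegrE.
  - by rewrite nnegrE mulr_ge0// sumr_ge0.
  rewrite powRM//; last exact: sumr_ge0.
  rewrite -mulrA ler_wpM2l ?powR_ge0//.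
  have := powR_sum_le (enum {ffun 'I_N -> bool})
    (fun ep => `|U (idx h x + - shv ep) - U (idx h x)|) q0.
  rewrite !big_enum /= ger0_norm; last exact: sumr_ge0.
  rewrite -cardT => H; apply: le_trans H _.
  by rewrite ler_wpM2l ?exprn_ge0 ?powR_ge0// ler_sum// => ep _; rewrite normr_id.
have mF := measurable_norm_powR q Fm.
have iF : intg (fun x => `|F x| `^ q).
  by apply: (@intg_dom _ (Rn R N) R mu _ (fun x : Rn R N => K * S x)) => //; exact: intgZ.
split=> //.
have -> : Int (fun x => `|F x| `^ q) = Int (fun x => `| `|F x| `^ q |).
  by congr Rintegral; apply/funext => x; rewrite (ger0_norm (powR_ge0 _ _)).
apply: le_trans (Int_dom mF le (intgZ K iS)) _.
rewrite (IntZ K iS) /S Int_sum; last by move=> ep; case: (sh ep).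
rewrite /K /cube_const -!mulrA ler_wpM2l ?powR_ge0// ler_wpM2l ?exprn_ge0 ?powR_ge0//.
apply: le_trans (ler_sum _ (fun ep _ => (sh ep).2)) _.
rewrite sumr_const /ncube -mulr_natl mulrA mulrA le_eqVlt; apply/orP; left; apply/eqP.
by ring.
Qed.

End interpolation.

(** In the gradient the factor [h^q] of the hypothesis cancels against the factor [h^-1] that
    differentiation produces, so both estimates hold with a constant independent of the mesh. *)
Lemma interp_estimates (R : realType) (N : nat) (q : R) : (0 < N)%N -> 0 < q ->
  exists K : R, 0 <= K /\ forall (h b : R) (I : seq 'rV[int]_N) (U : 'rV[int]_N -> R),
  0 < h -> uniq I -> (forall k, k \notin I -> U k = 0) ->
  (forall e, \int[leb R N]_x (`|U (idx h (x : Rn R N) + dir e) - U (idx h (x : Rn R N))| `^ q)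
     <= h `^ q * b) ->
  ((leb R N).-integrable [set: Rn R N]
      (EFin \o (fun x : Rn R N => `|interp h I U x - U (idx h x)| `^ q)) /\
    \int[leb R N]_x (`|interp h I U (x : Rn R N) - U (idx h (x : Rn R N))| `^ q)
      <= K * (h `^ q * b)) /\
  forall i, (leb R N).-integrable [set: Rn R N]
      (EFin \o (fun x : Rn R N => `|partial_deriv i (interp h I U) x| `^ q)) /\
    \int[leb R N]_x (`|partial_deriv i (interp h I U) (x : Rn R N)| `^ q) <= K * b.
Proof.
move=> N0 q0; have [b' [M [bd b0 bp bM]]] := derive_spl R.
have M0 : 0 <= M by apply: le_trans (bM 0).
pose L := (M + 1) ^+ N.
have L1 : 1 <= L by apply: exprn_ege1; rewrite lerDr.
have L0 : 0 <= L by exact: le_trans L1.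
exists (L `^ q * @cube_const R N q); split.
  by rewrite mulr_ge0 ?powR_ge0// /cube_const /ncube !mulr_ge0 ?exprn_ge0 ?powR_ge0.
move=> h b I U h0 uI UI Ub.
have Dv := @Dn_interp R N h I U.
have vc : continuous (interp h I U) by have [] := Dv 1%N.
have vm := continuous_measurable_Rn vc.
have um := measurable_lat h0 U.
split.
  apply: (@cube_bound R N h I U N0 h0 uI UI q (h `^ q * b)
    (fun x => interp h I U x - U (idx h x)) L q0 L0 (measurable_funB vm um) Ub) => x.
  have := @interp_bound R N h I U N0 h0 uI UI (fun=> @spl R) (fun=> 1) 1 x
    (fun _ => @spl0 R) (fun _ => @spl_partition R) (fun _ => @norm_spl R).
  rewrite big1_eq mul1r expr1n mul1r => H; apply: le_trans H _.
  by rewrite ler_peMl// sumr_ge0.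
move=> i; pose bb j := if j == i then b' else @spl R.
have pE : partial_deriv i (interp h I U) =
    (fun x => h^-1 * \sum_(k <- I) U k * weight h bb k x).
  by apply/funext => x; rewrite /partial_deriv; have [_ ->] := @is_derive_interp R N h I U b' x i bd.
have pm : measurable_fun [set: Rn R N] (partial_deriv i (interp h I U) : Rn R N -> R).
  have [_ /(_ i)[v' v1 [v2 _]]] := Dv 2%N.
  rewrite (_ : partial_deriv i _ = v'); first exact: continuous_measurable_Rn.
  by apply/funext => x; rewrite /partial_deriv; have [_ ->] := v1 x.
have FU x : `|partial_deriv i (interp h I U) x| <=
    h^-1 * L * \sum_ep `|U (idx h x + - shv ep) - U (idx h x)|.
  rewrite pE normrM (ger0_norm (_ : 0 <= h^-1)) ?invr_ge0 ?(ltW h0)//.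
  rewrite -mulrA ler_wpM2l ?invr_ge0 ?(ltW h0)//.
  have := @interp_bound R N h I U N0 h0 uI UI bb (fun j => if j == i then 0 else 1) (M + 1) x.
  have -> : \prod_j (if j == i then 0 else 1) = 0 :> R.
    by rewrite (bigD1 i)//= eqxx mul0r.
  rewrite mul0r subr0; apply.
  - by move=> j t Ht; rewrite /bb; case: ifP => _; [exact: b0|exact: spl0].
  - by move=> j t Ht; rewrite /bb; case: ifP => _; [exact: bp|exact: spl_partition].
  - move=> j t; rewrite /bb; case: ifP => _.
      by apply: le_trans (bM t) _; rewrite lerDl.
    by apply: le_trans (norm_spl t) _; rewrite lerDr.
have hL : 0 <= h^-1 * L by rewrite mulr_ge0// invr_ge0 ltW.
have [c1 c2] := @cube_bound R N h I U N0 h0 uI UI q (h `^ q * b) _ _ q0 hL pm Ub FU.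
split=> //; apply: le_trans c2 _; rewrite le_eqVlt; apply/orP; left; apply/eqP.
rewrite powRM ?invr_ge0 ?(ltW h0)//.
have hh : h^-1 `^ q * h `^ q = 1 by rewrite -powRM ?invr_ge0 ?(ltW h0)// mulVf ?lt0r_neq0// powR1.
transitivity ((h^-1 `^ q * h `^ q) * (L `^ q * @cube_const R N q * b)); first by ring.
by rewrite hh mul1r.
Qed.

(** * Functions orthogonal to all test functions *)

Section fundamental_lemma.
Context (R : realType) (N : nat).
Notation mu := (leb R N).
Notation mf f := (measurable_fun [set: Rn R N] (f : Rn R N -> R)).
Notation intg f := (mu.-integrable [set: Rn R N] (EFin \o (f : Rn R N -> R))).
Notation Int f := (\int[mu]_x (f : Rn R N -> R) x).
Notation bx o := (@box R N o : set (Rn R N)).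
Implicit Types (x : 'rV[R]_N) (o : option ('rV[R]_N * 'rV[R]_N)).

Lemma box_inter o o' : exists o'', @box R N o'' = box o `&` box o'.
Proof.
case: o => [[a b]|]; last by exists None; rewrite /box set0I.
case: o' => [[a' b']|]; last by exists None; rewrite /box setI0.
exists (Some (\row_j Num.max (a 0 j) (a' 0 j), \row_j Num.min (b 0 j) (b' 0 j))).
apply/seteqP; split=> x /=.
  move=> H; split=> j; have := H j; rewrite !mxE gt_max le_min.
    by move=> /andP[/andP[-> _] /andP[-> _]].
  by move=> /andP[/andP[_ ->] /andP[_ ->]].
move=> [H H'] j; have /andP[h1 h2] := H j; have /andP[h3 h4] := H' j.
by rewrite !mxE gt_max le_min h1 h2 h3 h4.
Qed.

(** The transitions start exactly at [a] and at [b], so the limit is the indicator of the left-open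
    box at every point, boundary included. *)
Definition box_step (a b : 'rV[R]_N) (n : nat) x : R :=
  \prod_j (smooth_step (n.+1%:R * (x 0 j - a 0 j)) *
    (1 - smooth_step (n.+1%:R * (x 0 j - b 0 j)))).

Lemma box_step01 a b n x : 0 <= box_step a b n x <= 1.
Proof.
rewrite /box_step; apply/andP; split.
  apply: prodr_ge0 => j _; have /andP[h1 h2] := @smooth_step01 R (n.+1%:R * (x 0 j - a 0 j)).
  have /andP[h3 h4] := @smooth_step01 R (n.+1%:R * (x 0 j - b 0 j)).
  by rewrite mulr_ge0// subr_ge0.
apply: prodr_ile1 => j; have /andP[h1 h2] := @smooth_step01 R (n.+1%:R * (x 0 j - a 0 j)).
have /andP[h3 h4] := @smooth_step01 R (n.+1%:R * (x 0 j - b 0 j)).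
have h5 : 0 <= 1 - smooth_step (n.+1%:R * (x 0 j - b 0 j)) by rewrite subr_ge0.
by rewrite mulr_ge0//= mulr_ile1// gerBl.
Qed.

Lemma Dn_box_step a b n k : Dn k (box_step a b n).
Proof.
apply: Dn_prod => j; have Dl (c : R) : Dn k (fun x : 'rV[R]_N => smooth_step (n.+1%:R * (x 0 j - c))).
  have H l : dn l (fun t => smooth_step (n.+1%:R * t + - (n.+1%:R * c))).
    by apply: dn_affine; exact: dn_smooth_step.
  have := @Dn_coord R N _ k j H.
  by under eq_fun do rewrite -mulrBr.
apply: DnM => //; apply: DnD; first exact: Dn_cst.
have := DnM (Dn_cst _ k (-1)) (Dl (b 0 j)).
by under eq_fun do rewrite mulN1r.
Qed.

Lemma box_step_support a b n x : box_step a b n x != 0 ->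
  forall j, a 0 j <= x 0 j <= b 0 j + 1.
Proof.
move=> H j; have : smooth_step (n.+1%:R * (x 0 j - a 0 j)) *
    (1 - smooth_step (n.+1%:R * (x 0 j - b 0 j))) != 0.
  by apply: contraNneq H => E; rewrite /box_step (bigD1 j)//= E mul0r.
rewrite mulf_eq0 negb_or => /andP[H1 H2]; apply/andP; split.
  rewrite leNgt; apply: contra H1 => xa; rewrite smooth_step0//.
  by rewrite mulr_ge0_le0// subr_le0 ltW.
rewrite leNgt; apply: contra H2 => xb; rewrite smooth_step1 ?subrr//.
have xb1 : 1 <= x 0 j - b 0 j by rewrite lerBrDl ltW.
have xb0 : 0 <= x 0 j - b 0 j by rewrite (le_trans _ xb1).
by apply: le_trans xb1 _; rewrite ler_peMl// ler1n.
Qed.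

Lemma bounded_rV (A : set 'rV[R]_N) M : (forall x, A x -> `|x| <= M) -> bounded_set A.
Proof.
move=> AM; exists M; split=> [|y My x Ax /=]; first exact: num_real.
by rewrite (le_trans (AM x Ax))// ltW.
Qed.

Lemma test_box_step a b n : test_function setT (box_step a b n).
Proof.
split=> //; first by apply: smooth_Dn => k; exact: Dn_box_step.
pose M := `|a| + `|b| + 1.
have bM x : box_step a b n x != 0 -> `|x| <= M.
  move=> /box_step_support H; apply: rV_norm_le => [|j]; first by rewrite !addr_ge0.
  have /andP[h1 h2] := H j; have a1 := rV_normP a j; have b1 := rV_normP b j.
  move: a1 b1; rewrite !ler_norml => /andP[a1 _] /andP[_ b1].
  by rewrite /M; apply/andP; split; have := normr_ge0 a; have := normr_ge0 b; lra.
apply: bounded_closed_compact; last exact: closed_closure.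
apply: (@bounded_rV _ M) => x Hx.
have cl : closed [set y : 'rV[R]_N | `|y| <= M].
  rewrite (_ : [set y | _] = (fun y : 'rV[R]_N => `|y|) @^-1` [set t | t <= M])//.
  by apply: closed_comp; [move=> y _; exact: norm_continuous|exact: closed_le].
have := @closureS _ [set y | box_step a b n y != 0] [set y : 'rV[R]_N | `|y| <= M] bM x Hx.
by rewrite -(closure_id _).1.
Qed.

Lemma cvg_box_step a b x : box_step a b n x @[n --> \oo] --> (\1_(bx (Some (a, b))) x : R).
Proof.
have E : \1_(bx (Some (a, b))) x = \prod_j (if a 0 j < x 0 j <= b 0 j then 1 else 0) :> R.
  rewrite indicE; have [xb|/negP xb] := boolP (x \in _).
    rewrite big1// => j _; move: xb; rewrite inE /= => /(_ j) ->//.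
  have [j xj] : exists j, ~~ (a 0 j < x 0 j <= b 0 j).
    apply: contrapT => H; apply: xb; rewrite inE /= => j.
    by apply: contrapT => /negP xj; apply: H; exists j.
  by rewrite (bigD1 j)//= (negbTE xj) mul0r.
rewrite E; apply: cvg_near_cst.
have big (c : R) : 0 < c -> \forall n \near \oo, 1 <= n.+1%:R * c.
  move=> c0; have [k _ kc] := near_infty_natSinv_lt (PosNum c0).
  by exists k => // n /kc /= H; rewrite -ler_pdivrMl ?ltr0n// mulr1 ltW.
have : \forall n \near \oo, forall j,
    smooth_step (n.+1%:R * (x 0 j - a 0 j)) * (1 - smooth_step (n.+1%:R * (x 0 j - b 0 j))) =
    (if a 0 j < x 0 j <= b 0 j then 1 else 0) :> R.
  apply: filter_forall => j.
  have [xa|xa] := leP (x 0 j) (a 0 j).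
    apply: nearW => n; rewrite smooth_step0 ?mul0r//.
    by rewrite mulr_ge0_le0// subr_le0.
  have [xb|xb] := leP (x 0 j) (b 0 j).
    have := big _ (_ : 0 < x 0 j - a 0 j); rewrite subr_gt0 => /(_ xa).
    apply: filterS => n H; rewrite smooth_step1// [smooth_step _]smooth_step0 ?subr0 ?mulr1//.
    by rewrite mulr_ge0_le0// subr_le0.
  have := big _ (_ : 0 < x 0 j - b 0 j); rewrite subr_gt0 => /(_ xb).
  by apply: filterS => n H; rewrite [X in 1 - X]smooth_step1// subrr mulr0.
by apply: filterS => n H; apply: eq_bigr => j _; exact: H.
Qed.

Lemma intg_mul_indic (g : 'rV[R]_N -> R) (B : set (Rn R N)) : measurable B -> intg g ->
  intg (fun x => g x * \1_B x).
Proof.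
move=> mB gi; apply: (@intg_mul_bounded _ (Rn R N) R mu g (\1_B) 1 gi).
  exact: measurable_indic.
by move=> x; rewrite indicE; case: (_ \in _); rewrite ?normr1 ?normr0.
Qed.

Lemma Int_indic_cvg (g : 'rV[R]_N -> R) (q : nat -> 'rV[R]_N -> R) (B : set (Rn R N)) :
  intg g -> measurable B -> (forall n, mf (q n)) -> (forall n x, `|q n x| <= 1) ->
  (forall x, q n x @[n --> \oo] --> (\1_B x : R)) ->
  Int (fun x => g x * q n x) @[n --> \oo] --> Int (fun x => g x * \1_B x).
Proof.
move=> gi mB qm q1 qc.
apply: (@cvg_Int_mul _ (Rn R N) R mu (fun=> g) g q (\1_B) 1) => //.
- have -> : (fun _ : nat => Int (fun x => `|g x - g x|)) = (fun=> 0).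
    apply/funext => n; rewrite -[RHS](@Int0 _ (Rn R N) R mu).
    by congr Rintegral; apply/funext => x; rewrite subrr normr0.
  exact: cvg_cst.
- exact: aeW.
- exact: intg_mul_indic.
Qed.

Variables (g : 'rV[R]_N -> R) (M q : R).
Hypotheses (N0 : (0 < N)%N) (gi : intg g) (g0 : forall x, M < `|x| -> g x = 0)
  (q1 : 1 < q) (gq : intg (fun x => `|g x| `^ q)).
Hypothesis gtest : forall f, test_function setT f -> Int (fun x => g x * f x) = 0.

Let Int_box o : Int (fun x => g x * \1_(bx o) x) = 0.
Proof.
case: o => [[a b]|]; last first.
  rewrite -[RHS](@Int0 _ (Rn R N) R mu); congr Rintegral; apply/funext => x.
  by rewrite indicE in_set0 mulr0.
have c1 := @Int_indic_cvg g (box_step a b) (bx (Some (a, b))) gi (measurable_box _) _ _ (@cvg_box_step a b).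
have {}c1 := c1 ltac:(by move=> n; apply: continuous_measurable_Rn; have [] := Dn_box_step a b n 1)
  ltac:(by move=> n x; have /andP[h1 h2] := box_step01 a b n x; rewrite ger0_norm).
rewrite -(cvg_lim _ c1)//; apply: cvg_lim => //.
rewrite (_ : (fun n => _) = (fun=> 0)); first exact: cvg_cst.
by apply/funext => n; apply: gtest; exact: test_box_step.
Qed.

Let Vn (F : nat -> option ('rV[R]_N * 'rV[R]_N)) n : set (Rn R N) := \bigcup_(k < n) bx (F k).

Let mVn F n : measurable (Vn F n).
Proof. by apply: bigcup_measurable => k _; exact: measurable_box. Qed.

(** Inclusion-exclusion by induction on [n]. The intersection with an arbitrary box [o] is carried
    along because the intersection of two boxes is a box. *)
Let Int_union F n o : Int (fun x => g x * \1_(bx o `&` Vn F n) x) = 0.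
Proof.
elim: n o => [|n IH] o.
  rewrite -[RHS](@Int0 _ (Rn R N) R mu); congr Rintegral; apply/funext => x.
  by rewrite indicE memNset ?mulr0// => -[_ []].
have [p pE] := box_inter o (F n).
have mo := measurable_box o; have mp := measurable_box p.
have E x : \1_(bx o `&` Vn F n.+1) x = \1_(bx o `&` Vn F n) x + \1_(bx p) x -
    \1_(bx p `&` Vn F n) x :> R.
  have VS : (x \in Vn F n.+1) = (x \in Vn F n) || (x \in bx (F n)).
    apply/idP/orP; rewrite ?inE.
      move=> [k /= kn Fk]; move: kn; rewrite ltnS leq_eqVlt => /predU1P[<-|kn].
        by right.
      by left; exists k.
    case; last by exists n => /=.
    by move=> [k /= kn Fk]; exists k => //=; exact: ltnW.
  have oS : (x \in bx p) = (x \in bx o) && (x \in bx (F n)).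
    by rewrite pE in_setI.
  rewrite !indicE !in_setI VS oS.
  by case: (x \in bx o); case: (x \in Vn F n); case: (x \in bx (F n)) => /=; ring.
have i1 : intg (fun x => g x * \1_(bx o `&` Vn F n) x).
  by apply: intg_mul_indic => //; exact: measurableI.
have i2 : intg (fun x => g x * \1_(bx p) x) by exact: intg_mul_indic.
have i3 : intg (fun x => g x * \1_(bx p `&` Vn F n) x).
  by apply: intg_mul_indic => //; exact: measurableI.
have -> : Int (fun x => g x * \1_(bx o `&` Vn F n.+1) x) =
    Int (fun x => g x * \1_(bx o `&` Vn F n) x + g x * \1_(bx p) x -
      g x * \1_(bx p `&` Vn F n) x).
  by congr Rintegral; apply/funext => x; rewrite E mulrBr mulrDr.
by rewrite (IntB (intgD i1 i2) i3) (IntD i1 i2) !IH Int_box subr0 addr0.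
Qed.

Let V (F : nat -> option ('rV[R]_N * 'rV[R]_N)) : set (Rn R N) := \bigcup_k bx (F k).

Let mV F : measurable (V F).
Proof. by apply: bigcup_measurable => k _; exact: measurable_box. Qed.

Let Int_V F : Int (fun x => g x * \1_(V F) x) = 0.
Proof.
(* A box outside which [g] vanishes, so that intersecting with it changes no integral of [g]. *)
pose o := Some (const_mx (- (`|M| + 1)) : 'rV[R]_N, const_mx (`|M| + 1) : 'rV[R]_N).
have go x : g x = g x * \1_(bx o) x.
  rewrite indicE; have [_|/negP xo] := boolP (x \in _); first by rewrite mulr1.
  rewrite g0 ?mul0r// ltNge; apply/negP => xM; apply: xo; rewrite inE /= => j.
  rewrite !mxE; have := rV_normP x j; rewrite ler_norml => /andP[h1 h2].
  by have := ler_norm M; lra.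
have c1 := @Int_indic_cvg g (fun n => \1_(Vn F n)) (V F) gi (mV F) _ _ _.
have {}c1 : Int (fun x => g x * \1_(Vn F n) x) @[n --> \oo] --> Int (fun x => g x * \1_(V F) x).
  apply: c1 => [n|n x|x]; first exact: measurable_indic.
    by rewrite indicE; case: (_ \in _); rewrite ?normr1 ?normr0.
  apply: cvg_near_cst; have [xV|xV] := pselect (V F x).
    have [k _ Fk] := xV; exists k.+1 => // n /= kn.
    by rewrite !indicE !mem_set//; exists k.
  apply: nearW => n; rewrite !indicE !memNset// => -[k _ Fk].
  by apply: xV; exists k.
rewrite -(cvg_lim _ c1)//; apply: cvg_lim => //.
rewrite (_ : (fun n => _) = (fun=> 0)); first exact: cvg_cst.
apply/funext => n; rewrite -(Int_union F n o); congr Rintegral; apply/funext => x.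
rewrite [in LHS]go -mulrA; congr (_ * _).
by rewrite !indicE in_setI -natrM mulnb.
Qed.

(** [A] is covered by countably many boxes with excess measure at most [2^-n]. The integral over
    their union vanishes, and the one over the excess tends to 0 because [g] is in [L^q] with
    [q > 1]. *)
Let Int_measurable (A : set (Rn R N)) : measurable A -> (mu A < +oo)%E ->
  Int (fun x => g x * \1_A x) = 0.
Proof.
move=> mA Afin; have Af : mu A \is a fin_num by rewrite ge0_fin_numE.
have /choice[F HF] n : exists F, A `<=` V F /\ (mu (V F `\` A) <= (2 ^- n)%:E)%E.
  have e0 : (0 < 2 ^- n :> R) by rewrite invr_gt0 exprn_gt0.
  have [_ [F AF <-] FS] := lb_ereal_inf_adherent e0 (Af : lebesgue_outer A \is a fin_num).
  have VF : (mu (V F) <= mu A + (2 ^- n)%:E)%E.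
    apply: le_trans (ltW FS); apply: (@le_trans _ _ (\sum_(k <oo) mu (bx (F k)))%E).
      by apply: measure_sigma_subadditive => // k; exact: measurable_box.
    by apply: lee_nneseries => // k _; exact: leb_box_le.
  exists F; split=> //; rewrite measureD//; last first.
    by apply: le_lt_trans VF _; rewrite lte_add_pinfty ?ltry.
  have -> : V F `&` A = A by rewrite setIC; apply/setIidPl.
  by rewrite leeBlDl.
pose B n := V (F n) `\` A.
have mB n : measurable (B n) by apply: measurableD.
have Bfin n : (mu (B n) < +oo)%E by apply: le_lt_trans (HF n).2 _; rewrite ltry.
have qp : 0 < q by apply: lt_trans q1.
have qp1 : 0 < q - 1 by rewrite subr_gt0.
have qq0 : q / (q - 1) != 0 by rewrite mulf_neq0 ?invr_neq0 ?lt0r_neq0.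
have Bp n : (fun x => `|\1_(B n) x| `^ (q / (q - 1))) = \1_(B n) :> (Rn R N -> R).
  apply/funext => x; rewrite indicE; case: (_ \in _); rewrite ?normr1 ?normr0 ?powR1//.
  by rewrite powR0.
have [|||||i1 c1] := @Int_product_cvg0 _ (Rn R N) R mu q (Int (fun x => `|g x| `^ q))
    (fun n => \1_(B n)) (fun=> g) q1.
- by move=> n; exact: measurable_indic.
- by move=> n; exact: intg_mf gi.
- by [].
- by move=> n; rewrite Bp; exact: intg_indic.
- apply: (@squeeze_cvgr _ _ _ _ (fun=> 0) (fun n => 2 ^- n)); [|exact: cvg_cst|].
    apply: nearW => n; rewrite Bp Int_indic// fine_ge0 ?measure_ge0//=.
    have Bf : mu (B n) \is a fin_num by rewrite ge0_fin_numE.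
    by rewrite -lee_fin (fineK Bf); exact: (HF n).2.
  by under eq_fun do rewrite -exprVn; apply: cvg_expr; rewrite ger0_norm ?invr_ge0// invf_lt1// ltr1n.
have E n : Int (fun x => \1_(B n) x * g x) = - Int (fun x => g x * \1_A x).
  have iA : intg (fun x => g x * \1_A x) by exact: intg_mul_indic.
  have iV : intg (fun x => g x * \1_(V (F n)) x) by exact: intg_mul_indic.
  rewrite -[RHS]add0r -{1}(Int_V (F n)) -(IntB iV iA); congr Rintegral; apply/funext => x.
  rewrite -mulrBr mulrC; congr (_ * _); rewrite !indicE in_setD.
  have := (HF n).1 x; have [xA|xA] := boolP (x \in A).
    by move: xA; rewrite inE => xA /(_ xA) xV; rewrite mem_set// subrr.
  by move=> _; rewrite andbT subr0.
have {}c1 : - Int (fun x => g x * \1_A x) = 0.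
  by rewrite -(cvg_lim _ c1)//; apply/esym/cvg_lim => //; under eq_fun do rewrite E; exact: cvg_cst.
by apply/eqP; rewrite -oppr_eq0 c1.
Qed.

(** The sets where [g] is positive and where it is negative are bounded, hence of finite measure;
    subtracting the two integrals shows that [|g|] has integral 0. *)
Lemma ae_zero_of_test : {ae mu, forall x, g x = 0}.
Proof.
have gm := intg_mf gi.
pose Ap : set (Rn R N) := [set x | 0 < g x]; pose An : set (Rn R N) := [set x | g x < 0].
have mAp : measurable Ap.
  have := gm measurableT _ (measurable_itv `]0, +oo[); rewrite setTI.
  by congr measurable; apply/seteqP; split=> x /=; rewrite in_itv/= andbT.
have mAn : measurable An.
  have := gm measurableT _ (measurable_itv `]-oo, 0[); rewrite setTI.
  by congr measurable; apply/seteqP; split=> x /=; rewrite in_itv.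
have fin (A : set (Rn R N)) : (forall x, A x -> g x != 0) -> (mu A < +oo)%E.
  move=> Ag; apply: leb_bounded; apply: (@bounded_rV _ M) => x /Ag gx.
  by rewrite leNgt; apply: contra gx => /g0 ->.
have Ip := Int_measurable mAp (fin Ap (fun x => @lt0r_neq0 _ _)).
have In := Int_measurable mAn (fin An (fun x => @ltr0_neq0 _ _)).
have In0 : Int (fun x => `|g x|) = 0.
  rewrite -[RHS]subr0 -{1}Ip -In -IntB; [|exact: intg_mul_indic..].
  congr Rintegral; apply/funext => x; rewrite !indicE /Ap /An.
  have [gx|gx|gx] := ltgtP (g x) 0.
  - by rewrite memNset ?mem_set//= ?mulr0 ?mulr1 ?sub0r ?ltr0_norm// ltNge (ltW gx).
  - by rewrite mem_set ?memNset//= ?mulr0 ?mulr1 ?subr0 ?gtr0_norm// ltNge (ltW gx).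
  - by rewrite gx normr0 !mul0r subr0.
have H0 : (\int[mu]_x `|(EFin \o g) x| = 0)%E.
  rewrite -[RHS]/(0%:E) -In0 (intg_EFin (intg_norm gi)).
  by apply: eq_integral => x _.
have gmE : measurable_fun [set: Rn R N] (EFin \o g : Rn R N -> \bar R) by exact/measurable_EFinP.
have := (ae_eq_integral_abs mu measurableT gmE).1 H0.
by apply: filterS => x /= /(_ I) [].
Qed.

End fundamental_lemma.

(** * Cells inside the domain and the discrete solutions *)

Section inner_cells.
Context (R : realType) (N : nat).
Implicit Types (Om K : set 'rV[R]_N) (h : R) (k : 'rV[int]_N) (x : 'rV[R]_N).

(** The radius [4 h] leaves room for the adjacent cells and for the supports of the splines, both
    within [2 h] of the node. *)
Definition inner Om h k := forall x, `|x - pt h k| <= 4 * h -> Om x.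

Lemma inner_near Om h k x : 0 < h -> inner Om h k ->
  (forall i, `|k 0 i - idx h x 0 i| <= 1) -> Om x.
Proof.
move=> h0 Hk kx; apply: Hk; apply: rV_norm_le => [|i]; first by rewrite mulr_ge0// ltW.
have ptE l : pt h l 0 i = h * (l 0 i)%:~R by rewrite mxE.
have -> : (x - pt h k) 0 i = x 0 i - h * (k 0 i)%:~R by rewrite mxE [X in _ + X]mxE ptE.
have /andP[H1 H2] := idx_dist x i h0; move: H1 H2; rewrite !ptE.
have {}kx : `|(k 0 i - idx h x 0 i)%:~R| <= 1 :> R by rewrite -intr_norm (ler_int _ _ 1).
move: kx; rewrite intrB; set a := (k 0 i)%:~R; set b := (idx h x 0 i)%:~R : R.
rewrite ler_norml => /andP[k1 k2] H1 H2.
have E : h * a - h * b = h * (a - b) by ring.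
have l1 : - h <= h * (a - b) by rewrite -[leLHS]mulr1 mulNr -mulrN ler_pM2l.
have l2 : h * (a - b) <= h by rewrite -[leRHS]mulr1 ler_pM2l.
by rewrite ler_norml; apply/andP; split; lra.
Qed.

(** Boundedness of [Om] puts the inner indices of level [n] in a cube of side of order [2^n], from
    which they are extracted by filtering. *)
Lemma inner_lattice Om : bounded_set Om -> exists (B : R) (I : nat -> seq 'rV[int]_N),
  [/\ 0 <= B, forall n, uniq (I n), forall n k, k \in I n <-> inner Om (2 ^- n) k &
    forall n k i, k \in I n -> `|(k 0 i)%:~R| <= B * 2 ^+ n].
Proof.
move=> [M0 [_ HM]]; pose B := `|M0| + 1.
have B0 : 0 <= B by rewrite addr_ge0.
have OB x : Om x -> `|x| <= B by apply: HM; rewrite ltr_pwDr// ler_norm.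
have inB n k i : inner Om (2 ^- n) k -> `|(k 0 i)%:~R| <= B * 2 ^+ n.
  have h0 : 0 < 2 ^- n :> R by rewrite invr_gt0 exprn_gt0.
  move=> Hk; have /OB Op : Om (pt (2 ^- n) k) by apply: Hk; rewrite subrr normr0 mulr_ge0// ltW.
  have := le_trans (rV_normP (pt (2 ^- n) k) i) Op; rewrite mxE normrM.
  by rewrite (ger0_norm (ltW h0)) mulrC ler_pdivrMr// exprn_gt0.
have [M HM'] : exists M : nat -> nat, forall n, B * 2 ^+ n <= (M n)%:R.
  exists (fun n => (Num.truncn (B * 2 ^+ n)).+1) => n.
  by rewrite ltW//; have /andP[] := truncn_itv (mulr_ge0 B0 (exprn_ge0 n (ler0n R 2))).
pose z n (c : {ffun 'I_N -> 'I_(M n + M n).+1}) : 'rV[int]_N := \row_i ((c i)%:Z - (M n)%:Z).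
pose I n := undup [seq k <- [seq z n c | c <- enum {ffun 'I_N -> 'I_(M n + M n).+1}] |
  `[< inner Om (2 ^- n) k >]].
have II n k : k \in I n <-> inner Om (2 ^- n) k.
  rewrite mem_undup mem_filter; split=> [/andP[/asboolP//]|Hk].
  apply/andP; split; first exact/asboolP.
  have kM i : `|k 0 i| <= (M n)%:Z.
    by rewrite -(ler_int R) intr_norm; apply: le_trans (inB n k i Hk) _; exact: HM'.
  apply/mapP; exists [ffun i => inord `|(k 0 i + (M n)%:Z)%R|%N]; first by rewrite mem_enum.
  apply/rowP => i; rewrite mxE ffunE; have ki := kM i.
  rewrite inordK; first by move: ki; move: (k 0 i) (M n) => a b; clear; lia.
  by move: ki; move: (k 0 i) (M n) => a b; clear; lia.
exists B, I; split=> // [n|n k i /II]; first exact: undup_uniq.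
exact: inB.
Qed.

(** Compactness makes the distance to the complement uniform. Hence the lattice restriction of any
    test function is eventually supported on inner nodes and admissible in the scheme. *)
Lemma compact_inner Om K : open Om -> compact K -> K `<=` Om ->
  exists n0, forall n k, (n0 <= n)%N -> K (pt (2 ^- n) k) -> inner Om (2 ^- n) k.
Proof.
move=> oO /compact_near_coveringP cK KO.
have [|n0 _ Hn] := cK nat \oo (fun n x => forall y, `|y - x| <= 4 * 2 ^- n -> Om y) _ _.
  move=> x Kx; have /nbhs_ballP[d /= d0 Hd] : nbhs x Om by apply: open_nbhs_nbhs; split=> //; exact: KO.
  have d8 : 0 < d / 8 by rewrite divr_gt0.
  have [k _ Hk] := near_infty_natSinv_expn_lt (PosNum d8).
  exists (ball x (d / 2), [set n | (k <= n)%N]).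
    split=> /=; first by apply: nbhsx_ballx; exact: divr_gt0.
    by exists k.
  move=> [x' n] [/= xx' kn] y yx; apply: Hd; rewrite -ball_normE /=.
  have := Hk n kn; rewrite /= div1r => h8.
  move: xx'; rewrite -ball_normE /= => xx'.
  rewrite (_ : x - y = (x - x') - (y - x')); last by rewrite opprB addrA subrK.
  apply: le_lt_trans (ler_normB _ _) _.
  by move: xx' yx h8; move: `|x - x'| `|y - x'| (2 ^- n) => s t u; lra.
exists n0 => n k nn Kk x; exact: (Hn n nn _ Kk).
Qed.

End inner_cells.

Section discrete_solutions.
Context (R : realType) (N : nat).
Notation mu := (leb R N).
Notation mf f := (measurable_fun [set: Rn R N] (f : Rn R N -> R)).
Notation intg f := (mu.-integrable [set: Rn R N] (EFin \o (f : Rn R N -> R))).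
Notation Int f := (\int[mu]_x (f : Rn R N -> R) x).
Variables (Om : set 'rV[R]_N) (A : 'rV[R]_N -> R -> R) (f : 'rV[R]_N -> R)
  (E : 'I_N -> 'rV[R]_N -> R) (th g m r al be : R).
Hypotheses (N0 : (0 < N)%N) (mOm : measurable (Om : set (Rn R N)))
  (Om_bd : bounded_set Om).
Hypotheses (m2 : 2 <= m) (mth : m < th + 2) (th0 : 0 < th) (g0 : 0 < g)
  (thg : 0 < 2 - th - 2 * g) (al0 : 0 < al) (be0 : 0 < be).
Hypothesis Am : forall s, mf (A ^~ s).
Hypothesis Ale : forall x s t, s <= t ->
  al * Mx s t `^ (- th) * (t - s) <= A x t - A x s <= be * (t - s).
Hypotheses (fm : mf f) (f_off : forall x, ~ Om x -> f x = 0)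
  (fi : intg (fun x => `|f x| `^ m)).
Hypotheses (Em : forall e, mf (E e)) (E_off : forall e x, ~ Om x -> E e x = 0)
  (rm : m / (2 - th - 2 * g) <= r) (Ei : forall e, intg (fun x => `|E e x| `^ (2 * r))).

Definition sobolev_exp := 2 * m / (th + 2).
Notation q := sobolev_exp.

(** The lower bound comes from [m >= 2] and [th < 2], the upper one from [m < th + 2]. *)
Lemma sobolev_exp_itv : 1 < q < 2.
Proof.
have t2 : 0 < th + 2 by move: th0; lra.
rewrite /q ltr_pdivlMr// ltr_pdivrMr//; apply/andP; split; last by move: mth; lra.
by move: m2 thg g0; lra.
Qed.

Lemma exponent_r1 : 1 <= r.
Proof.
apply: le_trans rm; rewrite ler_pdivlMr// mul1r; by move: m2 th0 g0; lra.
Qed.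

Lemma discrete_solutions : exists (C B : R) (I : nat -> seq 'rV[int]_N)
  (U : nat -> 'rV[int]_N -> R), 0 <= C /\ 0 <= B /\ forall n,
  [/\ uniq (I n), forall k, k \in I n <-> inner Om (2 ^- n) k,
    forall k i, k \in I n -> `|(k 0 i)%:~R| <= B * 2 ^+ n &
    forall k, k \notin I n -> U n k = 0] /\
  [/\ intg (fun x => `|U n (idx (2 ^- n) x)| `^ m) /\
      Int (fun x => `|U n (idx (2 ^- n) x)| `^ m) <= C,
    forall e, intg (fun x => `|(U n (idx (2 ^- n) x + dir e) - U n (idx (2 ^- n) x)) / 2 ^- n| `^ q) /\
      Int (fun x => `|(U n (idx (2 ^- n) x + dir e) - U n (idx (2 ^- n) x)) / 2 ^- n| `^ q) <= C &
    forall ps : 'rV[int]_N -> R, (forall k, k \notin I n -> ps k = 0) ->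
    [/\ intg (fun x => f x * ps (idx (2 ^- n) x)),
      forall e, intg (fun x => flux (A x) g (2 ^- n) (E e x) (U n (idx (2 ^- n) x)) (U n (idx (2 ^- n) x + dir e)) *
        ((ps (idx (2 ^- n) x) - ps (idx (2 ^- n) x + dir e)) / 2 ^- n)) &
      Int (fun x => U n (idx (2 ^- n) x) * ps (idx (2 ^- n) x)) +
      \sum_e Int (fun x => flux (A x) g (2 ^- n) (E e x) (U n (idx (2 ^- n) x)) (U n (idx (2 ^- n) x + dir e)) *
        ((ps (idx (2 ^- n) x) - ps (idx (2 ^- n) x + dir e)) / 2 ^- n)) =
      Int (fun x => f x * ps (idx (2 ^- n) x))]].
Proof.
have [B [I [B0 uI IP IB]]] := inner_lattice Om_bd.
have Om_fin : (mu Om < +oo)%E by exact: leb_bounded.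
have [m24 g01 m0] : [/\ 2 <= m <= 4, 0 < g < 1 & 0 < m].
  by split; move: m2 mth th0 g0 thg; lra.
have h0 n : 0 < 2 ^- n :> R by rewrite invr_gt0 exprn_gt0.
have r1 := exponent_r1.
have q02 : 0 < q < 2 by have := sobolev_exp_itv; lra.
have qE : (th + 2) * q = 2 * m.
  by rewrite /q mulrC divfK//; move: th0; lra.
have [C HC] := @a_priori_bounds R _ (Rn R N) mu N Om f E th g m r al q mOm Om_fin m24 al0 g01
  th0 thg rm mth q02 qE N0 f_off fi E_off Ei.
have /choice[U HU] n := scheme_solution N0 mOm Om_fin m24 g01 al0 be0 Am Ale fm f_off fi Em E_off
  r1 Ei (h0 n) (uI n).
have UI n k : k \notin I n -> U n k = 0 by case: (HU n) => H _; exact: H.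
have bound n : Int (fun x => `|U n (idx (2 ^- n) x)| `^ m) <= C /\
  forall e, intg (fun x => `|(U n (idx (2 ^- n) x + dir e) - U n (idx (2 ^- n) x)) / 2 ^- n| `^ q) /\
    Int (fun x => `|(U n (idx (2 ^- n) x + dir e) - U n (idx (2 ^- n) x)) / 2 ^- n| `^ q) <= C.
  have i2 (Psi : R -> R -> R) e : Psi 0 0 = 0 ->
      intg (fun x => Psi (U n (idx (2 ^- n) x)) (U n (idx (2 ^- n) x + dir e))).
    by move=> P0; apply: (intg_lat2 N0 (dir e) (h0 n) (uI n) (UI n) P0).
  have i1 (Psi : R -> R) : Psi 0 = 0 -> intg (fun x => Psi (U n (idx (2 ^- n) x))).
    by move=> P0; exact: (i2 (fun s _ => Psi s) (Ordinal N0) P0).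
  have pm0 : `|0 : R| `^ m = 0 by rewrite normr0 powR0// lt0r_neq0.
  (* Since [psi m] vanishes at 0, [psi m (U n)] is an admissible test sequence for the scheme. *)
  have psI k : k \notin I n -> psi m (U n k) = 0 by move=> /UI ->; rewrite /psi mul0r.
  have [e1 e2 e3] := (HU n).2 (fun k => psi m (U n k)) psI.
  apply: (HC (2 ^- n) A (fun x => U n (idx (2 ^- n) x))
    (fun e x => U n (idx (2 ^- n) x + dir e)) (h0 n)).
  - by move=> x s t st; have /andP[] := Ale x st.
  - exact: measurable_lat.
  - by move=> e; exact: (measurable_lat (h0 n) (fun k => U n (k + dir e))).
  (* Off [Om] neither the cell of [x] nor its neighbour is inner, so both values are 0. *)
  - move=> e x Ox; have off (z : 'rV[int]_N) : (forall i, `|z 0 i| <= 1) -> U n (idx (2 ^- n) x + z) = 0.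
      move=> z1; apply: UI; apply/negP => /IP Hk; apply: Ox; apply: (inner_near (h0 n) Hk) => i.
      by rewrite mxE addrAC subrr add0r.
    rewrite (off (dir e)); last by move=> i; rewrite mxE; case: (_ && _).
    by rewrite -{1}[idx _ _]addr0 off// => i; rewrite mxE normr0.
  - exact: (i1 (fun s => `|s| `^ m)).
  - by apply: (i1 (fun s => s * psi m s)); rewrite mul0r.
  - by move=> e; exact: (i2 (fun _ t => `|t| `^ m) e).
  - move=> e; rewrite (_ : (fun x => `|U n (idx (2 ^- n) x + dir e)| `^ m) =
        (fun x => `|U n (idx (2 ^- n) (x + pt (2 ^- n) (dir e)))| `^ m)).
      by apply: (Int_translate (f := fun x => `|U n (idx (2 ^- n) x)| `^ m)); exact: (i1 (fun s => `|s| `^ m)).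
    by apply/funext => x; rewrite idx_translate.
  - move=> e; apply: (i2 (fun s t => Mx s t `^ (m - 2 - th) * ((t - s) / 2 ^- n) ^+ 2)).
    by rewrite subrr mul0r expr0n mulr0.
  - exact: e1.
  - exact: e2.
  - exact: e3.
exists (Num.max 0 C), B, I, U; split; first by rewrite le_max lexx.
split=> // n; have [b1 b2] := bound n; split; first exact: (And4 (uI n) (IP n) (IB n) (UI n)).
split.
- split; last by rewrite le_max b1 orbT.
  apply: (intg_lat2 N0 0 (h0 n) (uI n) (UI n) (Psi := fun s _ => `|s| `^ m)).
  by rewrite normr0 powR0// lt0r_neq0.
- by move=> e; have [? b] := b2 e; split=> //; rewrite le_max b orbT.
- exact: (HU n).2.
Qed.

End discrete_solutions.

Lemma ae_imp d (T : measurableType d) (R : realType) (mu : {measure set T -> \bar R})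
    (P Q : T -> Prop) :
  {ae mu, forall x, P x} -> (forall x, P x -> Q x) -> {ae mu, forall x, Q x}.
Proof. by move=> HP PQ; apply: filterS HP. Qed.

Lemma cvg_norm_powR (R : realType) (p l : R) (a : nat -> R) : 0 < p ->
  a n @[n --> \oo] --> l -> `|a n| `^ p @[n --> \oo] --> `|l| `^ p.
Proof.
move=> p0 al; apply: (@continuous_cvg _ _ _ _ _ a (fun y : R => `|y| `^ p) l) => //.
exact: continuous_norm_powR.
Qed.

(** * The limit and its gradient *)

Section limit.
Context (R : realType) (N : nat).
Notation mu := (leb R N).
Notation mf f := (measurable_fun [set: Rn R N] (f : Rn R N -> R)).
Notation intg f := (mu.-integrable [set: Rn R N] (EFin \o (f : Rn R N -> R))).
Notation Int f := (\int[mu]_x (f : Rn R N -> R) x).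
Notation bas i := (delta_mx 0 i : 'rV[R]_N).

Lemma partial_off Om (f : 'rV[R]_N -> R) i x : test_function Om f -> ~ Om x ->
  f x = 0 /\ partial_deriv i f x = 0.
Proof.
move=> [_ _ fO] Ox; have xs : ~ closure [set y | f y != 0] x by move=> /fO.
have near0 : \forall y \near x, f y = 0.
  have : nbhs x (~` closure [set y | f y != 0]).
    by apply: open_nbhs_nbhs; split=> //; apply: closed_openC; exact: closed_closure.
  apply: filterS => y ys; apply/eqP; apply: contrapT => /negP fy.
  by apply: ys; exact: subset_closure.
split; first exact: nbhs_singleton near0.
by rewrite /partial_deriv (@near_eq_derive _ _ _ _ (fun=> (0 : R))) ?derive_cst.
Qed.

Lemma pt_dir h e : pt h (dir e) = h *: bas e.
Proof. by apply/rowP => i; rewrite !mxE; case: (_ && _); rewrite ?mulr1 ?mulr0. Qed.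

(** [Int_product_cvg0] is used with the exponent [Q] dual to [q] and the fixed factor [\1_B];
    dualizing twice returns [q]. *)
Lemma Lq_L1_cvg0 (B : set (Rn R N)) (q : R) (b : nat -> 'rV[R]_N -> R) :
  measurable B -> (mu B < +oo)%E -> 1 < q -> (forall n, mf (b n)) ->
  (forall n x, ~ B x -> b n x = 0) -> (forall n, intg (fun x => `|b n x| `^ q)) ->
  Int (fun x => `|b n x| `^ q) @[n --> \oo] --> 0 ->
  Int (fun x => `|b n x|) @[n --> \oo] --> 0.
Proof.
move=> mB Bfin q1 bm b0 bi bc; pose Q := q / (q - 1).
have q10 : 0 < q - 1 by rewrite subr_gt0.
have Q1 : 1 < Q by rewrite /Q ltr_pdivlMr// mul1r gtrBl.
have Q0 : Q != 0 by rewrite lt0r_neq0// (lt_trans ltr01).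
have QQ : Q / (Q - 1) = q.
  have Q1E : Q - 1 = (q - 1)^-1 by rewrite /Q; field; exact: lt0r_neq0.
  by rewrite Q1E invrK /Q divfK// lt0r_neq0.
have nE n : (fun x => `| `|b n x| | `^ q) = (fun x => `|b n x| `^ q).
  by apply/funext => x; rewrite normr_id.
have BE : (fun x => `|\1_B x| `^ Q) = (\1_B : Rn R N -> R).
  apply/funext => x; rewrite indicE; case: (_ \in _); rewrite ?normr1 ?normr0 ?powR1//.
  by rewrite powR0.
have iB : intg (\1_B : Rn R N -> R) by exact: intg_indic.
have bm' n : mf (fun x => `|b n x|) := measurableT_comp (@normr_measurable R setT) (bm n).
have [_ c1] := @Int_product_cvg0 _ (Rn R N) R mu Q (Int (\1_B : Rn R N -> R))
  (fun n x => `|b n x|) (fun=> \1_B) Q1 bm' (fun=> measurable_indic mB)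
  (fun n => ltac:(by rewrite BE; split))
  (fun n => ltac:(by rewrite QQ nE; exact: bi))
  ltac:(by rewrite QQ; under eq_fun do rewrite nE; exact: bc).
rewrite (_ : (fun n => _) = (fun n => Int (fun x => `|b n x| * \1_B x)))//.
apply/funext => n; congr Rintegral; apply/funext => x; rewrite indicE.
have [_|/negP xB] := boolP (x \in B); first by rewrite mulr1.
by rewrite b0 ?normr0 ?mul0r// => xB'; apply: xB; rewrite inE.
Qed.

Section combination.
Variables (B : set (Rn R N)) (q : R) (F : nat -> 'rV[R]_N -> R) (H : 'rV[R]_N -> R)
  (K : nat -> nat) (c : nat -> nat -> R).
Hypotheses (mB : measurable B) (Bfin : (mu B < +oo)%E) (q1 : 1 < q)
  (Fm : forall n, mf (F n)) (Hm : mf H)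
  (F0 : forall n x, ~ B x -> F n x = 0) (H0 : forall x, ~ B x -> H x = 0)
  (Fi : forall n, intg (fun x => `|F n x| `^ q)) (Hi : intg (fun x => `|H x| `^ q))
  (cw : forall k, tail_weights k (K k) (c k))
  (WH : forall e, 0 < e -> exists n0, forall k, (n0 <= k)%N ->
     intg (fun x => `|\sum_(n < K k) c k n * F n x - H x| `^ q) /\
     Int (fun x => `|\sum_(n < K k) c k n * F n x - H x| `^ q) <= e).

(** Integration is linear in the combination, and strong convergence in [L^q] on a set of finite
    measure gives convergence in [L^1], which is then paired with a bounded function. *)
Lemma combination_limit (f : 'rV[R]_N -> R) M : mf f -> (forall x, `|f x| <= M) ->
  \sum_(n < K k) c k n * Int (fun x => F n x * f x) @[k --> \oo] --> Int (fun x => H x * f x).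
Proof.
move=> fm fM; have q0 : 0 < q by apply: lt_trans q1.
have Fi1 n : intg (F n) by apply: (intg_of_powR mB Bfin (ltW q1) (Fm n) (F0 n) (Fi n)).
have Hi1 : intg H by apply: (intg_of_powR mB Bfin (ltW q1) Hm H0 Hi).
have Ffi n : intg (fun x => F n x * f x) by exact: intg_mul_bounded (Fi1 n) fm fM.
have Hfi : intg (fun x => H x * f x) by exact: intg_mul_bounded Hi1 fm fM.
pose W k x := \sum_(n < K k) c k n * F n x.
have Wm k : mf (W k).
  by apply: measurable_sum => n; apply: measurable_funM => //; exact: measurable_cst.
have WE k : Int (fun x => W k x * f x) = \sum_(n < K k) c k n * Int (fun x => F n x * f x).
  have -> : (fun x => W k x * f x) = (fun x => \sum_(n < K k) c k n * (F n x * f x)).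
    by apply/funext => x; rewrite /W mulr_suml; apply: eq_bigr => n _; rewrite mulrA.
  rewrite (@Int_sum _ (Rn R N) R mu _ _ (fun (n : 'I_(K k)) x => c k n * (F n x * f x))); last first.
    by move=> n; exact: intgZ.
  by apply: eq_bigr => n _; rewrite IntZ.
have Wfi k : intg (fun x => W k x * f x).
  have -> : (fun x => W k x * f x) = (fun x => \sum_(n < K k) c k n * (F n x * f x)).
    by apply/funext => x; rewrite /W mulr_suml; apply: eq_bigr => n _; rewrite mulrA.
  by apply: (@intg_sum _ (Rn R N) R mu _ _ (fun (n : 'I_(K k)) x => c k n * (F n x * f x))) => n; exact: intgZ.
have [n1 Hn1] := WH ltr01.
pose bb k x := W (n1 + k)%N x - H x.
have bm k : mf (bb k) by exact: measurable_funB (Wm _) Hm.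
have b0 k x : ~ B x -> bb k x = 0.
  move=> xB; rewrite /bb H0// subr0 /W big1// => n _.
  by rewrite F0// mulr0.
have bi k : intg (fun x => `|bb k x| `^ q) by case: (Hn1 (n1 + k)%N (leq_addr _ _)).
have bc : Int (fun x => `|bb k x| `^ q) @[k --> \oo] --> 0.
  apply/cvgr0Pnorm_le => e e0; have [n2 Hn2] := WH e0.
  near=> k; rewrite ger0_norm; last by apply: Int_ge0 => x; exact: powR_ge0.
  apply: (Hn2 (n1 + k)%N _).2; rewrite (leq_trans _ (leq_addl _ _))//.
  by near: k; exact: nbhs_infty_ge.
have bi1 k : intg (bb k) by apply: (intg_of_powR mB Bfin (ltW q1) (bm k) (b0 k) (bi k)).
have b1 := Lq_L1_cvg0 mB Bfin q1 bm b0 bi bc.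
have bfi k : intg (fun x => bb k x * f x) by exact: intg_mul_bounded (bi1 k) fm fM.
have c2 : Int (fun x => bb k x * f x) @[k --> \oo] --> 0.
  apply/norm_cvg0P; apply: (@squeeze_cvgr _ _ _ _ (fun=> 0)
    (fun k => M * Int (fun x => `|bb k x|))); [|exact: cvg_cst|].
    apply: nearW => k; rewrite normr_ge0/= -(IntZ M (intg_norm (bi1 k))).
    apply: le_trans (norm_Int (bfi k)) _; apply: le_Int.
    - exact: intg_norm.
    - exact: intgZ (intg_norm (bi1 k)).
    - by move=> x; rewrite normrM mulrC ler_wpM2r.
  by rewrite -[X in _ --> X](mulr0 M); apply: cvgM b1; exact: cvg_cst.
have E k : Int (fun x => bb k x * f x) =
    Int (fun x => W (n1 + k)%N x * f x) - Int (fun x => H x * f x).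
  by rewrite -(IntB (Wfi _) Hfi); congr Rintegral; apply/funext => x; rewrite mulrBl.
apply/cvgrPdist_le => e e0; have [n2 _ Hn2] := cvgr0_norm_le _ c2 _ e0.
near=> k; have kn : (n1 + n2 <= k)%N by near: k; exact: nbhs_infty_ge.
have n1k : (n1 <= k)%N by apply: leq_trans kn; exact: leq_addr.
have := Hn2 (k - n1)%N; rewrite /= leq_subRL// => /(_ kn).
by rewrite E subnKC// WE distrC.
Unshelve. all: by end_near. Qed.

End combination.

Variables (Om : set 'rV[R]_N) (q m C : R) (h : nat -> R) (I : nat -> seq 'rV[int]_N)
  (U : nat -> 'rV[int]_N -> R) (u : 'rV[R]_N -> R).
Hypotheses (N0 : (0 < N)%N) (oOm : open Om) (bOm : bounded_set Om) (q12 : 1 < q < 2) (m2 : 2 <= m)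
  (h01 : forall n, 0 < h n <= 1) (hc : h n @[n --> \oo] --> 0)
  (uI : forall n, uniq (I n)) (IP : forall n k, k \in I n -> inner Om (h n) k)
  (UI : forall n k, k \notin I n -> U n k = 0).
Notation un n := (fun x : 'rV[R]_N => U n (idx (h n) x)).
Notation D n e := (fun x : 'rV[R]_N => (U n (idx (h n) x + dir e) - U n (idx (h n) x)) / h n).
Hypotheses (Um : forall n, intg (fun x => `|un n x| `^ m) /\ Int (fun x => `|un n x| `^ m) <= C)
  (UD : forall n e, intg (fun x => `|D n e x| `^ q) /\ Int (fun x => `|D n e x| `^ q) <= C)
  (um : mf u) (uO : forall x, ~ Om x -> u x = 0)
  (uc : {ae mu, forall x, U n (idx (h n) x) @[n --> \oo] --> u x}).

Let h0 n : 0 < h n. Proof. by case/andP: (h01 n). Qed.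
Let mOm : measurable (Om : set (Rn R N)). Proof. exact: open_measurable_Rn. Qed.
Let Ofin : (mu Om < +oo)%E. Proof. exact: leb_bounded. Qed.
Let q1 : 1 < q. Proof. by case/andP: q12. Qed.
Let q0 : 0 < q. Proof. exact: lt_trans q1. Qed.
Let m0 : 0 < m. Proof. by move: m2; lra. Qed.

Let unm n : mf (un n). Proof. exact: measurable_lat. Qed.

Lemma lattice_off n (z : 'rV[int]_N) x : (forall i, `|z 0 i| <= 1) -> ~ Om x ->
  U n (idx (h n) x + z) = 0.
Proof.
move=> z1 Ox; apply: UI; apply/negP => /IP Hk; apply: Ox; apply: (inner_near (h0 n) Hk) => i.
by rewrite mxE addrAC subrr add0r.
Qed.

Let un0 n x : ~ Om x -> un n x = 0.
Proof.
by move=> Ox /=; rewrite -[idx _ _]addr0 lattice_off// => i; rewrite mxE normr0.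
Qed.

Let D0 n e x : ~ Om x -> D n e x = 0.
Proof.
move=> Ox /=; have /= -> := un0 n Ox; rewrite lattice_off ?subrr ?mul0r// => i.
by rewrite mxE; case: (_ && _).
Qed.

Let Dm n e : mf (D n e).
Proof.
apply: (measurable_funM (g := fun=> (h n)^-1)); last exact: measurable_cst.
by apply: measurable_funB; [exact: (measurable_lat (h0 n) (fun k => U n (k + dir e)))|exact: unm].
Qed.

Lemma limit_integrable : intg (fun x => `|u x| `^ m) /\ Int (fun x => `|u x| `^ m) <= C.
Proof.
apply: (@Int_fatou _ (Rn R N) R mu (fun n x => `|un n x| `^ m)).
- by move=> n; case: (Um n).
- exact: (@measurable_norm_powR _ (Rn R N) R u m um).
- by move=> n x; exact: powR_ge0.
- by move=> x; exact: powR_ge0.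
- apply: (@ae_imp _ (Rn R N) R mu _ _ uc) => x ux; exact: cvg_norm_powR.
- by move=> n; case: (Um n).
Qed.

Let diff_m n : intg (fun x => `|un n x - u x| `^ m) /\
  Int (fun x => `|un n x - u x| `^ m) <= 2 `^ m * (C + C).
Proof.
have [u1 u2] := limit_integrable; have [v1 v2] := Um n.
have iB : intg (fun x => 2 `^ m * (`|un n x| `^ m + `|u x| `^ m)) by apply: intgZ; exact: intgD.
have dm : mf (fun x => `|un n x - u x| `^ m).
  exact: (@measurable_norm_powR _ (Rn R N) R (fun x => un n x - u x) m (measurable_funB (unm n) um)).
have le x : `|un n x - u x| `^ m <= 2 `^ m * (`|un n x| `^ m + `|u x| `^ m).
  by have := ler_powRD (un n x) (- u x) (ltW m0); rewrite normrN.
have iD : intg (fun x => `|un n x - u x| `^ m).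
  apply: intg_dom dm _ iB => x; rewrite (ger0_norm (powR_ge0 _ _)); exact: le.
split=> //; apply: le_trans (le_Int iD iB le) _.
by rewrite IntZ ?IntD//; [rewrite ler_wpM2l ?powR_ge0// lerD|exact: intgD].
Qed.

Let diff_ae : {ae mu, forall x, un n x - u x @[n --> \oo] --> 0}.
Proof.
apply: (@ae_imp _ (Rn R N) R mu _ _ uc) => x ux; rewrite -(subrr (u x)).
by apply: cvgB ux _; exact: cvg_cst.
Qed.

Let diff0 n x : ~ Om x -> un n x - u x = 0.
Proof. by move=> Ox; have /= -> := un0 n Ox; rewrite uO// subrr. Qed.

Lemma limit_L1 : [/\ forall n, intg (un n), intg u &
  Int (fun x => `|un n x - u x|) @[n --> \oo] --> 0].
Proof.
have m1 : 1 < m by move: m2; lra.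
have [_ c1] := @Int_vitali _ (Rn R N) R mu Om (fun n x => un n x - u x) m _ m1 mOm Ofin
  (fun n => measurable_funB (unm n) um) diff0 diff_m diff_ae.
split=> // [n|].
  by apply: (intg_of_powR mOm Ofin (ltW m1) (unm n) (un0 n) (Um n).1).
by apply: (intg_of_powR mOm Ofin (ltW m1) um uO limit_integrable.1).
Qed.

(** Vitali's theorem is applied to [|un - u|^q], whose moment of exponent [m / q > 1] is the bound
    in [L^m]. *)
Lemma limit_Lq : (forall n, intg (fun x => `|un n x - u x| `^ q)) /\
  Int (fun x => `|un n x - u x| `^ q) @[n --> \oo] --> 0.
Proof.
have mq : 1 < m / q by rewrite ltr_pdivlMr// mul1r; move: m2 q12; lra.
have pE n x : `| `|un n x - u x| `^ q | `^ (m / q) = `|un n x - u x| `^ m.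
  by rewrite (ger0_norm (powR_ge0 _ _)) -powRrM mulrCA divff ?mulr1// lt0r_neq0.
pose G n (x : 'rV[R]_N) := `|un n x - u x| `^ q.
have Gm n : mf (G n).
  exact: (@measurable_norm_powR _ (Rn R N) R (fun x => un n x - u x) q (measurable_funB (unm n) um)).
have G0 n x : ~ Om x -> G n x = 0.
  by move=> Ox; rewrite /G (diff0 n Ox) normr0 powR0// lt0r_neq0.
have Gb n : intg (fun x => `|G n x| `^ (m / q)) /\
    Int (fun x => `|G n x| `^ (m / q)) <= 2 `^ m * (C + C).
  rewrite (_ : (fun x => `|G n x| `^ (m / q)) = (fun x => `|un n x - u x| `^ m)); first exact: diff_m.
  by apply/funext => x; exact: pE.
have Gc : {ae mu, forall x, G n x @[n --> \oo] --> 0}.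
  apply: (@ae_imp _ (Rn R N) R mu _ _ diff_ae) => x dx.
  have := cvg_norm_powR q0 dx.
  by rewrite normr0 powR0// lt0r_neq0.
have [i1 c1] := @Int_vitali _ (Rn R N) R mu Om G (m / q) _ mq mOm Ofin Gm G0 Gb Gc.
split=> //; rewrite (_ : (fun n => _) = (fun n => Int (fun x => `| `|un n x - u x| `^ q |)))//.
by apply/funext => n; congr Rintegral; apply/funext => x; rewrite (ger0_norm (powR_ge0 _ _)).
Qed.

Let v n := interp (h n) (I n) (U n).

(** The support lies in a finite union of closed balls of radius [2 h n] around inner nodes, all
    contained in [Om]. *)
Let test_v n : test_function Om (v n).
Proof.
have vB x : v n x != 0 -> exists2 k, k \in I n & `|x - pt (h n) k| <= 2 * h n.
  exact: interp_support.
pose B := \big[setU/set0]_(k <- I n) [set x : 'rV[R]_N | `|x - pt (h n) k| <= 2 * h n].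
have cB : closed B.
  rewrite /B; elim: (I n) => [|k s IH]; first by rewrite big_nil; exact: closed0.
  rewrite big_cons; apply: closedU => //.
  rewrite (_ : [set x | _] = closed_ball_ Num.norm (pt (h n) k) (2 * h n)).
    exact: closed_closed_ball_.
  by apply/seteqP; split=> x /=; rewrite /closed_ball_ /= distrC.
have BO : B `<=` Om.
  rewrite /B => x; rewrite -bigcup_seq => -[k /= kI xk]; apply: (IP kI).
  by apply: le_trans xk _; rewrite ler_pM2r// ler_nat.
have clB : closure [set x | v n x != 0] `<=` B.
  rewrite (closure_id B).1//; apply: closureS => x /vB[k kI xk].
  by rewrite /B -bigcup_seq; exists k.
split; first by apply: smooth_Dn => k; exact: Dn_interp.
- apply: bounded_closed_compact; last exact: closed_closure.
  have [M0 [Mr HM]] := bOm; exists M0; split=> // y My x Hx.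
  by apply: HM My _ _; apply: BO; exact: clB.
- exact: subset_trans clB BO.
Qed.

Let v_bounds : exists2 C', 0 <= C' & forall n,
  [/\ intg (fun x => `|v n x - un n x| `^ q), Int (fun x => `|v n x - un n x| `^ q) <= C' * h n `^ q &
   forall e, intg (fun x => `|partial_deriv e (v n) x| `^ q) /\ Int (fun x => `|partial_deriv e (v n) x| `^ q) <= C'].
Proof.
have [K [K0 HK]] := @interp_estimates R N q N0 q0.
have C0 : 0 <= C by apply: le_trans (UD 0 (Ordinal N0)).2; apply: Int_ge0 => x; exact: powR_ge0.
exists (K * C); first exact: mulr_ge0.
move=> n; have [|[i1 i2] i3] := HK (h n) C (I n) (U n) (h0 n) (uI n) (@UI n).
  move=> e; have [d1 d2] := UD n e.
  rewrite (_ : (fun x => _) = (fun x => h n `^ q * `|D n e x| `^ q)); last first.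
    apply/funext => x; rewrite normrM normfV (gtr0_norm (h0 n)) powRM//; last by rewrite invr_ge0 ltW.
    rewrite mulrCA -powRM ?invr_ge0 ?(ltW (h0 n))// divff ?lt0r_neq0//.
    by rewrite powR1 mulr1.
  by rewrite IntZ// ler_wpM2l ?powR_ge0.
by split=> //; rewrite -mulrA [C * _]mulrC.
Qed.

Lemma cvg_test_difference e f M : C1c M f ->
  Int (fun x => D n e x * f x) @[n --> \oo] --> - Int (fun x => u x * partial_deriv e f x).
Proof.
move=> fM; have [l1 l2 l3] := limit_L1.
have H := @cvg_Int_difference R N M f e h (fun n => un n) u fM h01 hc l1 l2 l3.
rewrite (_ : (fun n => _) = (fun n => Int (fun x => (U n (idx (h n) (x + h n *: bas e)) -
  U n (idx (h n) x)) / h n * f x)))//.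
apply/funext => n; congr Rintegral; apply/funext => x.
by rewrite -pt_dir idx_translate.
Qed.

(** The derivative is moved to [f]; the interpolant differs from the lattice function by order [h n]
    in [L^q], so both tend to [u] in [L^1]. *)
Lemma cvg_test_interp e f : test_function setT f ->
  Int (fun x => partial_deriv e (v n) x * f x) @[n --> \oo] -->
    - Int (fun x => u x * partial_deriv e f x).
Proof.
move=> /test_C1c[M fM]; have [C' C'0 vb] := v_bounds.
have vC n : exists M', C1c M' (v n) by exact: test_C1c (test_v n).
have E n : Int (fun x => partial_deriv e (v n) x * f x) =
    - Int (fun x => v n x * partial_deriv e f x).
  have [M' vM'] := vC n.
  apply: (@C1c_by_parts R N (Num.max M M')).
    by apply: (C1cW _ vM'); rewrite le_max lexx orbT.
  by apply: (C1cW _ fM); rewrite le_max lexx.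
have [l1 l2 l3] := limit_L1; have [c1 c2] := limit_Lq.
have vm n : mf (v n).
  by have [M' vM'] := vC n; case: (C1c_measurable vM').
have v0 n x : ~ Om x -> v n x = 0 by move=> Ox; case: (partial_off e (test_v n) Ox).
have vu n : intg (fun x => v n x - un n x).
  have [b1 _ _] := vb n; apply: (intg_of_powR mOm Ofin (ltW q1) _ _ b1).
    exact: (measurable_funB (vm n) (unm n)).
  by move=> x Ox; rewrite v0// (un0 n Ox) subrr.
have vi n : intg (v n).
  have := intgD (vu n) (l1 n); rewrite (_ : (fun x => _ + _) = v n)//.
  by apply/funext => x; rewrite subrK.
have hq : Int (fun x => `|v n x - un n x| `^ q) @[n --> \oo] --> 0.
  apply: (@squeeze_cvgr _ _ _ _ (fun=> 0) (fun n => C' * h n `^ q)); [|exact: cvg_cst|].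
    apply: nearW => n; have [_ b2 _] := vb n; rewrite b2 andbT.
    by apply: Int_ge0 => x; exact: powR_ge0.
  rewrite -[X in _ --> X](mulr0 C'); apply: cvgM; first exact: cvg_cst.
  have := cvg_norm_powR q0 hc; rewrite normr0 powR0 ?lt0r_neq0//.
  by under eq_fun do rewrite (gtr0_norm (h0 _)).
have L1 : Int (fun x => `|v n x - un n x|) @[n --> \oo] --> 0.
  apply: (Lq_L1_cvg0 mOm Ofin q1 _ _ _ hq).
  - by move=> n; exact: measurable_funB (vm n) (unm n).
  - by move=> n x Ox; rewrite v0// (un0 n Ox) subrr.
  - by move=> n; case: (vb n).
have L2 : Int (fun x => `|v n x - u x|) @[n --> \oo] --> 0.
  apply: (@squeeze_cvgr _ _ _ _ (fun=> 0)
    (fun n => Int (fun x => `|v n x - un n x|) + Int (fun x => `|un n x - u x|))); [|exact: cvg_cst|].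
    apply: nearW => n; apply/andP; split; first by apply: Int_ge0 => x.
    rewrite -(IntD (intg_norm (vu n)) (intg_norm (intgB (l1 n) l2))); apply: le_Int.
    - by apply: intg_norm; exact: intgB.
    - by apply: intgD; apply: intg_norm => //; exact: intgB.
    - by move=> x; apply: le_trans (ler_normD _ _); rewrite addrA subrK.
  by rewrite -[X in _ --> X]addr0; exact: cvgD L1 l3.
under eq_fun do rewrite E; apply: cvgN.
have [CC _ HCC] := C1c_lipschitz fM; have [_ pm] := C1c_measurable fM.
apply: (@cvg_Int_mul _ (Rn R N) R mu v u (fun _ => partial_deriv e f) (partial_deriv e f) CC vi l2 L2
   (fun=> pm e) (pm e)).
- by move=> n x; case: (HCC x e 0).
- by apply: aeW => x; exact: cvg_cst.
- by apply: (@intg_mul_bounded _ (Rn R N) R mu u (partial_deriv e f) CC l2 (pm e)) => x; case: (HCC x e 0).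
Qed.

(** [K] and [c] are part of the conclusion because the convergence of the difference quotients is
    recorded only along these averages; the limit equation has to be averaged with the same
    weights. *)
Lemma gradient_limit : exists (G : 'I_N -> 'rV[R]_N -> R) (K : nat -> nat) (c : nat -> nat -> R),
  [/\ forall k, tail_weights k (K k) (c k), forall e, mf (G e),
    forall e x, ~ Om x -> G e x = 0, forall e, intg (fun x => `|G e x| `^ q) &
    [/\ forall e f M, mf f -> (forall x, `|f x| <= M) ->
          \sum_(n < K k) c k n * Int (fun x => D n e x * f x) @[k --> \oo] -->
            Int (fun x => G e x * f x),
        forall e f, test_function setT f ->
          Int (fun x => G e x * f x) = - Int (fun x => u x * partial_deriv e f x) &
        forall ep, 0 < ep -> exists2 w, test_function Om w &
          [/\ intg (fun x => `|u x - w x| `^ q), Int (fun x => `|u x - w x| `^ q) <= ep &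
            forall e, intg (fun x => `|G e x - partial_deriv e w x| `^ q) /\
              Int (fun x => `|G e x - partial_deriv e w x| `^ q) <= ep]]].
Proof.
have [C' C'0 vb] := v_bounds.
have Om_fin := Ofin.
(* Both discrete gradients are indexed together, so that one choice of convex weights makes all
   [2 N] sequences converge. *)
pose F n (j : bool * 'I_N) (x : 'rV[R]_N) := if j.1 then D n j.2 x else partial_deriv j.2 (v n) x.
have pm n e : mf (partial_deriv e (v n)).
  by have [M vM] := test_C1c (test_v n); case: (C1c_measurable vM).
have Fm n j : mf (F n j).
  by case: j => [[] e]; rewrite /F /=; [exact: Dm|exact: pm].
have F0 n j x : ~ Om x -> F n j x = 0.
  case: j => [[] e] Ox; rewrite /F /=; first exact: (@D0 n e x Ox).
  by case: (partial_off e (test_v n) Ox).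
have Fb n j : intg (fun x => `|F n j x| `^ q) /\ Int (fun x => `|F n j x| `^ q) <= Num.max C C'.
  case: j => [[] e]; rewrite /F /=.
    by have [d1 d2] := UD n e; split=> //; rewrite le_max d2.
  by have [_ _ /(_ e)[d1 d2]] := vb n; split=> //; rewrite le_max d2 orbT.
have q12' : 1 < q <= 2 by move: q12; lra.
have [K [c [H [cw Hm H0 Hi WH]]]] := convex_combination_Lq q12' mOm Ofin Fm F0 Fb.
have lim j f M : mf f -> (forall x, `|f x| <= M) ->
    \sum_(n < K k) c k n * Int (fun x => F n j x * f x) @[k --> \oo] -->
      Int (fun x => H j x * f x).
  exact: (@combination_limit Om q (fun n => F n j) (H j) K c mOm Ofin q1 (fun n => Fm n j) (Hm j)
    (fun n => F0 n j) (H0 j) (fun n => (Fb n j).1) (Hi j) (WH j)).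
have test j f : test_function setT f ->
    Int (fun x => H j x * f x) = - Int (fun x => u x * partial_deriv j.2 f x).
  move=> ft; have [M fM] := test_C1c ft; have [CC _ HCC] := C1c_lipschitz fM.
  have [fm _] := C1c_measurable fM.
  have l1 : Int (fun x => F n j x * f x) @[n --> \oo] --> - Int (fun x => u x * partial_deriv j.2 f x).
    case: j => [[] e]; rewrite /F /=; first exact: cvg_test_difference fM.
    exact: cvg_test_interp.
  have l2 := lim j f CC fm (fun x => ltac:(by case: (HCC x j.2 0))).
  by rewrite -(cvg_lim _ l2)//; exact: cvg_lim (tail_weights_cvg cw l1).
have [M0 OM] : exists M0, forall x, Om x -> `|x| <= M0.
  have [M [_ HM]] := bOm; exists (M + 1) => x Ox; apply: HM Ox.
  by rewrite ltrDl.
have Hi1 j : intg (H j) by apply: (intg_of_powR mOm Ofin (ltW q1) (Hm j) (H0 j) (Hi j)).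
(* Both limits have the same integrals against test functions, namely
   [- Int (u * partial_deriv e f)], so they agree almost everywhere. *)
have HH e : {ae mu, forall x, H (true, e) x - H (false, e) x = 0}.
  pose g (x : 'rV[R]_N) := H (true, e) x - H (false, e) x.
  have gi : intg g by exact: intgB.
  have gz x : M0 < `|x| -> g x = 0.
    move=> Mx; have Ox : ~ Om x by move=> /OM; rewrite leNgt Mx.
    by rewrite /g !H0// subrr.
  have gq : intg (fun x => `|g x| `^ q).
    have nm : mf (fun x => -1 * H (false, e) x) by apply: measurable_funM => //; exact: measurable_cst.
    have := intg_powRD (ltW q0) (Hm (true, e)) nm (Hi _) (intg_powRZ (-1) (Hi _)).
    by under eq_fun do rewrite mulN1r.
  have gt f : test_function setT f -> Int (fun x => g x * f x) = 0.
    move=> ft; have [M fM] := test_C1c ft; have [CC _ HCC] := C1c_lipschitz fM.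
    have [fm _] := C1c_measurable fM.
    have fC x : `|f x| <= CC by case: (HCC x e 0).
    rewrite (_ : (fun x => g x * f x) = (fun x => H (true, e) x * f x - H (false, e) x * f x)); last first.
      by apply/funext => x; rewrite /g mulrBl.
    rewrite (IntB (intg_mul_bounded (Hi1 (true, e)) fm fC) (intg_mul_bounded (Hi1 (false, e)) fm fC)).
    by rewrite (test (true, e) f ft) (test (false, e) f ft) subrr.
  have Z := @ae_zero_of_test R N g M0 q gi gz q1 gq gt.
  exact Z.
have IntH e f : mf f -> Int (fun x => H (true, e) x * f x) = Int (fun x => H (false, e) x * f x).
  move=> fm; congr fine; apply: ae_eq_integral; first exact: measurableT.
  - by apply/measurable_EFinP; exact: measurable_funM.
  - by apply/measurable_EFinP; exact: measurable_funM.
  - apply: (@ae_imp _ (Rn R N) R mu _ _ (HH e)) => x /eqP; rewrite subr_eq0 => /eqP E _.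
    by rewrite E.
exists (fun e => H (false, e)), K, c.
split; [exact: cw|by move=> e; exact: Hm|by move=> e x Ox; exact: H0|by move=> e; exact: Hi|].
split.
- by move=> e f M fm fM; rewrite -IntH//; exact: (lim (true, e) f M fm fM).
- by move=> e f ft; exact: (test (false, e)).
move=> ep ep0.
have vm n : mf (v n) by have [M vM] := test_C1c (test_v n); case: (C1c_measurable vM).
pose T n (x : 'rV[R]_N) := `|u x - v n x| `^ q.
have [c1 c2] := limit_Lq.
have hq : h n `^ q @[n --> \oo] --> 0.
  have := cvg_norm_powR q0 hc; rewrite normr0 powR0 ?lt0r_neq0//.
  by under eq_fun do rewrite (gtr0_norm (h0 _)).
have leT n x : T n x <= 2 `^ q * (`|un n x - u x| `^ q + `|v n x - un n x| `^ q).
  have := ler_powRD (un n x - u x) (v n x - un n x) (ltW q0).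
  by rewrite /T addrC addrA subrK distrC.
have Tm n : mf (T n) by exact: (@measurable_norm_powR _ (Rn R N) R (fun x => u x - v n x) q (measurable_funB um (vm n))).
have iB n : intg (fun x => 2 `^ q * (`|un n x - u x| `^ q + `|v n x - un n x| `^ q)).
  by apply: intgZ; apply: intgD => //; case: (vb n).
have Ti n : intg (T n).
  by apply: intg_dom (Tm n) _ (iB n) => x; rewrite ger0_norm ?powR_ge0.
have Tc : Int (T n) @[n --> \oo] --> 0.
  apply: (@squeeze_cvgr _ _ _ _ (fun=> 0) (fun n => 2 `^ q * (Int (fun x => `|un n x - u x| `^ q) + C' * h n `^ q)));
    [|exact: cvg_cst|].
    apply: nearW => n; apply/andP; split; first by apply: Int_ge0 => x; exact: powR_ge0.
    have [b1 b2 _] := vb n; apply: le_trans (le_Int (Ti n) (iB n) (leT n)) _.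
    by rewrite IntZ; [rewrite IntD// ler_wpM2l ?powR_ge0// lerD2l|exact: intgD].
  rewrite -[X in _ --> X](mulr0 (2 `^ q)); apply: cvgM; first exact: cvg_cst.
  rewrite -[X in _ --> X]addr0; apply: cvgD c2 _.
  by rewrite -[X in _ --> X](mulr0 C'); apply: cvgM hq; exact: cvg_cst.
have Sc := tail_weights_cvg cw Tc.
have [k1 _ Hk1] := cvgr0_norm_le _ Sc _ ep0.
have /choice[n2 Hn2] e := WH (false, e) ep ep0.
(* One index beyond the threshold for the averaged distances to [u] and those of all [N] gradient
   components. *)
pose k := maxn k1 (\max_e n2 e)%N.
have kn2 e : (n2 e <= k)%N by rewrite leq_max leq_bigmax orbT.
pose w x := \sum_(n < K k) c k n * v n x.
have wD l : Dn l w.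
  by apply: Dn_sum => n; apply: DnM; [exact: Dn_cst|exact: Dn_interp].
have wE e : partial_deriv e w = (fun x => \sum_(n < K k) c k n * partial_deriv e (v n) x).
  apply/funext => x.
  have vd n : is_derive x (bas e) (v n) (partial_deriv e (v n) x).
    have [vs _ _] := test_v n; have [_ vd] := vs [::].
    by apply: DeriveDef => //; exact: vd.
  have dsum (l : seq 'I_(K k)) : is_derive x (bas e) (fun x => \sum_(n <- l) c k n * v n x)
      (\sum_(n <- l) c k n * partial_deriv e (v n) x).
    elim: l => [|n l IH].
      by rewrite big_nil; under eq_fun do rewrite big_nil; exact: is_derive_cst.
    rewrite big_cons; under eq_fun do rewrite big_cons.
    exact: (is_deriveD (is_deriveZ (c k n) (vd n)) IH).
  by case: (dsum (index_enum 'I_(K k))).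
have wt : test_function Om w.
  pose S := \big[setU/set0]_(n <- iota 0 (K k)) closure [set x | v n x != 0].
  have cS : closed S.
    rewrite /S; elim: (iota _ _) => [|n s IH]; first by rewrite big_nil; exact: closed0.
    by rewrite big_cons; apply: closedU => //; exact: closed_closure.
  have SO : S `<=` Om.
    rewrite /S => x; rewrite -bigcup_seq => -[n _]; have [_ _] := test_v n; exact.
  have wS : closure [set x | w x != 0] `<=` S.
    rewrite (closure_id S).1//; apply: closureS => x wx.
    have [n vn] : exists n : 'I_(K k), v n x != 0.
      apply: contrapT => H'; case/eqP: wx; rewrite /w big1// => n _.
      by apply/eqP; rewrite mulf_eq0; apply/orP; right; apply: contrapT => /negP vn; apply: H'; exists n.
    rewrite /S -bigcup_seq; exists (n : nat); first by rewrite /= mem_iota leq0n add0n ltn_ord.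
    exact: subset_closure.
  split; first exact: smooth_Dn.
  - apply: bounded_closed_compact; last exact: closed_closure.
    have [M1 [Mr HM]] := bOm; exists M1; split=> // y My x Hx.
    by apply: HM My _ _; apply: SO; exact: wS.
  - exact: subset_trans wS SO.
have [cw0 _ _ cw1] := cw k.
have iS : intg (fun x => \sum_(n < K k) c k n * T n x).
  by apply: (@intg_sum _ (Rn R N) R mu _ _ (fun (n : 'I_(K k)) x => c k n * T n x)) => n; exact: intgZ.
(* As the weights sum to 1, [u - w] is the same convex combination of the [u - v n], and Jensen's
   inequality applies. *)
have le x : `|u x - w x| `^ q <= \sum_(n < K k) c k n * T n x.
  have -> : u x - w x = \sum_(n < K k) c k n * (u x - v n x).
    under eq_bigr do rewrite mulrBr.
    by rewrite sumrB -mulr_suml cw1 mul1r.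
  exact: (@jensen_powR R q (K k) (c k) (fun n => u x - v n x) q1 cw0 cw1).
have wm : mf w by apply: continuous_measurable_Rn; have [] := wD 1%N.
have wi : intg (fun x => `|u x - w x| `^ q).
  have wqm : mf (fun x => `|u x - w x| `^ q).
    exact: (@measurable_norm_powR _ (Rn R N) R (fun x => u x - w x) q (measurable_funB um wm)).
  have le' x : `| `|u x - w x| `^ q | <= \sum_(n < K k) c k n * T n x.
    by rewrite (ger0_norm (powR_ge0 _ _)).
  exact: (@intg_dom _ (Rn R N) R mu _ _ wqm le' iS).
exists w => //; split=> // [|e].
  apply: le_trans (le_Int wi iS le) _.
  rewrite (@Int_sum _ (Rn R N) R mu _ _ (fun (n : 'I_(K k)) x => c k n * T n x)); last first.
    by move=> n; exact: intgZ.
  apply: le_trans (Hk1 k (leq_maxl _ _)); apply: le_trans (ler_norm _).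
  by apply: ler_sum => n _; rewrite IntZ.
have := Hn2 e k (kn2 e).
rewrite (_ : (fun x => _) = (fun x => `|H (false, e) x - partial_deriv e w x| `^ q))//.
by apply/funext => x; rewrite wE distrC.
Qed.

End limit.

Section sequence_limits.
Context (R : realType).
Implicit Types (a b : nat -> R) (l k : R).

Lemma seqD a b l k : a n @[n --> \oo] --> l -> b n @[n --> \oo] --> k ->
  a n + b n @[n --> \oo] --> l + k.
Proof. by move=> al bk; exact: cvgD. Qed.

Lemma seqB a b l k : a n @[n --> \oo] --> l -> b n @[n --> \oo] --> k ->
  a n - b n @[n --> \oo] --> l - k.
Proof. by move=> al bk; exact: cvgB. Qed.

Lemma seqM a b l k : a n @[n --> \oo] --> l -> b n @[n --> \oo] --> k ->
  a n * b n @[n --> \oo] --> l * k.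
Proof. by move=> al bk; exact: cvgM. Qed.

Lemma seq_eq a b l : a =1 b -> a n @[n --> \oo] --> l -> b n @[n --> \oo] --> l.
Proof. by move=> /funext ->. Qed.

Lemma seq_near_eq a b l : (\forall n \near \oo, a n = b n) ->
  a n @[n --> \oo] --> l -> b n @[n --> \oo] --> l.
Proof.
move=> [n0 _ H] al; apply: cvg_trans al; apply: near_eq_cvg; exists n0 => // n nn.
Qed.

End sequence_limits.

Lemma series_terms_cvg0 (R : realType) (F : nat -> R) (K : R) : (forall n, \sum_(0 <= k < n) F k <= K) ->
  (forall n, 0 <= F n) -> F n @[n --> \oo] --> 0.
Proof.
move=> FK F0; apply: cvg_series_cvg_0; apply: nondecreasing_is_cvgn.
  by apply/nondecreasing_seqP => n; rewrite /series /= big_nat_recr//= lerDl.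
by exists K => _ [n _ <-]; exact: FK.
Qed.

Lemma sum_geometric_le (R : realType) (n : nat) : \sum_(0 <= k < n) (2 ^- k : R) <= 2.
Proof.
suff -> : \sum_(0 <= k < n) (2 ^- k : R) = 2 - 2 * 2 ^- n.
  by rewrite gerBl mulr_ge0// invr_ge0 exprn_ge0.
elim: n => [|n IH]; first by rewrite big_nil expr0 invr1 mulr1 subrr.
rewrite big_nat_recr//= IH exprS; field.
by rewrite expf_neq0.
Qed.

Lemma ae_and d (T : measurableType d) (R : realType) (mu : {measure set T -> \bar R})
    (P Q : T -> Prop) :
  {ae mu, forall x, P x} -> {ae mu, forall x, Q x} -> {ae mu, forall x, P x /\ Q x}.
Proof. by move=> HP HQ; apply: filterS2 HP HQ => x. Qed.

(** * The limit of the equation *)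

Section limit_equation.
Context (R : realType) (N : nat).
Notation mu := (leb R N).
Notation mf f := (measurable_fun [set: Rn R N] (f : Rn R N -> R)).
Notation intg f := (mu.-integrable [set: Rn R N] (EFin \o (f : Rn R N -> R))).
Notation Int f := (\int[mu]_x (f : Rn R N -> R) x).
Notation bas i := (delta_mx 0 i : 'rV[R]_N).

Lemma cvg_lattice_point (h : nat -> R) (x : 'rV[R]_N) : (forall n, 0 < h n) ->
  h n @[n --> \oo] --> 0 -> pt (h n) (idx (h n) x) @[n --> \oo] --> x.
Proof.
move=> h0 hc; apply/cvgrPdist_le => e e0.
near=> n; apply: (@le_trans _ _ (h n)).
  apply: rV_norm_le => [|i]; first exact: ltW.
  have /andP[H1 H2] := idx_dist x i (h0 n).
  by rewrite mxE [X in _ + X]mxE ler_norml; apply/andP; split; move: H1 H2 (h0 n); lra.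
have : `|h n| <= e by near: n; exact: (cvgr0_norm_le _ hc _ e0).
by rewrite gtr0_norm.
Unshelve. all: by end_near. Qed.

(** The base point moves with [n], so differentiability at [x] alone says nothing; the mean value
    theorem turns the quotient into a value of the continuous partial derivative near [x]. *)
Lemma cvg_moving_quotient M (f : 'rV[R]_N -> R) i (y : nat -> 'rV[R]_N) (x : 'rV[R]_N)
    (h : nat -> R) : C1c M f -> (forall n, 0 < h n) -> h n @[n --> \oo] --> 0 ->
  y n @[n --> \oo] --> x ->
  (f (y n + h n *: bas i) - f (y n)) / h n @[n --> \oo] --> partial_deriv i f x.
Proof.
move=> fM h0 hc yc; have [fc fd fp _] := fM.
have /choice[c Hc] n : exists c : R, 0 <= c <= h n /\
    (f (y n + h n *: bas i) - f (y n)) / h n = partial_deriv i f (y n + c *: bas i).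
  have [||c cI E] := @MVT_segment R (fun t => f (y n + t *: bas i))
    (fun t => partial_deriv i f (y n + t *: bas i)) 0 (h n) (ltW (h0 n)).
  - by move=> s _; exact: is_derive_line.
  - apply: continuous_subspaceT => s; apply: differentiable_continuous.
    by apply/derivable1_diffP; case: (@is_derive_line R N f i (y n) s (fd i _)).
  exists c; split; first by move: cI; rewrite in_itv.
  by move: E; rewrite scale0r addr0 subr0 => ->; rewrite mulfK// lt0r_neq0.
under eq_fun do rewrite (Hc _).2.
have zc : y n + c n *: bas i @[n --> \oo] --> x.
  rewrite -[x]addr0; apply: cvgD => //; rewrite -(scale0r (bas i)).
  apply: (@cvgZl _ _ _ _ _ _ _ (bas i)).
  apply: (@squeeze_cvgr _ _ _ _ (fun=> 0) h); [|exact: cvg_cst|exact: hc].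
  by apply: nearW => n; case: (Hc n).
by apply: (@continuous_cvg _ _ _ _ _ (fun n => y n + c n *: bas i) (partial_deriv i f) x) => //; exact: fp.
Qed.

Variables (Om : set 'rV[R]_N) (a A : 'rV[R]_N -> R -> R) (f : 'rV[R]_N -> R)
  (E : 'I_N -> 'rV[R]_N -> R) (g m r q be C : R) (h : nat -> R)
  (U : nat -> 'rV[int]_N -> R) (u : 'rV[R]_N -> R).
Hypotheses (N0 : (0 < N)%N) (oOm : open Om) (bOm : bounded_set Om) (q12 : 1 < q < 2) (m2 : 2 <= m)
  (g01 : 0 < g < 1) (r1 : 1 < r) (be0 : 0 < be)
  (h01 : forall n, 0 < h n <= 1) (hfast : forall n, h n <= 2 ^- n) (hc : h n @[n --> \oo] --> 0).
Notation un n := (fun x : 'rV[R]_N => U n (idx (h n) x)).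
Notation ue n e := (fun x : 'rV[R]_N => U n (idx (h n) x + dir e)).
Notation D n e := (fun x : 'rV[R]_N => (U n (idx (h n) x + dir e) - U n (idx (h n) x)) / h n).
Hypotheses (am : forall s, mf (a ^~ s)) (ac : forall x, continuous (a x))
  (ab : forall x s, 0 <= a x s <= be) (Am : forall s, mf (A ^~ s))
  (AE : forall x s t lo hi, s <= t -> (forall y, s <= y <= t -> lo <= a x y <= hi) ->
      lo * (t - s) <= A x t - A x s <= hi * (t - s)).
Hypotheses (fi : intg f) (Em : forall e, mf (E e)) (E_off : forall e x, ~ Om x -> E e x = 0)
  (Ei : forall e, intg (fun x => `|E e x| `^ (2 * r))).
Hypotheses (Ui : forall n e (Psi : R -> R -> R), Psi 0 0 = 0 ->
    intg (fun x => Psi (U n (idx (h n) x)) (U n (idx (h n) x + dir e))))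
  (Uoff : forall n e x, ~ Om x -> U n (idx (h n) x) = 0 /\ U n (idx (h n) x + dir e) = 0)
  (Um : forall n, Int (fun x => `|un n x| `^ m) <= C)
  (Uem : forall n e, Int (fun x => `|ue n e x| `^ m) <= C)
  (UD : forall n e, Int (fun x => `|D n e x| `^ q) <= C)
  (um : mf u) (uO : forall x, ~ Om x -> u x = 0) (ui : intg u) (uim : intg (fun x => `|u x| `^ m))
  (uc : {ae mu, forall x, U n (idx (h n) x) @[n --> \oo] --> u x})
  (uL1 : Int (fun x => `|un n x - u x|) @[n --> \oo] --> 0).

Let h0 n : 0 < h n. Proof. by case/andP: (h01 n). Qed.
Let mOm : measurable (Om : set (Rn R N)). Proof. exact: open_measurable_Rn. Qed.
Let Ofin : (mu Om < +oo)%E. Proof. exact: leb_bounded. Qed.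
Let q1 : 1 < q. Proof. by case/andP: q12. Qed.
Let q0 : 0 < q. Proof. exact: lt_trans q1. Qed.
Let m0 : 0 < m. Proof. by move: m2; lra. Qed.
Let unm n : mf (un n). Proof. exact: measurable_lat. Qed.
Let uem n e : mf (ue n e). Proof. exact: (measurable_lat (h0 n) (fun k => U n (k + dir e))). Qed.
Let Dm n e : mf (D n e).
Proof.
apply: (measurable_funM (g := fun=> (h n)^-1)); last exact: measurable_cst.
by apply: measurable_funB; [exact: uem|exact: unm].
Qed.
Let iO : intg (\1_Om : Rn R N -> R). Proof. exact: intg_indic. Qed.

Let Di n e : intg (fun x => `|D n e x| `^ q).
Proof.
apply: (Ui n e (Psi := fun s t => `|(t - s) / h n| `^ q)).
by rewrite subrr mul0r normr0 powR0// lt0r_neq0.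
Qed.
Let D0 n e x : ~ Om x -> D n e x = 0.
Proof. by move=> /(Uoff n e)[/= -> ->]; rewrite subrr mul0r. Qed.
Let Di1 n e : intg (D n e).
Proof. by apply: (intg_of_powR mOm Ofin (ltW q1) (Dm n e) (D0 n e) (Di n e)). Qed.

(** Because [h n <= 2^-n], the integrals of the one-step differences are summable, so these
    differences tend to 0 almost everywhere along the sequence at hand. *)
Let ue_cvg e : {ae mu, forall x, U n (idx (h n) x + dir e) @[n --> \oo] --> u x}.
Proof.
pose F n (x : Rn R N) := `|U n (idx (h n) x + dir e) - U n (idx (h n) x)|.
have Fi n : intg (F n).
  by apply: (Ui n e (Psi := fun s t => `|t - s|)); rewrite subrr normr0.
pose K := fine (mu Om) + C.
have K0 : 0 <= K.
  apply: addr_ge0; first exact: fine_ge0.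
  by apply: le_trans (Um 0); apply: Int_ge0 => x; exact: powR_ge0.
have FK n : Int (F n) <= 2 ^- n * K.
  have -> : F n = (fun x => h n * `|D n e x|).
    by apply/funext => x; rewrite /F normrM normfV (gtr0_norm (h0 n)) mulrCA mulfV ?mulr1// lt0r_neq0.
  rewrite (IntZ _ (intg_norm (Di1 n e))); apply: ler_pM => //; [exact: ltW|by apply: Int_ge0 => x|].
  apply: (@le_trans _ _ (Int (fun x => \1_Om x + `|D n e x| `^ q))); last first.
    by rewrite (IntD iO (Di n e)) Int_indic// lerD2l.
  apply: le_Int; [exact: intg_norm|exact: intgD|move=> x].
  rewrite indicE; have [_|/negP xO] := boolP (x \in _); last first.
    have Ox : ~ Om x by move=> Ox; apply: xO; rewrite inE.
    by have /= -> := D0 n e Ox; rewrite normr0 add0r powR_ge0.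
  have [d1|d1] := leP `|D n e x| 1; first by rewrite (le_trans d1)// lerDl powR_ge0.
  by rewrite -[leLHS]add0r lerD//; apply: le1r_powR => //; exact: ltW.
have := @ae_bounded_series _ (Rn R N) R mu F (2 * K) Fi (fun n x => normr_ge0 _) _.
have SF n : \sum_(0 <= k < n) Int (F k) <= 2 * K.
  apply: (@le_trans _ _ (\sum_(0 <= k < n) 2 ^- k * K)); first by apply: ler_sum => k _; exact: FK.
  by rewrite -mulr_suml ler_wpM2r// sum_geometric_le.
move=> /(_ SF) H; have {}H : {ae mu, forall x, F n x @[n --> \oo] --> 0}.
  apply: (@ae_imp _ (Rn R N) R mu _ _ H) => x [B HB].
  by apply: (@series_terms_cvg0 R (F^~ x) B HB) => n; exact: normr_ge0.
have HH : {ae mu, forall x, (U n (idx (h n) x) @[n --> \oo] --> u x) /\ (F n x @[n --> \oo] --> 0)}.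
  exact: (@ae_and _ (Rn R N) R mu).
apply: (@ae_imp _ (Rn R N) R mu _ _ HH) => x [c1 /norm_cvg0P c2].
have c3 : (fun n => U n (idx (h n) x + dir e) - U n (idx (h n) x) + U n (idx (h n) x)) @ \oo -->
  0 + u x := cvgD c2 c1.
rewrite add0r in c3; rewrite (_ : (fun n => _) = (fun n => U n (idx (h n) x + dir e) -
  U n (idx (h n) x) + U n (idx (h n) x))); first exact: c3.
by apply/funext => n; rewrite subrK.
Qed.

Let both e : {ae mu, forall x, (U n (idx (h n) x) @[n --> \oo] --> u x) /\
  (U n (idx (h n) x + dir e) @[n --> \oo] --> u x)}.
Proof. exact: (@ae_and _ (Rn R N) R mu _ _ uc (ue_cvg e)). Qed.

(* The difference quotient of the primitive [A x], extended continuously to the diagonal. *)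
Definition coef_quotient x s t := if s == t then a x s else (A x t - A x s) / (t - s).

Let quotient_itv x s t lo hi : (forall y, Num.min s t <= y <= Num.max s t -> lo <= a x y <= hi) ->
  lo <= coef_quotient x s t <= hi.
Proof.
rewrite /coef_quotient; have [st|ts|->] := ltgtP s t => H.
- have /andP[h1 h2] := AE (ltW st) H; have d : 0 < t - s by rewrite subr_gt0.
  by rewrite ler_pdivlMr// ler_pdivrMr// h1.
- have /andP[h1 h2] := AE (ltW ts) H; have d : 0 < s - t by rewrite subr_gt0.
  by rewrite -[_ / _]mulrNN -invrN !opprB ler_pdivlMr// ler_pdivrMr// h1.
- by apply: H; rewrite lexx.
Qed.

(** The quotient lies between bounds of [a x] on the segment joining the two values, and this
    segment shrinks to [s]. *)
Let quotient_cvg x s (v w : nat -> R) : v n @[n --> \oo] --> s -> w n @[n --> \oo] --> s ->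
  coef_quotient x (v n) (w n) @[n --> \oo] --> a x s.
Proof.
move=> vs ws; apply/cvgrPdist_le => e e0.
have /cvgrPdist_le/(_ e e0) : a x y @[y --> s] --> a x s by exact: ac.
move=> /nbhs_ballP[d /= d0 Hd].
near=> n.
have dv : `|s - v n| < d by near: n; move/cvgrPdist_lt: vs; apply.
have dw : `|s - w n| < d by near: n; move/cvgrPdist_lt: ws; apply.
rewrite ler_distlC; apply: quotient_itv => y /andP[y1 y2].
rewrite -ler_distlC; apply: Hd; rewrite -ball_normE /=.
move: dv dw y1 y2; rewrite !ltr_norml ge_min le_max.
by move=> /andP[v1 v2] /andP[w1 w2] /orP[y1|y1] /orP[y2|y2]; apply/andP; split; lra.
Unshelve. all: by end_near. Qed.

Let coefm n e : mf (fun x => coef_quotient x (U n (idx (h n) x)) (U n (idx (h n) x + dir e))).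
Proof.
apply: (@measurable_lat_cases R N (h n) (h0 n)
  (fun k x => coef_quotient x (U n k) (U n (k + dir e)))) => k.
move: (U n k) (U n (k + dir e)) => s t; rewrite /coef_quotient; case: (s == t); first exact: am.
by apply: measurable_funM; [apply: measurable_funB; exact: Am|exact: measurable_cst].
Qed.

Lemma cvg_odd_power (v : nat -> R) s : v n @[n --> \oo] --> s ->
  odd_power g (v n) @[n --> \oo] --> odd_power g s.
Proof.
move=> vs; have /andP[g0 _] := g01.
(* The odd power is the difference of the powers of the positive and the negative part, each
   continuous because [g > 0]. *)
have oE t : odd_power g t = `|(t + `|t|) / 2| `^ g - `|(`|t| - t) / 2| `^ g.
  have g00 : `|0 : R| `^ g = 0 by rewrite normr0 powR0// lt0r_neq0.
  rewrite odd_powerE//; have [t0|t0] := leP 0 t.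
    rewrite (ger0_norm t0) subrr mul0r g00 subr0 (_ : (t + t) / 2 = t); last by field.
    by rewrite ger0_norm.
  rewrite (ltr0_norm t0) subrr mul0r g00 sub0r (_ : (- t - t) / 2 = - t); last by field.
  by rewrite (ger0_norm (_ : 0 <= - t)) ?oppr_ge0 ?ltW.
have ns : `|v n| @[n --> \oo] --> `|s| by exact: cvg_norm.
have c2 (l : R) (w : nat -> R) : w n @[n --> \oo] --> l -> w n / 2 @[n --> \oo] --> l / 2.
  by move=> wl; apply: seqM wl _; exact: cvg_cst.
have := seqB (cvg_norm_powR g0 (c2 _ _ (seqD vs ns))) (cvg_norm_powR g0 (c2 _ _ (seqB ns vs))).
by rewrite -oE; apply: seq_eq => n; rewrite oE.
Qed.

Let g0 : 0 < g. Proof. by case/andP: g01. Qed.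

Let hg : h n `^ g @[n --> \oo] --> 0.
Proof.
have := cvg_norm_powR g0 hc; rewrite normr0 powR0 ?lt0r_neq0//.
by under eq_fun do rewrite (gtr0_norm (h0 _)).
Qed.

Let greg_cvg (v : nat -> R) s : v n @[n --> \oo] --> s ->
  greg g (h n) (v n) @[n --> \oo] --> odd_power g s.
Proof.
move=> vs; have c1 := cvg_odd_power vs.
have c2 : greg g (h n) (v n) - odd_power g (v n) @[n --> \oo] --> 0.
  apply/norm_cvg0P; apply: (@squeeze_cvgr _ _ _ _ (fun=> 0) (fun n => h n `^ g)); [|exact: cvg_cst|exact: hg].
  by apply: nearW => n; rewrite normr_ge0 greg_odd_power.
have c3 : (fun n => greg g (h n) (v n) - odd_power g (v n) + odd_power g (v n)) @ \oo -->
  0 + odd_power g s := cvgD c2 c1.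
rewrite add0r in c3; rewrite (_ : (fun n => _) = (fun n => greg g (h n) (v n) -
  odd_power g (v n) + odd_power g (v n))); first exact: c3.
by apply/funext => n; rewrite subrK.
Qed.

Section test_equation.
Variables (M : R) (phi : 'rV[R]_N -> R).
Hypothesis phiM : C1c M phi.

Let psi_ n (x : 'rV[R]_N) := phi (pt (h n) (idx (h n) x)).
Let del n e (x : 'rV[R]_N) :=
  (phi (pt (h n) (idx (h n) x + dir e)) - phi (pt (h n) (idx (h n) x))) / h n.

Let lip : exists2 CC, 0 <= CC & forall x i t,
  [/\ `|phi x| <= CC, `|partial_deriv i phi x| <= CC & `|phi (x + t *: bas i) - phi x| <= CC * `|t|].
Proof. exact: C1c_lipschitz phiM. Qed.

Let ptD n e x : pt (h n) (idx (h n) x + dir e) = pt (h n) (idx (h n) x) + h n *: bas e.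
Proof.
rewrite -pt_dir; apply/rowP => i; rewrite /pt !mxE -mulrDr -intrD.
by [].
Qed.

Let psim n : mf (psi_ n).
Proof. exact: (measurable_lat (h0 n) (fun k => phi (pt (h n) k))). Qed.

Let delm n e : mf (del n e).
Proof.
exact: (measurable_lat (h0 n) (fun k => (phi (pt (h n) (k + dir e)) - phi (pt (h n) k)) / h n)).
Qed.

Let psi_cvg x : psi_ n x @[n --> \oo] --> phi x.
Proof.
have [fc _ _ _] := phiM.
apply: (@continuous_cvg _ _ _ _ _ (fun n => pt (h n) (idx (h n) x)) phi x); first exact: fc.
exact: cvg_lattice_point.
Qed.

Let del_cvg e x : del n e x @[n --> \oo] --> partial_deriv e phi x.
Proof.
have H := @cvg_moving_quotient M phi e _ x h phiM h0 hc (@cvg_lattice_point h x h0 hc).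
rewrite (_ : (fun n => _) = (fun n => (phi (pt (h n) (idx (h n) x) + h n *: bas e) -
  phi (pt (h n) (idx (h n) x))) / h n)); first exact: H.
by apply/funext => n; rewrite /del ptD.
Qed.

Let del_le CC n e x : (forall x i t,
  [/\ `|phi x| <= CC, `|partial_deriv i phi x| <= CC & `|phi (x + t *: bas i) - phi x| <= CC * `|t|]) ->
  `|del n e x| <= CC.
Proof.
move=> HC; rewrite /del ptD normrM normfV (gtr0_norm (h0 n)) ler_pdivrMr//.
by have [_ _] := HC (pt (h n) (idx (h n) x)) e (h n); rewrite (gtr0_norm (h0 n)).
Qed.

Let au x := a x (u x).
Let aum : mf au. Proof. exact: (@measurable_superposition _ (Rn R N) R a u am ac um). Qed.

Let pphim e : mf (partial_deriv e phi). Proof. by have [_ pm] := C1c_measurable phiM. Qed.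

Let bn n e (x : 'rV[R]_N) :=
  coef_quotient x (U n (idx (h n) x)) (U n (idx (h n) x + dir e)) * del n e x.

Let bn_le CC n e x : 0 <= CC -> `|del n e x| <= CC -> `|bn n e x| <= be * CC.
Proof.
move=> CC0 dC; rewrite normrM ler_pM//.
have /andP[h1 h2] : 0 <= coef_quotient x (U n (idx (h n) x)) (U n (idx (h n) x + dir e)) <= be.
  by apply: quotient_itv.
by rewrite ger0_norm.
Qed.

(** The quotients [D] are bounded in [L^q], while the bounded coefficients [bn] converge almost
    everywhere, hence in the dual exponent on [Om]. Subtracting the integral with the limiting
    coefficient defers the limit of [D] itself. *)
Let principal e : (forall n, intg (fun x => D n e x * bn n e x)) /\
  Int (fun x => D n e x * bn n e x) - Int (fun x => D n e x * (au x * partial_deriv e phi x))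
    @[n --> \oo] --> 0.
Proof.
have [CC CC0 HCC] := lip.
have dC n x : `|del n e x| <= CC by exact: del_le.
have bm n : mf (bn n e) by exact: (measurable_funM (coefm n e) (delm n e)).
have lm : mf (fun x => au x * partial_deriv e phi x) by exact: (measurable_funM aum (pphim e)).
have l_le x : `|au x * partial_deriv e phi x| <= be * CC.
  rewrite normrM ler_pM//; last by case: (HCC x e 0).
  by have /andP[h1 h2] := ab x (u x); rewrite /au ger0_norm.
have i1 n : intg (fun x => D n e x * bn n e x).
  by apply: (intg_mul_bounded (Di1 n e) (bm n)) => x; exact: (bn_le CC0 (dC n x)).
have i2 n : intg (fun x => D n e x * (au x * partial_deriv e phi x)).
  exact: (intg_mul_bounded (Di1 n e) lm l_le).
split=> //.
pose B n (x : 'rV[R]_N) := (bn n e x - au x * partial_deriv e phi x) * \1_Om x.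
have Bm n : mf (B n).
  by apply: measurable_funM; [exact: measurable_funB (bm n) lm|exact: measurable_indic].
have Ble n x : `|B n x| <= (be * CC + be * CC) * \1_Om x.
  rewrite /B normrM (ger0_norm (_ : 0 <= \1_Om x)) ?indicE// ler_wpM2r//.
  by apply: le_trans (ler_normB _ _) _; apply: lerD => //; exact: (bn_le CC0 (dC n x)).
have Bc : {ae mu, forall x, B n x @[n --> \oo] --> 0}.
  apply: (@ae_imp _ (Rn R N) R mu _ _ (both e)) => x [c1 c2].
  have cc (z : R) : (fun _ : nat => z) @ \oo --> z by exact: cvg_cst.
  have c3 : bn n e x @[n --> \oo] --> au x * partial_deriv e phi x.
    by apply: seqM; [exact: quotient_cvg c1 c2|exact: del_cvg].
  have c4 := seqM (seqB c3 (cc (au x * partial_deriv e phi x))) (cc (\1_Om x)).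
  by rewrite subrr mul0r in c4; exact: c4.
have Q0 : 0 < q / (q - 1) by rewrite divr_gt0// subr_gt0.
have B0 := @Int_bounded_cvg0 _ (Rn R N) R mu Om B _ _ Q0 mOm Ofin Bm Ble Bc.
have Bi n : intg (fun x => `|B n x| `^ (q / (q - 1))).
  have iB : intg (fun x => (be * CC + be * CC) `^ (q / (q - 1)) * \1_Om x) by exact: intgZ.
  have Bqm : mf (fun x => `|B n x| `^ (q / (q - 1))).
    exact: (@measurable_norm_powR _ (Rn R N) R (B n) _ (Bm n)).
  have Bq_le x : `| `|B n x| `^ (q / (q - 1)) | <= (be * CC + be * CC) `^ (q / (q - 1)) * \1_Om x.
    rewrite (ger0_norm (powR_ge0 _ _)); have := Ble n x; rewrite indicE.
    have bc0 : 0 <= be * CC + be * CC by rewrite addr_ge0// mulr_ge0// ltW.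
    case: (x \in _); rewrite ?mulr1 ?mulr0 => H.
      by apply: ge0_ler_powR; rewrite ?nnegrE// ltW.
    have /eqP -> : `|B n x| == 0 by rewrite eq_le H normr_ge0.
    by rewrite powR0// lt0r_neq0.
  exact: (@intg_dom _ (Rn R N) R mu _ _ Bqm Bq_le iB).
have [_ c0] := @Int_product_cvg0 _ (Rn R N) R mu q C B (fun n => D n e) q1 Bm (fun n => Dm n e)
  (fun n => conj (Di n e) (UD n e)) Bi B0.
rewrite (_ : (fun n => _) = (fun n => Int (fun x => B n x * D n e x)))//.
apply/funext => n; rewrite -(IntB (i1 n) (i2 n)); congr Rintegral; apply/funext => x.
rewrite /B indicE; have [_|/negP xO] := boolP (x \in Om); first by rewrite mulr1 -mulrBr mulrC.
have Ox : ~ Om x by move=> Ox; apply: xO; rewrite inE.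
by have /= -> := D0 n e Ox; rewrite !mul0r subrr mulr0.
Qed.

Let Pn n e (x : 'rV[R]_N) := Num.max 0 (E e x) * greg g (h n) (U n (idx (h n) x)) -
  Num.max 0 (- E e x) * greg g (h n) (U n (idx (h n) x + dir e)).

Let Z0 e (x : 'rV[R]_N) := odd_power g (u x) * E e x * partial_deriv e phi x.

Let drift e : [/\ forall n, intg (fun x => Pn n e x * del n e x), intg (Z0 e),
   intg (fun x => odd_power g (u x) * E e x) &
   Int (fun x => Pn n e x * del n e x) @[n --> \oo] --> Int (Z0 e)].
Proof.
have [CC CC0 HCC] := lip.
have dC n x : `|del n e x| <= CC by exact: del_le.
have maxm (F : Rn R N -> R) : mf F -> mf (fun x => Num.max 0 (F x)).
  by move=> Fm; under eq_fun do rewrite maxC; exact: measurable_funrpos.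
have gm n : mf (fun x => greg g (h n) (U n (idx (h n) x))).
  exact: (measurable_lat (h0 n) (fun k => greg g (h n) (U n k))).
have gem n : mf (fun x => greg g (h n) (U n (idx (h n) x + dir e))).
  exact: (measurable_lat (h0 n) (fun k => greg g (h n) (U n (k + dir e)))).
have Pm n : mf (Pn n e).
  have Nm : mf (fun x => - E e x) by exact: measurableT_comp.
  exact: (measurable_funB (measurable_funM (maxm _ (Em e)) (gm n)) (measurable_funM (maxm _ Nm) (gem n))).
have om : mf (fun x => odd_power g (u x)).
  exact: (measurable_funM (@measurable_norm_powR _ (Rn R N) R u (g - 1) um) um).
have oEm : mf (fun x => odd_power g (u x) * E e x) by exact: (measurable_funM om (Em e)).
have Zm : mf (Z0 e) by exact: (measurable_funM oEm (pphim e)).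
have Pdm n : mf (fun x => Pn n e x * del n e x) by exact: (measurable_funM (Pm n) (delm n e)).
(* In [(|E| X^g)^p <= |E|^(2p) + X^(2gp)] this is the largest exponent with [2 p <= 2 r] and
   [2 g p <= m], so that both powers are controlled; it exceeds 1 since [r > 1] and [m > 2 g]. *)
pose p := Num.min r (m / (2 * g)).
have g2 : 0 < 2 * g by rewrite mulr_gt0.
have p1 : 1 < p.
  by rewrite /p lt_min r1/= ltr_pdivlMr// mul1r; move: g01 m2; lra.
have p0 : 0 < p by apply: lt_trans p1.
have pr : 2 * p <= 2 * r by rewrite ler_pM2l// ge_min lexx.
have pm_ : 2 * g * p <= m by rewrite mulrC -ler_pdivlMr// ge_min lexx orbT.
have key y s t w : `|w| <= `|E e y| * Mx s t `^ g ->
    `|w| `^ p <= \1_Om y + `|E e y| `^ (2 * r) + 2 `^ m * (\1_Om y + `|s| `^ m + `|t| `^ m).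
  move=> wE; have X0 := Mx_gt0 s t; have X1 := Mx_ge1 s t.
  rewrite indicE; have [_|/negP yO] := boolP (y \in Om); last first.
    have Oy : ~ Om y by move=> Oy; apply: yO; rewrite inE.
    have /eqP -> : `|w| == 0.
      by rewrite eq_le normr_ge0 andbT (le_trans wE)// E_off// normr0 mul0r.
    by rewrite powR0 ?lt0r_neq0// !addr_ge0 ?mulr_ge0 ?addr_ge0 ?powR_ge0.
  apply: le_trans (ge0_ler_powR (ltW p0) _ _ wE) _; rewrite ?nnegrE ?mulr_ge0 ?powR_ge0//.
  rewrite powRM ?powR_ge0//.
  have sq (z e' : R) : (z `^ e') ^+ 2 = z `^ (2 * e').
    by rewrite -powR_mulrn ?powR_ge0// -powRrM mulrC.
  apply: (@le_trans _ _ (`|E e y| `^ (2 * p) + Mx s t `^ (2 * g * p))).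
    have e2 : Mx s t `^ (2 * g * p) = ((Mx s t `^ g) `^ p) ^+ 2 by rewrite sq -powRrM mulrA [g * 2]mulrC.
    rewrite e2 -sq.
    move: (`|E e y| `^ p) ((Mx s t `^ g) `^ p) (powR_ge0 `|E e y| p) (powR_ge0 (Mx s t `^ g) p).
    by move=> aa bb a0 b0; nra.
  apply: lerD.
    have [E1|E1] := leP `|E e y| 1.
      apply: (@le_trans _ _ (1 `^ (2 * p))); last by rewrite powR1 lerDl powR_ge0.
      by apply: ge0_ler_powR; rewrite ?nnegrE// mulr_ge0// ltW.
    by rewrite -[leLHS]add0r lerD// ler_powR// ltW.
  apply: le_trans (Mx_powR s t (ltW m0)).
  by rewrite ler_powR.
pose V (v w : Rn R N -> R) (y : Rn R N) : R := \1_Om y + `|E e y| `^ (2 * r) +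
  2 `^ m * (\1_Om y + `|v y| `^ m + `|w y| `^ m).
have iV (v w : Rn R N -> R) : intg (fun x => `|v x| `^ m) -> intg (fun x => `|w x| `^ m) -> intg (V v w).
  by move=> v1 w1; apply: intgD; [exact: intgD|apply: intgZ; apply: intgD => //; exact: intgD].
have IV (v w : Rn R N -> R) : intg (fun x => `|v x| `^ m) -> intg (fun x => `|w x| `^ m) ->
    Int (V v w) = fine (mu Om) + Int (fun x => `|E e x| `^ (2 * r)) +
      2 `^ m * (fine (mu Om) + Int (fun x => `|v x| `^ m) + Int (fun x => `|w x| `^ m)).
  move=> v1 w1; have k1 := intgD iO v1; have k2 := intgD k1 w1; have k3 := intgD iO (Ei e).
  rewrite /V (IntD k3 (intgZ (2 `^ m) k2)) (IntD iO (Ei e)) (IntZ _ k2) (IntD k1 w1) (IntD iO v1).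
  by rewrite !Int_indic.
have pm0 : `|0 : R| `^ m = 0 by rewrite normr0 powR0// lt0r_neq0.
have iun n : intg (fun x => `|un n x| `^ m) by exact: (Ui n e (Psi := fun s _ => `|s| `^ m)).
have iue n : intg (fun x => `|ue n e x| `^ m) by exact: (Ui n e (Psi := fun _ t => `|t| `^ m)).
have P_le n x : `|Pn n e x| <= `|E e x| * Mx (un n x) (ue n e x) `^ g by exact: upwind_le.
have oE_le x : `|odd_power g (u x) * E e x| <= `|E e x| * Mx (u x) (u x) `^ g.
  rewrite normrM mulrC ler_wpM2l// norm_odd_power//.
  apply: ge0_ler_powR; rewrite ?nnegrE ?(ltW g0) ?(ltW (Mx_gt0 _ _))//.
  by apply: le_trans (Mx_l (u x) (u x)); rewrite lerDr.
have CCp : 0 <= CC `^ p by exact: powR_ge0.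
have mul_le (w z : R) y s t : `|w| <= `|E e y| * Mx s t `^ g -> `|z| <= CC ->
    `|w * z| `^ p <= CC `^ p * (\1_Om y + `|E e y| `^ (2 * r) + 2 `^ m * (\1_Om y + `|s| `^ m + `|t| `^ m)).
  move=> wE zC; rewrite normrM powRM// mulrC ler_pM ?powR_ge0//; last exact: key.
  by apply: ge0_ler_powR; rewrite ?nnegrE// ltW.
have Pd_le n x : `|Pn n e x * del n e x| `^ p <= CC `^ p * V (un n) (ue n e) x.
  exact: mul_le (P_le n x) (dC n x).
have Z_le x : `|Z0 e x| `^ p <= CC `^ p * V u u x.
  by apply: mul_le (oE_le x) _; case: (HCC x e 0).
have intp (F G : Rn R N -> R) : mf F -> intg G -> (forall x, `|F x| `^ p <= G x) -> intg (fun x => `|F x| `^ p).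
  move=> Fm Gi FG; apply: (@intg_dom _ (Rn R N) R mu _ G _ _ Gi).
    exact: (@measurable_norm_powR _ (Rn R N) R F p Fm).
  by move=> x; rewrite (ger0_norm (powR_ge0 _ _)).
have iPd n : intg (fun x => `|Pn n e x * del n e x| `^ p).
  by apply: intp (Pdm n) _ (Pd_le n); apply: intgZ; exact: iV.
have iZ : intg (fun x => `|Z0 e x| `^ p) by apply: intp Zm _ Z_le; apply: intgZ; exact: iV.
have ioE : intg (fun x => `|odd_power g (u x) * E e x| `^ p).
  by apply: (intp _ (V u u) oEm); [exact: iV|move=> x; apply: key; exact: oE_le].
have P_off n x : ~ Om x -> Pn n e x = 0.
  move=> Ox; apply/eqP; rewrite -normr_eq0 eq_le normr_ge0 andbT.
  by apply: le_trans (P_le n x) _; rewrite E_off// normr0 mul0r.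
have oE_off x : ~ Om x -> odd_power g (u x) * E e x = 0 by move=> Ox; rewrite E_off// mulr0.
have Pd_off n x : ~ Om x -> Pn n e x * del n e x = 0 by move=> /P_off ->; rewrite mul0r.
have Z_off x : ~ Om x -> Z0 e x = 0 by move=> /oE_off; rewrite /Z0 => ->; rewrite mul0r.
have i1 n : intg (fun x => Pn n e x * del n e x).
  exact: (intg_of_powR mOm Ofin (ltW p1) (Pdm n) (Pd_off n) (iPd n)).
have i2 : intg (Z0 e) by exact: (intg_of_powR mOm Ofin (ltW p1) Zm Z_off iZ).
have i3 : intg (fun x => odd_power g (u x) * E e x).
  exact: (intg_of_powR mOm Ofin (ltW p1) oEm oE_off ioE).
split=> //.
pose F n (x : Rn R N) := Pn n e x * del n e x - Z0 e x.
have Fm n : mf (F n) by exact: (measurable_funB (Pdm n) Zm).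
have F_off n x : ~ Om x -> F n x = 0 by move=> Ox; rewrite /F Pd_off// Z_off// subrr.
pose KV (c : R) := fine (mu Om) + Int (fun x => `|E e x| `^ (2 * r)) + 2 `^ m * (fine (mu Om) + c + c).
pose K := 2 `^ p * (CC `^ p * KV C + CC `^ p * KV (Int (fun x => `|u x| `^ m))).
have Fb n : intg (fun x => `|F n x| `^ p) /\ Int (fun x => `|F n x| `^ p) <= K.
  pose G (x : Rn R N) := 2 `^ p * (CC `^ p * V (un n) (ue n e) x + CC `^ p * V u u x).
  have k1 := intgZ (CC `^ p) (iV _ _ (iun n) (iue n)).
  have k2 := intgZ (CC `^ p) (iV _ _ uim uim).
  have k3 := intgD k1 k2.
  have Gi : intg G by exact: intgZ.
  have FG x : `|F n x| `^ p <= G x.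
    have := ler_powRD (Pn n e x * del n e x) (- Z0 e x) (ltW p0); rewrite normrN => H.
    apply: le_trans H _; rewrite ler_wpM2l ?powR_ge0//; apply: lerD; [exact: Pd_le|exact: Z_le].
  have Fi := intp _ _ (Fm n) Gi FG; split=> //.
  apply: le_trans (le_Int Fi Gi FG) _.
  rewrite /G (IntZ _ k3) (IntD k1 k2) (IntZ _ (iV _ _ (iun n) (iue n))) (IntZ _ (iV _ _ uim uim)).
  rewrite (IV _ _ (iun n) (iue n)) (IV _ _ uim uim) /K ler_wpM2l ?powR_ge0// lerD2r.
  rewrite ler_wpM2l// /KV lerD2l ler_wpM2l ?powR_ge0//.
  by apply: lerD; [rewrite lerD2l; exact: Um|exact: Uem].
have Fc : {ae mu, forall x, F n x @[n --> \oo] --> 0}.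
  apply: (@ae_imp _ (Rn R N) R mu _ _ (both e)) => x [c1 c2].
  have cc (z : R) : (fun _ : nat => z) @ \oo --> z by exact: cvg_cst.
  have c3 := seqB (seqM (cc (Num.max 0 (E e x))) (greg_cvg c1)) (seqM (cc (Num.max 0 (- E e x))) (greg_cvg c2)).
  have c4 := seqB (seqM c3 (@del_cvg e x)) (cc (Z0 e x)).
  have lim_eq (z : R) : F ^~ x @ \oo --> z -> z = 0 -> F ^~ x @ \oo --> 0 by move=> c ze; move: c; rewrite ze.
  apply: (lim_eq _ c4).
  (* The upwind splitting recombines in the limit: the positive part of [E] minus its negative part
     is [E]. *)
  apply/eqP; rewrite subr_eq0; apply/eqP; rewrite /Z0.
  have [E0|E0] := leP 0 (E e x); first by rewrite (max_idPl (_ : - E e x <= 0)) ?oppr_le0//; ring.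
  by rewrite (max_idPr (_ : 0 <= - E e x)) ?oppr_ge0 ?ltW//; ring.
have [_ c0] := @Int_vitali _ (Rn R N) R mu Om F p K p1 mOm Ofin Fm F_off Fb Fc.
apply/subr_cvg0/norm_cvg0P.
apply: (@squeeze_cvgr _ _ _ _ (fun=> 0) (fun n => Int (fun x => `|F n x|))); [|exact: cvg_cst|exact: c0].
by apply: nearW => n; rewrite normr_ge0/= -(IntB (i1 n) i2); apply: norm_Int; exact: intgB.
Qed.

Lemma drift_integrable e : intg (fun x => odd_power g (u x) * E e x).
Proof. by case: (drift e). Qed.

(** The difference quotients are paired with the limiting coefficient [a x (u x)], so that the left
    side is linear in them and can be averaged with convex weights afterwards. *)
Lemma equation_limit :
  (\forall n \near \oo, Int (fun x => U n (idx (h n) x) * phi (pt (h n) (idx (h n) x))) +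
    \sum_e Int (fun x => flux (A x) g (h n) (E e x) (U n (idx (h n) x)) (U n (idx (h n) x + dir e)) *
      ((phi (pt (h n) (idx (h n) x)) - phi (pt (h n) (idx (h n) x + dir e))) / h n)) =
    Int (fun x => f x * phi (pt (h n) (idx (h n) x)))) ->
  \sum_e Int (fun x => D n e x * (a x (u x) * partial_deriv e phi x)) @[n --> \oo] -->
    Int (fun x => f x * phi x) +
    \sum_e Int (fun x => odd_power g (u x) * E e x * partial_deriv e phi x) -
    Int (fun x => u x * phi x).
Proof.
move=> [n0 _ Heq]; have [CC CC0 HCC] := lip.
have phm : mf phi by case: (C1c_measurable phiM).
have uni n : intg (un n) by apply: (Ui n (Ordinal N0) (Psi := fun s _ => s)).
have ph_le x : `|phi x| <= CC by case: (HCC x (Ordinal N0) 0).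
have ps_le n x : `|psi_ n x| <= CC by exact: ph_le.
have pae : {ae mu, forall x, psi_ n x @[n --> \oo] --> phi x} by apply: aeW; exact: psi_cvg.
have t1 : Int (fun x => un n x * psi_ n x) @[n --> \oo] --> Int (fun x => u x * phi x).
  exact: (@cvg_Int_mul _ (Rn R N) R mu (fun n => un n) u psi_ phi CC uni ui uL1 psim phm ps_le pae
    (intg_mul_bounded ui phm ph_le)).
have t2 : Int (fun x => f x * psi_ n x) @[n --> \oo] --> Int (fun x => f x * phi x).
  apply: (@cvg_Int_mul _ (Rn R N) R mu (fun=> f) f psi_ phi CC (fun=> fi) fi _ psim phm ps_le pae
    (intg_mul_bounded fi phm ph_le)).
  rewrite (_ : (fun n => _) = (fun=> 0)); first exact: cvg_cst.
  apply/funext => n; rewrite -[RHS](@Int0 _ (Rn R N) R mu).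
  by congr Rintegral; apply/funext => x; rewrite subrr normr0.
have t3 : \sum_e Int (fun x => Pn n e x * del n e x) @[n --> \oo] --> \sum_e Int (Z0 e).
  by apply: cvg_sum_fin => e; case: (drift e).
have t4 : \sum_e (Int (fun x => D n e x * bn n e x) - Int (fun x => D n e x * (au x * partial_deriv e phi x)))
    @[n --> \oo] --> \sum_(e < N) (0 : R).
  by apply: cvg_sum_fin => e; case: (principal e).
rewrite big1_eq in t4.
have t5 := seqB (seqB (seqD t2 t3) t1) t4; rewrite subr0 in t5.
apply: seq_near_eq t5; exists n0 => // n /= nn.
have /= Hn := Heq n nn.
(* [A s - A t] is minus the divided difference of [A] times [t - s], and the test difference has the
   opposite sign too; when [s = t] both principal terms are 0. *)
have fE e : Int (fun x => flux (A x) g (h n) (E e x) (U n (idx (h n) x)) (U n (idx (h n) x + dir e)) *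
      ((phi (pt (h n) (idx (h n) x)) - phi (pt (h n) (idx (h n) x + dir e))) / h n)) =
    Int (fun x => D n e x * bn n e x) - Int (fun x => Pn n e x * del n e x).
  have [k1 _] := principal e; have [k2 _ _ _] := drift e.
  rewrite -(IntB (k1 n) (k2 n)); congr Rintegral; apply/funext => x.
  rewrite /bn /Pn /flux /del /coef_quotient.
  move: (phi (pt (h n) (idx (h n) x))) (phi (pt (h n) (idx (h n) x + dir e))) => p1 p2.
  move: (U n (idx (h n) x)) (U n (idx (h n) x + dir e)) (Num.max 0 (E e x)) (Num.max 0 (- E e x)) => s t E1 E2.
  have hn0 : h n != 0 by rewrite lt0r_neq0.
  have [->|st] := eqVneq s t; first by field.
  have ts : t - s != 0 by rewrite subr_eq0 eq_sym.
  by field; rewrite ts hn0.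
move: Hn; rewrite (eq_bigr _ (fun e _ => fE e)) sumrB => Hn.
have ar (x1 x2 x3 x4 x5 : R) : x1 + (x2 - x3) = x4 -> x4 + x3 - x1 - (x2 - x5) = x5 by move=> <-; ring.
rewrite /= sumrB; exact: ar Hn.
Qed.

End test_equation.

End limit_equation.

(** * Solutions when the structure conditions hold at every point *)

Section regular_data.
Context (R : realType) (N : nat).
Notation mu := (leb R N).
Notation mf f := (measurable_fun [set: Rn R N] (f : Rn R N -> R)).
Notation intg f := (mu.-integrable [set: Rn R N] (EFin \o (f : Rn R N -> R))).
Notation Int f := (\int[mu]_x (f : Rn R N -> R) x).

Lemma half_pow_itv n : 0 < (2 ^- n : R) <= 1.
Proof. by rewrite invr_gt0 exprn_gt0//= invf_le1 ?exprn_gt0// exprn_ege1// ler1n. Qed.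

Lemma half_pow_cvg0 (s : nat -> nat) : (forall n, (n <= s n)%N) -> (2 ^- s n : R) @[n --> \oo] --> 0.
Proof.
move=> sn; have c2 : (2^-1 : R) ^+ n @[n --> \oo] --> 0.
  by apply: cvg_expr; rewrite ger0_norm ?invr_ge0// invf_lt1// ltr1n.
apply: (squeeze_cvgr _ (cvg_cst 0) c2); apply: nearW => n.
by rewrite invr_ge0 exprn_ge0//= exprVn lef_pV2 ?posrE ?exprn_gt0// ler_weXn2l// ler1n.
Qed.

Lemma Int_le_power Om p C (v : 'rV[R]_N -> R) : measurable (Om : set (Rn R N)) -> (mu Om < +oo)%E ->
  1 <= p -> mf v -> (forall x, ~ Om x -> v x = 0) -> intg (fun x => `|v x| `^ p) ->
  Int (fun x => `|v x| `^ p) <= C -> Int (fun x => `|v x|) <= Int (\1_Om : Rn R N -> R) + C.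
Proof.
move=> mOm Of p1 vm v0 vi vC.
have iO : intg (\1_Om : Rn R N -> R) by exact: intg_indic.
have nvm : mf (fun x => `|v x|) by exact: measurableT_comp vm.
have v1 : intg (fun x => `|v x|).
  apply: (intg_of_powR mOm Of p1 nvm) => [x /v0 ->|]; first by rewrite normr0.
  by under eq_fun => x do rewrite normr_id.
apply: le_trans (_ : Int (fun x => \1_Om x + `|v x| `^ p) <= _); last by rewrite IntD// lerD2l.
apply: le_Int => // [|x]; first exact: intgD.
have [xO|xO] := pselect (Om x); last by rewrite v0// normr0 addr_ge0// powR_ge0.
rewrite indicE mem_set//=; have [x1|x1] := leP `|v x| 1.
  by apply: le_trans x1 _; rewrite lerDl powR_ge0.
apply: le_trans (_ : `|v x| `^ p <= _); last by rewrite lerDr.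
by rewrite -{1}[`|v x|]powRr1// ler_powR// ltW.
Qed.

Variables (Om : set 'rV[R]_N) (a : 'rV[R]_N -> R -> R) (f : 'rV[R]_N -> R) (E : 'I_N -> 'rV[R]_N -> R).
Variables (th g m r al be : R).
Hypotheses (N0 : (0 < N)%N) (oOm : open Om) (bOm : bounded_set Om) (m2 : 2 <= m) (mth : m < th + 2)
  (th0 : 0 < th) (g0 : 0 < g) (thg : 0 < 2 - th - 2 * g) (al0 : 0 < al) (be0 : 0 < be)
  (rm : m / (2 - th - 2 * g) <= r).
Hypotheses (am : forall s, mf (a ^~ s)) (ac : forall x, continuous (a x))
  (ab : forall x s, al / (1 + `|s|) `^ th <= a x s <= be).
Hypotheses (fm : mf f) (f_off : forall x, ~ Om x -> f x = 0) (fi : intg (fun x => `|f x| `^ m)).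
Hypotheses (Em : forall e, mf (E e)) (E_off : forall e x, ~ Om x -> E e x = 0)
  (Ei : forall e, intg (fun x => `|E e x| `^ (2 * r))).
Notation q := (sobolev_exp th m).

Theorem regular_data_solution : exists u G,
  [/\ [/\ mf u, forall x, ~ Om x -> u x = 0 & intg (fun x => `|u x| `^ m)],
    [/\ forall e, mf (G e), forall e x, ~ Om x -> G e x = 0 & forall e, intg (fun x => `|G e x| `^ q)],
    forall e phi, test_function setT phi ->
      Int (fun x => G e x * phi x) = - Int (fun x => u x * partial_deriv e phi x),
    forall ep, 0 < ep -> exists2 w, test_function Om w &
      [/\ intg (fun x => `|u x - w x| `^ q), Int (fun x => `|u x - w x| `^ q) <= ep &
        forall e, intg (fun x => `|G e x - partial_deriv e w x| `^ q) /\
          Int (fun x => `|G e x - partial_deriv e w x| `^ q) <= ep] &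
    (forall e, intg (fun x => odd_power g (u x) * E e x)) /\
    forall phi, test_function Om phi ->
      \sum_e Int (fun x => G e x * (a x (u x) * partial_deriv e phi x)) + Int (fun x => u x * phi x) =
      \sum_e Int (fun x => odd_power g (u x) * E e x * partial_deriv e phi x) + Int (fun x => f x * phi x)].
Proof.
have mOm : measurable (Om : set (Rn R N)) by exact: open_measurable_Rn.
have Of : (mu Om < +oo)%E by exact: leb_bounded.
have a0 x s : 0 <= a x s <= be.
  have /andP[a1 ->] := ab x s; rewrite andbT; apply: le_trans a1.
  by rewrite divr_ge0 ?powR_ge0// ltW.
have [A [Am Ab]] := @caratheodory_primitive _ (Rn R N) R a be am ac a0.
have Ale x s t : s <= t -> al * Mx s t `^ (- th) * (t - s) <= A x t - A x s <= be * (t - s).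
  move=> st; apply: Ab => // y /andP[sy yt]; have /andP[b1 ->] := ab x y; rewrite andbT.
  apply: le_trans b1; rewrite powRN ler_pM2l// lef_pV2 ?posrE ?powR_gt0 ?ltr_pwDl//.
  apply: ge0_ler_powR; rewrite ?nnegrE ?addr_ge0 ?(ltW th0)//.
  rewrite lerD2l le_max; have [y0|y0] := leP 0 y.
    by rewrite (ger0_norm y0) (le_trans yt (ler_norm t)) orbT.
  by rewrite (ltr0_norm y0) (le_trans _ (_ : - s <= `|s|)) ?lerN2// -normrN ler_norm.
have [C [B [I0 [U0 [C0 [B0 H]]]]]] := discrete_solutions N0 mOm bOm m2 mth th0 g0 thg al0 be0 Am Ale
  fm f_off fi Em E_off rm Ei.
have uI0 n : uniq (I0 n) by have [[]] := H n.
have IP0 n k : k \in I0 n -> inner Om (2 ^- n) k by have [[_ IP _ _] _] := H n; case: (IP k).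
have UI0 n k : k \notin I0 n -> U0 n k = 0 by have [[_ _ _ UI] _] := H n; exact: UI.
have off0 := lattice_off half_pow_itv IP0 UI0.
have dirle (e i : 'I_N) : `|(dir e : 'rV[int]_N) 0 i| <= 1 by rewrite mxE; case: (_ && _).
have p0 n : 0 < (2 ^- n : R) by case/andP: (half_pow_itv n).
have offU n x : ~ Om x -> U0 n (idx (2 ^- n) x) = 0.
  by move=> Ox; rewrite -[idx _ _]addr0; apply: off0 => // i; rewrite mxE normr0.
have offE n e x : ~ Om x -> U0 n (idx (2 ^- n) x + dir e) = 0 by move=> Ox; apply: off0.
have um0 n : mf (fun x => U0 n (idx (2 ^- n) x)) by exact: measurable_lat.
have em0 n e : mf (fun x => U0 n (idx (2 ^- n) x + dir e)).
  exact: (measurable_lat (p0 n) (fun k => U0 n (k + dir e))).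
have q12 : 1 < q < 2 by exact: (sobolev_exp_itv m2 mth th0 g0 thg).
have L1u n : Int (fun x => `|U0 n (idx (2 ^- n) x)|) <= Int (\1_Om : Rn R N -> R) + C.
  have [_ [[i1 i2] _ _]] := H n; apply: (Int_le_power mOm Of _ (um0 n) (offU n) i1 i2).
  by move: m2; lra.
have V0 : 0 <= Int (\1_Om : Rn R N -> R) by apply: Int_ge0 => x; rewrite indicE.
have L1d n e : Int (fun x => `|U0 n (idx (2 ^- n) x + dir e) - U0 n (idx (2 ^- n) x)|) <=
    2 ^- n * (Int (\1_Om : Rn R N -> R) + C).
  have [_ [_ D _]] := H n; have [d1 d2] := D e.
  have dm : mf (fun x => (U0 n (idx (2 ^- n) x + dir e) - U0 n (idx (2 ^- n) x)) / 2 ^- n).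
    by apply: measurable_funM; [exact: measurable_funB|exact: measurable_cst].
  have doff x : ~ Om x -> (U0 n (idx (2 ^- n) x + dir e) - U0 n (idx (2 ^- n) x)) / 2 ^- n = 0.
    by move=> Ox; rewrite offU// offE// subrr mul0r.
  have q1 : 1 <= q by case/andP: q12 => /ltW.
  rewrite -ler_pdivrMl//; apply: le_trans (Int_le_power mOm Of q1 dm doff d1 d2).
  rewrite -IntZ; last first.
    apply: (intg_lat2 N0 (dir e) (p0 n) (uI0 n) (UI0 n) (Psi := fun s t => `|t - s|)).
    by rewrite subrr normr0.
  rewrite le_eqVlt; apply/orP; left; apply/eqP; congr Rintegral; apply/funext => x.
  by rewrite normrM mulrC [in RHS](gtr0_norm (_ : 0 < (2 ^- n)^-1)) ?invr_gt0.
have bd n k i : U0 n k != 0 -> `|(k 0 i)%:~R| <= B * 2 ^+ n.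
  have [[_ _ Ib _] _] := H n => Uk; apply: Ib; apply: contraNT Uk => /UI0 ->; exact: eqxx.
have [s [u0 [u0m sn u0c]]] := lattice_compactness N0 B0 (addr_ge0 V0 C0) uI0 UI0 bd L1u L1d.
(* The limit is set to 0 off [Om], where the lattice functions vanish. *)
pose u x := u0 x * \1_Om x.
have um : mf u by apply: measurable_funM => //; exact: measurable_indic.
have uO x : ~ Om x -> u x = 0 by move=> Ox; rewrite /u indicE memNset// mulr0.
have uc : {ae mu, forall x, U0 (s n) (idx (2 ^- s n) x) @[n --> \oo] --> u x}.
  apply: (@ae_imp _ (Rn R N) R mu _ _ u0c) => x cx.
  have [xO|xO] := pselect (Om x); first by rewrite /u indicE mem_set// mulr1.
  by rewrite uO//; apply: seq_eq (cvg_cst 0) => n; rewrite offU.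
pose h n : R := 2 ^- s n.
have h01 n : 0 < h n <= 1 by exact: half_pow_itv.
have hc : h n @[n --> \oo] --> 0 by exact: half_pow_cvg0.
have hfast n : h n <= 2 ^- n by rewrite /h lef_pV2 ?posrE ?exprn_gt0// ler_weXn2l// ler1n.
have Um n : intg (fun x => `|U0 (s n) (idx (h n) x)| `^ m) /\
    Int (fun x => `|U0 (s n) (idx (h n) x)| `^ m) <= C by have [_ []] := H (s n).
have UD n e : intg (fun x => `|(U0 (s n) (idx (h n) x + dir e) - U0 (s n) (idx (h n) x)) / h n| `^ q) /\
    Int (fun x => `|(U0 (s n) (idx (h n) x + dir e) - U0 (s n) (idx (h n) x)) / h n| `^ q) <= C.
  by have [_ [_ D _]] := H (s n); exact: D.
have Uem n e : Int (fun x => `|U0 (s n) (idx (h n) x + dir e)| `^ m) <= C.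
  have [i1 i2] := Um n; have ph := p0 (s n).
  rewrite (_ : (fun x => _) = (fun x => `|U0 (s n) (idx (h n) (x + pt (h n) (dir e)))| `^ m)).
    by rewrite (Int_translate (f := fun x => `|U0 (s n) (idx (h n) x)| `^ m)).
  by apply/funext => x; rewrite idx_translate.
have [G [K [c [cw Gm GO Gi [Gw Gp Ga]]]]] := gradient_limit (h := h) (I := fun n => I0 (s n))
  (U := fun n => U0 (s n)) N0 oOm bOm q12 m2 h01 hc (fun n => uI0 (s n)) (fun n => IP0 (s n))
  (fun n => UI0 (s n)) Um UD um uO uc.
have [uim _] := limit_integrable (h := h) (U := fun n => U0 (s n)) m2 Um um uc.
have [_ ui uL1] := limit_L1 (h := h) (I := fun n => I0 (s n)) (U := fun n => U0 (s n)) oOm bOm m2 h01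
  (fun n => IP0 (s n)) (fun n => UI0 (s n)) Um um uO uc.
have fi1 : intg f by apply: (intg_of_powR mOm Of _ fm f_off fi); move: m2; lra.
have g01 : 0 < g < 1 by apply/andP; split=> //; move: th0 thg; lra.
have r1 : 1 < r by apply: lt_le_trans rm; rewrite ltr_pdivlMr// mul1r; move: m2 th0 g0; lra.
have Ui n e (Psi : R -> R -> R) : Psi 0 0 = 0 ->
    intg (fun x => Psi (U0 (s n) (idx (h n) x)) (U0 (s n) (idx (h n) x + dir e))).
  by move=> P0; apply: (intg_lat2 N0 (dir e) (p0 (s n)) (uI0 (s n)) (UI0 (s n)) P0).
have Uoff n e x : ~ Om x -> U0 (s n) (idx (h n) x) = 0 /\ U0 (s n) (idx (h n) x + dir e) = 0.
  by move=> Ox; split; [exact: offU|exact: offE].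
have Um2 n := (Um n).2; have UD2 n e := (UD n e).2.
exists u, G; split=> //; split.
  (* Integrability of the drift was obtained in the presence of a test function; one of the
     approximants of [u] is supplied. *)
  have [w wt _] := Ga 1 ltr01; have [M wM] := test_C1c wt.
  exact: (@drift_integrable R N Om E g m r q C h (fun n => U0 (s n)) u oOm bOm q12 m2 g01 r1 h01 hfast hc
    Em E_off Ei Ui Uoff Um2 Uem UD2 um uim uc M w wM).
move=> phi pt_; have [M phM] := test_C1c pt_.
have [sm cs sO] := pt_.
have [n0 n0P] := compact_inner oOm cs sO.
have L := @equation_limit R N Om a A f E g m r q be C h (fun n => U0 (s n)) u N0 oOm bOm q12 m2 g01 r1 be0
  h01 hfast hc am ac a0 Am Ab fi1 Em E_off Ei Ui Uoff Um2 Uem UD2 um ui uim uc uL1 M phi phM.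
have /L {}L : \forall n \near \oo,
    Int (fun x => U0 (s n) (idx (h n) x) * phi (pt (h n) (idx (h n) x))) +
    \sum_e Int (fun x => flux (A x) g (h n) (E e x) (U0 (s n) (idx (h n) x)) (U0 (s n) (idx (h n) x + dir e)) *
      ((phi (pt (h n) (idx (h n) x)) - phi (pt (h n) (idx (h n) x + dir e))) / h n)) =
    Int (fun x => f x * phi (pt (h n) (idx (h n) x))).
  exists n0 => // n /= nn.
  have [_ [_ _ eqn]] := H (s n).
  have [|_ _ ->//] := eqn (fun k => phi (pt (h n) k)).
  move=> k kI; apply: contrapT => /eqP pk; move/negP: kI; apply.
  have [[_ IP _ _] _] := H (s n); apply/IP; apply: n0P; first exact: leq_trans nn (sn n).
  exact: subset_closure.
have pphm e : mf (partial_deriv e phi) by have [_] := C1c_measurable phM.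
have [CC CC0 lipC] := C1c_lipschitz phM.
pose F e x := a x (u x) * partial_deriv e phi x.
have aum : mf (fun x => a x (u x)) by exact: (@measurable_superposition _ (Rn R N) R a u am ac um).
have Fm e : mf (F e) by exact: measurable_funM (aum) (pphm e).
have Fle e x : `|F e x| <= be * CC.
  rewrite normrM ler_pM//; last by case: (lipC x e 0).
  by have /andP[b1 b2] := a0 x (u x); rewrite ger0_norm.
(* Averaging with the weights of [gradient_limit] keeps the limit of the equation, while the
   averaged integrals of the difference quotients tend to those of [G]. *)
have L1 := tail_weights_cvg cw L.
have L2 : \sum_e \sum_(n < K k) c k n *
    Int (fun x => (U0 (s n) (idx (h n) x + dir e) - U0 (s n) (idx (h n) x)) / h n * F e x) @[k --> \oo] -->
    \sum_e Int (fun x => G e x * F e x).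
  by apply: cvg_sum_fin => e; exact: (Gw e (F e) _ (Fm e) (Fle e)).
have {}L1 : \sum_e \sum_(n < K k) c k n *
    Int (fun x => (U0 (s n) (idx (h n) x + dir e) - U0 (s n) (idx (h n) x)) / h n * F e x) @[k --> \oo] -->
    Int (fun x => f x * phi x) + \sum_e Int (fun x => odd_power g (u x) * E e x * partial_deriv e phi x) -
    Int (fun x => u x * phi x).
  apply: seq_eq L1 => k; rewrite exchange_big; apply: eq_bigr => n _; by rewrite mulr_sumr.
rewrite (cvg_unique _ L2 L1); first by rewrite subrK addrC.
exact: Rhausdorff.
Qed.

End regular_data.

(** * Passage to the Sobolev spaces and norms of the statement *)

Section sobolev_space.
Context (R : realType) (N : nat).
Notation mu := (leb R N).
Notation mf f := (measurable_fun [set: Rn R N] (f : Rn R N -> R)).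
Notation intg f := (mu.-integrable [set: Rn R N] (EFin \o (f : Rn R N -> R))).
Notation Int f := (\int[mu]_x (f : Rn R N -> R) x).

Lemma restrict_off (Om : set 'rV[R]_N) (v : 'rV[R]_N -> R) :
  (forall x, ~ Om x -> v x = 0) -> v \_ Om = v.
Proof.
move=> v0; apply/funext => x; rewrite patchE; case: ifPn => // /negP; rewrite inE => xO.
by rewrite v0.
Qed.

Lemma Int_restrict (Om : set 'rV[R]_N) (v : 'rV[R]_N -> R) :
  (forall x, ~ Om x -> v x = 0) -> \int[mu]_(x in Om) v x = Int v.
Proof. by move=> v0; rewrite Rintegral_mkcond (restrict_off v0). Qed.

Lemma inLp_mf_intg (Om : set 'rV[R]_N) p (v : 'rV[R]_N -> R) : 1 <= p -> inLp Om p v ->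
  mf (v \_ Om) /\ intg (fun x => `|(v \_ Om) x| `^ p).
Proof.
move=> p1 vp; split; last exact: Lfun_integrable.
by have := sub_Lfun_mfun vp; rewrite inE.
Qed.

Lemma normLpE (Om : set 'rV[R]_N) p (v : 'rV[R]_N -> R) : (forall x, ~ Om x -> v x = 0) ->
  intg (fun x => `|v x| `^ p) ->
  normLp Om p v = ((Int (fun x => `|v x| `^ p)) `^ p^-1)%:E.
Proof.
move=> v0 vi; rewrite /normLp (restrict_off v0) unlock /= -poweR_EFin (intg_EFin vi).
by congr poweR; apply: eq_integral => x _ /=; rewrite abse_EFin poweR_EFin.
Qed.

Lemma intg_inLp (Om : set 'rV[R]_N) p (v : 'rV[R]_N -> R) : mf v -> (forall x, ~ Om x -> v x = 0) ->
  intg (fun x => `|v x| `^ p) -> inLp Om p v.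
Proof.
move=> vm v0 vi; rewrite /inLp (restrict_off v0); apply/andP; split; first by rewrite inE.
rewrite inE /=; have := normLpE v0 vi; rewrite /normLp (restrict_off v0) /finite_norm => ->.
exact: ltry.
Qed.

Lemma intg_inL1loc (Om : set 'rV[R]_N) (v w : 'rV[R]_N -> R) : open Om -> intg v ->
  (forall x, Om x -> w x = v x) -> inL1loc Om w.
Proof.
move=> oOm vi wv.
have mOm : measurable (Om : set (Rn R N)) by exact: open_measurable_Rn.
split=> [|K cK KO].
  apply: (@eq_measurable_fun _ _ (Rn R N) _ Om v) => [x|]; first by rewrite inE => /wv.
  by apply: (@measurable_funS _ _ (Rn R N) _ setT _ _ (@measurableT _ (Rn R N)) (@subsetT _ _)); move/integrableP: vi => [/measurable_EFinP].
have mK : measurable (K : set (Rn R N)).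
  rewrite -[K]setCK; apply: (@measurableC _ (Rn R N)); apply: open_measurable_Rn.
  apply: closed_openC; apply: compact_closed cK; exact: norm_hausdorff.
apply: (@eq_integrable _ (Rn R N) R mu K mK (EFin \o v)) => [x|].
  by rewrite inE => /KO /wv /= ->.
by apply: (@integrableS _ (Rn R N) R mu setT K) => //.
Qed.

(** On [Om], [|v| <= t + t^(1-p) |v|^p]: the level [t] is fixed by the measure of [Om], then [dl]
    makes the second part at most [ep / 2]. This transfers approximation from exponent [p] to
    exponent 1. *)
Lemma power_L1_small (Om : set 'rV[R]_N) p ep : measurable (Om : set (Rn R N)) -> (mu Om < +oo)%E ->
  1 <= p -> 0 < ep -> exists2 dl, 0 < dl & forall v : 'rV[R]_N -> R, mf v ->
    (forall x, ~ Om x -> v x = 0) -> intg (fun x => `|v x| `^ p) ->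
    Int (fun x => `|v x| `^ p) <= dl -> Int (fun x => `|v x|) <= ep.
Proof.
move=> mOm Of p1 ep0.
have iO : intg (\1_Om : Rn R N -> R) by exact: intg_indic.
have V0 : 0 <= Int (\1_Om : Rn R N -> R) by apply: Int_ge0 => x; rewrite indicE.
set V := Int (\1_Om : Rn R N -> R) in V0.
pose t := ep / 2 / (V + 1).
have t0 : 0 < t by rewrite !divr_gt0// ltr_pwDr.
exists (ep / 2 * t `^ (p - 1)); first by apply: mulr_gt0; [exact: divr_gt0|exact: powR_gt0].
move=> v vm v0 vi vd.
have nvm : mf (fun x => `|v x|) by exact: measurableT_comp vm.
have v1 : intg (fun x => `|v x|).
  apply: (intg_of_powR mOm Of p1 nvm) => [x /v0 ->|]; first by rewrite normr0.
  by under eq_fun => x do rewrite normr_id.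
have tV : t * V <= ep / 2.
  rewrite /t mulrAC ler_pdivrMr ?ltr_pwDr// ler_pM2l ?divr_gt0//; lra.
apply: le_trans (_ : Int (fun x => t * \1_Om x + t `^ (1 - p) * `|v x| `^ p) <= _); last first.
  rewrite (IntD (intgZ _ iO) (intgZ _ vi)) (IntZ _ iO) (IntZ _ vi) -/V.
  have : t `^ (1 - p) * Int (fun x => `|v x| `^ p) <= ep / 2.
    rewrite -ler_pdivlMl ?powR_gt0// -powRN opprB mulrC; exact: vd.
  by move: tV; lra.
apply: le_Int => // [|x]; first by apply: intgD; exact: intgZ.
have [xO|xO] := pselect (Om x); last first.
  rewrite v0// normr0; apply: addr_ge0; apply: mulr_ge0; rewrite ?powR_ge0 ?(ltW t0)//.
rewrite indicE mem_set//= mulr1; have [x1|x1] := leP `|v x| t.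
  by apply: le_trans x1 _; rewrite lerDl mulr_ge0 ?powR_ge0.
apply: le_trans (_ : t `^ (1 - p) * `|v x| `^ p <= _); last by rewrite lerDr ltW.
have x0 : 0 < `|v x| by apply: lt_trans x1.
have -> : `|v x| `^ p = `|v x| * `|v x| `^ (p - 1).
  by rewrite -{2}[`|v x|]powRr1// -powRD ?(gt_eqF x0) ?implybT//; congr powR; ring.
rewrite mulrCA ler_peMr// -[X in X `^ (1 - p)]invrK -(opprB p 1) powRN.
rewrite invrK mulrC ler_pdivlMr ?powR_gt0// mul1r.
by apply: ge0_ler_powR; rewrite ?nnegrE ?subr_ge0 ?(ltW t0) ?(ltW x0) ?(ltW x1).
Qed.

Lemma test_off (Om : set 'rV[R]_N) (w : 'rV[R]_N -> R) x : test_function Om w -> ~ Om x -> w x = 0.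
Proof.
move=> [_ _ wO] Ox; apply: contrapT => /eqP wx; apply: Ox; apply: wO.
exact: subset_closure.
Qed.

Lemma W01p_grad (Om : set 'rV[R]_N) p (u : 'rV[R]_N -> R) (G : 'I_N -> 'rV[R]_N -> R) :
  open Om -> bounded_set Om -> 1 <= p ->
  mf u -> (forall x, ~ Om x -> u x = 0) -> intg (fun x => `|u x| `^ p) ->
  (forall e, mf (G e)) -> (forall e x, ~ Om x -> G e x = 0) -> (forall e, intg (fun x => `|G e x| `^ p)) ->
  (forall e phi, test_function setT phi ->
      Int (fun x => G e x * phi x) = - Int (fun x => u x * partial_deriv e phi x)) ->
  (forall ep, 0 < ep -> exists2 w, test_function Om w &
      [/\ intg (fun x => `|u x - w x| `^ p), Int (fun x => `|u x - w x| `^ p) <= ep &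
        forall e, intg (fun x => `|G e x - partial_deriv e w x| `^ p) /\
          Int (fun x => `|G e x - partial_deriv e w x| `^ p) <= ep]) ->
  inW01p_grad Om p u (fun x => \row_e G e x).
Proof.
move=> oOm bOm p1 um u0 ui Gm G0 Gi wk ap.
have mOm : measurable (Om : set (Rn R N)) by exact: open_measurable_Rn.
have Of : (mu Om < +oo)%E by exact: leb_bounded.
have rowE i : (fun x => (\row_e G e x) 0 i) = G i by apply/funext => x; rewrite mxE.
have p0 : 0 < p by exact: lt_le_trans p1.
split; first split; first split.
- by apply: (@intg_inL1loc Om u) => //; exact: (intg_of_powR mOm Of p1 um u0 ui).
- move=> i; rewrite rowE; apply: (@intg_inL1loc Om (G i)) => //.
  exact: (intg_of_powR mOm Of p1 (Gm i) (G0 i) (Gi i)).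
- move=> phi pt_ i; rewrite Int_restrict => [|x /u0 ->]; last by rewrite mul0r.
  rewrite (@Int_restrict Om (fun x => (\row_e G e x) 0 i * phi x)) => [|x Ox]; last by rewrite mxE G0// mul0r.
  rewrite (_ : (fun x => (\row_e G e x) 0 i * phi x) = (fun x => G i x * phi x)); last first.
    by apply/funext => x; rewrite mxE.
  by rewrite wk ?opprK//; case: pt_.
- exact: intg_inLp.
- by move=> i; rewrite rowE; exact: (intg_inLp (Gm i) (G0 i) (Gi i)).
(* There are [N + 1] norms, each at most [d]; dividing by [N + 2] makes the final inequality
   strict. *)
move=> e e0; pose d := e / N.+2%:R.
have d0 : 0 < d by rewrite divr_gt0// ltr0n.
have dK : (d `^ p) `^ p^-1 = d by rewrite -powRrM mulfV ?lt0r_neq0// powRr1// ltW.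
have [w wt [wi we wG]] := ap (d `^ p) (powR_gt0 _ d0).
exists w => //.
have small (v : 'rV[R]_N -> R) : (forall x, ~ Om x -> v x = 0) -> intg (fun x => `|v x| `^ p) ->
    Int (fun x => `|v x| `^ p) <= d `^ p -> (normLp Om p v <= d%:E)%E.
  move=> v0 vi vd; rewrite normLpE// lee_fin -dK; apply: ge0_ler_powR => //.
  - by rewrite invr_ge0 ltW.
  - by rewrite nnegrE; apply: Int_ge0 => x; exact: powR_ge0.
  - by rewrite nnegrE powR_ge0.
rewrite /normW1p; apply: (@le_lt_trans _ _ (d%:E + \sum_(i < N) d%:E)%E).
  apply: leeD; first by apply: small => // x Ox; rewrite u0// (test_off wt Ox) subr0.
  apply: lee_sum => i _.
  rewrite (_ : (fun x => (\row_e G e x - grad w x) 0 i) = (fun x => G i x - partial_deriv i w x)); last first.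
    by apply/funext => x; rewrite !mxE.
  have [w1 w2] := wG i; apply: small => // x Ox; by rewrite G0// (partial_off i wt Ox).2 subr0.
rewrite sumEFin sumr_const card_ord -EFinD lte_fin -mulrS -mulr_natr /d mulrAC.
by rewrite ltr_pdivrMr ?ltr0n// ltr_pM2l// ltr_nat.
Qed.

Lemma W01p_approx_L1 (Om : set 'rV[R]_N) p (u : 'rV[R]_N -> R) (G : 'I_N -> 'rV[R]_N -> R) :
  open Om -> bounded_set Om -> 1 <= p ->
  mf u -> (forall x, ~ Om x -> u x = 0) -> (forall e, mf (G e)) -> (forall e x, ~ Om x -> G e x = 0) ->
  (forall ep, 0 < ep -> exists2 w, test_function Om w &
      [/\ intg (fun x => `|u x - w x| `^ p), Int (fun x => `|u x - w x| `^ p) <= ep &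
        forall e, intg (fun x => `|G e x - partial_deriv e w x| `^ p) /\
          Int (fun x => `|G e x - partial_deriv e w x| `^ p) <= ep]) ->
  forall ep, 0 < ep -> exists2 w, test_function Om w &
      [/\ intg (fun x => `|u x - w x| `^ 1), Int (fun x => `|u x - w x| `^ 1) <= ep &
        forall e, intg (fun x => `|G e x - partial_deriv e w x| `^ 1) /\
          Int (fun x => `|G e x - partial_deriv e w x| `^ 1) <= ep].
Proof.
move=> oOm bOm p1 um u0 Gm G0 ap ep ep0.
have mOm : measurable (Om : set (Rn R N)) by exact: open_measurable_Rn.
have Of : (mu Om < +oo)%E by exact: leb_bounded.
have [dl dl0 Hd] := power_L1_small mOm Of p1 ep0.
have [w wt [wi we wG]] := ap dl dl0; exists w => //.
have [M wM] := test_C1c wt; have [wm dwm] := C1c_measurable wM.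
have E1 (v : 'rV[R]_N -> R) : (fun x => `|v x| `^ 1) = (fun x => `|v x|).
  by apply/funext => x; rewrite powRr1.
have L1 (v : 'rV[R]_N -> R) : mf v -> (forall x, ~ Om x -> v x = 0) -> intg (fun x => `|v x| `^ p) ->
    Int (fun x => `|v x| `^ p) <= dl -> intg (fun x => `|v x| `^ 1) /\ Int (fun x => `|v x| `^ 1) <= ep.
  move=> vm v0 vi vd; rewrite E1; split; last exact: Hd.
  have nvm : mf (fun x => `|v x|) by exact: measurableT_comp vm.
  apply: (intg_of_powR mOm Of p1 nvm) => [x /v0 ->|]; first by rewrite normr0.
  by under eq_fun => x do rewrite normr_id.
have [k1 k2] : intg (fun x => `|u x - w x| `^ 1) /\ Int (fun x => `|u x - w x| `^ 1) <= ep.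
  apply: (L1 (fun x => u x - w x) (measurable_funB um wm) _ wi we) => x Ox.
  by rewrite u0// (test_off wt Ox) subr0.
split; [exact: k1|exact: k2|move=> e; have [w1 w2] := wG e].
apply: (L1 (fun x => G e x - partial_deriv e w x) (measurable_funB (Gm e) (dwm e)) _ w1 w2) => x Ox.
by rewrite G0// (partial_off e wt Ox).2 subr0.
Qed.

(** Measurability of [w] comes from the completeness of Lebesgue measure, since [w] agrees almost
    everywhere with the measurable [v]. *)
Lemma ae_eq_Int (v w : 'rV[R]_N -> R) : mf v -> {ae mu, forall x, w x = v x} -> Int w = Int v.
Proof.
move=> vm H; congr fine.
have vm' : measurable_fun [set: Rn R N] (EFin \o (v : Rn R N -> R)) by exact/measurable_EFinP.
have cm : measure_is_complete mu by exact: measure_is_complete_caratheodory.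
have E1 : ae_eq mu [set: Rn R N] (EFin \o (v : Rn R N -> R)) (EFin \o (w : Rn R N -> R)).
  by apply: (@ae_imp _ (Rn R N) R mu _ _ H) => x /= -> _.
apply/esym/(@ae_eq_integral _ (Rn R N) R mu) => //.
exact: (@ae_measurable_fun _ (Rn R N) R mu cm _ _ _ E1).
Qed.

End sobolev_space.

Lemma intg_lower_power (R : realType) (N : nat) (Om : set 'rV[R]_N) (p q : R) (v : 'rV[R]_N -> R) :
  measurable (Om : set (Rn R N)) -> (leb R N Om < +oo)%E -> 0 < p <= q ->
  measurable_fun [set: Rn R N] (v : Rn R N -> R) -> (forall x, ~ Om x -> v x = 0) ->
  (leb R N).-integrable [set: Rn R N] (EFin \o ((fun x => `|v x| `^ q) : Rn R N -> R)) ->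
  (leb R N).-integrable [set: Rn R N] (EFin \o ((fun x => `|v x| `^ p) : Rn R N -> R)).
Proof.
move=> mOm Of /andP[p0 pq] vm v0 vi.
have iO : (leb R N).-integrable [set: Rn R N] (EFin \o (\1_Om : Rn R N -> R)) by exact: intg_indic.
have vm' : measurable_fun [set: Rn R N] (fun x : Rn R N => `|v x| `^ p).
  exact: (@measurable_norm_powR _ (Rn R N) R v p vm).
have le x : `| `|v x| `^ p | <= \1_Om x + `|v x| `^ q.
  rewrite (ger0_norm (powR_ge0 _ _)).
  have [xO|xO] := pselect (Om x); last first.
    by rewrite v0// normr0 powR0 ?lt0r_neq0// addr_ge0// ?powR_ge0// indicE ler0n.
  rewrite indicE mem_set//=; have [x1|x1] := leP `|v x| 1.
    apply: le_trans (_ : 1 <= _); last by rewrite lerDl powR_ge0.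
    have o1 : (1 : R) `^ p = 1 by rewrite powR1.
    rewrite -[leRHS]o1; apply: ge0_ler_powR; rewrite ?nnegrE//; exact: ltW.
  apply: le_trans (_ : `|v x| `^ q <= _); last by rewrite lerDr.
  by rewrite ler_powR// ltW.
exact: (@intg_dom _ (Rn R N) R (leb R N) _ _ vm' le (intgD iO vi)).
Qed.

Lemma patch_on (R : realType) (T : Type) (Om : set T) (v : T -> R) x : Om x -> (v \_ Om) x = v x.
Proof. by move=> xO; rewrite patchE mem_set. Qed.

Lemma patch_off (R : realType) (T : Type) (Om : set T) (v : T -> R) x : ~ Om x -> (v \_ Om) x = 0.
Proof. by move=> xO; rewrite patchE memNset. Qed.

(** * From almost everywhere hypotheses to the theorem *)

Theorem theorem6 (R : realType) (N : nat) (hN : (3 <= N)%N)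
  (Om : set 'rV[R]_N) (hOm : bounded_domain Om)
  (theta gamma : R) (htheta : 0 < theta) (hgamma : 0 < gamma)
  (hthetagamma : theta + 2 * gamma < 2)
  (a : 'rV[R]_N -> R -> R) (ha : caratheodory_function Om a)
  (alpha beta : R) (halpha : 0 < alpha) (hbeta : 0 < beta)
  (hab : {ae leb R N, forall x, Om x ->
     forall s : R, alpha / (1 + `|s|) `^ theta <= a x s <= beta})
  (m : R) (hm : 2 <= m < theta + 2)
  (f : 'rV[R]_N -> R) (hf : inLp Om m f)
  (r : R)
  (hr : Num.max (m / (2 - 2 * gamma - theta))
                (m / (6 + theta - 2 * m - 2 * gamma)) <= r)
  (E : 'rV[R]_N -> 'rV[R]_N)
  (hE : forall i, inLp Om (2 * r) (fun x => E x 0 i)) :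
  exists u : 'rV[R]_N -> R,
    [/\ distributional_solution Om a gamma E f u,
        inW01p Om (2 * m / (theta + 2)) u &
        inLp Om m u].
Proof.
have [oOm _ _ bOm] := hOm; have /andP[m2 mth] := hm.
have mOm : measurable (Om : set (Rn R N)) by exact: open_measurable_Rn.
have Of : (leb R N Om < +oo)%E by exact: leb_bounded.
have N0 : (0 < N)%N by exact: leq_trans hN.
have thg : 0 < 2 - theta - 2 * gamma by move: hthetagamma; lra.
have rm : m / (2 - theta - 2 * gamma) <= r.
  by move: hr; rewrite ge_max addrAC => /andP[].
have r1 : 1 <= r := exponent_r1 m2 htheta hgamma thg rm.
have [am ac] := ha.
have [Z [mZ Z0 subZ]] := ae_and ac hab.
pose W := Om `\` Z.
have mW : measurable (W : set (Rn R N)) by exact: (@measurableD _ (Rn R N)).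
have goodW x : W x -> continuous (a x) /\ forall s, alpha / (1 + `|s|) `^ theta <= a x s <= beta.
  move=> [xO xZ]; have [] : (Om x -> continuous (a x)) /\
    (Om x -> forall s : R, alpha / (1 + `|s|) `^ theta <= a x s <= beta).
    by apply: contrapT => h; apply: xZ; exact: subZ.
  by move=> h1 h2; split; [exact: h1|exact: h2].
(* Replacing [a] by the constant [alpha] off the good set makes the structure conditions hold at
   every point: [alpha] satisfies the lower bound because [1 + |s| >= 1], and the upper bound
   becomes [Num.max alpha beta]. *)
pose b x s := if x \in W then a x s else alpha.
have bm s : measurable_fun [set: Rn R N] (b ^~ s : Rn R N -> R).
  rewrite (_ : b ^~ s = (fun x => alpha + ((fun x => a x s - alpha) \_ W) x)); last first.
    by apply/funext => x; rewrite /b patchE; case: ifP => _; rewrite ?addr0// addrC subrK.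
  apply: measurable_funD; first exact: measurable_cst.
  suff Wm : measurable_fun (W : set (Rn R N)) ((fun x => a x s - alpha) : Rn R N -> R).
    exact: ((measurable_restrictT _ mW).1 Wm).
  apply: measurable_funB; last exact: measurable_cst.
  by apply: (@measurable_funS _ _ (Rn R N) _ Om _ _ mOm _ (am s)); exact: subDsetl.
have bc x : continuous (b x).
  have [xW|xW] := pselect (W x).
    by rewrite (_ : b x = a x); [case: (goodW x xW)|apply/funext => s; rewrite /b mem_set].
  rewrite (_ : b x = fun=> alpha); first exact: cst_continuous.
  by apply/funext => s; rewrite /b memNset.
have bb x s : alpha / (1 + `|s|) `^ theta <= b x s <= Num.max alpha beta.
  rewrite /b le_max; case: ifPn => [|_].
    by rewrite inE => /goodW[_ /(_ s) /andP[-> ->]]; rewrite orbT.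
  rewrite lexx andbT ler_pdivrMr ?powR_gt0 ?ltr_pwDl// ler_peMr ?(ltW halpha)//.
  have o1 : (1 : R) `^ theta = 1 by rewrite powR1.
  by rewrite -[leLHS]o1; apply: ge0_ler_powR; rewrite ?nnegrE ?addr_ge0 ?(ltW htheta)// lerDl.
have be0 : 0 < Num.max alpha beta by rewrite lt_max halpha.
have m1 : 1 <= m by move: m2; lra.
have [fm fi] := inLp_mf_intg m1 hf.
have r2 : 1 <= 2 * r by move: r1; lra.
have Emi e := inLp_mf_intg r2 (hE e).
have [u [G [[um u0 ui] [Gm G0 Gi] wk ap [di eqn]]]] := regular_data_solution N0 oOm bOm m2 mth htheta
  hgamma thg halpha be0 rm bm bc bb fm (@patch_off R _ Om f) fi (fun e => (Emi e).1)
  (fun e => @patch_off R _ Om (fun x => E x 0 e)) (fun e => (Emi e).2).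
have /andP[q1 q2] := sobolev_exp_itv m2 mth htheta hgamma thg.
have {}q1 := ltW q1.
(* A solution is required to have its gradient in the sense of [W_0^(1,1)], so the approximation in
   exponent [q] is also weakened to exponent 1 on the bounded set [Om]. *)
have ap1 := W01p_approx_L1 oOm bOm q1 um u0 Gm G0 ap.
have ui1 := intg_lower_power mOm Of (_ : 0 < 1 <= m) um u0 ui.
have Gi1 e := intg_lower_power mOm Of (_ : 0 < 1 <= sobolev_exp theta m) (Gm e) (G0 e) (Gi e).
have uiq := intg_lower_power mOm Of (_ : 0 < sobolev_exp theta m <= m) um u0 ui.
have off (x : 'rV[R]_N) (phi : 'rV[R]_N -> R) : ~ Om x -> dotv (\row_e G e x) (grad phi x) = 0.
  by move=> Ox; rewrite /dotv big1// => i _; rewrite mxE G0// mul0r.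
exists u; split; last exact: intg_inLp um u0 ui.
  exists (fun x => \row_e G e x); split.
  - by apply: (W01p_grad oOm bOm (lexx 1) um u0 _ Gm G0 _ wk ap1); [apply: ui1|move=> e; apply: Gi1];
      rewrite ltr01.
  - by move=> i; apply: (intg_inL1loc oOm (di i)) => x xO; rewrite patch_on.
  move=> phi pt_; have [M phM] := test_C1c pt_; have [phm dphm] := C1c_measurable phM.
  have [CC CC0 lipC] := C1c_lipschitz phM.
  have dph e x : `|partial_deriv e phi x| <= CC by case: (lipC x e 0).
  have -> : \int[leb R N]_(x in Om) (a x (u x) * dotv (\row_e G e x) (grad phi x)) =
      \sum_e \int[leb R N]_x (G e x * (b x (u x) * partial_deriv e phi x)).
    rewrite (@Int_restrict R N Om (fun x => a x (u x) * dotv (\row_e G e x) (grad phi x))) => [|x Ox]; last first.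
      by rewrite off// mulr0.
    have bum : measurable_fun [set: Rn R N] ((fun x => b x (u x)) : Rn R N -> R).
      exact: (@measurable_superposition _ (Rn R N) R b u bm bc um).
    have Fm e : measurable_fun [set: Rn R N] ((fun x => b x (u x) * partial_deriv e phi x) : Rn R N -> R).
      exact: (measurable_funM bum (dphm e)).
    have Fle e x : `|b x (u x) * partial_deriv e phi x| <= Num.max alpha beta * CC.
      rewrite normrM ler_pM//; have /andP[b1 b2] := bb x (u x).
      rewrite ger0_norm//; apply: le_trans b1; rewrite divr_ge0 ?powR_ge0//; exact: ltW.
    have GFi e : (leb R N).-integrable [set: Rn R N]
        (EFin \o ((fun x => G e x * (b x (u x) * partial_deriv e phi x)) : Rn R N -> R)).
      apply: (@intg_mul_bounded _ (Rn R N) R (leb R N) _ _ _ _ (Fm e) (Fle e)).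
      exact: (intg_of_powR mOm Of q1 (Gm e) (G0 e) (Gi e)).
    rewrite -(Int_sum _ GFi); apply: ae_eq_Int.
      by apply: (@measurable_sum _ (Rn R N) R) => e; exact: (measurable_funM (Gm e) (Fm e)).
    (* Off [Z] the coefficients [a] and [b] agree in [Om], and outside [Om] both integrands vanish
       with [G]. *)
    exists Z; split=> // x /= nx; apply: contrapT => xZ; apply: nx.
    have [xO|xO] := pselect (Om x); last first.
      by rewrite off// mulr0 big1// => e _; rewrite G0// mul0r.
    rewrite /b mem_set// mulr_sumr; apply: eq_bigr => e _; rewrite !mxE; ring.
  have -> : \int[leb R N]_(x in Om) (odd_power gamma (u x) * dotv (E x) (grad phi x)) =
      \sum_e \int[leb R N]_x (odd_power gamma (u x) * ((fun y => E y 0 e) \_ Om) x * partial_deriv e phi x).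
    have di2 e := @intg_mul_bounded _ (Rn R N) R (leb R N) _ _ _ (di e) (dphm e) (dph e).
    have doff x : ~ Om x -> odd_power gamma (u x) * dotv (E x) (grad phi x) = 0.
      move=> Ox; rewrite /dotv big1 ?mulr0// => i _.
      by rewrite mxE (partial_off i pt_ Ox).2 mulr0.
    rewrite (Int_restrict doff) -(Int_sum _ di2); congr Rintegral; apply/funext => x.
    have [xO|xO] := pselect (Om x).
      rewrite mulr_sumr; apply: eq_bigr => e _; rewrite patch_on// mxE; ring.
    by rewrite doff// big1// => e _; rewrite (partial_off e pt_ xO).2 mulr0.
  rewrite (@Int_restrict R N Om (fun x => u x * phi x)) => [|x Ox]; last by rewrite u0// mul0r.
  rewrite (@Int_restrict R N Om (fun x => f x * phi x)) => [|x Ox]; last by rewrite (test_off pt_ Ox) mulr0.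
  rewrite eqn//; congr (_ + _); congr Rintegral; apply/funext => x.
  have [xO|xO] := pselect (Om x); first by rewrite patch_on.
  by rewrite (test_off pt_ xO) !mulr0.
exists (fun x => \row_e G e x).
apply: (W01p_grad oOm bOm q1 um u0 _ Gm G0 Gi wk ap); apply: uiq.
by rewrite (lt_le_trans _ q1)//= (le_trans (ltW q2)).
Qed.
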